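(* Let $M\ge4$. There exist $\eta_{ap},\delta_{ap}\in(0,1]$ and $C_{ap}>0$, depending only on $M$ and the parameters, such that if $T>0$ and $(u,p,\theta,K)$ is a smooth solution of (P) on $[0,T]\times\mathbb T^3$ with $u(t)$ of mean zero for all $t$, $J_{eq}+K(0,x)$ having spectrum $\{\lambda,\lambda,\nu\}$ for every $x$, and $$(\mathcal E_M+\mathcal F_M)(0)\le\eta_{ap},\qquad \sup_{0\le t\le T}\mathcal E_M(t)+\int_0^T\overline{\mathcal D}_M\le\delta_{ap},$$ then $$\sup_{0\le t\le T}\Big(\mathcal E_{low}(t)(1+t)^{2M-2}+\overline{\mathcal E}_M(t)+\frac{\mathcal F_M(t)}{1+t}\Big)+\int_0^T\mathcal D_M\le C_{ap}(\overline{\mathcal E}_M+\mathcal F_M)(0)$$ and $$\sup_{0\le t\le T}\mathcal E_M^{(K)}(t)\le C_{ap}(\mathcal E_M+\mathcal F_M)(0).$$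
   Context: Let $\mathbb{T}^3=\mathbb{R}^3/\mathbb{Z}^3$. Fix constants $\mu,\kappa,\alpha,\beta,\gamma>0$, $\tau>0$ and $\nu>\lambda>0$; set $\tilde\alpha=\alpha+\tfrac43\beta$, $\tilde\gamma=\beta+\gamma$, $\tilde\tau=\tau/(2\kappa)$, $\omega_{eq}=\tilde\tau e_3$, $J_{eq}=\mathrm{diag}(\lambda,\lambda,\nu)$. $\mathrm{ten}\,w$ is the antisymmetric matrix with $(\mathrm{ten}\,w)v=w\times v$; $\Omega_{eq}=\mathrm{ten}\,\omega_{eq}$, $\Theta=\mathrm{ten}\,\theta$, $[A,B]=AB-BA$. System (P): $\partial_t u+(u\cdot\nabla)u=(\mu+\kappa/2)\Delta u+\kappa\nabla\times\theta-\nabla p$, $\nabla\cdot u=0$, $(J_{eq}+K)(\partial_t\theta+(u\cdot\nabla)\theta)+(\omega_{eq}+\theta)\times\big((J_{eq}+K)(\omega_{eq}+\theta)\big)=\kappa\nabla\times u-2\kappa\theta+(\tilde\alpha-\tilde\gamma)\nabla(\nabla\cdot\theta)+\tilde\gamma\Delta\theta$, $\partial_t K+(u\cdot\nabla)K=[\Omega_{eq}+\Theta,J_{eq}+K]$, $K$ symmetric. $a=(K_{13},K_{23})$. Parabolic norms: $\partial^\alpha=\partial_t^{\alpha_0}\partial_x^{\bar\alpha}$, $|\alpha|_P=2\alpha_0+|\bar\alpha|$, $\|f\|_{P^k}^2=\sum_{|\alpha|_P\le k}\|\partial^\alpha f\|_{L^2}^2$, squared norms of tuples add. Functionals: $\overline{\mathcal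 E}_M=\|(u,\theta,a)\|_{P^{2M}}^2$; $\mathcal E_{low}=\|(u,\theta,a)\|_{P^2}^2+\|\partial_t a\|_{H^1}^2+\|\partial_t^2a\|_{L^2}^2$; $\mathcal E^{(K)}_M=\|K\|_{H^{2M-3}}^2+\|\partial_tK\|_{H^{2M-3}}^2+\|\partial_t^2K\|_{H^{2M-3}}^2+\sum_{j=3}^M\|\partial_t^jK\|_{H^{2M-2j+2}}^2$; $\mathcal E_M=\overline{\mathcal E}_M+\mathcal E_M^{(K)}$; $\mathcal F_M=\|K\|_{H^{2M+1}}^2+\|\partial_tK\|_{H^{2M}}^2+\|\partial_t^2K\|_{H^{2M-2}}^2$; $\overline{\mathcal D}_M=\|(u,\theta)\|_{P^{2M+1}}^2$; $\mathcal D_M=\overline{\mathcal D}_M+\sum_{j=0}^3\|\partial_t^ja\|_{H^{2M-j-1}}^2+\sum_{j=4}^M\|\partial_t^ja\|_{H^{2M-2j+3}}^2$. *)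

(* Defs.v *)
From Stdlib Require Import Reals Lra List.
From Coquelicot Require Import Coquelicot.
Import ListNotations.
Open Scope R_scope.

(** A scalar field on R_t x R^3 : (t, x1, x2, x3) |-> value.
    Fields on T^3 are represented as 1-periodic functions in x1,x2,x3. *)
Definition Field := R -> R -> R -> R -> R.
Definition VField := nat -> Field.          (* components 0,1,2 *)
Definition MField := nat -> nat -> Field.   (* entries (i,j), 0<=i,j<=2 *)

Definition slice (k : nat) (f : Field) (t x y z : R) : R -> R :=
  match k with
  | O => fun s => f s x y z
  | 1%nat => fun s => f t s y z
  | 2%nat => fun s => f t x s z
  | _ => fun s => f t x y s
  end.
Definition coord (k : nat) (t x y z : R) : R :=
  match k with O => t | 1%nat => x | 2%nat => y | _ => z end.

Definition pd (k : nat) (f : Field) : Field :=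
  fun t x y z => Derive (slice k f t x y z) (coord k t x y z).

Definition uncurry4 (f : Field) (p : R * (R * (R * R))) : R :=
  f (fst p) (fst (snd p)) (fst (snd (snd p))) (snd (snd (snd p))).

Definition smooth (f : Field) : Prop :=
  forall ks : list nat,
    let g := fold_right pd f ks in
    (forall p, continuous (uncurry4 g) p) /\
    (forall k t x y z, ex_derive (slice k g t x y z) (coord k t x y z)).

Definition periodic (f : Field) : Prop :=
  forall t x y z,
    f t (x + 1) y z = f t x y z /\ f t x (y + 1) z = f t x y z /\
    f t x y (z + 1) = f t x y z.

Definition dt (f : Field) : Field := pd 0 f.
Definition dx (i : nat) (f : Field) : Field := pd (S i) f.
Definition dpow (k n : nat) (f : Field) : Field := Nat.iter n (pd k) f.
Definition dmulti (a0 a1 a2 a3 : nat) (f : Field) : Field :=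
  dpow 0 a0 (dpow 1 a1 (dpow 2 a2 (dpow 3 a3 f))).

Definition torus_int (f : Field) (t : R) : R :=
  RInt (fun x => RInt (fun y => RInt (fun z => f t x y z) 0 1) 0 1) 0 1.

Definition L2sq (f : Field) (t : R) : R :=
  torus_int (fun t x y z => (f t x y z) ^ 2) t.

Definition Hs_sq (s : nat) (f : Field) (t : R) : R :=
  sum_f_R0 (fun a1 => sum_f_R0 (fun a2 => sum_f_R0 (fun a3 =>
    if (a1 + a2 + a3 <=? s)%nat then L2sq (dmulti 0 a1 a2 a3 f) t else 0)
  s) s) s.

Definition Pk_sq (k : nat) (f : Field) (t : R) : R :=
  sum_f_R0 (fun a0 => sum_f_R0 (fun a1 => sum_f_R0 (fun a2 => sum_f_R0 (fun a3 =>
    if (2 * a0 + a1 + a2 + a3 <=? k)%nat then L2sq (dmulti a0 a1 a2 a3 f) t else 0)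
  k) k) k) k.

Definition sumN (N : Field -> R -> R) (l : list Field) (t : R) : R :=
  fold_right (fun f acc => N f t + acc) 0 l.

Definition comps3 (v : VField) : list Field := [v 0%nat; v 1%nat; v 2%nat].
Definition compsK (K : MField) : list Field :=
  [K 0%nat 0%nat; K 0%nat 1%nat; K 0%nat 2%nat;
   K 1%nat 0%nat; K 1%nat 1%nat; K 1%nat 2%nat;
   K 2%nat 0%nat; K 2%nat 1%nat; K 2%nat 2%nat].
Definition aK (K : MField) : list Field := [K 0%nat 2%nat; K 1%nat 2%nat].
Definition dtl (j : nat) (l : list Field) : list Field := map (dpow 0 j) l.

Definition sum_from (m n : nat) (g : nat -> R) : R :=
  sum_f_R0 (fun j => if (m <=? j)%nat then g j else 0) n.

Definition Ebar (M : nat) (u th : VField) (K : MField) (t : R) : R :=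
  sumN (Pk_sq (2 * M)) (comps3 u ++ comps3 th ++ aK K) t.

Definition Elow (u th : VField) (K : MField) (t : R) : R :=
  sumN (Pk_sq 2) (comps3 u ++ comps3 th ++ aK K) t
  + sumN (Hs_sq 1) (dtl 1 (aK K)) t
  + sumN L2sq (dtl 2 (aK K)) t.

Definition EK (M : nat) (K : MField) (t : R) : R :=
  sumN (Hs_sq (2 * M - 3)) (compsK K) t
  + sumN (Hs_sq (2 * M - 3)) (dtl 1 (compsK K)) t
  + sumN (Hs_sq (2 * M - 3)) (dtl 2 (compsK K)) t
  + sum_from 3 M (fun j => sumN (Hs_sq (2 * M - 2 * j + 2)) (dtl j (compsK K)) t).

Definition EM (M : nat) (u th : VField) (K : MField) (t : R) : R :=
  Ebar M u th K t + EK M K t.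

Definition FM (M : nat) (K : MField) (t : R) : R :=
  sumN (Hs_sq (2 * M + 1)) (compsK K) t
  + sumN (Hs_sq (2 * M)) (dtl 1 (compsK K)) t
  + sumN (Hs_sq (2 * M - 2)) (dtl 2 (compsK K)) t.

Definition Dbar (M : nat) (u th : VField) (t : R) : R :=
  sumN (Pk_sq (2 * M + 1)) (comps3 u ++ comps3 th) t.

Definition DM (M : nat) (u th : VField) (K : MField) (t : R) : R :=
  Dbar M u th t
  + sum_from 0 3 (fun j => sumN (Hs_sq (2 * M - j - 1)) (dtl j (aK K)) t)
  + sum_from 4 M (fun j => sumN (Hs_sq (2 * M - 2 * j + 3)) (dtl j (aK K)) t).

Definition sum3 (g : nat -> R) : R := g 0%nat + g 1%nat + g 2%nat.
Definition cross (a b : nat -> R) (i : nat) : R :=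
  match i with
  | O => a 1%nat * b 2%nat - a 2%nat * b 1%nat
  | 1%nat => a 2%nat * b 0%nat - a 0%nat * b 2%nat
  | _ => a 0%nat * b 1%nat - a 1%nat * b 0%nat
  end.
(** ten w : the antisymmetric matrix with (ten w) v = w x v *)
Definition ten (w : nat -> R) (i j : nat) : R :=
  match i, j with
  | O, 1%nat => - w 2%nat | O, 2%nat => w 1%nat
  | 1%nat, O => w 2%nat | 1%nat, 2%nat => - w 0%nat
  | 2%nat, O => - w 1%nat | 2%nat, 1%nat => w 0%nat
  | _, _ => 0
  end.
Definition mv (A : nat -> nat -> R) (v : nat -> R) (i : nat) : R :=
  sum3 (fun j => A i j * v j).
Definition mm (A B : nat -> nat -> R) (i j : nat) : R :=
  sum3 (fun k => A i k * B k j).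
Definition comm (A B : nat -> nat -> R) (i j : nat) : R := mm A B i j - mm B A i j.
Definition det3 (A : nat -> nat -> R) : R :=
  A 0%nat 0%nat * (A 1%nat 1%nat * A 2%nat 2%nat - A 1%nat 2%nat * A 2%nat 1%nat)
  - A 0%nat 1%nat * (A 1%nat 0%nat * A 2%nat 2%nat - A 1%nat 2%nat * A 2%nat 0%nat)
  + A 0%nat 2%nat * (A 1%nat 0%nat * A 2%nat 1%nat - A 1%nat 1%nat * A 2%nat 0%nat).

Definition Jeq (lam nu : R) (i j : nat) : R :=
  if (i =? j)%nat then (if (i =? 2)%nat then nu else lam) else 0.
Definition omega_eq (kappa tau : R) (i : nat) : R :=
  if (i =? 2)%nat then tau / (2 * kappa) else 0.

Definition lap (f : Field) : Field :=
  fun t x y z => sum3 (fun j => dx j (dx j f) t x y z).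
Definition div (v : VField) : Field :=
  fun t x y z => sum3 (fun j => dx j (v j) t x y z).
Definition curl (v : VField) (i : nat) : Field :=
  fun t x y z =>
  match i with
  | O => dx 1 (v 2%nat) t x y z - dx 2 (v 1%nat) t x y z
  | 1%nat => dx 2 (v 0%nat) t x y z - dx 0 (v 2%nat) t x y z
  | _ => dx 0 (v 1%nat) t x y z - dx 1 (v 0%nat) t x y z
  end.

Definition system_P (mu kappa alpha beta gamma tau lam nu : R)
  (u : VField) (p : Field) (th : VField) (K : MField) (t x y z : R) : Prop :=
  let atil := alpha + 4 / 3 * beta in
  let gtil := beta + gamma in
  let uv := fun i => u i t x y z in
  let thv := fun i => th i t x y z in
  let A := fun i j => Jeq lam nu i j + K i j t x y z in
  let W := fun i => omega_eq kappa tau i + thv i in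
  (forall i, (i < 3)%nat ->
     dt (u i) t x y z + sum3 (fun j => uv j * dx j (u i) t x y z)
     = (mu + kappa / 2) * lap (u i) t x y z + kappa * curl th i t x y z
       - dx i p t x y z) /\
  div u t x y z = 0 /\
  (forall i, (i < 3)%nat ->
     sum3 (fun j => A i j * (dt (th j) t x y z
                             + sum3 (fun k => uv k * dx k (th j) t x y z)))
     + cross W (mv A W) i
     = kappa * curl u i t x y z - 2 * kappa * thv i
       + (atil - gtil) * dx i (div th) t x y z + gtil * lap (th i) t x y z) /\
  (forall i j, (i < 3)%nat -> (j < 3)%nat ->
     dt (K i j) t x y z + sum3 (fun k => uv k * dx k (K i j) t x y z)
     = comm (fun a b => ten W a b) A i j) /\
  (forall i j, (i < 3)%nat -> (j < 3)%nat -> K i j t x y z = K j i t x y z).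

(* Main.v *)
From Stdlib Require Import Reals Lra Lia ZArith List Permutation FunctionalExtensionality ProofIrrelevance ClassicalEpsilon.
From Coquelicot Require Import Coquelicot.
Require Import Defs.
Import ListNotations.
Open Scope R_scope.

(** The matrix (J - lam)(J - nu), with J = Jeq + K, is transported by the same commutator equation as J, so the spectral
    constraint persists.  It expresses the other entries of K quadratically through K, so that K is controlled by its
    entries a = (K13, K23).

    After a differentiation, testing the equations of u, theta and a against u, theta and a multiple of a gives a
    parabolic energy whose linear coupling between theta and a cancels and whose dissipation contains u and theta only.
    The rotation part of the theta equation expresses a through u and theta with the loss of one derivative.
    At order 2 all nonlinear terms are absorbed, and interpolation between the dissipation and the bounded energy of
    order 2M gives the decay (1 + t)^-(2M - 2).  At order 2M the only terms not absorbed are those of the transport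
    of a, whose coefficients are controlled by a fractional power of the decaying low norm and are integrable in time.

    The norm of K in H^(2M+1) obeys a transport estimate with integrable coefficients and a source bounded by the
    square root of the dissipation, hence the growth 1 + t of its square.  The remaining norms of time derivatives of K
    follow from its equation. *)

(** The obstacle is that [a] is only transported and rotated: nothing in its equation dissipates,
    and the theta equation returns it with one derivative fewer than the energy contains. At order 2
    the missing derivative is gained by moving all derivatives of a pairing onto one copy of [a],
    which the bounded energy keeps small in the sup norm. At order 2M there is no regularity left to
    move them to, hence the recourse to decay. The exponent 2M - 2 is the gap in the interpolation
    of the second derivatives of [a] between the first ones, which are dissipated, and those of
    order 2M. The low norm in front of the transport terms is at most a multiple of the fourth root
    of the product of the energies of order 2 and 2M, so it decays with exponent (2M - 2) / 4; for M
    >= 4 this is at least 3/2, hence integrable. Estimates are bounds [<~] between functions of a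
    solution and a time, uniform in both; explicit constants reappear only where a differential
    inequality is integrated. *)

(** * Smooth fields and their partial derivatives *)

Lemma field_ext (f g : Field) :
  (forall t x y z, f t x y z = g t x y z) -> f = g.
Proof.
  intros H; repeat (apply functional_extensionality; intro); apply H.
Qed.

Lemma smooth_pd k f : smooth f -> smooth (pd k f).
Proof.
  intros H ks; specialize (H (ks ++ [k])); rewrite fold_right_app in H; exact H.
Qed.

Lemma smooth_cont f : smooth f -> forall p, continuous (uncurry4 f) p.
Proof. intros H; exact (proj1 (H [])). Qed.

Lemma smooth_ex_derive f : smooth f ->
  forall k t x y z, ex_derive (slice k f t x y z) (coord k t x y z).
Proof. intros H; exact (proj2 (H [])). Qed.

(** Smoothness quantifies over all words of derivatives; a class stable under every [pd] reduces it
    to one check of continuity and differentiability per member, without formulas for iterated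
    derivatives. *)
Lemma smooth_class (P : Field -> Prop) :
  (forall g, P g -> (forall p, continuous (uncurry4 g) p) /\
    (forall k t x y z, ex_derive (slice k g t x y z) (coord k t x y z)) /\
    (forall k, P (pd k g))) ->
  forall f, P f -> smooth f.
Proof.
  intros H f Hf ks; cbv zeta.
  assert (HP : P (fold_right pd f ks)).
  { induction ks as [|k ks IH]; simpl; [exact Hf | apply H, IH]. }
  destruct (H _ HP) as (H1 & H2 & _); split; assumption.
Qed.

(** Points are nested pairs, so that continuity refers to the product topology. A slice becomes the
    composition with a coordinate update, which is jointly continuous in the new value and the
    point. *)
Definition upd (k : nat) (s : R) (p : R * (R * (R * R))) : R * (R * (R * R)) :=
  match p with (t, (x, (y, z))) =>
  match k with
  | O => (s, (x, (y, z)))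
  | 1%nat => (t, (s, (y, z)))
  | 2%nat => (t, (x, (s, z)))
  | _ => (t, (x, (y, s)))
  end end.

Lemma slice_upd k f t x y z s : slice k f t x y z s = uncurry4 f (upd k s (t, (x, (y, z)))).
Proof. destruct k as [|[|[|k]]]; reflexivity. Qed.

Lemma slice_coord k f t x y z : slice k f t x y z (coord k t x y z) = f t x y z.
Proof. destruct k as [|[|[|k]]]; reflexivity. Qed.

Lemma continuous_pair {U V W : UniformSpace} (f : U -> V) (g : U -> W) x :
  continuous f x -> continuous g x -> continuous (fun u => (f u, g u)) x.
Proof.
  intros Hf Hg. apply (continuous_comp_2 f g (fun a b => (a, b)) x Hf Hg).
  apply (continuous_ext (fun v : V * W => v)); [intros [a b]; reflexivity | apply continuous_id].
Qed.

Lemma continuous_upd k (q : (R * (R * (R * R))) * R) :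
  continuous (fun q : (R * (R * (R * R))) * R => upd k (snd q) (fst q)) q.
Proof.
  assert (Hid : forall q : (R * (R * (R * R))) * R, continuous (fun q => q) q) by (intro; apply continuous_id).
  assert (Hs : continuous (fun q : (R * (R * (R * R))) * R => snd q) q)
    by apply continuous_snd.
  assert (Hp : continuous (fun q : (R * (R * (R * R))) * R => fst q) q) by apply continuous_fst.
  assert (H1 : continuous (fun q : (R * (R * (R * R))) * R => fst (fst q)) q)
    by (apply (continuous_comp _ fst); [exact Hp | apply continuous_fst]).
  assert (H2 : continuous (fun q : (R * (R * (R * R))) * R => snd (fst q)) q)
    by (apply (continuous_comp _ snd); [exact Hp | apply continuous_snd]).
  assert (H3 : continuous (fun q : (R * (R * (R * R))) * R => fst (snd (fst q))) q)
    by (apply (continuous_comp _ fst); [exact H2 | apply continuous_fst]).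
  assert (H4 : continuous (fun q : (R * (R * (R * R))) * R => snd (snd (fst q))) q)
    by (apply (continuous_comp _ snd); [exact H2 | apply continuous_snd]).
  assert (H5 : continuous (fun q : (R * (R * (R * R))) * R => fst (snd (snd (fst q)))) q)
    by (apply (continuous_comp _ fst); [exact H4 | apply continuous_fst]).
  assert (H6 : continuous (fun q : (R * (R * (R * R))) * R => snd (snd (snd (fst q)))) q)
    by (apply (continuous_comp _ snd); [exact H4 | apply continuous_snd]).
  destruct k as [|[|[|k]]].
  - apply (continuous_ext (fun q => (snd q, (fst (snd (fst q)), (fst (snd (snd (fst q))), snd (snd (snd (fst q)))))))).
    { intros [[t [x [y z]]] s]; reflexivity. }
    repeat apply continuous_pair; assumption.
  - apply (continuous_ext (fun q => (fst (fst q), (snd q, (fst (snd (snd (fst q))), snd (snd (snd (fst q)))))))).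
    { intros [[t [x [y z]]] s]; reflexivity. }
    repeat apply continuous_pair; assumption.
  - apply (continuous_ext (fun q => (fst (fst q), (fst (snd (fst q)), (snd q, snd (snd (snd (fst q)))))))).
    { intros [[t [x [y z]]] s]; reflexivity. }
    repeat apply continuous_pair; assumption.
  - apply (continuous_ext (fun q => (fst (fst q), (fst (snd (fst q)), (fst (snd (snd (fst q))), snd q))))).
    { intros [[t [x [y z]]] s]; reflexivity. }
    repeat apply continuous_pair; assumption.
Qed.

Lemma continuous_slice_joint f (Hf : forall p, continuous (uncurry4 f) p) k q :
  continuous (fun q : (R * (R * (R * R))) * R => uncurry4 f (upd k (snd q) (fst q))) q.
Proof. apply (continuous_comp _ (uncurry4 f)); [apply continuous_upd | apply Hf]. Qed.

Lemma continuous_slice f (Hf : forall p, continuous (uncurry4 f) p) k t x y z s :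
  continuous (slice k f t x y z) s.
Proof.
  apply (continuous_ext (fun s => uncurry4 f (upd k s (t, (x, (y, z)))))).
  { intros u; symmetry; apply slice_upd. }
  apply (continuous_comp (fun s => ((t, (x, (y, z))), s)) (fun q => uncurry4 f (upd k (snd q) (fst q)))).
  - apply continuous_pair; [apply continuous_const | apply continuous_id].
  - apply continuous_slice_joint, Hf.
Qed.

(** Joint continuity in two coordinates, in the form used by the Schwarz theorem and by
    differentiation under the integral sign. *)
Lemma continuity_2d_slice2 f (Hf : forall p, continuous (uncurry4 f) p) k l t x y z a b :
  continuity_2d_pt (fun a b => uncurry4 f (upd k a (upd l b (t, (x, (y, z)))))) a b.
Proof.
  apply continuity_2d_pt_filterlim.
  apply (continuous_comp (fun w : R * R => (upd l (snd w) (t, (x, (y, z))), fst w))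
          (fun q => uncurry4 f (upd k (snd q) (fst q))) (a, b)).
  - apply continuous_pair.
    + apply (continuous_comp (fun w : R * R => ((t, (x, (y, z))), snd w))
          (fun q => upd l (snd q) (fst q))).
      * apply continuous_pair; [apply continuous_const | apply continuous_snd].
      * apply continuous_upd.
    + apply continuous_fst.
  - apply continuous_slice_joint, Hf.
Qed.

Lemma smooth_const c : smooth (fun _ _ _ _ => c).
Proof.
  apply (smooth_class (fun g => exists c, g = fun _ _ _ _ => c)); [|exists c; reflexivity].
  intros g [d ->]; split; [|split].
  - intros p; apply continuous_const.
  - intros k t x y z; destruct k as [|[|[|k]]]; apply ex_derive_const.
  - intros k; exists 0; apply field_ext; intros t x y z.
    unfold pd; destruct k as [|[|[|k]]]; cbn [slice coord]; apply Derive_const.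
Qed.

Definition fadd (f g : Field) : Field := fun t x y z => f t x y z + g t x y z.
Definition fmul (f g : Field) : Field := fun t x y z => f t x y z * g t x y z.

Lemma slice_fadd k f g t x y z : slice k (fadd f g) t x y z = fun s => slice k f t x y z s + slice k g t x y z s.
Proof. destruct k as [|[|[|k]]]; reflexivity. Qed.
Lemma slice_fmul k f g t x y z : slice k (fmul f g) t x y z = fun s => slice k f t x y z s * slice k g t x y z s.
Proof. destruct k as [|[|[|k]]]; reflexivity. Qed.

Definition cdiff (f : Field) := (forall p, continuous (uncurry4 f) p) /\
    (forall k t x y z, ex_derive (slice k f t x y z) (coord k t x y z)).

Lemma smooth_cdiff f : smooth f -> cdiff f.
Proof. intros H; exact (H []). Qed.

Lemma cdiff_fadd f g : cdiff f -> cdiff g -> cdiff (fadd f g).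
Proof.
  intros [H1 H2] [H3 H4]; split.
  - intros p. apply (continuous_plus (uncurry4 f) (uncurry4 g)); auto.
  - intros; rewrite slice_fadd; apply (ex_derive_plus (V := R_NormedModule)); auto.
Qed.
Lemma cdiff_fmul f g : cdiff f -> cdiff g -> cdiff (fmul f g).
Proof.
  intros [H1 H2] [H3 H4]; split.
  - intros p. apply (continuous_mult (uncurry4 f) (uncurry4 g)); auto.
  - intros; rewrite slice_fmul; apply (ex_derive_mult); auto.
Qed.
Lemma pd_fadd k f g : cdiff f -> cdiff g -> pd k (fadd f g) = fadd (pd k f) (pd k g).
Proof.
  intros [_ H2] [_ H4]; apply field_ext; intros t x y z; unfold pd, fadd at 2.
  rewrite slice_fadd; apply Derive_plus; auto.
Qed.
Lemma pd_fmul k f g : cdiff f -> cdiff g -> pd k (fmul f g) = fadd (fmul (pd k f) g) (fmul f (pd k g)).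
Proof.
  intros [_ H2] [_ H4]; apply field_ext; intros t x y z; unfold fadd, fmul at 2 3, pd.
  rewrite slice_fmul, Derive_mult; auto.
  rewrite !slice_coord; reflexivity.
Qed.

Lemma smooth_fadd f g : smooth f -> smooth g -> smooth (fadd f g).
Proof.
  intros Hf Hg.
  apply (smooth_class (fun h => exists f g, smooth f /\ smooth g /\ h = fadd f g)); [|eauto].
  intros h (f1 & g1 & H1 & H2 & ->).
  destruct (cdiff_fadd f1 g1) as [A B]; try (apply smooth_cdiff; assumption).
  split; [exact A|split;[exact B|]].
  intros k; exists (pd k f1), (pd k g1); repeat split; try apply smooth_pd; auto.
  apply pd_fadd; apply smooth_cdiff; assumption.
Qed.

(** Products alone are not stable under [pd], since the derivative of a product is a sum of
    products; this class is stable, as [smooth_class] requires. *)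
Inductive sum_of_products : Field -> Prop :=
| sop_mul f g : smooth f -> smooth g -> sum_of_products (fmul f g)
| sop_add f g : sum_of_products f -> sum_of_products g -> sum_of_products (fadd f g).

Lemma smooth_fmul f g : smooth f -> smooth g -> smooth (fmul f g).
Proof.
  intros Hf Hg.
  apply (smooth_class sum_of_products); [|constructor; assumption].
  intros h Hh.
  assert (H : cdiff h /\ forall k, sum_of_products (pd k h)).
  { induction Hh as [f1 g1 H1 H2 | f1 g1 H1 [IH1 IH1'] H2 [IH2 IH2']].
    - split; [apply cdiff_fmul; apply smooth_cdiff; assumption|].
      intros k; rewrite pd_fmul by (apply smooth_cdiff; assumption).
      apply sop_add; apply sop_mul; try apply smooth_pd; assumption.
    - split; [apply cdiff_fadd; assumption|].
      intros k; rewrite pd_fadd by assumption. apply sop_add; auto. }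
  destruct H as [[H1 H2] H3]; auto.
Qed.

Definition coordP (k : nat) (p : R * (R * (R * R))) : R :=
  match p with (t, (x, (y, z))) => coord k t x y z end.

Lemma pd_upd k f p : uncurry4 (pd k f) p = Derive (fun s => uncurry4 f (upd k s p)) (coordP k p).
Proof.
  destruct p as [t [x [y z]]]; unfold uncurry4 at 1, pd; simpl fst; simpl snd; simpl coordP.
  apply Derive_ext; intros s; apply slice_upd.
Qed.
Lemma ex_derive_upd f (Hf : smooth f) k p : ex_derive (fun s => uncurry4 f (upd k s p)) (coordP k p).
Proof.
  destruct p as [t [x [y z]]]; simpl coordP.
  apply (ex_derive_ext (slice k f t x y z)); [intros; apply slice_upd|].
  apply (smooth_ex_derive f Hf k t x y z).
Qed.
Lemma upd_upd k a b p : upd k a (upd k b p) = upd k a p.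
Proof. destruct p as [t [x [y z]]]; destruct k as [|[|[|k]]]; reflexivity. Qed.
Lemma coordP_upd k a p : coordP k (upd k a p) = a.
Proof. destruct p as [t [x [y z]]]; destruct k as [|[|[|k]]]; reflexivity. Qed.
Lemma upd_coordP k p : upd k (coordP k p) p = p.
Proof. destruct p as [t [x [y z]]]; destruct k as [|[|[|k]]]; reflexivity. Qed.
Lemma upd_swap k l a b p : Nat.min k 3 <> Nat.min l 3 -> upd k a (upd l b p) = upd l b (upd k a p).
Proof.
  destruct p as [t [x [y z]]]; destruct k as [|[|[|k]]]; destruct l as [|[|[|l]]]; try reflexivity; simpl; lia.
Qed.
Lemma pd_min k f : pd (Nat.min k 3) f = pd k f.
Proof. destruct k as [|[|[|k]]]; reflexivity. Qed.

Lemma Derive_slice2_l f (Hf : smooth f) k l p a b :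
  is_derive (fun s => uncurry4 f (upd k s (upd l b p))) a (uncurry4 (pd k f) (upd k a (upd l b p))).
Proof.
  set (q := upd k a (upd l b p)).
  assert (E : coordP k q = a) by apply coordP_upd.
  apply (is_derive_ext (fun s => uncurry4 f (upd k s q))).
  { intros s; unfold q; rewrite upd_upd; reflexivity. }
  pose proof (ex_derive_upd f Hf k q) as H; rewrite E in H.
  rewrite pd_upd, E; apply Derive_correct, H.
Qed.

Lemma Derive_slice2_r f (Hf : smooth f) k l p a b : Nat.min k 3 <> Nat.min l 3 ->
  is_derive (fun s => uncurry4 f (upd k a (upd l s p))) b (uncurry4 (pd l f) (upd k a (upd l b p))).
Proof.
  intros Hkl. rewrite upd_swap by assumption.
  apply (is_derive_ext (fun s => uncurry4 f (upd l s (upd k a p)))).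
  { intros s; rewrite (upd_swap k l) by assumption; reflexivity. }
  apply Derive_slice2_l, Hf.
Qed.

Lemma uncurry4_inj (f g : Field) : (forall p, uncurry4 f p = uncurry4 g p) -> f = g.
Proof. intros H; apply field_ext; intros t x y z; apply (H (t, (x, (y, z)))). Qed.

Lemma continuity_2d_pt_ext_all f g x y : (forall a b, f a b = g a b) ->
  continuity_2d_pt f x y -> continuity_2d_pt g x y.
Proof. intros H; apply continuity_2d_pt_ext_loc; exists (mkposreal 1 Rlt_0_1); intros; apply H. Qed.

(** Schwarz's theorem in the two coordinates moved by [upd], the other coordinates being frozen. *)
Lemma pd_comm k l f : smooth f -> pd k (pd l f) = pd l (pd k f).
Proof.
  intros Hf.
  (* Every index from 3 on denotes the last coordinate, so directions are compared after truncation
     at 3. *)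
  destruct (Nat.eq_dec (Nat.min k 3) (Nat.min l 3)) as [E|E].
  { rewrite <- (pd_min k (pd l f)), <- (pd_min k f), E, !pd_min; reflexivity. }
  apply uncurry4_inj; intros p.
  assert (Hk : forall k, smooth (pd k f)) by (intro; apply smooth_pd, Hf).
  assert (E1 : forall a b, Derive (fun s => uncurry4 f (upd k a (upd l s p))) b
     = uncurry4 (pd l f) (upd k a (upd l b p)))
    by (intros; apply is_derive_unique, Derive_slice2_r; assumption).
  assert (E2 : forall a b, Derive (fun s => uncurry4 f (upd k s (upd l b p))) a
     = uncurry4 (pd k f) (upd k a (upd l b p)))
    by (intros; apply is_derive_unique, Derive_slice2_l; assumption).
  assert (F1 : forall a b, Derive (fun a => Derive (fun s => uncurry4 f (upd k a (upd l s p))) b) a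
     = uncurry4 (pd k (pd l f)) (upd k a (upd l b p))).
  { intros; rewrite (Derive_ext _ (fun a => uncurry4 (pd l f) (upd k a (upd l b p)))) by (intros; apply E1).
    apply is_derive_unique, Derive_slice2_l, Hk. }
  assert (F2 : forall a b, Derive (fun b => Derive (fun s => uncurry4 f (upd k s (upd l b p))) a) b
     = uncurry4 (pd l (pd k f)) (upd k a (upd l b p))).
  { intros; rewrite (Derive_ext _ (fun b => uncurry4 (pd k f) (upd k a (upd l b p)))) by (intros; apply E2).
    apply is_derive_unique, Derive_slice2_r; [apply Hk | assumption]. }
  assert (Ep : p = upd k (coordP k p) (upd l (coordP l p) p)) by (rewrite !upd_coordP; reflexivity).
  rewrite Ep, <- F1, <- F2.
  apply (Schwarz (fun a b => uncurry4 f (upd k a (upd l b p)))).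
  - exists (mkposreal 1 Rlt_0_1); intros u v _ _; repeat split.
    + eexists; apply Derive_slice2_l, Hf.
    + eexists; apply Derive_slice2_r; assumption.
    + apply (ex_derive_ext (fun a => uncurry4 (pd l f) (upd k a (upd l v p)))); [intros; symmetry; apply E1|].
      eexists; apply Derive_slice2_l, Hk.
    + apply (ex_derive_ext (fun b => uncurry4 (pd k f) (upd k u (upd l b p)))); [intros; symmetry; apply E2|].
      eexists; apply Derive_slice2_r; [apply Hk | assumption].
  - eapply continuity_2d_pt_ext_all; [intros; symmetry; apply F1|].
    destruct p as [t [x [y z]]]; apply continuity_2d_slice2, smooth_cont, smooth_pd, Hk.
  - eapply continuity_2d_pt_ext_all; [intros; symmetry; apply F2|].
    destruct p as [t [x [y z]]]; apply continuity_2d_slice2, smooth_cont, smooth_pd, Hk.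
Qed.

(** * Partial integrals of smooth fields *)

(** Compactness of the unit interval turns continuity of [h] at the points over [p] into one
    neighbourhood of [p] that serves all [s]. This is what makes integrals over [s] continuous in
    [p]. *)
Lemma tube (U : UniformSpace) (h : U * R -> R) (Hh : forall q, continuous h q) (p : U) (eps : posreal) :
  exists d : posreal, forall q, ball p d q -> forall s, 0 <= s <= 1 -> Rabs (h (q, s) - h (p, s)) < eps.
Proof.
  assert (Hex : forall s, exists d : posreal, forall q s', ball p d q -> ball s d s' ->
            Rabs (h (q, s') - h (p, s)) < eps / 2).
  { intros s.
    assert (He : 0 < eps / 2) by (destruct eps; simpl; lra).
    destruct (proj1 (filterlim_locally h (h (p, s))) (Hh (p, s)) (mkposreal _ He)) as [d Hd].
    exists d; intros q s' H1 H2; apply (Hd (q, s')); split; assumption. }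
  set (delta := fun s => proj1_sig (constructive_indefinite_description _ (Hex s))).
  assert (Hdelta : forall s q s', ball p (delta s) q -> ball s (delta s) s' ->
            Rabs (h (q, s') - h (p, s)) < eps / 2).
  { intros s; unfold delta; destruct (constructive_indefinite_description _ (Hex s)); simpl; assumption. }
  destruct (compactness_value_1d 0 1 delta) as [d Hd].
  exists d; intros q Hq s Hs.
  (* Compactness gives the centre of a covering ball only under a double negation. *)
  destruct (Classical_Prop.NNPP _ (Hd s Hs)) as (t & _ & Ht & Hdt).
  assert (B : ball t (delta t) s) by exact Ht.
  replace (h (q, s) - h (p, s)) with ((h (q, s) - h (p, t)) - (h (p, s) - h (p, t))) by ring.
  apply Rle_lt_trans with (1 := Rabs_triang _ _). rewrite Rabs_Ropp.
  assert (A1 := Hdelta t q s (ball_le _ _ _ Hdt _ Hq) B).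
  assert (A2 := Hdelta t p s (ball_center _ _) B).
  destruct eps; simpl in *; lra.
Qed.

Lemma continuous_RInt_joint (U : UniformSpace) (h : U * R -> R) (Hh : forall q, continuous h q) (p : U) :
  continuous (fun p => RInt (fun s => h (p, s)) 0 1) p.
Proof.
  assert (Hc : forall p s, continuous (fun s => h (p, s)) s).
  { intros q s; apply (continuous_comp (fun s => (q, s)) h); [|apply Hh].
    apply continuous_pair; [apply continuous_const | apply continuous_id]. }
  assert (Hi : forall p, ex_RInt (fun s => h (p, s)) 0 1)
    by (intros; apply (ex_RInt_continuous (V := R_CompleteNormedModule)); intros; apply Hc).
  apply filterlim_locally; intros eps.
  assert (He : 0 < eps / 2) by (destruct eps; simpl; lra).
  destruct (tube U h Hh p (mkposreal _ He)) as [d Hd]; exists d; intros q Hq.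
  change (Rabs (RInt (fun s => h (q, s)) 0 1 - RInt (fun s => h (p, s)) 0 1) < eps).
  assert (E : RInt (fun s => h (q, s)) 0 1 - RInt (fun s => h (p, s)) 0 1
     = RInt (fun s => h (q, s) - h (p, s)) 0 1).
  { symmetry; apply (RInt_minus (V := R_CompleteNormedModule)); apply Hi. }
  rewrite E.
  apply Rle_lt_trans with ((1 - 0) * (eps / 2)); [|destruct eps; simpl; lra].
  apply abs_RInt_le_const; [lra| |].
  - apply (ex_RInt_minus (V := R_NormedModule)); apply Hi.
  - intros s Hs; left; apply (Hd q Hq s Hs).
Qed.

(** The partial integral is kept as a field of all four variables, constant in the integrated one.
    The torus integral is then a threefold iteration of [Iv], and [pd] applies to partial integrals
    as to any field. *)
Definition Iv (k : nat) (f : Field) : Field := fun t x y z => RInt (slice k f t x y z) 0 1.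

Lemma Iv_upd k f p : uncurry4 (Iv k f) p = RInt (fun s => uncurry4 f (upd k s p)) 0 1.
Proof.
  destruct p as [t [x [y z]]]; unfold uncurry4 at 1, Iv; simpl fst; simpl snd.
  apply RInt_ext; intros; apply slice_upd.
Qed.

Lemma continuous_upd_s f (Hf : forall p, continuous (uncurry4 f) p) k p s :
  continuous (fun s => uncurry4 f (upd k s p)) s.
Proof.
  destruct p as [t [x [y z]]].
  apply (continuous_ext (slice k f t x y z)); [intros; apply slice_upd|apply continuous_slice, Hf].
Qed.

Lemma Iv_continuous k f : (forall p, continuous (uncurry4 f) p) -> forall p, continuous (uncurry4 (Iv k f)) p.
Proof.
  intros Hf p.
  apply (continuous_ext (fun p => RInt (fun s => uncurry4 f (upd k s p)) 0 1)).
  { intros; symmetry; apply Iv_upd. }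
  apply (continuous_RInt_joint _ (fun q => uncurry4 f (upd k (snd q) (fst q)))).
  intros; apply continuous_slice_joint, Hf.
Qed.

Lemma Iv_is_derive k l f (Hf : smooth f) p : Nat.min k 3 <> Nat.min l 3 ->
  is_derive (fun s => uncurry4 (Iv k f) (upd l s p)) (coordP l p) (uncurry4 (Iv k (pd l f)) p).
Proof.
  intros Hkl.
  apply (is_derive_ext (fun a => RInt (fun s => uncurry4 f (upd k s (upd l a p))) 0 1)).
  { intros; symmetry; apply Iv_upd. }
  assert (E : forall a s, Derive (fun u => uncurry4 f (upd k s (upd l u p))) a =
               uncurry4 (pd l f) (upd k s (upd l a p))).
  { intros; apply is_derive_unique, Derive_slice2_r; assumption. }
  rewrite Iv_upd.
  replace (RInt (fun s => uncurry4 (pd l f) (upd k s p)) 0 1) with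
    (RInt (fun s => Derive (fun u => uncurry4 f (upd k s (upd l u p))) (coordP l p)) 0 1).
  2:{ apply RInt_ext; intros; rewrite E, upd_coordP; reflexivity. }
  apply (is_derive_RInt_param (fun a s => uncurry4 f (upd k s (upd l a p)))).
  - exists (mkposreal 1 Rlt_0_1); intros a _ s _. eexists; apply Derive_slice2_r; assumption.
  - intros s _.
    apply (continuity_2d_pt_ext_all (fun a s => uncurry4 (pd l f) (upd l a (upd k s p)))).
    { intros; rewrite E, upd_swap by auto; reflexivity. }
    destruct p as [t [x [y z]]]; apply continuity_2d_slice2, smooth_cont, smooth_pd, Hf.
  - exists (mkposreal 1 Rlt_0_1); intros a _.
    apply (ex_RInt_continuous (V := R_CompleteNormedModule)); intros; apply continuous_upd_s, smooth_cont, Hf.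
Qed.

Lemma pd_Iv k l f : smooth f -> Nat.min k 3 <> Nat.min l 3 -> pd l (Iv k f) = Iv k (pd l f).
Proof.
  intros Hf Hkl; apply uncurry4_inj; intros p; rewrite pd_upd.
  apply is_derive_unique, Iv_is_derive; assumption.
Qed.

Lemma Iv_upd_const k l f s p : Nat.min k 3 = Nat.min l 3 ->
  uncurry4 (Iv k f) (upd l s p) = uncurry4 (Iv k f) p.
Proof.
  intros E; rewrite !Iv_upd; apply RInt_ext; intros a _.
  destruct p as [t [x [y z]]]; destruct k as [|[|[|k]]]; destruct l as [|[|[|l]]]; try reflexivity; simpl in E; lia.
Qed.

Lemma pd_Iv_same k l f : Nat.min k 3 = Nat.min l 3 -> pd l (Iv k f) = (fun _ _ _ _ => 0).
Proof.
  intros E; apply uncurry4_inj; intros p; rewrite pd_upd.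
  rewrite (Derive_ext _ (fun _ => uncurry4 (Iv k f) p)) by (intros; apply Iv_upd_const; assumption).
  apply Derive_const.
Qed.

(** A derivative in another direction passes under the integral, and one in the integrated direction
    gives zero; hence the zero field is added to the class. *)
Lemma Iv_smooth k f : smooth f -> smooth (Iv k f).
Proof.
  intros Hf.
  apply (smooth_class (fun g => (exists f, smooth f /\ g = Iv k f) \/ g = fun _ _ _ _ => 0)); [|eauto].
  intros g [(h & Hh & ->)| ->].
  - split; [apply Iv_continuous, smooth_cont, Hh|split].
    + intros l t x y z.
      apply (ex_derive_ext (fun s => uncurry4 (Iv k h) (upd l s (t, (x, (y, z)))))); [intros; symmetry; apply slice_upd|].
      destruct (Nat.eq_dec (Nat.min k 3) (Nat.min l 3)) as [E|E].
      * apply (ex_derive_ext (fun _ => uncurry4 (Iv k h) (t, (x, (y, z))))); [intros; symmetry; apply Iv_upd_const, E|].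
        apply ex_derive_const.
      * eexists; apply (Iv_is_derive k l h Hh (t, (x, (y, z))) E).
    + intros l; destruct (Nat.eq_dec (Nat.min k 3) (Nat.min l 3)) as [E|E].
      * right; apply pd_Iv_same, E.
      * left; exists (pd l h); split; [apply smooth_pd, Hh | apply pd_Iv; assumption].
  - assert (H := smooth_const 0). split; [apply smooth_cont, H | split; [apply smooth_ex_derive, H|]].
    intros l; right. apply field_ext; intros t x y z.
    unfold pd; destruct l as [|[|[|l]]]; cbn [slice coord]; apply Derive_const.
Qed.

(** * Periodic fields *)

Lemma periodic_eqs f : periodic f ->
  (forall t x y z, f t (x + 1) y z = f t x y z) /\ (forall t x y z, f t x (y + 1) z = f t x y z) /\
  (forall t x y z, f t x y (z + 1) = f t x y z).
Proof. intros H; repeat split; intros; apply H. Qed.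

Lemma Derive_shift (g : R -> R) x : (forall s, g (s + 1) = g s) -> ex_derive g (x + 1) ->
  Derive g (x + 1) = Derive g x.
Proof.
  intros Hg He. symmetry; apply is_derive_unique.
  apply (is_derive_ext (fun s => g (s + 1))); [assumption|].
  replace (Derive g (x + 1)) with (scal 1 (Derive g (x + 1))) by (unfold scal; simpl; unfold mult; simpl; ring).
  apply (is_derive_comp g (fun s => s + 1)); [apply Derive_correct, He|].
  auto_derive; [trivial | reflexivity].
Qed.

Lemma periodic_pd k f : smooth f -> periodic f -> periodic (pd k f).
Proof.
  intros Hs Hp. destruct (periodic_eqs f Hp) as (P1 & P2 & P3).
  assert (E1 := fun t x y z => smooth_ex_derive f Hs 1 t x y z).
  assert (E2 := fun t x y z => smooth_ex_derive f Hs 2 t x y z).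
  assert (E3 := fun t x y z => smooth_ex_derive f Hs 3 t x y z).
  intros t x y z; unfold pd; destruct k as [|[|[|k]]]; cbn [slice coord] in *; repeat split;
    try (apply Derive_ext; intros; auto; fail); apply Derive_shift; auto.
Qed.

Lemma periodic_fadd f g : periodic f -> periodic g -> periodic (fadd f g).
Proof.
  intros H1 H2 t x y z; destruct (H1 t x y z) as (A & B & C), (H2 t x y z) as (A' & B' & C'); unfold fadd.
  rewrite A, B, C, A', B', C'; auto.
Qed.
Lemma periodic_fmul f g : periodic f -> periodic g -> periodic (fmul f g).
Proof.
  intros H1 H2 t x y z; destruct (H1 t x y z) as (A & B & C), (H2 t x y z) as (A' & B' & C'); unfold fmul.
  rewrite A, B, C, A', B', C'; auto.
Qed.
Lemma periodic_const c : periodic (fun _ _ _ _ => c).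
Proof. intros t x y z; auto. Qed.

(** * The differential ring of smooth periodic fields *)

(** With smoothness and periodicity bundled, fields form a commutative ring with commuting
    derivations: identities are plain equalities, proved by [ring] and free of side conditions. *)
Record F := mkF { fv :> R -> R -> R -> R -> R; f_smooth : smooth fv; f_periodic : periodic fv }.

Lemma F_ext (f g : F) : (forall t x y z, f t x y z = g t x y z) -> f = g.
Proof.
  intros H; destruct f as [f H1 H2], g as [g H3 H4]; simpl in H.
  assert (E : f = g) by (apply field_ext, H). subst g.
  f_equal; apply proof_irrelevance.
Qed.

(* The operations are sealed so that unification never unfolds them to derivatives and integrals. *)
Lemma Fadd_sig : {h : F -> F -> F | forall f g, fv (h f g) = fadd f g}.
Proof.
  exists (fun f g : F => mkF (fadd f g) (smooth_fadd _ _ (f_smooth f) (f_smooth g))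
    (periodic_fadd _ _ (f_periodic f) (f_periodic g))); reflexivity.
Qed.
Lemma Fmul_sig : {h : F -> F -> F | forall f g, fv (h f g) = fmul f g}.
Proof.
  exists (fun f g : F => mkF (fmul f g) (smooth_fmul _ _ (f_smooth f) (f_smooth g))
    (periodic_fmul _ _ (f_periodic f) (f_periodic g))); reflexivity.
Qed.
Lemma Fc_sig : {h : R -> F | forall c, fv (h c) = fun _ _ _ _ => c}.
Proof. exists (fun c => mkF _ (smooth_const c) (periodic_const c)); reflexivity. Qed.
Lemma D_sig : {h : nat -> F -> F | forall k f, fv (h k f) = pd k f}.
Proof.
  exists (fun k (f : F) => mkF (pd k f) (smooth_pd k f (f_smooth f)) (periodic_pd k f (f_smooth f) (f_periodic f)));
  reflexivity.
Qed.
Definition Fadd := proj1_sig Fadd_sig.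
Definition Fmul := proj1_sig Fmul_sig.
Definition Fc := proj1_sig Fc_sig.
Definition D := proj1_sig D_sig.
Definition fv_Fadd : forall f g, fv (Fadd f g) = fadd f g := proj2_sig Fadd_sig.
Definition fv_Fmul : forall f g, fv (Fmul f g) = fmul f g := proj2_sig Fmul_sig.
Definition fv_Fc : forall c, fv (Fc c) = fun _ _ _ _ => c := proj2_sig Fc_sig.
Definition fv_D : forall k f, fv (D k f) = pd k f := proj2_sig D_sig.
Definition Fopp (f : F) : F := Fmul (Fc (-1)) f.
Definition Fsub (f g : F) : F := Fadd f (Fopp g).
Definition Dw (w : list nat) (f : F) : F := fold_right D f w.

Declare Scope F_scope.
Delimit Scope F_scope with fld.
Bind Scope F_scope with F.
Notation "f + g" := (Fadd f g) : F_scope.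
Notation "f * g" := (Fmul f g) : F_scope.
Notation "f - g" := (Fsub f g) : F_scope.
Notation "- f" := (Fopp f) : F_scope.

Lemma Fadd_v (f g : F) t x y z : (f + g)%fld t x y z = f t x y z + g t x y z.
Proof. rewrite fv_Fadd; reflexivity. Qed.
Lemma Fmul_v (f g : F) t x y z : (f * g)%fld t x y z = f t x y z * g t x y z.
Proof. rewrite fv_Fmul; reflexivity. Qed.
Lemma Fc_v c t x y z : Fc c t x y z = c. Proof. rewrite fv_Fc; reflexivity. Qed.
Lemma Fopp_v (f : F) t x y z : (- f)%fld t x y z = - f t x y z.
Proof. unfold Fopp; rewrite Fmul_v, Fc_v; ring. Qed.
Lemma Fsub_v (f g : F) t x y z : (f - g)%fld t x y z = f t x y z - g t x y z.
Proof. unfold Fsub; rewrite Fadd_v, Fopp_v; ring. Qed.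
Ltac Fv := repeat rewrite ?Fadd_v, ?Fmul_v, ?Fopp_v, ?Fsub_v, ?Fc_v.

Lemma F_ring_theory : ring_theory (Fc 0) (Fc 1) Fadd Fmul Fsub Fopp eq.
Proof. split; intros; apply F_ext; intros; Fv; ring. Qed.
Add Ring F_ring : F_ring_theory.

Lemma F_cdiff (f : F) : cdiff f. Proof. apply smooth_cdiff, f_smooth. Qed.

Lemma D_add k f g : D k (f + g)%fld = (D k f + D k g)%fld.
Proof. apply F_ext; intros; Fv; rewrite !fv_D, fv_Fadd, pd_fadd by apply F_cdiff; reflexivity. Qed.
Lemma D_mul k f g : D k (f * g)%fld = (D k f * g + f * D k g)%fld.
Proof. apply F_ext; intros; Fv; rewrite !fv_D, fv_Fmul, pd_fmul by apply F_cdiff; reflexivity. Qed.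
Lemma D_c k c : D k (Fc c) = Fc 0.
Proof.
  apply F_ext; intros; rewrite Fc_v, fv_D, fv_Fc.
  unfold pd; destruct k as [|[|[|k]]]; cbn [slice coord]; apply Derive_const.
Qed.
Lemma D_opp k f : D k (- f)%fld = (- D k f)%fld.
Proof. unfold Fopp; rewrite D_mul, D_c; ring. Qed.
Lemma D_sub k f g : D k (f - g)%fld = (D k f - D k g)%fld.
Proof. replace (f - g)%fld with (f + - g)%fld by ring. rewrite D_add, D_opp; ring. Qed.
Lemma D_scal k c f : D k (Fc c * f)%fld = (Fc c * D k f)%fld.
Proof. rewrite D_mul, D_c; ring. Qed.
Lemma D_comm k l f : D k (D l f) = D l (D k f).
Proof. apply F_ext; intros; rewrite !fv_D, pd_comm by apply f_smooth; reflexivity. Qed.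
Lemma Dw_add w f g : Dw w (f + g)%fld = (Dw w f + Dw w g)%fld.
Proof. induction w as [|k w IH]; simpl; [reflexivity|]. rewrite IH; apply D_add. Qed.
Lemma Dw_opp w f : Dw w (- f)%fld = (- Dw w f)%fld.
Proof. induction w as [|k w IH]; simpl; [reflexivity|]. rewrite IH; apply D_opp. Qed.
Lemma Dw_sub w f g : Dw w (f - g)%fld = (Dw w f - Dw w g)%fld.
Proof. induction w as [|k w IH]; simpl; [reflexivity|]. rewrite IH; apply D_sub. Qed.
Lemma Dw_scal w c f : Dw w (Fc c * f)%fld = (Fc c * Dw w f)%fld.
Proof. induction w as [|k w IH]; simpl; [reflexivity|]. rewrite IH; apply D_scal. Qed.
Lemma Dw_D w k f : Dw w (D k f) = D k (Dw w f).
Proof. induction w as [|l w IH]; simpl; [reflexivity|]. rewrite IH; apply D_comm. Qed.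
Lemma Dw_0 w : Dw w (Fc 0) = Fc 0.
Proof. induction w as [|l w IH]; simpl; [reflexivity|]. rewrite IH; apply D_c. Qed.
Lemma Dw_app w1 w2 f : Dw (w1 ++ w2) f = Dw w1 (Dw w2 f).
Proof. apply fold_right_app. Qed.
Lemma Dw_perm w w' f : Permutation w w' -> Dw w f = Dw w' f.
Proof.
  intros H; induction H; simpl; [reflexivity | f_equal; assumption | apply D_comm | congruence].
Qed.
Lemma Dw_val w (f : F) : fv (Dw w f) = fold_right pd (fv f) w.
Proof. induction w as [|k w IH]; simpl; [reflexivity|]. rewrite fv_D, IH; reflexivity. Qed.

(** * Integration over the torus *)

Lemma TI_sig : {h : F -> R -> R | forall f t, h f t = torus_int f t}.
Proof. exists (fun (f : F) t => torus_int f t); reflexivity. Qed.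
Definition TI := proj1_sig TI_sig.
Definition TI_E : forall f t, TI f t = torus_int f t := proj2_sig TI_sig.
Definition L2 (f : F) (t : R) : R := TI (f * f)%fld t.

(** The base point is immaterial: after three partial integrals the field is constant in space. *)
Lemma TI_Iv f t : TI f t = Iv 1 (Iv 2 (Iv 3 f)) t 0 0 0. Proof. rewrite TI_E; reflexivity. Qed.

Lemma ex_RInt_slice (f : Field) k t x y z : smooth f -> ex_RInt (slice k f t x y z) 0 1.
Proof.
  intros H; apply (ex_RInt_continuous (V := R_CompleteNormedModule)); intros; apply continuous_slice, smooth_cont, H.
Qed.

Lemma Iv_fadd k f g : smooth f -> smooth g -> Iv k (fadd f g) = fadd (Iv k f) (Iv k g).
Proof.
  intros Hf Hg; apply field_ext; intros; unfold Iv at 1; rewrite slice_fadd.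
  apply (RInt_plus (V := R_CompleteNormedModule)); apply ex_RInt_slice; assumption.
Qed.
Lemma Iv_scal k c f : smooth f -> Iv k (fmul (fun _ _ _ _ => c) f) = fmul (fun _ _ _ _ => c) (Iv k f).
Proof.
  intros Hf; apply field_ext; intros; unfold Iv at 1; rewrite slice_fmul.
  transitivity (RInt (fun s => scal c (slice k f t x y z s)) 0 1).
  { apply RInt_ext; intros; destruct k as [|[|[|k]]]; reflexivity. }
  rewrite (RInt_scal (V := R_CompleteNormedModule)); [reflexivity|]. apply ex_RInt_slice; assumption.
Qed.
Lemma Iv_le k (f g : Field) t : smooth f -> smooth g -> (forall x y z, f t x y z <= g t x y z) ->
  forall x y z, Iv (S k) f t x y z <= Iv (S k) g t x y z.
Proof.
  intros Hf Hg H x y z; apply RInt_le; [lra | apply ex_RInt_slice, Hf | apply ex_RInt_slice, Hg|].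
  intros s _; destruct k as [|[|k]]; apply H.
Qed.
Lemma Iv_ext k (f g : Field) t : (forall x y z, f t x y z = g t x y z) ->
  forall x y z, Iv (S k) f t x y z = Iv (S k) g t x y z.
Proof.
  intros H x y z; apply RInt_ext; intros s _; destruct k as [|[|k]]; apply H.
Qed.

Ltac smIv := repeat match goal with |- smooth (Iv _ _) => apply Iv_smooth | |- smooth (fv _) => apply f_smooth end.

Lemma TI_ext (f g : F) t : (forall x y z, f t x y z = g t x y z) -> TI f t = TI g t.
Proof. intros H; rewrite !TI_Iv; repeat (apply Iv_ext; intros); apply H. Qed.
Lemma TI_add f g t : TI (f + g)%fld t = TI f t + TI g t.
Proof.
  rewrite !TI_Iv, fv_Fadd. rewrite !Iv_fadd by smIv. reflexivity.
Qed.
Lemma TI_scal c f t : TI (Fc c * f)%fld t = c * TI f t.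
Proof.
  rewrite !TI_Iv, fv_Fmul, fv_Fc. rewrite !Iv_scal by smIv. reflexivity.
Qed.
Lemma TI_opp f t : TI (- f)%fld t = - TI f t.
Proof. unfold Fopp; rewrite TI_scal; ring. Qed.
Lemma TI_sub f g t : TI (f - g)%fld t = TI f t - TI g t.
Proof. replace (f - g)%fld with (f + - g)%fld by ring. rewrite TI_add, TI_opp; ring. Qed.
Lemma TI_le (f g : F) t : (forall x y z, f t x y z <= g t x y z) -> TI f t <= TI g t.
Proof.
  intros H; rewrite !TI_Iv; repeat (apply Iv_le; smIv; intros); apply H.
Qed.
Lemma TI_c c t : TI (Fc c) t = c.
Proof.
  assert (H : forall k, Iv k (fun _ _ _ _ => c) = (fun _ _ _ _ => c)).
  { intros k; apply field_ext; intros; unfold Iv.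
    transitivity (RInt (fun _ => c) 0 1); [apply RInt_ext; intros; destruct k as [|[|[|k]]]; reflexivity|].
    rewrite RInt_const; unfold scal; simpl; unfold mult; simpl; ring. }
  rewrite TI_Iv, fv_Fc,  !H; reflexivity.
Qed.

Lemma Iv_pd_same k (f : Field) : smooth f -> periodic f -> Iv (S k) (pd (S k) f) = (fun _ _ _ _ => 0).
Proof.
  intros Hs Hp; apply field_ext; intros t x y z; unfold Iv.
  transitivity (RInt (Derive (slice (S k) f t x y z)) 0 1).
  { apply RInt_ext; intros; destruct k as [|[|k]]; reflexivity. }
  rewrite RInt_Derive.
  - destruct (periodic_eqs f Hp) as (P1 & P2 & P3).
    replace 1 with (0 + 1) by ring.
    destruct k as [|[|k]]; cbn [slice]; rewrite ?P1, ?P2, ?P3; ring.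
  - intros s _. destruct k as [|[|k]];
      [apply (smooth_ex_derive f Hs 1 t s y z)|apply (smooth_ex_derive f Hs 2 t x s z)|apply (smooth_ex_derive f Hs 3 t x y s)].
  - intros s _. apply (continuous_ext (slice (S k) (pd (S k) f) t x y z)).
    { intros u; destruct k as [|[|k]]; reflexivity. }
    apply continuous_slice, smooth_cont, smooth_pd, Hs.
Qed.

Lemma periodic_Iv k (f : Field) : periodic f -> periodic (Iv k f).
Proof.
  intros Hp. destruct (periodic_eqs f Hp) as (P1 & P2 & P3).
  intros t x y z; repeat split; apply RInt_ext; intros s _; destruct k as [|[|[|k]]]; cbn [slice]; auto.
Qed.

Lemma Iv_0 k : Iv k (fun _ _ _ _ => 0) = (fun _ _ _ _ => 0).
Proof.
  apply field_ext; intros; unfold Iv.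
  transitivity (RInt (fun _ => 0) 0 1); [apply RInt_ext; intros; destruct k as [|[|[|k]]]; reflexivity|].
  rewrite RInt_const; unfold scal; simpl; unfold mult; simpl; ring.
Qed.

(** The derivative passes the integrals in the other variables, and its integral in its own variable
    vanishes by periodicity. All integrations by parts rest on this. *)
Lemma TI_D i (f : F) t : TI (D (S i) f) t = 0.
Proof.
  rewrite TI_Iv, fv_D.
  assert (S1 := f_smooth f). assert (S2 := Iv_smooth 3 f S1). assert (S3 := Iv_smooth 2 _ S2).
  assert (P1 := f_periodic f). assert (P2 := periodic_Iv 3 f P1). assert (P3 := periodic_Iv 2 _ P2).
  destruct i as [|[|i]].
  - rewrite <- pd_Iv, <- pd_Iv by (simpl; auto; lia). rewrite Iv_pd_same by assumption; reflexivity.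
  - rewrite <- pd_Iv by (simpl; auto; lia). rewrite Iv_pd_same by assumption. rewrite Iv_0; reflexivity.
  - change (pd (S (S (S i))) f) with (pd 3 f). rewrite (Iv_pd_same 2) by assumption.
    rewrite !Iv_0; reflexivity.
Qed.

Lemma TI_derive (f : F) t : is_derive (TI f) t (TI (D 0 f) t).
Proof.
  assert (S1 := f_smooth f). assert (S2 := Iv_smooth 3 f S1). assert (S3 := Iv_smooth 2 _ S2).
  assert (S4 := Iv_smooth 1 _ S3).
  rewrite TI_Iv, fv_D. rewrite <- !pd_Iv by (simpl; auto; lia).
  apply (is_derive_ext (slice 0 (Iv 1 (Iv 2 (Iv 3 f))) t 0 0 0)); [intros; rewrite TI_Iv; reflexivity|].
  apply Derive_correct. apply (smooth_ex_derive _ S4 0 t 0 0 0).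
Qed.

Lemma L2_TI f t : L2 f t = TI (f * f)%fld t.
Proof. reflexivity. Qed.
Lemma L2_E (f : F) t : L2sq f t = L2 f t.
Proof.
  unfold L2, L2sq; rewrite TI_E; unfold torus_int.
  apply RInt_ext; intros. apply RInt_ext; intros. apply RInt_ext; intros. rewrite Fmul_v; simpl; ring.
Qed.
Lemma TI_nonneg (f : F) t : (forall x y z, 0 <= f t x y z) -> 0 <= TI f t.
Proof. intros H; rewrite <- (TI_c 0 t). apply TI_le; intros; Fv; apply H. Qed.
Lemma L2_nonneg f t : 0 <= L2 f t.
Proof. rewrite L2_TI; apply TI_nonneg; intros; Fv; apply Rle_0_sqr. Qed.

(** * The inner product and the norm of L2 *)

Definition ip (f g : F) (t : R) : R := TI (f * g)%fld t.
Definition n2 (f : F) (t : R) : R := sqrt (L2 f t).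

Lemma ip_sym f g t : ip f g t = ip g f t.
Proof. unfold ip; f_equal; ring. Qed.
Lemma ip_add_l f g h t : ip (f + g)%fld h t = ip f h t + ip g h t.
Proof. unfold ip; rewrite <- TI_add; f_equal; ring. Qed.
Lemma ip_add_r f g h t : ip h (f + g)%fld t = ip h f t + ip h g t.
Proof. unfold ip; rewrite <- TI_add; f_equal; ring. Qed.
Lemma ip_sub_l f g h t : ip (f - g)%fld h t = ip f h t - ip g h t.
Proof. unfold ip; rewrite <- TI_sub; f_equal; ring. Qed.
Lemma ip_sub_r f g h t : ip h (f - g)%fld t = ip h f t - ip h g t.
Proof. unfold ip; rewrite <- TI_sub; f_equal; ring. Qed.
Lemma ip_opp_r f h t : ip h (- f)%fld t = - ip h f t.
Proof. unfold ip; rewrite <- TI_opp; f_equal; ring. Qed.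
Lemma ip_scal_l c f h t : ip (Fc c * f)%fld h t = c * ip f h t.
Proof. unfold ip; rewrite <- TI_scal; f_equal; ring. Qed.
Lemma ip_scal_r c f h t : ip h (Fc c * f)%fld t = c * ip h f t.
Proof. unfold ip; rewrite <- TI_scal; f_equal; ring. Qed.
Lemma ip_D i f g t : ip (D (S i) f) g t = - ip f (D (S i) g) t.
Proof.
  assert (H := TI_D i (f * g)%fld t). rewrite D_mul, TI_add in H. unfold ip; lra.
Qed.
Lemma ip_self f t : ip f f t = L2 f t. Proof. symmetry; apply L2_TI. Qed.
Lemma ip_ext (f g f' g' : F) t : (forall x y z, f t x y z = f' t x y z) -> (forall x y z, g t x y z = g' t x y z) ->
  ip f g t = ip f' g' t.
Proof. intros H1 H2; apply TI_ext; intros; Fv; rewrite H1, H2; reflexivity. Qed.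
Lemma ip_derive f g t : is_derive (ip f g) t (ip (D 0 f) g t + ip f (D 0 g) t).
Proof.
  unfold ip; rewrite <- TI_add, <- D_mul. apply TI_derive.
Qed.

Lemma n2_nonneg f t : 0 <= n2 f t. Proof. apply sqrt_pos. Qed.
Lemma n2_sqr f t : n2 f t * n2 f t = L2 f t. Proof. apply sqrt_sqrt, L2_nonneg. Qed.

Lemma cauchy_schwarz f g t : Rabs (ip f g t) <= n2 f t * n2 g t.
Proof.
  assert (H : forall r, 0 <= L2 f t + 2 * r * ip f g t + r * r * L2 g t).
  { intros r. assert (E := L2_nonneg (f + Fc r * g)%fld t). rewrite <- ip_self in E.
    rewrite ip_add_l, !ip_add_r, !ip_scal_l, !ip_scal_r, !ip_self, (ip_sym g f) in E. lra. }
  assert (Hf := L2_nonneg f t). assert (Hg := L2_nonneg g t).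
  apply Rsqr_incr_0_var; [|apply Rmult_le_pos; apply n2_nonneg].
  rewrite <- Rsqr_abs. unfold Rsqr.
  replace (n2 f t * n2 g t * (n2 f t * n2 g t)) with ((n2 f t * n2 f t) * (n2 g t * n2 g t)) by ring.
  rewrite !n2_sqr. set (b := ip f g t) in *.
  destruct (Req_dec (L2 g t) 0) as [E|E].
  - rewrite E in *. destruct (Req_dec b 0) as [Eb|Eb]; [rewrite Eb; lra|].
    (* For [g] of norm zero the polynomial is affine in r; this r gives it the value -1. *)
    specialize (H (- (L2 f t + 1) / (2 * b))).
    exfalso. replace (L2 f t + 2 * (- (L2 f t + 1) / (2 * b)) * b + - (L2 f t + 1) / (2 * b) * (- (L2 f t + 1) / (2 * b)) * 0) with (-1) in H by (field; assumption). lra.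
  - specialize (H (- b / L2 g t)).
    assert (H' : 0 <= (L2 f t + 2 * (- b / L2 g t) * b + - b / L2 g t * (- b / L2 g t) * L2 g t) * L2 g t)
      by (apply Rmult_le_pos; assumption).
    replace ((L2 f t + 2 * (- b / L2 g t) * b + - b / L2 g t * (- b / L2 g t) * L2 g t) * L2 g t)
      with (L2 f t * L2 g t - b * b) in H' by (field; assumption). lra.
Qed.

Lemma n2_le_sqrt f t B : 0 <= B -> L2 f t <= B * B -> n2 f t <= B.
Proof. intros H1 H2; unfold n2; rewrite <- (sqrt_square B) by assumption. apply sqrt_le_1_alt, H2. Qed.

Lemma n2_triang f g t : n2 (f + g)%fld t <= n2 f t + n2 g t.
Proof.
  assert (H1 := n2_nonneg f t). assert (H2 := n2_nonneg g t).
  apply n2_le_sqrt; [lra|].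
  rewrite <- ip_self, ip_add_l, !ip_add_r, !ip_self, (ip_sym g f), <- !n2_sqr.
  assert (H := cauchy_schwarz f g t). apply Rabs_le_between in H. nra.
Qed.
Lemma n2_scal c f t : n2 (Fc c * f)%fld t = Rabs c * n2 f t.
Proof.
  change (sqrt (L2 (Fc c * f)%fld t) = Rabs c * sqrt (L2 f t)). rewrite <- ip_self, ip_scal_l, ip_scal_r, ip_self.
  rewrite <- sqrt_Rsqr_abs, <- sqrt_mult; [f_equal; unfold Rsqr; ring|apply Rle_0_sqr|apply L2_nonneg].
Qed.
Lemma n2_ext (f g : F) t : (forall x y z, f t x y z = g t x y z) -> n2 f t = n2 g t.
Proof. intros H; change (sqrt (L2 f t) = sqrt (L2 g t)); rewrite <- !ip_self; f_equal; apply ip_ext; assumption. Qed.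
Lemma n2_mul_sup (f g : F) t B : 0 <= B -> (forall x y z, Rabs (f t x y z) <= B) -> n2 (f * g)%fld t <= B * n2 g t.
Proof.
  intros HB H. apply n2_le_sqrt; [apply Rmult_le_pos; [assumption|apply n2_nonneg]|].
  replace (B * n2 g t * (B * n2 g t)) with (B * B * (n2 g t * n2 g t)) by ring.
  rewrite n2_sqr, !L2_TI, <- TI_scal. apply TI_le; intros; Fv.
  specialize (H x y z). assert (H' : f t x y z * f t x y z <= B * B).
  { apply Rabs_le_between in H; nra. }
  assert (0 <= g t x y z * g t x y z) by apply Rle_0_sqr. nra.
Qed.

Ltac smt := repeat match goal with
  | H : smooth ?f |- smooth ?f => exact H
  | |- smooth (Iv _ _) => apply Iv_smooth
  | |- smooth (fv _) => apply f_smooth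
  | |- smooth (fadd _ _) => apply smooth_fadd
  | |- smooth (fmul _ _) => apply smooth_fmul
  | |- smooth (pd _ _) => apply smooth_pd
  | |- smooth (fun _ _ _ _ => _) => apply smooth_const
  end.

(** * Sobolev and Poincare inequalities *)

Lemma ex_RInt_cont (g : R -> R) a b : (forall s, continuous g s) -> ex_RInt g a b.
Proof. intros H; apply (ex_RInt_continuous (V := R_CompleteNormedModule)); intros; apply H. Qed.

Lemma RInt_mono_interval (q : R -> R) a b : (forall s, continuous q s) -> (forall s, 0 <= q s) ->
  0 <= a <= b -> b <= 1 -> RInt q a b <= RInt q 0 1.
Proof.
  intros Hc Hq [H1 H2] H3.
  rewrite <- (RInt_Chasles (V := R_CompleteNormedModule) q 0 a 1) by (apply ex_RInt_cont, Hc).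
  rewrite <- (RInt_Chasles (V := R_CompleteNormedModule) q a b 1) by (apply ex_RInt_cont, Hc).
  assert (A := RInt_ge_0 q 0 a H1 (ex_RInt_cont _ _ _ Hc) (fun s _ => Hq s)).
  assert (B := RInt_ge_0 q b 1 H3 (ex_RInt_cont _ _ _ Hc) (fun s _ => Hq s)).
  unfold plus; simpl. lra.
Qed.

Lemma osc_le (phi : R -> R) x y : (forall s, ex_derive phi s) -> (forall s, continuous (Derive phi) s) ->
  0 <= y <= x -> x <= 1 -> Rabs (phi x - phi y) <= RInt (fun s => Rabs (Derive phi s)) 0 1.
Proof.
  intros H1 H2 H3 H4.
  assert (Hc : forall s, continuous (fun s => Rabs (Derive phi s)) s)
    by (intros s; apply (continuous_comp (Derive phi) Rabs); [apply H2 | apply continuous_Rabs]).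
  rewrite <- (RInt_Derive phi y x) by (intros; auto).
  apply Rle_trans with (RInt (fun s => Rabs (Derive phi s)) y x).
  - apply abs_RInt_le; [lra | apply ex_RInt_cont, H2].
  - apply RInt_mono_interval; auto. intros; apply Rabs_pos.
Qed.

Lemma RInt_lin2 (f g : R -> R) a b : (forall s, continuous f s) -> (forall s, continuous g s) ->
  RInt (fun s => a * f s + b * g s) 0 1 = a * RInt f 0 1 + b * RInt g 0 1.
Proof.
  intros Hf Hg.
  assert (E1 : RInt (fun s => a * f s) 0 1 = a * RInt f 0 1)
    by (apply (RInt_scal (V := R_CompleteNormedModule)), ex_RInt_cont, Hf).
  assert (E2 : RInt (fun s => b * g s) 0 1 = b * RInt g 0 1)
    by (apply (RInt_scal (V := R_CompleteNormedModule)), ex_RInt_cont, Hg).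
  rewrite (RInt_plus (V := R_CompleteNormedModule) (fun s => a * f s) (fun s => b * g s)).
  - rewrite E1, E2; reflexivity.
  - apply (ex_RInt_scal (V := R_CompleteNormedModule)), ex_RInt_cont, Hf.
  - apply (ex_RInt_scal (V := R_CompleteNormedModule)), ex_RInt_cont, Hg.
Qed.

Lemma RInt_c (c : R) : RInt (fun _ => c) 0 1 = c.
Proof. rewrite RInt_const; unfold scal; simpl; unfold mult; simpl; ring. Qed.

Lemma RInt_extR (f g : R -> R) : (forall s, f s = g s) -> RInt f 0 1 = RInt g 0 1.
Proof. intros H; apply RInt_ext; intros; apply H. Qed.

(** Nonnegativity of the variance on an interval of length one. *)
Lemma jensen (g : R -> R) : (forall s, continuous g s) -> (RInt g 0 1) ^ 2 <= RInt (fun s => g s * g s) 0 1.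
Proof.
  intros Hg. set (m := RInt g 0 1).
  assert (Hgg : forall s, continuous (fun s => g s * g s) s) by (intros; apply (continuous_mult g g); auto).
  assert (H : 0 <= RInt (fun s => (g s - m) * (g s - m)) 0 1).
  { apply RInt_ge_0; [lra| |intros; apply Rle_0_sqr].
    apply ex_RInt_cont; intros. apply (continuous_mult (fun s => g s - m) (fun s => g s - m));
    apply (continuous_minus g (fun _ => m)); auto; apply continuous_const. }
  rewrite (RInt_extR _ (fun s => 1 * (g s * g s) + 1 * ((-2 * m) * g s + (m * m) * 1))) in H by (intros; ring).
  rewrite RInt_lin2 in H; auto.
  - rewrite RInt_lin2 in H; auto; [|intros; apply continuous_const]. rewrite RInt_c in H. fold m in H.
    simpl; lra.
  - intros s. apply (continuous_plus (fun s => -2 * m * g s) (fun s => m * m * 1)); [|apply continuous_const].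
    apply (continuous_mult (fun _ => -2 * m) g); [apply continuous_const|auto].
Qed.

(** The deviation from the mean is the mean of [phi x - phi s], each of which is at most the
    integral of the absolute derivative; [jensen] then passes to squares. *)
Lemma poincare_1d (phi : R -> R) x : (forall s, ex_derive phi s) -> (forall s, continuous (Derive phi) s) ->
  0 <= x <= 1 -> (phi x - RInt phi 0 1) ^ 2 <= RInt (fun s => Derive phi s * Derive phi s) 0 1.
Proof.
  intros H1 H2 Hx.
  assert (Hphi : forall s, continuous phi s) by (intros; apply (ex_derive_continuous phi), H1).
  set (m := RInt (fun s => Rabs (Derive phi s)) 0 1).
  assert (Hc : forall s, continuous (fun s => Rabs (Derive phi s)) s)
    by (intros s; apply (continuous_comp (Derive phi) Rabs); [apply H2 | apply continuous_Rabs]).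
  assert (E : phi x - RInt phi 0 1 = RInt (fun s => phi x * 1 + (-1) * phi s) 0 1).
  { rewrite RInt_lin2, RInt_c; auto; [ring|]. intros; apply continuous_const. }
  assert (Hb : Rabs (phi x - RInt phi 0 1) <= m).
  { rewrite E. apply Rle_trans with ((1 - 0) * m); [|lra]. apply abs_RInt_le_const; [lra| |].
    - apply ex_RInt_cont; intros. apply (continuous_plus (fun s => phi x * 1) (fun s => -1 * phi s)).
      + apply continuous_const.
      + apply (continuous_mult (fun _ => -1) phi); auto; apply continuous_const.
    - intros s Hs. destruct (Rle_dec s x) as [L|L].
      + replace (phi x * 1 + -1 * phi s) with (phi x - phi s) by ring. apply osc_le; auto; lra.
      + replace (phi x * 1 + -1 * phi s) with (- (phi s - phi x)) by ring. rewrite Rabs_Ropp. apply osc_le; auto; lra. }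
  apply Rle_trans with (m ^ 2).
  - rewrite <- pow2_abs. apply pow_incr; split; [apply Rabs_pos | assumption].
  - apply Rle_trans with (1 := jensen _ Hc). apply Req_le, RInt_ext; intros.
    rewrite <- Rabs_mult. apply Rabs_right, Rle_ge, Rle_0_sqr.
Qed.

Lemma periodic_reduce (phi : R -> R) x : (forall s, phi (s + 1) = phi s) -> exists x', 0 <= x' <= 1 /\ phi x = phi x'.
Proof.
  intros H.
  assert (Hn : forall n s, phi (s + INR n) = phi s).
  { induction n as [|n IH]; intros s; [simpl; f_equal; ring|].
    rewrite S_INR. replace (s + (INR n + 1)) with ((s + INR n) + 1) by ring. rewrite H; apply IH. }
  assert (Hz : forall z s, phi (s + IZR z) = phi s).
  { intros z s; destruct (ZArith_dec.Z_le_dec 0 z) as [L|L].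
    - rewrite <- (Z2Nat.id z) by assumption. rewrite <- INR_IZR_INZ. apply Hn.
    - rewrite <- (Hn (Z.to_nat (- z)) (s + IZR z)). f_equal. rewrite INR_IZR_INZ, Z2Nat.id by lia.
      rewrite opp_IZR; ring. }
  exists (x - IZR (Int_part x)). split.
  - destruct (base_Int_part x); lra.
  - rewrite <- (Hz (- Int_part x)%Z x). f_equal. rewrite opp_IZR; ring.
Qed.

Lemma poincare_dir k (f : Field) t x y z : smooth f -> periodic f ->
  (f t x y z - Iv (S k) f t x y z) ^ 2 <= Iv (S k) (fmul (pd (S k) f) (pd (S k) f)) t x y z.
Proof.
  intros Hs Hp. destruct (periodic_eqs f Hp) as (P1 & P2 & P3).
  set (phi := slice (S k) f t x y z).
  assert (Hper : forall s, phi (s + 1) = phi s) by (intros; unfold phi; destruct k as [|[|k]]; cbn [slice]; auto).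
  assert (He : forall s, ex_derive phi s).
  { intros s; unfold phi; destruct k as [|[|k]];
      [apply (smooth_ex_derive f Hs 1 t s y z)|apply (smooth_ex_derive f Hs 2 t x s z)|apply (smooth_ex_derive f Hs 3 t x y s)]. }
  assert (Ed : forall s, Derive phi s = slice (S k) (pd (S k) f) t x y z s)
    by (intros s; unfold phi; destruct k as [|[|k]]; reflexivity).
  assert (Hc : forall s, continuous (Derive phi) s).
  { intros s; apply (continuous_ext (slice (S k) (pd (S k) f) t x y z)); [intros; symmetry; apply Ed|].
    apply continuous_slice, smooth_cont, smooth_pd, Hs. }
  assert (Ef : f t x y z = phi (coord (S k) t x y z)) by (symmetry; apply slice_coord).
  destruct (periodic_reduce phi (coord (S k) t x y z) Hper) as (c & Hc1 & Hc2).
  rewrite Ef, Hc2. change (Iv (S k) f t x y z) with (RInt phi 0 1).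
  apply Rle_trans with (1 := poincare_1d phi c He Hc Hc1).
  apply Req_le. unfold Iv. rewrite slice_fmul. apply RInt_ext; intros; rewrite Ed; reflexivity.
Qed.

Lemma jensen_dir k (f : Field) t x y z : smooth f ->
  (Iv k f t x y z) ^ 2 <= Iv k (fmul f f) t x y z.
Proof.
  intros Hs; unfold Iv; rewrite slice_fmul.
  apply (jensen (slice k f t x y z)). intros; apply continuous_slice, smooth_cont, Hs.
Qed.

Definition scl (c : R) (f : Field) : Field := fmul (fun _ _ _ _ => c) f.

(** The value splits into its deviation from the mean in direction [S k], controlled by Poincare,
    and that mean, controlled by Jensen; the factor 2 comes from the splitting. *)
Lemma sobolev_dir k (f : Field) t x y z : smooth f -> periodic f ->
  (f t x y z) ^ 2 <= Iv (S k) (scl 2 (fadd (fmul f f) (fmul (pd (S k) f) (pd (S k) f)))) t x y z.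
Proof.
  intros Hs Hp.
  assert (H1 := poincare_dir k f t x y z Hs Hp).
  assert (H2 := jensen_dir (S k) f t x y z Hs).
  unfold scl; rewrite Iv_scal, Iv_fadd;
    smt.
  unfold fmul at 1, fadd.
  set (a := f t x y z) in *; set (b := Iv (S k) f t x y z) in *.
  assert (0 <= (a - b - b) ^ 2) by apply pow2_ge_0. nra.
Qed.

(** Using a one-dimensional inequality once per direction produces the derivatives taken at most
    once in each direction. This elementary route costs three derivatives, which is the origin of
    every [+ 3] in the counts below. *)
Definition sobolev_words : list (list nat) :=
  [[]; [3]; [2]; [3; 2]; [1]; [3; 1]; [2; 1]; [3; 2; 1]]%nat.

Definition lsum (l : list R) : R := fold_right Rplus 0 l.

Lemma sobolev (f : F) t x y z :
  (f t x y z) ^ 2 <= 8 * lsum (map (fun w => L2 (Dw w f) t) sobolev_words).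
Proof.
  assert (T : forall k (g : F) x y z, g t x y z * g t x y z
             <= Iv (S k) (Fc 2 * (g * g + D (S k) g * D (S k) g))%fld t x y z).
  { intros k g x' y' z'. assert (H := sobolev_dir k g t x' y' z' (f_smooth g) (f_periodic g)).
    rewrite !fv_Fmul, fv_Fc, fv_Fadd, !fv_Fmul, fv_D. unfold scl in H. simpl (_ ^ 2) in H. lra. }
  assert (C : forall k (a b : F) x y z, Iv k (Fc 2 * (a + b))%fld t x y z = 2 * (Iv k a t x y z + Iv k b t x y z)).
  { intros. rewrite fv_Fmul, fv_Fc, fv_Fadd. rewrite Iv_scal, Iv_fadd;
      smt. reflexivity. }
  (* The integrands left after one, two and three directions; each direction contributes a factor 2,
     hence the 8. *)
  set (E3 := fun g : F => (Fc 2 * (g * g + D 3 g * D 3 g))%fld).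
  set (E23 := fun g : F => (Fc 2 * (E3 g + E3 (D 2 g)))%fld).
  set (E123 := fun g : F => (Fc 2 * (E23 g + E23 (D 1 g)))%fld).
  assert (B3 : forall (g : F) x y z, g t x y z * g t x y z <= Iv 3 (E3 g) t x y z) by (intros; apply T).
  assert (B23 : forall (g : F) x y z, g t x y z * g t x y z <= Iv 2 (Iv 3 (E23 g)) t x y z).
  { intros g x' y' z'; apply Rle_trans with (1 := T 1%nat g x' y' z').
    apply (Iv_le 1); [apply f_smooth | apply Iv_smooth, f_smooth|]. intros x0 y0 z0. unfold E23. rewrite C; Fv.
    assert (A := B3 g x0 y0 z0). assert (B := B3 (D 2 g) x0 y0 z0). lra. }
  assert (B123 : f t x y z * f t x y z <= Iv 1 (Iv 2 (Iv 3 (E123 f))) t x y z).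
  { apply Rle_trans with (1 := T 0%nat f x y z).
    apply (Iv_le 0); [apply f_smooth | apply Iv_smooth, Iv_smooth, f_smooth|].
    intros x0 y0 z0. unfold E123.
    assert (E : Iv 2 (Iv 3 (Fc 2 * (E23 f + E23 (D 1 f)))%fld) t x0 y0 z0
        = 2 * (Iv 2 (Iv 3 (E23 f)) t x0 y0 z0 + Iv 2 (Iv 3 (E23 (D 1 f))) t x0 y0 z0)).
    { rewrite fv_Fmul, fv_Fc, fv_Fadd. rewrite !Iv_scal, !Iv_fadd;
      smt. reflexivity. }
    rewrite E; Fv.
    assert (A := B23 f x0 y0 z0). assert (B := B23 (D 1 f) x0 y0 z0). lra. }
  change (Iv 1 (Iv 2 (Iv 3 (E123 f))) t x y z) with (Iv 1 (Iv 2 (Iv 3 (E123 f))) t 0 0 0) in B123.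
  rewrite <- TI_Iv in B123. unfold E123, E23, E3 in B123.
  repeat rewrite ?TI_scal, ?TI_add in B123.
  cbn [sobolev_words map lsum fold_right Dw]. unfold L2. simpl (_ ^ 2). lra.
Qed.

Lemma Iv_indep k (f : Field) : (forall t x y z s, slice k f t x y z s = f t x y z) -> Iv k f = f.
Proof.
  intros H; apply field_ext; intros; unfold Iv.
  rewrite (RInt_ext _ (fun _ => f t x y z)) by (intros; apply H). apply RInt_c.
Qed.

(** Each of the three bounds is already an integral in some of the variables, so integrating it over
    these again does not change it. *)
Lemma TI_le_3 (f : F) (g3 lownorm_sq g1 : Field) t : smooth g3 -> smooth lownorm_sq -> smooth g1 ->
  (forall x y z, f t x y z <= fmul (fun _ _ _ _ => 3) (fadd (fadd g3 lownorm_sq) g1) t x y z) ->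
  Iv 3 g3 = g3 -> Iv 3 lownorm_sq = lownorm_sq -> Iv 2 lownorm_sq = lownorm_sq -> Iv 3 g1 = g1 -> Iv 2 g1 = g1 -> Iv 1 g1 = g1 ->
  TI f t <= 3 * (Iv 1 (Iv 2 g3) t 0 0 0 + Iv 1 lownorm_sq t 0 0 0 + g1 t 0 0 0).
Proof.
  intros Q3 Q2 Q1 B I3 I2 I2' I1 I1' I1''.
  assert (S2 : smooth (fadd g3 lownorm_sq)) by (apply smooth_fadd; assumption).
  assert (S1 : smooth (fadd (fadd g3 lownorm_sq) g1)) by (apply smooth_fadd; assumption).
  assert (SS : smooth (fmul (fun _ _ _ _ => 3) (fadd (fadd g3 lownorm_sq) g1)))
      by (apply smooth_fmul; [apply smooth_const | exact S1]).
  rewrite TI_Iv.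
  apply Rle_trans with (Iv 1 (Iv 2 (Iv 3 (fmul (fun _ _ _ _ => 3) (fadd (fadd g3 lownorm_sq) g1)))) t 0 0 0).
  { apply (Iv_le 0); [apply Iv_smooth, Iv_smooth, f_smooth | apply Iv_smooth, Iv_smooth, SS|]. intros.
    apply (Iv_le 1); [apply Iv_smooth, f_smooth | apply Iv_smooth, SS|]. intros.
    apply (Iv_le 2); [apply f_smooth | apply SS|]. intros. apply B. }
  apply Req_le.
  rewrite (Iv_scal 3 3 _ S1), (Iv_fadd 3 _ _ S2 Q1), (Iv_fadd 3 _ _ Q3 Q2), I3, I2, I1.
  rewrite (Iv_scal 2 3 _ S1), (Iv_fadd 2 _ _ S2 Q1), (Iv_fadd 2 _ _ Q3 Q2), I2', I1'.
  assert (Q3' := Iv_smooth 2 _ Q3).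
  assert (S2' : smooth (fadd (Iv 2 g3) lownorm_sq)) by (apply smooth_fadd; assumption).
  assert (S1' : smooth (fadd (fadd (Iv 2 g3) lownorm_sq) g1)) by (apply smooth_fadd; assumption).
  rewrite (Iv_scal 1 3 _ S1'), (Iv_fadd 1 _ _ S2' Q1), (Iv_fadd 1 _ _ Q3' Q2), I1''.
  reflexivity.
Qed.

(** The field is telescoped through its successive partial means, the last of which is the total
    mean. A one-dimensional inequality controls each difference, and Jensen moves the partial
    integrals inside the squares. *)
Lemma poincare (f : F) t : TI f t = 0 ->
  L2 f t <= 3 * (L2 (D 1 f) t + L2 (D 2 f) t + L2 (D 3 f) t).
Proof.
  intros H0.
  assert (S0 := f_smooth f). assert (S1 := Iv_smooth 3 f S0). assert (S2 := Iv_smooth 2 _ S1).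
  assert (P0 := f_periodic f). assert (P1 := periodic_Iv 3 f P0). assert (P2 := periodic_Iv 2 _ P1).
  set (g3 := Iv 3 (D 3 f * D 3 f)%fld).
  set (lownorm_sq := Iv 2 (Iv 3 (D 2 f * D 2 f)%fld)).
  set (g1 := Iv 1 (Iv 2 (Iv 3 (D 1 f * D 1 f)%fld))).
  assert (Q3 : smooth g3) by apply Iv_smooth, f_smooth.
  assert (Q2 : smooth lownorm_sq) by apply Iv_smooth, Iv_smooth, f_smooth.
  assert (Q1 : smooth g1) by apply Iv_smooth, Iv_smooth, Iv_smooth, f_smooth.
  assert (B : forall x y z, (f * f)%fld t x y z <= fmul (fun _ _ _ _ => 3) (fadd (fadd g3 lownorm_sq) g1) t x y z).
  { intros x y z; Fv. unfold fmul, fadd.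
    assert (A3 : (f t x y z - Iv 3 f t x y z) ^ 2 <= g3 t x y z).
    { unfold g3; rewrite fv_Fmul, fv_D. apply (poincare_dir 2); assumption. }
    assert (A2 : (Iv 3 f t x y z - Iv 2 (Iv 3 f) t x y z) ^ 2 <= lownorm_sq t x y z).
    { apply Rle_trans with (1 := poincare_dir 1 (Iv 3 f) t x y z S1 P1). unfold lownorm_sq.
      rewrite pd_Iv by (auto; simpl; lia).
      apply (Iv_le 1); [apply smooth_fmul; apply Iv_smooth, smooth_pd, S0 | apply Iv_smooth, f_smooth|].
      intros x0 y0 z0. rewrite fv_Fmul, fv_D.
      assert (J := jensen_dir 3 (pd 2 f) t x0 y0 z0 (smooth_pd _ _ S0)). unfold fmul at 1. simpl in J. lra. }
    assert (A1 : (Iv 2 (Iv 3 f) t x y z - Iv 1 (Iv 2 (Iv 3 f)) t x y z) ^ 2 <= g1 t x y z).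
    { apply Rle_trans with (1 := poincare_dir 0 (Iv 2 (Iv 3 f)) t x y z S2 P2). unfold g1.
      rewrite !pd_Iv by (auto; simpl; lia).
      apply (Iv_le 0); [apply smooth_fmul; apply Iv_smooth, Iv_smooth, smooth_pd, S0 | apply Iv_smooth, Iv_smooth, f_smooth|].
      intros x0 y0 z0. rewrite fv_Fmul, fv_D.
      assert (J := jensen_dir 2 (Iv 3 (pd 1 f)) t x0 y0 z0 (Iv_smooth _ _ (smooth_pd _ _ S0))).
      unfold fmul at 1. apply Rle_trans with (Iv 2 (fmul (Iv 3 (pd 1 f)) (Iv 3 (pd 1 f))) t x0 y0 z0).
      { simpl in J; lra. }
      apply (Iv_le 1); [apply smooth_fmul; apply Iv_smooth, smooth_pd, S0 | apply Iv_smooth, smooth_fmul; apply smooth_pd, S0|].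
      intros x1 y1 z1. assert (J' := jensen_dir 3 (pd 1 f) t x1 y1 z1 (smooth_pd _ _ S0)). unfold fmul at 1. simpl in J'. lra. }
    assert (Z : Iv 1 (Iv 2 (Iv 3 f)) t x y z = 0) by (rewrite TI_Iv in H0; exact H0).
    rewrite Z in A1.
    set (a := f t x y z) in *; set (b := Iv 3 f t x y z) in *; set (c := Iv 2 (Iv 3 f) t x y z) in *.
    clearbody a b c. assert (0 <= (a - b - (b - c)) ^ 2) by apply pow2_ge_0.
    assert (0 <= (a - b - c) ^ 2) by apply pow2_ge_0. assert (0 <= (b - c - c) ^ 2) by apply pow2_ge_0.
    nra. }
  assert (X := TI_le_3 (f * f)%fld g3 lownorm_sq g1 t Q3 Q2 Q1 B).
  unfold L2; rewrite (TI_Iv (D 1 f * D 1 f)%fld), (TI_Iv (D 2 f * D 2 f)%fld), (TI_Iv (D 3 f * D 3 f)%fld).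
  apply Rle_trans with (1 := X (Iv_indep 3 g3 (fun _ _ _ _ _ => eq_refl)) (Iv_indep 3 lownorm_sq (fun _ _ _ _ _ => eq_refl))
    (Iv_indep 2 lownorm_sq (fun _ _ _ _ _ => eq_refl)) (Iv_indep 3 g1 (fun _ _ _ _ _ => eq_refl))
    (Iv_indep 2 g1 (fun _ _ _ _ _ => eq_refl)) (Iv_indep 1 g1 (fun _ _ _ _ _ => eq_refl))).
  unfold g1, lownorm_sq, g3. lra.
Qed.

(** * Equality of fields on the time interval *)

(** At an end of the interval the two-sided derivative exists by assumption and is therefore
    determined by increments towards the interior. *)
Lemma Derive_zero_on (g : R -> R) T t : 0 < T -> (forall s, 0 <= s <= T -> g s = 0) -> 0 <= t <= T ->
  ex_derive g t -> Derive g t = 0.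
Proof.
  intros HT Hg Ht [l Hl]. rewrite (is_derive_unique g t l Hl).
  apply is_derive_Reals in Hl.
  destruct (Req_dec l 0) as [E|E]; [assumption|exfalso].
  assert (Hl0 : 0 < Rabs l) by (apply Rabs_pos_lt, E).
  destruct (Hl (Rabs l) Hl0) as [d Hd].
  set (h := Rmin (d / 2) (T / 2)).
  assert (Hh : 0 < h) by (unfold h; destruct d as [d dp]; simpl; apply Rmin_pos; lra).
  assert (Hh1 : h <= d / 2) by apply Rmin_l. assert (Hh2 : h <= T / 2) by apply Rmin_r.
  assert (Hd2 : d / 2 < d) by (destruct d; simpl; lra).
  (* The increment stays in the interval: forward in the first half, backward in the second. *)
  destruct (Rle_dec t (T / 2)) as [L|L].
  - specialize (Hd h ltac:(lra) ltac:(rewrite Rabs_right; lra)).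
    rewrite !Hg in Hd by lra.
    replace ((0 - 0) / h - l) with (- l) in Hd by (field; lra). rewrite Rabs_Ropp in Hd; lra.
  - specialize (Hd (- h) ltac:(lra) ltac:(rewrite Rabs_Ropp, Rabs_right; lra)).
    rewrite !Hg in Hd by lra.
    replace ((0 - 0) / - h - l) with (- l) in Hd by (field; lra). rewrite Rabs_Ropp in Hd; lra.
Qed.

(** Fields live on all times while the system holds on [0, T] only. For 0 < T this equality is still
    stable under all derivatives, including the time derivative at both ends. *)
Definition eqT (T : R) (f g : F) : Prop := forall t x y z, 0 <= t <= T -> f t x y z = g t x y z.

Lemma eqT_D T k f g : 0 < T -> eqT T f g -> eqT T (D k f) (D k g).
Proof.
  intros HT H.
  assert (Z : eqT T (D k (f - g)%fld) (Fc 0)).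
  { intros t x y z Ht; rewrite fv_D; Fv.
    assert (E0 : forall t x y z, 0 <= t <= T -> (f - g)%fld t x y z = 0) by (intros; Fv; rewrite H by assumption; ring).
    assert (He := smooth_ex_derive _ (f_smooth (f - g)%fld) k t x y z).
    unfold pd; destruct k as [|[|[|k]]]; cbn [slice coord] in *.
    - apply (Derive_zero_on _ T); auto.
    - rewrite (Derive_ext _ (fun _ => 0)) by (intros; auto). apply Derive_const.
    - rewrite (Derive_ext _ (fun _ => 0)) by (intros; auto). apply Derive_const.
    - rewrite (Derive_ext _ (fun _ => 0)) by (intros; auto). apply Derive_const. }
  intros t x y z Ht. specialize (Z t x y z Ht). rewrite D_sub in Z. revert Z; Fv; intros; lra.
Qed.
Lemma eqT_Dw T w f g : 0 < T -> eqT T f g -> eqT T (Dw w f) (Dw w g).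
Proof. intros HT H; induction w as [|k w IH]; simpl; [assumption | apply eqT_D; assumption]. Qed.

(** Moving one derivative by parts and using Cauchy-Schwarz leaves the vanishing norm of [f] as a
    factor. *)
Lemma L2_zero_D i (f : F) t : L2 f t = 0 -> L2 (D (S i) f) t = 0.
Proof.
  intros H. assert (E : L2 (D (S i) f) t = - ip f (D (S i) (D (S i) f)) t) by (rewrite <- ip_self, ip_D; reflexivity).
  assert (C := cauchy_schwarz f (D (S i) (D (S i) f)) t).
  assert (n2 f t = 0) by (unfold n2; rewrite H; apply sqrt_0).
  rewrite H0, Rmult_0_l in C. assert (P := L2_nonneg (D (S i) f) t).
  apply Rabs_le_between in C. lra.
Qed.

(** The Sobolev inequality, all of whose right side vanishes by [L2_zero_D], takes the place of a
    continuity argument on the integrand. *)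
Lemma L2_zero_pt (f : F) t : L2 f t = 0 -> forall x y z, f t x y z = 0.
Proof.
  intros H x y z. assert (S := sobolev f t x y z).
  cbn [sobolev_words map lsum fold_right Dw] in S.
  assert (Z : forall i g, L2 g t = 0 -> L2 (D (Datatypes.S i) g) t = 0) by (intros; apply L2_zero_D; assumption).
  rewrite H, !Z in S; repeat apply Z; auto.
  assert (P := pow2_ge_0 (f t x y z)).
  assert (f t x y z ^ 2 = 0) by lra. simpl in H0. rewrite Rmult_1_r in H0.
  destruct (Rmult_integral _ _ H0); assumption.
Qed.

(** * Words of derivatives and the Leibniz rule *)

(* A word is the list of the directions of successive derivatives, 0 being time; [ord] is its parabolic order. *)
Definition wt (k : nat) : nat := match k with O => 2%nat | _ => 1%nat end.
Fixpoint ord (w : list nat) : nat := match w with [] => O | k :: w => (wt k + ord w)%nat end.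
(** The distributions of the letters over two factors, one for each subset of positions. Repeated
    letters give repeated pairs, so the binomial coefficients of the Leibniz rule appear as
    multiplicities. *)
Fixpoint splits (w : list nat) : list (list nat * list nat) :=
  match w with
  | [] => [([], [])]
  | k :: w => map (fun p => (k :: fst p, snd p)) (splits w) ++ map (fun p => (fst p, k :: snd p)) (splits w)
  end.
Definition Fsum (l : list F) : F := fold_right Fadd (Fc 0) l.

Lemma ord_app w1 w2 : ord (w1 ++ w2) = (ord w1 + ord w2)%nat.
Proof. induction w1 as [|k w IH]; simpl; [reflexivity | rewrite IH; lia]. Qed.
Lemma ord_perm w w' : Permutation w w' -> ord w = ord w'.
Proof. intros H; induction H; simpl; lia. Qed.

Lemma splits_perm w p : In p (splits w) -> Permutation (fst p ++ snd p) w.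
Proof.
  revert p; induction w as [|k w IH]; simpl; intros p H.
  - destruct H as [<-|[]]; constructor.
  - apply in_app_or in H; destruct H as [H|H]; apply in_map_iff in H; destruct H as (q & <- & Hq); simpl.
    + constructor; apply IH, Hq.
    + rewrite <- Permutation_middle. constructor; apply IH, Hq.
Qed.
Lemma splits_ord w p : In p (splits w) -> (ord (fst p) + ord (snd p) = ord w)%nat.
Proof. intros H; rewrite <- ord_app; apply ord_perm, splits_perm, H. Qed.

Lemma Fsum_app l1 l2 : Fsum (l1 ++ l2) = (Fsum l1 + Fsum l2)%fld.
Proof. induction l1 as [|f l IH]; simpl; [ring | rewrite IH; ring]. Qed.
Lemma Fsum_map_add {A} (l : list A) (f g : A -> F) :
  Fsum (map (fun a => f a + g a)%fld l) = (Fsum (map f l) + Fsum (map g l))%fld.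
Proof. induction l as [|a l IH]; simpl; [ring | rewrite IH; ring]. Qed.
Lemma D_Fsum {A} k (l : list A) (f : A -> F) : D k (Fsum (map f l)) = Fsum (map (fun a => D k (f a)) l).
Proof. induction l as [|a l IH]; simpl; [apply D_c | rewrite D_add, IH; reflexivity]. Qed.
Lemma Fsum_filter {A} (P : A -> bool) (l : list A) (f : A -> F) :
  Fsum (map f l) = (Fsum (map f (filter P l)) + Fsum (map f (filter (fun a => negb (P a)) l)))%fld.
Proof. induction l as [|a l IH]; simpl; [ring|]. rewrite IH; destruct (P a); simpl; ring. Qed.

Definition lterm (f g : F) (p : list nat * list nat) : F := (Dw (fst p) f * Dw (snd p) g)%fld.

Lemma leibniz w f g : Dw w (f * g)%fld = Fsum (map (lterm f g) (splits w)).
Proof.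
  induction w as [|k w IH]; simpl.
  - unfold lterm; simpl; ring.
  - rewrite IH, D_Fsum, map_app, Fsum_app, !map_map, <- Fsum_map_add.
    f_equal; apply map_ext; intros [w1 w2]; unfold lterm; simpl; apply D_mul.
Qed.

Definition nilb (w : list nat) : bool := match w with [] => true | _ => false end.

Lemma filter_splits_nil w : filter (fun p => nilb (fst p)) (splits w) = [([], w)].
Proof.
  induction w as [|k w IH]; simpl; [reflexivity|].
  rewrite filter_app.
  assert (E1 : forall l, filter (fun p => nilb (fst p)) (map (fun p : list nat * list nat => (k :: fst p, snd p)) l) = []).
  { induction l as [|p l IHl]; simpl; [reflexivity | exact IHl]. }
  assert (E2 : forall l, filter (fun p => nilb (fst p)) (map (fun p : list nat * list nat => (fst p, k :: snd p)) l) =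
     map (fun p => (fst p, k :: snd p)) (filter (fun p => nilb (fst p)) l)).
  { induction l as [|p l IHl]; simpl; [reflexivity|]. destruct (nilb (fst p)); simpl; rewrite IHl; reflexivity. }
  rewrite E1, E2, IH; reflexivity.
Qed.

(* The Leibniz terms with at least one derivative on the first factor: they make up the commutator of [Dw w] with that factor. *)
Definition csplits (w : list nat) := filter (fun p => negb (nilb (fst p))) (splits w).

Lemma leibniz_comm w f g : Dw w (f * g)%fld = (f * Dw w g + Fsum (map (lterm f g) (csplits w)))%fld.
Proof.
  rewrite leibniz, (Fsum_filter (fun p => nilb (fst p))), filter_splits_nil. simpl. unfold lterm at 1; simpl.
  unfold csplits; ring.
Qed.

Lemma csplits_in w p : In p (csplits w) -> In p (splits w) /\ (1 <= ord (fst p))%nat.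
Proof.
  unfold csplits; intros H; apply filter_In in H; destruct H as [H1 H2]; split; [assumption|].
  destruct p as [[|k w1] w2]; simpl in *; [discriminate|]. destruct k; simpl; lia.
Qed.

(** * Comparison up to constants *)

Definition lesssim {St : Type} (A B : St -> R) : Prop := exists C, 0 <= C /\ forall s, A s <= C * B s.
Notation "A <~ B" := (lesssim A B) (at level 70).
Definition nn {St : Type} (B : St -> R) : Prop := forall s, 0 <= B s.

Section Calculus.
Context {St : Type} (tm : St -> R).

Lemma lesssim_le (A B : St -> R) : (forall s, A s <= B s) -> A <~ B.
Proof. intros H; exists 1; split; [lra | intros; rewrite Rmult_1_l; apply H]. Qed.
Lemma lesssim_trans (A B C : St -> R) : A <~ B -> B <~ C -> A <~ C.
Proof.
  intros (c & Hc & H1) (d & Hd & H2); exists (c * d); split; [apply Rmult_le_pos; assumption|].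
  intros s; apply Rle_trans with (1 := H1 s). rewrite Rmult_assoc; apply Rmult_le_compat_l; auto.
Qed.
Lemma lesssim_add (A B C : St -> R) : A <~ C -> B <~ C -> (fun s => A s + B s) <~ C.
Proof.
  intros (c & Hc & H1) (d & Hd & H2); exists (c + d); split; [lra|].
  intros s; specialize (H1 s); specialize (H2 s); lra.
Qed.
Lemma lesssim_scal (A C : St -> R) c : 0 <= c -> A <~ C -> (fun s => c * A s) <~ C.
Proof.
  intros Hc (d & Hd & H1); exists (c * d); split; [apply Rmult_le_pos; assumption|].
  intros s; rewrite Rmult_assoc; apply Rmult_le_compat_l; auto.
Qed.
Lemma lesssim_mul (A B C E : St -> R) : nn A -> nn B -> A <~ C -> B <~ E -> (fun s => A s * B s) <~ (fun s => C s * E s).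
Proof.
  intros HA HB (c & Hc & H1) (d & Hd & H2); exists (c * d); split; [apply Rmult_le_pos; assumption|].
  intros s. replace (c * d * (C s * E s)) with ((c * C s) * (d * E s)) by ring.
  apply Rmult_le_compat; auto.
Qed.
Lemma lesssim_zero (C : St -> R) : nn C -> (fun _ => 0) <~ C.
Proof. intros H; exists 0; split; [lra|]. intros; lra. Qed.
Lemma lesssim_ext (A A' C : St -> R) : (forall s, A s = A' s) -> A' <~ C -> A <~ C.
Proof. intros E (c & Hc & H); exists c; split; [assumption|]. intros; rewrite E; apply H. Qed.
Lemma lesssim_lsum {I} (l : list I) (A : I -> St -> R) (C : St -> R) : nn C -> (forall i, In i l -> A i <~ C) ->
  (fun s => lsum (map (fun i => A i s) l)) <~ C.
Proof.
  intros HC; induction l as [|i l IH]; intros H; simpl; [apply lesssim_zero, HC|].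
  apply lesssim_add; [apply H; left; reflexivity | apply IH; intros; apply H; right; assumption].
Qed.
Lemma lesssim_sum_f (g : nat -> St -> R) n (C : St -> R) : (forall i, (i <= n)%nat -> g i <~ C) ->
  (fun s => sum_f_R0 (fun i => g i s) n) <~ C.
Proof.
  intros H; induction n as [|n IH]; simpl; [apply H; lia|].
  apply lesssim_add; [apply IH; intros; apply H; lia | apply H; lia].
Qed.
Lemma lesssim_if (b : bool) (A C : St -> R) : nn C -> (b = true -> A <~ C) -> (fun s => if b then A s else 0) <~ C.
Proof. intros HC H; destruct b; [apply H; reflexivity | apply lesssim_zero, HC]. Qed.

Definition L2b (f : St -> F) (B : St -> R) : Prop := (fun s => n2 (f s) (tm s)) <~ B.
Definition Supb (f : St -> F) (B : St -> R) : Prop :=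
  exists C, 0 <= C /\ forall s x y z, Rabs (f s (tm s) x y z) <= C * B s.

Lemma L2b_le f (A B : St -> R) : L2b f A -> A <~ B -> L2b f B.
Proof. apply lesssim_trans. Qed.
Lemma Supb_le f (A B : St -> R) : Supb f A -> A <~ B -> Supb f B.
Proof.
  intros (c & Hc & H1) (d & Hd & H2); exists (c * d); split; [apply Rmult_le_pos; assumption|].
  intros s x y z; apply Rle_trans with (1 := H1 s x y z). rewrite Rmult_assoc; apply Rmult_le_compat_l; auto.
Qed.
Lemma L2b_ext (f g : St -> F) B : (forall s x y z, f s (tm s) x y z = g s (tm s) x y z) -> L2b g B -> L2b f B.
Proof. intros E; apply lesssim_ext; intros s; apply n2_ext; intros; apply E. Qed.
Lemma L2b_add f g B : L2b f B -> L2b g B -> L2b (fun s => f s + g s)%fld B.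
Proof.
  intros H1 H2. eapply lesssim_trans; [apply lesssim_le; intros s; apply n2_triang | apply lesssim_add; assumption].
Qed.
Lemma L2b_scal c f B : L2b f B -> L2b (fun s => Fc c * f s)%fld B.
Proof.
  intros H. apply (lesssim_ext _ (fun s => Rabs c * n2 (f s) (tm s))); [intros; apply n2_scal|].
  apply lesssim_scal; [apply Rabs_pos | assumption].
Qed.
Lemma L2b_opp f B : L2b f B -> L2b (fun s => - f s)%fld B.
Proof. apply (L2b_scal (-1)). Qed.
Lemma L2b_sub f g B : L2b f B -> L2b g B -> L2b (fun s => f s - g s)%fld B.
Proof. intros H1 H2; apply (L2b_add f (fun s => - g s)%fld); [assumption | apply L2b_opp, H2]. Qed.
Lemma L2b_zero B : nn B -> L2b (fun _ => Fc 0) B.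
Proof.
  intros H; apply (lesssim_ext _ (fun _ => 0)); [|apply lesssim_zero, H].
  intros s; replace (Fc 0) with (Fc 0 * Fc 0)%fld by ring. rewrite n2_scal, Rabs_R0; ring.
Qed.
Lemma L2b_Fsum {I} (l : list I) (f : I -> St -> F) B : nn B -> (forall i, In i l -> L2b (f i) B) ->
  L2b (fun s => Fsum (map (fun i => f i s) l)) B.
Proof.
  intros HB; induction l as [|i l IH]; intros H; simpl; [apply L2b_zero, HB|].
  apply L2b_add; [apply H; left; reflexivity | apply IH; intros; apply H; right; assumption].
Qed.
Lemma L2b_mul_sup f g A B : nn A -> nn B -> Supb f A -> L2b g B -> L2b (fun s => f s * g s)%fld (fun s => A s * B s).
Proof.
  intros HA HB (c & Hc & H1) (d & Hd & H2). exists (c * d); split; [apply Rmult_le_pos; assumption|].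
  intros s. replace (c * d * (A s * B s)) with ((c * A s) * (d * B s)) by ring.
  apply Rle_trans with ((c * A s) * n2 (g s) (tm s)).
  - apply n2_mul_sup; [apply Rmult_le_pos; auto | intros; apply H1].
  - apply Rmult_le_compat_l; [apply Rmult_le_pos; auto | apply H2].
Qed.
Lemma L2b_mul_sup_r f g A B : nn A -> nn B -> L2b f A -> Supb g B -> L2b (fun s => f s * g s)%fld (fun s => A s * B s).
Proof.
  intros HA HB Hf Hg. apply (L2b_le _ (fun s => B s * A s)).
  - apply (L2b_ext _ (fun s => g s * f s)%fld); [intros; Fv; ring|]. apply L2b_mul_sup; assumption.
  - apply lesssim_le; intros; lra.
Qed.

Lemma L2b_sqrt f B : nn B -> (fun s => L2 (f s) (tm s)) <~ B -> L2b f (fun s => sqrt (B s)).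
Proof.
  intros HB (c & Hc & H). exists (sqrt c); split; [apply sqrt_pos|]. intros s.
  rewrite <- sqrt_mult by auto. apply sqrt_le_1_alt, H.
Qed.
Lemma L2_of_L2b f B : nn B -> L2b f B -> (fun s => L2 (f s) (tm s)) <~ (fun s => B s * B s).
Proof.
  intros HB H. apply (lesssim_ext _ (fun s => n2 (f s) (tm s) * n2 (f s) (tm s))); [intros; symmetry; apply n2_sqr|].
  apply lesssim_mul; try (intros s; apply n2_nonneg); assumption.
Qed.

Lemma Supb_sobolev f B : nn B -> (forall w, In w sobolev_words -> L2b (fun s => Dw w (f s)) B) -> Supb f B.
Proof.
  intros HB H.
  assert (H' : (fun s => lsum (map (fun w => L2 (Dw w (f s)) (tm s)) sobolev_words)) <~ (fun s => B s * B s)).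
  { apply (lesssim_lsum sobolev_words (fun w s => L2 (Dw w (f s)) (tm s))).
    - intros s; apply Rle_0_sqr.
    - intros w Hw; apply L2_of_L2b; auto. }
  destruct H' as (c & Hc & H'). exists (sqrt (8 * c)); split; [apply sqrt_pos|]. intros s x y z.
  rewrite <- (sqrt_Rsqr (B s)) by auto. rewrite <- sqrt_mult by (try lra; apply Rle_0_sqr).
  rewrite <- sqrt_Rsqr_abs. apply sqrt_le_1_alt. unfold Rsqr.
  assert (S := sobolev (f s) (tm s) x y z). specialize (H' s). simpl (_ ^ 2) in S. lra.
Qed.

Definition Reg (n : nat) (B : St -> R) (f : St -> F) : Prop :=
  forall w, (ord w <= n)%nat -> L2b (fun s => Dw w (f s)) B.

Lemma Reg_mono n m B f : (m <= n)%nat -> Reg n B f -> Reg m B f.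
Proof. intros H1 H2 w Hw; apply H2; lia. Qed.
Lemma Reg_le n (A B : St -> R) f : A <~ B -> Reg n A f -> Reg n B f.
Proof. intros H1 H2 w Hw; eapply L2b_le; [apply H2, Hw | exact H1]. Qed.
Lemma Reg_add n B f g : Reg n B f -> Reg n B g -> Reg n B (fun s => f s + g s)%fld.
Proof.
  intros H1 H2 w Hw. apply (L2b_ext _ (fun s => Dw w (f s) + Dw w (g s))%fld); [intros; rewrite Dw_add; reflexivity|].
  apply L2b_add; auto.
Qed.
Lemma Reg_scal n B c f : Reg n B f -> Reg n B (fun s => Fc c * f s)%fld.
Proof.
  intros H1 w Hw. apply (L2b_ext _ (fun s => Fc c * Dw w (f s))%fld); [intros; rewrite Dw_scal; reflexivity|].
  apply L2b_scal; auto.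
Qed.
Lemma Reg_opp n B f : Reg n B f -> Reg n B (fun s => - f s)%fld.
Proof. apply (Reg_scal n B (-1)). Qed.
Lemma Reg_sub n B f g : Reg n B f -> Reg n B g -> Reg n B (fun s => f s - g s)%fld.
Proof. intros H1 H2; apply (Reg_add n B f (fun s => - g s)%fld); [assumption | apply Reg_opp, H2]. Qed.
Lemma Reg_D n B k f : Reg (wt k + n) B f -> Reg n B (fun s => D k (f s)).
Proof.
  intros H w Hw. apply (L2b_ext _ (fun s => Dw (k :: w) (f s))); [intros; rewrite Dw_D; reflexivity|].
  apply H; simpl; lia.
Qed.
Lemma Reg_Supb n B f w : nn B -> Reg n B f -> (ord w + 3 <= n)%nat -> Supb (fun s => Dw w (f s)) B.
Proof.
  intros HB H Hw; apply Supb_sobolev; [assumption|]. intros v Hv.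
  apply (L2b_ext _ (fun s => Dw (v ++ w) (f s))); [intros; rewrite Dw_app; reflexivity|].
  apply H; rewrite ord_app.
  assert (ord v <= 3)%nat; [|lia].
  repeat (destruct Hv as [<-|Hv]; [simpl; lia|]); destruct Hv.
Qed.
Lemma Reg_prod_L2b n1 n2 A B f g w1 w2 : nn A -> nn B -> Reg n1 A f -> Reg n2 B g ->
  ((ord w1 + 3 <= n1 /\ ord w2 <= n2) \/ (ord w1 <= n1 /\ ord w2 + 3 <= n2))%nat ->
  L2b (fun s => Dw w1 (f s) * Dw w2 (g s))%fld (fun s => A s * B s).
Proof.
  intros HA HB Hf Hg [[H1 H2]|[H1 H2]].
  - apply L2b_mul_sup; auto. apply (Reg_Supb n1); assumption.
  - apply L2b_mul_sup_r; auto. apply (Reg_Supb n2); assumption.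
Qed.
(** The arithmetic hypothesis says that however the derivatives are distributed, one factor has
    three of them to spare and can be taken in the sup norm. It is left as a goal for [lia]. *)
Lemma Reg_mul n n1 n2 A B f g : nn A -> nn B -> Reg n1 A f -> Reg n2 B g ->
  (forall b c, (b + c <= n)%nat -> ((b + 3 <= n1 /\ c <= n2) \/ (b <= n1 /\ c + 3 <= n2))%nat) ->
  Reg n (fun s => A s * B s) (fun s => f s * g s)%fld.
Proof.
  intros HA HB Hf Hg H w Hw.
  apply (L2b_ext _ (fun s => Fsum (map (fun p => lterm (f s) (g s) p) (splits w)))); [intros; rewrite leibniz; reflexivity|].
  apply (L2b_Fsum (splits w) (fun p s => lterm (f s) (g s) p)).
  { intros s; apply Rmult_le_pos; auto. }
  intros p Hp. apply (Reg_prod_L2b n1 n2); auto. apply H. assert (E := splits_ord w p Hp). lia.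
Qed.
(** Removing the term with all derivatives on [g] leaves at least one on [f], so [g] can have one
    order of regularity less than the full product would ask for. *)
Lemma comm_L2b n1 n2 A B f g w : nn A -> nn B -> Reg n1 A f -> Reg n2 B g ->
  (forall b c, (b + c = ord w)%nat -> (1 <= b)%nat -> ((b + 3 <= n1 /\ c <= n2) \/ (b <= n1 /\ c + 3 <= n2))%nat) ->
  L2b (fun s => Dw w (f s * g s) - f s * Dw w (g s))%fld (fun s => A s * B s).
Proof.
  intros HA HB Hf Hg H.
  apply (L2b_ext _ (fun s => Fsum (map (fun p => lterm (f s) (g s) p) (csplits w)))).
  { intros s x y z; rewrite leibniz_comm; Fv. unfold lterm; ring. }
  apply (L2b_Fsum (csplits w) (fun p s => lterm (f s) (g s) p)).
  { intros s; apply Rmult_le_pos; auto. }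
  intros p Hp. apply csplits_in in Hp; destruct Hp as [Hp1 Hp2].
  apply (Reg_prod_L2b n1 n2); auto. apply H; [apply (splits_ord w p Hp1) | exact Hp2].
Qed.

Lemma ip_lesssim f g A B : nn A -> nn B -> L2b f A -> L2b g B ->
  (fun s => Rabs (ip (f s) (g s) (tm s))) <~ (fun s => A s * B s).
Proof.
  intros HA HB H1 H2.
  eapply lesssim_trans; [apply lesssim_le; intros s; apply cauchy_schwarz|].
  apply lesssim_mul; auto; intros s; apply n2_nonneg.
Qed.

End Calculus.

(** * The norms of the statement in terms of words *)

Definition cw (a0 a1 a2 a3 : nat) : list nat := repeat 0%nat a0 ++ repeat 1%nat a1 ++ repeat 2%nat a2 ++ repeat 3%nat a3.

Lemma dpow_fold k n (f : Field) : dpow k n f = fold_right pd f (repeat k n).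
Proof. induction n as [|n IH]; simpl; [reflexivity|]. unfold dpow in *; simpl; rewrite IH; reflexivity. Qed.

Lemma dmulti_Dw a0 a1 a2 a3 (f : F) : dmulti a0 a1 a2 a3 f = Dw (cw a0 a1 a2 a3) f.
Proof.
  unfold dmulti, cw. rewrite Dw_val, !dpow_fold, !fold_right_app. reflexivity.
Qed.
Lemma dmulti_dpow a1 a2 a3 j (f : F) : dmulti 0 a1 a2 a3 (dpow 0 j f) = Dw (cw 0 a1 a2 a3 ++ repeat 0%nat j) f.
Proof.
  rewrite Dw_app, Dw_val, Dw_val. rewrite (dpow_fold 0 j). unfold dmulti, cw. rewrite !dpow_fold, !fold_right_app. reflexivity.
Qed.
Lemma ord_repeat k n : ord (repeat k n) = (wt k * n)%nat.
Proof. induction n as [|n IH]; simpl; [lia | rewrite IH; lia]. Qed.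
Lemma ord_cw a0 a1 a2 a3 : ord (cw a0 a1 a2 a3) = (2 * a0 + a1 + a2 + a3)%nat.
Proof. unfold cw; rewrite !ord_app, !ord_repeat; simpl; lia. Qed.

Lemma D_ge3 k f : D (S (S (S k))) f = D 3 f.
Proof. apply F_ext; intros; rewrite !fv_D; reflexivity. Qed.

(** The norms of the statement are sums over multi-indices, whereas words arise in any order and may
    contain letters above 3; commuting derivatives sorts them into a multi-index. *)
Lemma canonical_word w : exists a0 a1 a2 a3, ord w = (2 * a0 + a1 + a2 + a3)%nat /\
  (forall f, Dw w f = Dw (cw a0 a1 a2 a3) f) /\ (~ In 0%nat w -> a0 = 0%nat).
Proof.
  induction w as [|k w IH]; [exists 0%nat, 0%nat, 0%nat, 0%nat; repeat split; reflexivity|].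
  destruct IH as (a0 & a1 & a2 & a3 & E & H & Z).
  assert (P : forall k a l1 l2 f, D k (Dw (l1 ++ repeat k a ++ l2) f) = Dw (l1 ++ repeat k (S a) ++ l2) f).
  { intros l a l1 l2 f. change (D l (Dw (l1 ++ repeat l a ++ l2) f)) with (Dw (l :: l1 ++ repeat l a ++ l2) f).
    apply Dw_perm. simpl. apply Permutation_middle. }
  destruct k as [|[|[|k]]].
  - exists (S a0), a1, a2, a3; split; [simpl; lia|split].
    + intros f; simpl; rewrite H. apply (P 0%nat a0 []).
    + intros N; exfalso; apply N; left; reflexivity.
  - exists a0, (S a1), a2, a3; split; [simpl; lia|split].
    + intros f; simpl; rewrite H. apply (P 1%nat a1 (repeat 0%nat a0)).
    + intros N; apply Z; intros N'; apply N; right; assumption.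
  - exists a0, a1, (S a2), a3; split; [simpl; lia|split].
    + intros f; simpl; rewrite H. unfold cw. rewrite !app_assoc, <- app_assoc, P, !app_assoc; reflexivity.
    + intros N; apply Z; intros N'; apply N; right; assumption.
  - exists a0, a1, a2, (S a3); split; [simpl; lia|split].
    + intros f. simpl. rewrite D_ge3, H. unfold cw.
      assert (Q := P 3%nat a3 (repeat 0%nat a0 ++ repeat 1%nat a1 ++ repeat 2%nat a2) [] f).
      rewrite !app_nil_r, <- !app_assoc in Q. exact Q.
    + intros N; apply Z; intros N'; apply N; right; assumption.
Qed.

Lemma sum_f_term (g : nat -> R) n i : (forall j, 0 <= g j) -> (i <= n)%nat -> g i <= sum_f_R0 g n.
Proof.
  intros H Hi. induction n as [|n IH]; simpl.
  - replace i with 0%nat by lia; lra.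
  - destruct (Nat.eq_dec i (S n)) as [->|N].
    + assert (0 <= sum_f_R0 g n) by (apply cond_pos_sum; assumption). lra.
    + specialize (IH ltac:(lia)). specialize (H (S n)). lra.
Qed.

Lemma L2sq_nonneg (f : F) t : 0 <= L2sq f t. Proof. rewrite L2_E; apply L2_nonneg. Qed.

Lemma Pk_nonneg k (f : F) t : 0 <= Pk_sq k f t.
Proof.
  unfold Pk_sq; repeat (apply cond_pos_sum; intros).
  destruct (_ <=? _)%nat; [rewrite dmulti_Dw; apply L2sq_nonneg | lra].
Qed.

Lemma L2_le_Pk w k (f : F) t : (ord w <= k)%nat -> L2 (Dw w f) t <= Pk_sq k f t.
Proof.
  intros Hw. destruct (canonical_word w) as (a0 & a1 & a2 & a3 & E & H & _).
  rewrite H, <- L2_E, <- dmulti_Dw. unfold Pk_sq.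
  assert (Hp : forall a0 a1 a2 a3, 0 <= if (2 * a0 + a1 + a2 + a3 <=? k)%nat then L2sq (dmulti a0 a1 a2 a3 f) t else 0).
  { intros; destruct (_ <=? _)%nat; [rewrite dmulti_Dw; apply L2sq_nonneg | lra]. }
  eapply Rle_trans; [|apply (sum_f_term _ k a0); [intros; repeat (apply cond_pos_sum; intros); apply Hp | lia]].
  eapply Rle_trans; [|apply (sum_f_term _ k a1); [intros; repeat (apply cond_pos_sum; intros); apply Hp | lia]].
  eapply Rle_trans; [|apply (sum_f_term _ k a2); [intros; repeat (apply cond_pos_sum; intros); apply Hp | lia]].
  eapply Rle_trans; [|apply (sum_f_term _ k a3); [intros; repeat (apply cond_pos_sum; intros); apply Hp | lia]].
  cbv beta. replace (2 * a0 + a1 + a2 + a3 <=? k)%nat with true by (symmetry; apply Nat.leb_le; lia). lra.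
Qed.

Lemma Hs_nonneg k (f : F) t : 0 <= Hs_sq k f t.
Proof.
  unfold Hs_sq; repeat (apply cond_pos_sum; intros).
  destruct (_ <=? _)%nat; [rewrite dmulti_Dw; apply L2sq_nonneg | lra].
Qed.

Lemma L2_le_Hs w k (f : F) t : (ord w <= k)%nat -> ~ In 0%nat w -> L2 (Dw w f) t <= Hs_sq k f t.
Proof.
  intros Hw H0. destruct (canonical_word w) as (a0 & a1 & a2 & a3 & E & H & Z). specialize (Z H0); subst a0.
  rewrite H, <- L2_E, <- dmulti_Dw. unfold Hs_sq.
  assert (Hp : forall a1 a2 a3, 0 <= if (a1 + a2 + a3 <=? k)%nat then L2sq (dmulti 0 a1 a2 a3 f) t else 0).
  { intros; destruct (_ <=? _)%nat; [rewrite dmulti_Dw; apply L2sq_nonneg | lra]. }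
  eapply Rle_trans; [|apply (sum_f_term _ k a1); [intros; repeat (apply cond_pos_sum; intros); apply Hp | lia]].
  eapply Rle_trans; [|apply (sum_f_term _ k a2); [intros; repeat (apply cond_pos_sum; intros); apply Hp | lia]].
  eapply Rle_trans; [|apply (sum_f_term _ k a3); [intros; repeat (apply cond_pos_sum; intros); apply Hp | lia]].
  cbv beta. replace (a1 + a2 + a3 <=? k)%nat with true by (symmetry; apply Nat.leb_le; lia). lra.
Qed.

Lemma Pk_lesssim {St} (tm : St -> R) k (f : St -> F) (B : St -> R) : nn B ->
  (forall w, (ord w <= k)%nat -> (fun s => L2 (Dw w (f s)) (tm s)) <~ B) ->
  (fun s => Pk_sq k (f s) (tm s)) <~ B.
Proof.
  intros HB H; unfold Pk_sq; repeat (apply lesssim_sum_f; intros).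
  apply lesssim_if; [assumption|]. intros E; apply Nat.leb_le in E.
  eapply lesssim_ext; [intros s; rewrite dmulti_Dw, L2_E; reflexivity|]. apply H; rewrite ord_cw; assumption.
Qed.

Lemma Hs_lesssim {St} (tm : St -> R) k j (f : St -> F) (B : St -> R) : nn B ->
  (forall w, (ord w <= k)%nat -> ~ In 0%nat w -> (fun s => L2 (Dw (w ++ repeat 0%nat j) (f s)) (tm s)) <~ B) ->
  (fun s => Hs_sq k (dpow 0 j (f s)) (tm s)) <~ B.
Proof.
  intros HB H; unfold Hs_sq; repeat (apply lesssim_sum_f; intros).
  apply lesssim_if; [assumption|]. intros E; apply Nat.leb_le in E.
  eapply lesssim_ext; [intros s; rewrite dmulti_dpow, L2_E; reflexivity|]. apply H; [rewrite ord_cw; lia|].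
  unfold cw; simpl. intros I. repeat (apply in_app_or in I; destruct I as [I|I]; [apply repeat_spec in I; discriminate|]).
  apply repeat_spec in I; discriminate.
Qed.

(** * Solutions *)

Definition F3 (g : nat -> F) : F := (g 0%nat + g 1%nat + g 2%nat)%fld.
Definition crossF (a b : nat -> F) (i : nat) : F :=
  match i with
  | O => (a 1%nat * b 2%nat - a 2%nat * b 1%nat)%fld
  | 1%nat => (a 2%nat * b 0%nat - a 0%nat * b 2%nat)%fld
  | _ => (a 0%nat * b 1%nat - a 1%nat * b 0%nat)%fld
  end.
Definition tenF (w : nat -> F) (i j : nat) : F :=
  match i, j with
  | O, 1%nat => (- w 2%nat)%fld | O, 2%nat => w 1%nat
  | 1%nat, O => w 2%nat | 1%nat, 2%nat => (- w 0%nat)%fld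
  | 2%nat, O => (- w 1%nat)%fld | 2%nat, 1%nat => w 0%nat
  | _, _ => Fc 0
  end.
Definition mvF (A : nat -> nat -> F) (v : nat -> F) (i : nat) : F := F3 (fun j => A i j * v j)%fld.
Definition commF (A B : nat -> nat -> F) (i j : nat) : F :=
  (F3 (fun k => A i k * B k j) - F3 (fun k => B i k * A k j))%fld.
Definition lapF (f : F) : F := F3 (fun j => D (S j) (D (S j) f)).
Definition divF (v : nat -> F) : F := F3 (fun j => D (S j) (v j)).
Definition curlF (v : nat -> F) (i : nat) : F :=
  match i with
  | O => (D 2 (v 2%nat) - D 3 (v 1%nat))%fld
  | 1%nat => (D 3 (v 0%nat) - D 1 (v 2%nat))%fld
  | _ => (D 1 (v 1%nat) - D 2 (v 0%nat))%fld
  end.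
Definition advF (u : nat -> F) (f : F) : F := F3 (fun k => u k * D (S k) f)%fld.

Class Par := mkPar {
  mu : R; kappa : R; alpha : R; beta : R; gamma : R; tau : R; lam : R; nu : R; M : nat;
  mu_pos : 0 < mu; kappa_pos : 0 < kappa; alpha_pos : 0 < alpha; beta_pos : 0 < beta; gamma_pos : 0 < gamma;
  tau_pos : 0 < tau; lam_pos : 0 < lam; lam_nu : lam < nu; M_ge : (4 <= M)%nat }.

Section Sol.
Context {P : Par}.

Definition ttil : R := tau / (2 * kappa).
Definition dl : R := nu - lam.
Definition atil : R := alpha + 4 / 3 * beta.
Definition gtil : R := beta + gamma.
(* Below this size of [K] the quadratic constraint determines the remaining entries by absorption, and the matrix [Jeq + K] stays coercive. *)
Definition k0 : R := Rmin dl lam / 20.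

Definition jd (i : nat) : R := if (i =? 2)%nat then nu else lam.
Definition JeqF (i j : nat) : F := Fc (Jeq lam nu i j).
Definition omF (i : nat) : F := if (i =? 2)%nat then Fc ttil else Fc 0.

(* The linear part of the gyroscopic term omega x J omega at the equilibrium. *)
Definition LinF (th : nat -> F) (K : nat -> nat -> F) (i : nat) : F :=
  match i with
  | O => (Fc (ttil * dl) * th 1%nat - Fc (ttil * ttil) * K 1%nat 2%nat)%fld
  | 1%nat => (Fc (ttil * ttil) * K 0%nat 2%nat - Fc (ttil * dl) * th 0%nat)%fld
  | _ => Fc 0
  end.
(* The quadratic and cubic part of the gyroscopic term, once [LinF] is removed. *)
Definition NLc (th : nat -> F) (K : nat -> nat -> F) (i : nat) : F :=
  (crossF th (fun j => Fc ttil * K j 2%nat) i + crossF omF (mvF K th) i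
   + crossF th (fun j => Fc (jd j) * th j) i + crossF th (mvF K th) i)%fld.
Definition NLth (u th : nat -> F) (K : nat -> nat -> F) (i : nat) : F :=
  (Fc (jd i) * advF u (th i) + F3 (fun j => K i j * advF u (th j)) + NLc th K i)%fld.
Definition NLK (u th : nat -> F) (K : nat -> nat -> F) (i j : nat) : F :=
  (commF (tenF th) K i j - advF u (K i j))%fld.

(* [s_quad] and [s_quad2] are the blocks of (J - lam)(J - nu) = 0, the form in which the spectral constraint is used. *)
Record Sol := mkSol {
  su : nat -> F; sp : F; sth : nat -> F; sK : nat -> nat -> F; sT : R; eps : R;
  sT_pos : 0 < sT;
  s_u : forall i, (i < 3)%nat -> eqT sT (D 0 (su i))
    (Fc (mu + kappa / 2) * lapF (su i) + Fc kappa * curlF sth i - D (S i) sp - advF su (su i))%fld;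
  s_div : eqT sT (divF su) (Fc 0);
  s_th : forall i, (i < 3)%nat -> eqT sT (Fc (jd i) * D 0 (sth i) + F3 (fun j => sK i j * D 0 (sth j)))%fld
    (Fc kappa * curlF su i - Fc (2 * kappa) * sth i + Fc (atil - gtil) * D (S i) (divF sth)
     + Fc gtil * lapF (sth i) - LinF sth sK i - NLth su sth sK i)%fld;
  s_K : forall i j, (i < 3)%nat -> (j < 3)%nat -> eqT sT (D 0 (sK i j))
    (commF (tenF omF) sK i j + commF (tenF sth) JeqF i j + NLK su sth sK i j)%fld;
  s_sym : forall i j, (i < 3)%nat -> (j < 3)%nat -> eqT sT (sK i j) (sK j i);
  s_quad : forall i j, (i < 2)%nat -> (j < 2)%nat -> eqT sT (Fc dl * sK i j)%fld (F3 (fun k => sK i k * sK k j)%fld);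
  s_quad2 : eqT sT (Fc dl * sK 2%nat 2%nat)%fld (- F3 (fun k => sK 2%nat k * sK k 2%nat)%fld)%fld;
  s_mean : forall t i, 0 <= t <= sT -> (i < 3)%nat -> TI (su i) t = 0;
  s_small : forall t x y z i j, 0 <= t <= sT -> (i < 3)%nat -> (j < 3)%nat -> Rabs (sK i j t x y z) <= k0;
  s_eps : 0 <= eps <= 1;
  s_E : forall t, 0 <= t <= sT -> Ebar M (fun i => su i) (fun i => sth i) (fun i j => sK i j) t <= eps * eps
}.

(* A state is a solution with a time, so that [A <~ B] between functions of states is a bound uniform in both. *)
Record St := mkSt { ss : Sol; tm : R; tm_ok : 0 <= tm <= sT ss }.

Definition u_ (i : nat) (s : St) : F := su (ss s) i.
Definition th_ (i : nat) (s : St) : F := sth (ss s) i.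
Definition K_ (i j : nat) (s : St) : F := sK (ss s) i j.
Definition E_ (s : St) : R := Ebar M (fun i => su (ss s) i) (fun i => sth (ss s) i) (fun i j => sK (ss s) i j) (tm s).
Definition DN (N : nat) (s : St) : R :=
  sumN (Pk_sq (N + 1)) (comps3 (fun i => su (ss s) i) ++ comps3 (fun i => sth (ss s) i)) (tm s).
(** Square roots, because [L2b] and [Reg] bound norms and not their squares. The smallness itself is
    carried by [ep], which does not depend on time and dominates [se]. *)
Definition se (s : St) : R := sqrt (E_ s).
Definition sd (N : nat) (s : St) : R := sqrt (DN N s).
Definition ep (s : St) : R := eps (ss s).

Lemma E_nonneg s : 0 <= E_ s.
Proof.
  unfold E_, Ebar, sumN, comps3, aK; simpl.
  repeat apply Rplus_le_le_0_compat; try apply Pk_nonneg; lra.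
Qed.
Lemma DN_nonneg N s : 0 <= DN N s.
Proof.
  unfold DN, sumN, comps3, aK; simpl.
  repeat apply Rplus_le_le_0_compat; try apply Pk_nonneg; lra.
Qed.
Lemma se_nn : nn se. Proof. intros s; apply sqrt_pos. Qed.
Lemma sd_nn N : nn (sd N). Proof. intros s; apply sqrt_pos. Qed.
Lemma ep_nn : nn ep. Proof. intros s; apply s_eps. Qed.
Lemma ep_le1 s : ep s <= 1. Proof. apply s_eps. Qed.
Lemma se_sqr s : se s * se s = E_ s. Proof. apply sqrt_sqrt, E_nonneg. Qed.
Lemma sd_sqr N s : sd N s * sd N s = DN N s. Proof. apply sqrt_sqrt, DN_nonneg. Qed.
Lemma se_le_ep s : se s <= ep s.
Proof.
  unfold se; rewrite <- (sqrt_square (ep s)) by apply ep_nn. apply sqrt_le_1_alt. exact (s_E (ss s) (tm s) (tm_ok s)).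
Qed.
Lemma se_ep : se <~ ep. Proof. apply lesssim_le, se_le_ep. Qed.
Lemma se_one : se <~ (fun _ => 1).
Proof. apply lesssim_le; intros s; apply Rle_trans with (1 := se_le_ep s), ep_le1. Qed.
Lemma one_nn : nn (fun _ : St => 1). Proof. intros s; lra. Qed.

Lemma Reg_of_Pk n k (B : St -> R) (f : St -> F) : nn B -> (n <= k)%nat -> (forall s, Pk_sq k (f s) (tm s) <= B s) ->
  Reg tm n (fun s => sqrt (B s)) f.
Proof.
  intros HB Hn H w Hw; apply L2b_sqrt; [assumption|]. apply lesssim_le; intros s.
  apply Rle_trans with (2 := H s). apply L2_le_Pk; lia.
Qed.

Ltac pk3 := repeat match goal with |- context [Pk_sq ?k (fv ?f) ?t] =>
    let H := fresh in assert (H := Pk_nonneg k f t); generalize dependent (Pk_sq k (fv f) t); intros end.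

Lemma Reg_u i : (i < 3)%nat -> Reg tm (2 * M) se (u_ i).
Proof.
  intros Hi; apply (Reg_of_Pk _ (2 * M)); [intros s; apply E_nonneg | lia|].
  intros s; unfold E_, Ebar, sumN, comps3, aK, u_; simpl.
  destruct i as [|[|[|i]]]; [| | |lia]; pk3; lra.
Qed.
Lemma Reg_th i : (i < 3)%nat -> Reg tm (2 * M) se (th_ i).
Proof.
  intros Hi; apply (Reg_of_Pk _ (2 * M)); [intros s; apply E_nonneg | lia|].
  intros s; unfold E_, Ebar, sumN, comps3, aK, th_; simpl.
  destruct i as [|[|[|i]]]; [| | |lia]; pk3; lra.
Qed.
Lemma Reg_a i : (i < 2)%nat -> Reg tm (2 * M) se (K_ i 2).
Proof.
  intros Hi; apply (Reg_of_Pk _ (2 * M)); [intros s; apply E_nonneg | lia|].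
  intros s; unfold E_, Ebar, sumN, comps3, aK, K_; simpl.
  destruct i as [|[|i]]; [| |lia]; pk3; lra.
Qed.
Lemma Reg_u_sd N i : (i < 3)%nat -> Reg tm (N + 1) (sd N) (u_ i).
Proof.
  intros Hi; apply (Reg_of_Pk _ (N + 1)); [intros s; apply DN_nonneg | lia|].
  intros s; unfold DN, sumN, comps3, aK, u_; simpl.
  destruct i as [|[|[|i]]]; [| | |lia]; pk3; lra.
Qed.
Lemma Reg_th_sd N i : (i < 3)%nat -> Reg tm (N + 1) (sd N) (th_ i).
Proof.
  intros Hi; apply (Reg_of_Pk _ (N + 1)); [intros s; apply DN_nonneg | lia|].
  intros s; unfold DN, sumN, comps3, aK, th_; simpl.
  destruct i as [|[|[|i]]]; [| | |lia]; pk3; lra.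
Qed.

End Sol.

(** * The inertia perturbation is controlled by its off-diagonal block *)

(** When both factors carry a derivative, both words are shorter than [w]; this is what the
    inductions on the length use. *)
Definition psplits (w : list nat) := filter (fun p => negb (nilb (snd p))) (csplits w).

Lemma filter_csplits_nil w : filter (fun p => nilb (snd p)) (csplits w) = if nilb w then [] else [(w, [])].
Proof.
  assert (G : forall w, filter (fun p => nilb (snd p)) (splits w) = [(w, [])]).
  { induction w0 as [|k w0 IH]; simpl; [reflexivity|]. rewrite filter_app.
    assert (E1 : forall l, filter (fun p => nilb (snd p)) (map (fun p : list nat * list nat => (k :: fst p, snd p)) l) =
      map (fun p => (k :: fst p, snd p)) (filter (fun p => nilb (snd p)) l)).
    { induction l as [|p l IHl]; simpl; [reflexivity|]. destruct (nilb (snd p)); simpl; rewrite IHl; reflexivity. }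
    assert (E2 : forall l, filter (fun p => nilb (snd p)) (map (fun p : list nat * list nat => (fst p, k :: snd p)) l) = []).
    { induction l as [|p l IHl]; simpl; [reflexivity | exact IHl]. }
    rewrite E1, E2, IH; reflexivity. }
  assert (C : forall l : list (list nat * list nat), filter (fun p => nilb (snd p)) (filter (fun p => negb (nilb (fst p))) l)
     = filter (fun p => negb (nilb (fst p))) (filter (fun p => nilb (snd p)) l)).
  { induction l as [|p l IHl]; simpl; [reflexivity|].
    destruct (nilb (fst p)) eqn:E1; destruct (nilb (snd p)) eqn:E2; simpl; rewrite ?E1, ?E2; simpl; rewrite IHl; reflexivity. }
  unfold csplits; rewrite C, G; destruct w; reflexivity.
Qed.

Lemma leibniz_proper w f g : Dw w (f * g)%fld =
  (f * Dw w g + (if nilb w then Fc 0 else Dw w f * g) + Fsum (map (lterm f g) (psplits w)))%fld.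
Proof.
  rewrite leibniz_comm, (Fsum_filter (fun p => nilb (snd p))), filter_csplits_nil.
  unfold psplits; destruct (nilb w); simpl; [ring|].
  change (lterm f g (w, [])) with (Dw w f * g)%fld; ring.
Qed.

Lemma psplits_in w p : In p (psplits w) ->
  In p (splits w) /\ (length (fst p) < length w)%nat /\ (length (snd p) < length w)%nat.
Proof.
  unfold psplits; intros H; apply filter_In in H; destruct H as [H1 H2].
  unfold csplits in H1; apply filter_In in H1; destruct H1 as [H1 H3].
  split; [assumption|]. assert (L := Permutation_length (splits_perm w p H1)). rewrite length_app in L.
  destruct p as [[|a w1] [|b w2]]; simpl in *; try discriminate; lia.
Qed.

Lemma Fsum_abs (l : list F) t x y z : Rabs (Fsum l t x y z) <= lsum (map (fun f : F => Rabs (f t x y z)) l).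
Proof.
  induction l as [|f l IH]; simpl; Fv; [rewrite Rabs_R0; lra|].
  eapply Rle_trans; [apply Rabs_triang | lra].
Qed.

Lemma lsum_nonneg {I} (l : list I) (f : I -> R) : (forall i, 0 <= f i) -> 0 <= lsum (map f l).
Proof. intros H; induction l as [|i l IH]; simpl; [lra | specialize (H i); lra]. Qed.
Lemma lsum_app l1 l2 : lsum (l1 ++ l2) = lsum l1 + lsum l2.
Proof. induction l1 as [|a l IH]; simpl; [ring | rewrite IH; ring]. Qed.

(** The square of a sum of n terms is at most n times the sum of the squares, so a pointwise bound
    by finitely many fields passes to L2. *)
Lemma L2b_pointwise {St} (tm : St -> R) (l : list (St -> F)) (f : St -> F) (B : St -> R) C : nn B -> 0 <= C ->
  (forall s x y z, Rabs (f s (tm s) x y z) <= C * lsum (map (fun g : St -> F => Rabs (g s (tm s) x y z)) l)) ->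
  (forall g, In g l -> L2b tm g B) -> L2b tm f B.
Proof.
  intros HB HC Hf Hl.
  assert (H : (fun s => L2 (f s) (tm s)) <~ (fun s => B s * B s)).
  { apply lesssim_trans with (fun s => lsum (map (fun g : St -> F => L2 (g s) (tm s)) l)).
    - exists (C * C * INR (length l)); split; [apply Rmult_le_pos; [apply Rmult_le_pos; assumption | apply pos_INR]|].
      intros s.
      assert (E : lsum (map (fun g : St -> F => L2 (g s) (tm s)) l) = TI (Fsum (map (fun g : St -> F => g s * g s)%fld l)) (tm s)).
      { clear. induction l as [|g l IH]; simpl; [symmetry; apply TI_c | rewrite TI_add, IH; reflexivity]. }
      rewrite E, <- TI_scal, L2_TI. apply TI_le; intros x y z; Fv.
      apply Rle_trans with (C * C * (lsum (map (fun g : St -> F => Rabs (g s (tm s) x y z)) l) * lsum (map (fun g : St -> F => Rabs (g s (tm s) x y z)) l))).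
      + specialize (Hf s x y z). assert (P := Rabs_pos (f s (tm s) x y z)).
        replace (f s (tm s) x y z * f s (tm s) x y z) with (Rabs (f s (tm s) x y z) * Rabs (f s (tm s) x y z))
          by (rewrite <- Rabs_mult; apply Rabs_right, Rle_ge, Rle_0_sqr).
        eapply Rle_trans; [apply Rmult_le_compat; [exact P | exact P | exact Hf | exact Hf]|]. apply Req_le; ring.
      + rewrite !Rmult_assoc; apply Rmult_le_compat_l; [assumption|]. apply Rmult_le_compat_l; [assumption|].
        clear. induction l as [|g l IH]; [simpl; Fv; lra|].
        cbn [map lsum fold_right Fsum length]. Fv. rewrite S_INR. fold (lsum (map (fun g : St -> F => Rabs (g s (tm s) x y z)) l)).
        fold (Fsum (map (fun g : St -> F => g s * g s)%fld l)).
        set (S0 := lsum (map (fun g : St -> F => Rabs (g s (tm s) x y z)) l)) in *.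
        set (Q := fv (Fsum (map (fun g : St -> F => g s * g s)%fld l)) (tm s) x y z) in *.
        set (a := g s (tm s) x y z).
        replace (a * a) with (Rabs a * Rabs a) by (rewrite <- Rabs_mult; apply Rabs_right, Rle_ge, Rle_0_sqr).
        set (b := Rabs a). set (n := INR (length l)) in *.
        assert (Hn : 0 <= n) by apply pos_INR.
        assert (Hq : 0 <= Q).
        { unfold Q; clear. induction l as [|h l IH]; simpl; Fv; [lra|].
          apply Rplus_le_le_0_compat; [apply Rle_0_sqr | exact IH]. }
        destruct (Req_dec n 0) as [E|E].
        * assert (Z : l = []) by (destruct l; [reflexivity | exfalso; unfold n in E; simpl length in E; rewrite S_INR in E; assert (P := pos_INR (length l)); lra]).
          assert (S0 = 0) by (unfold S0; rewrite Z; reflexivity). rewrite E, H. lra.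
        * assert (Hn1 : 1 <= n).
          { unfold n in *. destruct l; [simpl in E; lra|]. simpl length. rewrite S_INR. assert (P := pos_INR (length l)); lra. }
          assert (X : 0 <= (n * b - S0) * (n * b - S0)) by apply Rle_0_sqr.
          (* 2 b S0 <= n b^2 + S0^2/n *)
          assert (Y : n * (2 * b * S0) <= n * (n * (b * b) + Q)).
          { apply Rle_trans with (n * n * (b * b) + S0 * S0); [nra|]. nra. }
          apply Rmult_le_reg_l in Y; [nra | lra].
    - apply (lesssim_lsum l (fun (g : St -> F) s => L2 (g s) (tm s))); [intros s; apply Rle_0_sqr|].
      intros g Hg; apply L2_of_L2b; auto. }
  apply L2b_sqrt in H; [|intros s; apply Rle_0_sqr].
  apply L2b_le with (1 := H). apply lesssim_le; intros s. rewrite sqrt_square; auto; lra.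
Qed.

Lemma Supb_pointwise {St} (tm : St -> R) (l : list (St -> F)) (f : St -> F) (B : St -> R) C : nn B -> 0 <= C ->
  (forall s x y z, Rabs (f s (tm s) x y z) <= C * lsum (map (fun g : St -> F => Rabs (g s (tm s) x y z)) l)) ->
  (forall g, In g l -> Supb tm g B) -> Supb tm f B.
Proof.
  intros HB HC Hf Hl.
  assert (H : exists C, 0 <= C /\ forall s x y z, lsum (map (fun g : St -> F => Rabs (g s (tm s) x y z)) l) <= C * B s).
  { clear Hf. induction l as [|g l IH]; simpl.
    - exists 0; split; [lra | intros; lra].
    - destruct IH as (c & Hc & H); [intros; apply Hl; right; assumption|].
      destruct (Hl g (or_introl eq_refl)) as (d & Hd & H').
      exists (d + c); split; [lra|]. intros s x y z; specialize (H s x y z); specialize (H' s x y z). lra. }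
  destruct H as (c & Hc & H). exists (C * c); split; [apply Rmult_le_pos; assumption|].
  intros s x y z. apply Rle_trans with (1 := Hf s x y z). rewrite Rmult_assoc. apply Rmult_le_compat_l; auto.
Qed.

Lemma Supb_mul {St} (tm : St -> R) f g (A B : St -> R) : nn A -> nn B -> Supb tm f A -> Supb tm g B ->
  Supb tm (fun s => f s * g s)%fld (fun s => A s * B s).
Proof.
  intros HA HB (c & Hc & H1) (d & Hd & H2); exists (c * d); split; [apply Rmult_le_pos; assumption|].
  intros s x y z; Fv; rewrite Rabs_mult. replace (c * d * (A s * B s)) with ((c * A s) * (d * B s)) by ring.
  apply Rmult_le_compat; try apply Rabs_pos; auto.
Qed.

Section KA.
Context {P : Par}.

Lemma dl_pos : 0 < dl. Proof. unfold dl; assert (H := lam_nu); lra. Qed.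
Lemma k0_dl : k0 <= dl / 20. Proof. unfold k0; assert (H := Rmin_l dl lam); lra. Qed.
Lemma k0_lam : k0 <= lam / 20. Proof. unfold k0; assert (H := Rmin_r dl lam); lra. Qed.

Definition idx3 : list nat := [0; 1; 2]%nat.
(** The products with derivatives on both factors, over all index triples at once: surplus terms are
    harmless in an upper bound. *)
Definition kterms (w : list nat) : list (St -> F) :=
  flat_map (fun i => flat_map (fun k => flat_map (fun j =>
    map (fun p s => lterm (K_ i k s) (K_ k j s) p) (psplits w)) idx3) idx3) idx3.
Definition klist (w : list nat) : list (St -> F) :=
  (fun s => Dw w (K_ 0 2 s)) :: (fun s => Dw w (K_ 1 2 s)) :: kterms w.

Lemma lsum_flat_map {I} (l : list I) (f : I -> list (St -> F)) (h : (St -> F) -> R) :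
  lsum (map h (flat_map f l)) = lsum (map (fun i => lsum (map h (f i))) l).
Proof. induction l as [|i l IH]; simpl; [reflexivity|]. rewrite map_app, lsum_app, IH; reflexivity. Qed.

(** The two extreme Leibniz terms keep all derivatives on one factor and have the small coefficient
    [k]; they are set apart in order to be absorbed. *)
Lemma leibniz_abs w (f g : F) t x y z k : Rabs (f t x y z) <= k -> Rabs (g t x y z) <= k ->
  Rabs (Dw w (f * g)%fld t x y z) <= k * Rabs (Dw w g t x y z) + k * Rabs (Dw w f t x y z)
     + lsum (map (fun p => Rabs (lterm f g p t x y z)) (psplits w)).
Proof.
  intros Hf Hg. rewrite leibniz_proper; Fv.
  assert (S0 := Fsum_abs (map (lterm f g) (psplits w)) t x y z). rewrite map_map in S0.
  assert (A1 : Rabs (f t x y z * Dw w g t x y z) <= k * Rabs (Dw w g t x y z))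
    by (rewrite Rabs_mult; apply Rmult_le_compat_r; [apply Rabs_pos | assumption]).
  assert (A2 : Rabs ((if nilb w then Fc 0 else Dw w f * g)%fld t x y z) <= k * Rabs (Dw w f t x y z)).
  { assert (0 <= k) by (eapply Rle_trans; [apply Rabs_pos | exact Hf]).
    destruct (nilb w); Fv; [rewrite Rabs_R0; apply Rmult_le_pos; [assumption | apply Rabs_pos]|].
    rewrite Rabs_mult, Rmult_comm; apply Rmult_le_compat_r; [apply Rabs_pos | assumption]. }
  eapply Rle_trans; [apply Rabs_triang|]. apply Rplus_le_compat; [|exact S0].
  eapply Rle_trans; [apply Rabs_triang|]. lra.
Qed.

(** When [Dw w] is applied to the quadratic constraint, the extreme terms have coefficients at most
    [dl / 20], because [k0 <= dl / 20]. The five inequalities for the upper block and the last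
    diagonal entry can therefore be solved for these entries; 4 and [10 / dl] are generous
    values. *)
Lemma K_pointwise w i j s x y z : (i < 3)%nat -> (j < 3)%nat ->
  Rabs (Dw w (K_ i j s) (tm s) x y z) <=
  (4 + 10 / dl) * lsum (map (fun g : St -> F => Rabs (g s (tm s) x y z)) (klist w)).
Proof.
  intros Hi Hj.
  set (v := fun i j => Rabs (Dw w (K_ i j s) (tm s) x y z)).
  set (r := fun i k j => lsum (map (fun p => Rabs (lterm (K_ i k s) (K_ k j s) p (tm s) x y z)) (psplits w))).
  assert (Hd := dl_pos). assert (Hk := k0_dl).
  assert (Hv : forall i j, 0 <= v i j) by (intros; apply Rabs_pos).
  assert (Hr : forall i k j, 0 <= r i k j) by (intros; apply lsum_nonneg; intros; apply Rabs_pos).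
  assert (Hp : forall i k j, (i < 3)%nat -> (k < 3)%nat -> (j < 3)%nat ->
     Rabs (Dw w (K_ i k s * K_ k j s)%fld (tm s) x y z) <= dl / 20 * v k j + dl / 20 * v i k + r i k j).
  { intros i0 k j0 Hi0 Hk0 Hj0. apply leibniz_abs; (eapply Rle_trans; [|exact Hk]); apply s_small; auto; apply tm_ok. }
  assert (Hq : forall i j (e : F), (i < 3)%nat -> (j < 3)%nat ->
     eqT (sT (ss s)) (Fc dl * K_ i j s)%fld e ->
     (e = F3 (fun k => K_ i k s * K_ k j s)%fld \/ e = (- F3 (fun k => K_ i k s * K_ k j s))%fld) ->
     v i j <= 1 / 20 * (v i 0%nat + v i 1%nat + v i 2%nat + v 0%nat j + v 1%nat j + v 2%nat j)
              + (r i 0%nat j + r i 1%nat j + r i 2%nat j) / dl).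
  { intros i0 j0 e Hi0 Hj0 He Hee.
    assert (X := eqT_Dw _ w _ _ (sT_pos (ss s)) He (tm s) x y z (tm_ok s)).
    rewrite Dw_scal in X. revert X; Fv; intros X.
    assert (Y : Rabs (Dw w e (tm s) x y z) <= dl / 20 * (v i0 0%nat + v i0 1%nat + v i0 2%nat + v 0%nat j0 + v 1%nat j0 + v 2%nat j0)
              + (r i0 0%nat j0 + r i0 1%nat j0 + r i0 2%nat j0)).
    { assert (Y : Rabs (Dw w (F3 (fun k => K_ i0 k s * K_ k j0 s)%fld) (tm s) x y z) <= dl / 20 * (v i0 0%nat + v i0 1%nat + v i0 2%nat + v 0%nat j0 + v 1%nat j0 + v 2%nat j0)
              + (r i0 0%nat j0 + r i0 1%nat j0 + r i0 2%nat j0)).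
      { unfold F3; rewrite !Dw_add; Fv.
        assert (A0 := Hp i0 0%nat j0 Hi0 ltac:(lia) Hj0). assert (A1 := Hp i0 1%nat j0 Hi0 ltac:(lia) Hj0).
        assert (A2 := Hp i0 2%nat j0 Hi0 ltac:(lia) Hj0).
        eapply Rle_trans; [apply Rabs_triang|]. eapply Rle_trans; [apply Rplus_le_compat_r, Rabs_triang|]. lra. }
      destruct Hee as [-> | ->]; [exact Y|]. rewrite Dw_opp; Fv; rewrite Rabs_Ropp; exact Y. }
    assert (Z : v i0 j0 = Rabs (Dw w e (tm s) x y z) / dl).
    { unfold v. rewrite <- X, Rabs_mult, (Rabs_right dl) by lra. field; lra. }
    rewrite Z. apply Rmult_le_reg_r with dl; [assumption|].
    replace (Rabs (Dw w e (tm s) x y z) / dl * dl) with (Rabs (Dw w e (tm s) x y z)) by (field; lra).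
    eapply Rle_trans; [exact Y|]. apply Req_le; field; lra. }
  assert (Hs : forall i j, (i < 3)%nat -> (j < 3)%nat -> v i j = v j i).
  { intros i0 j0 Hi0 Hj0; unfold v; f_equal.
    apply (eqT_Dw _ w _ _ (sT_pos (ss s)) (s_sym (ss s) i0 j0 Hi0 Hj0) (tm s) x y z (tm_ok s)). }
  assert (B00 := Hq 0%nat 0%nat _ ltac:(lia) ltac:(lia) (s_quad (ss s) 0%nat 0%nat ltac:(lia) ltac:(lia)) (or_introl eq_refl)).
  assert (B01 := Hq 0%nat 1%nat _ ltac:(lia) ltac:(lia) (s_quad (ss s) 0%nat 1%nat ltac:(lia) ltac:(lia)) (or_introl eq_refl)).
  assert (B10 := Hq 1%nat 0%nat _ ltac:(lia) ltac:(lia) (s_quad (ss s) 1%nat 0%nat ltac:(lia) ltac:(lia)) (or_introl eq_refl)).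
  assert (B11 := Hq 1%nat 1%nat _ ltac:(lia) ltac:(lia) (s_quad (ss s) 1%nat 1%nat ltac:(lia) ltac:(lia)) (or_introl eq_refl)).
  assert (B22 := Hq 2%nat 2%nat _ ltac:(lia) ltac:(lia) (s_quad2 (ss s)) (or_intror eq_refl)).
  assert (S20 := Hs 2%nat 0%nat ltac:(lia) ltac:(lia)). assert (S21 := Hs 2%nat 1%nat ltac:(lia) ltac:(lia)).
  clear Hq Hs Hp.
  set (Rt := r 0%nat 0%nat 0%nat + r 0%nat 1%nat 0%nat + r 0%nat 2%nat 0%nat + (r 0%nat 0%nat 1%nat + r 0%nat 1%nat 1%nat + r 0%nat 2%nat 1%nat)
     + (r 1%nat 0%nat 0%nat + r 1%nat 1%nat 0%nat + r 1%nat 2%nat 0%nat) + (r 1%nat 0%nat 1%nat + r 1%nat 1%nat 1%nat + r 1%nat 2%nat 1%nat)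
     + (r 2%nat 0%nat 2%nat + r 2%nat 1%nat 2%nat + r 2%nat 2%nat 2%nat)).
  assert (L : Rt + v 0%nat 2%nat + v 1%nat 2%nat <= lsum (map (fun g : St -> F => Rabs (g s (tm s) x y z)) (klist w))).
  { unfold klist. cbn [map lsum fold_right]. fold (lsum (map (fun g : St -> F => Rabs (g s (tm s) x y z)) (kterms w))).
    unfold kterms. rewrite lsum_flat_map. cbn [map idx3 lsum fold_right]. rewrite !lsum_flat_map.
    cbn [map idx3 lsum fold_right]. rewrite !lsum_flat_map. cbn [map idx3 lsum fold_right]. rewrite !map_map.
    assert (H : forall i k j, lsum (map (fun p => Rabs (lterm (K_ i k s) (K_ k j s) p (tm s) x y z)) (psplits w)) = r i k j) by reflexivity.
    rewrite !H. change (Rabs (Dw w (K_ 0 2 s) (tm s) x y z)) with (v 0%nat 2%nat).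
    change (Rabs (Dw w (K_ 1 2 s) (tm s) x y z)) with (v 1%nat 2%nat). clear H.
    assert (H1 := Hr 0%nat 0%nat 2%nat). assert (H2 := Hr 0%nat 1%nat 2%nat). assert (H3 := Hr 0%nat 2%nat 2%nat).
    assert (H4 := Hr 1%nat 0%nat 2%nat). assert (H5 := Hr 1%nat 1%nat 2%nat). assert (H6 := Hr 1%nat 2%nat 2%nat).
    assert (H7 := Hr 2%nat 0%nat 0%nat). assert (H8 := Hr 2%nat 1%nat 0%nat). assert (H9 := Hr 2%nat 2%nat 0%nat).
    assert (H10 := Hr 2%nat 0%nat 1%nat). assert (H11 := Hr 2%nat 1%nat 1%nat). assert (H12 := Hr 2%nat 2%nat 1%nat).
    unfold Rt. lra. }
  assert (Q : v i j <= 4 * (v 0%nat 2%nat + v 1%nat 2%nat) + 10 / dl * Rt).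
  { set (d := fun i j => (r i 0%nat j + r i 1%nat j + r i 2%nat j) / dl) in *.
    assert (Hdd : forall i j, 0 <= d i j).
    { intros; unfold d; apply Rmult_le_pos; [|left; apply Rinv_0_lt_compat, Hd].
      repeat apply Rplus_le_le_0_compat; apply Hr. }
    assert (E : 10 / dl * Rt = 10 * (d 0%nat 0%nat + d 0%nat 1%nat + d 1%nat 0%nat + d 1%nat 1%nat + d 2%nat 2%nat)).
    { unfold Rt, d; field; lra. }
    rewrite E. change (v 0%nat 0%nat <= 1 / 20 * (v 0%nat 0%nat + v 0%nat 1%nat + v 0%nat 2%nat + v 0%nat 0%nat + v 1%nat 0%nat + v 2%nat 0%nat) + d 0%nat 0%nat) in B00.
    change (v 0%nat 1%nat <= 1 / 20 * (v 0%nat 0%nat + v 0%nat 1%nat + v 0%nat 2%nat + v 0%nat 1%nat + v 1%nat 1%nat + v 2%nat 1%nat) + d 0%nat 1%nat) in B01.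
    change (v 1%nat 0%nat <= 1 / 20 * (v 1%nat 0%nat + v 1%nat 1%nat + v 1%nat 2%nat + v 0%nat 0%nat + v 1%nat 0%nat + v 2%nat 0%nat) + d 1%nat 0%nat) in B10.
    change (v 1%nat 1%nat <= 1 / 20 * (v 1%nat 0%nat + v 1%nat 1%nat + v 1%nat 2%nat + v 0%nat 1%nat + v 1%nat 1%nat + v 2%nat 1%nat) + d 1%nat 1%nat) in B11.
    change (v 2%nat 2%nat <= 1 / 20 * (v 2%nat 0%nat + v 2%nat 1%nat + v 2%nat 2%nat + v 0%nat 2%nat + v 1%nat 2%nat + v 2%nat 2%nat) + d 2%nat 2%nat) in B22.
    rewrite S20, S21 in *.
    assert (N00 := Hv 0%nat 0%nat). assert (N01 := Hv 0%nat 1%nat). assert (N10 := Hv 1%nat 0%nat). assert (N11 := Hv 1%nat 1%nat).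
    assert (N22 := Hv 2%nat 2%nat). assert (N02 := Hv 0%nat 2%nat). assert (N12 := Hv 1%nat 2%nat).
    assert (D00 := Hdd 0%nat 0%nat). assert (D01 := Hdd 0%nat 1%nat). assert (D10 := Hdd 1%nat 0%nat). assert (D11 := Hdd 1%nat 1%nat).
    assert (D22 := Hdd 2%nat 2%nat).
    clear - Hi Hj B00 B01 B10 B11 B22 N00 N01 N10 N11 N22 N02 N12 D00 D01 D10 D11 D22 S20 S21.
    destruct i as [|[|[|i]]]; destruct j as [|[|[|j]]]; try lia; rewrite ?S20, ?S21; lra. }
  apply Rle_trans with (1 := Q).
  assert (H10 : 0 < 10 / dl) by (apply Rdiv_lt_0_compat; lra).
  assert (Rt0 : 0 <= Rt) by (unfold Rt; repeat apply Rplus_le_le_0_compat; apply Hr).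
  assert (N02 := Hv 0%nat 2%nat). assert (N12 := Hv 1%nat 2%nat).
  apply Rle_trans with ((4 + 10 / dl) * (Rt + v 0%nat 2%nat + v 1%nat 2%nat)).
  - nra.
  - apply Rmult_le_compat_l; lra.
Qed.

Lemma kterms_in w g : In g (kterms w) -> exists i k j p, (i < 3)%nat /\ (k < 3)%nat /\ (j < 3)%nat /\
  In p (psplits w) /\ g = fun s => lterm (K_ i k s) (K_ k j s) p.
Proof.
  unfold kterms; intros H.
  apply in_flat_map in H; destruct H as (i & Hi & H). apply in_flat_map in H; destruct H as (k & Hk & H).
  apply in_flat_map in H; destruct H as (j & Hj & H). apply in_map_iff in H; destruct H as (p & <- & Hp).
  assert (I : forall n, In n idx3 -> (n < 3)%nat) by (intros n [<-|[<-|[<-|[]]]]; lia).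
  exists i, k, j, p; auto 6.
Qed.

Lemma kC_pos : 0 <= 4 + 10 / dl.
Proof. assert (H := dl_pos). assert (0 < 10 / dl) by (apply Rdiv_lt_0_compat; lra). lra. Qed.

(** Induction on the length: the fields in [kterms] are products of shorter derivatives, and one
    factor is bounded by a constant because [se <= 1], so the bound stays linear in [se]. *)
Lemma K_sup w i j : (ord w + 3 <= 2 * M)%nat -> (i < 3)%nat -> (j < 3)%nat -> Supb tm (fun s => Dw w (K_ i j s)) se.
Proof.
  remember (length w) as n eqn:En. revert w En i j.
  induction n as [n IH] using (well_founded_induction lt_wf); intros w En i j Hw Hi Hj.
  apply (Supb_pointwise tm (klist w) _ _ (4 + 10 / dl)).
  - apply se_nn.
  - apply kC_pos.
  - intros; apply K_pointwise; assumption.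
  - intros g [<-|[<-|Hg]].
    + apply (Reg_Supb tm (2 * M)); [apply se_nn | apply Reg_a; lia | assumption].
    + apply (Reg_Supb tm (2 * M)); [apply se_nn | apply Reg_a; lia | assumption].
    + apply kterms_in in Hg; destruct Hg as (i' & k & j' & p & Hi' & Hk & Hj' & Hp & ->).
      apply psplits_in in Hp; destruct Hp as (Hp & L1 & L2). assert (E := splits_ord w p Hp).
      apply (Supb_le tm _ (fun s => 1 * se s)); [|apply lesssim_le; intros; lra].
      apply Supb_mul; [apply one_nn | apply se_nn | |].
      * apply (Supb_le tm _ se); [|apply se_one]. apply (IH (length (fst p))); auto; lia.
      * apply (IH (length (snd p))); auto; lia.
Qed.

Definition down_closed (Q : list nat -> Prop) : Prop :=
  forall w p, Q w -> In p (splits w) -> Q (fst p) /\ Q (snd p).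

(* Induction on the word: by [K_pointwise], up to products of lower derivatives every entry is bounded by the two entries of [a]. *)
Lemma K_L2_of_a (Q : list nat -> Prop) (B : St -> R) : down_closed Q -> (forall w, Q w -> (ord w <= 2 * M + 2)%nat) -> nn B ->
  (forall w i, Q w -> (i < 2)%nat -> L2b tm (fun s => Dw w (K_ i 2 s)) B) ->
  forall w i j, Q w -> (i < 3)%nat -> (j < 3)%nat -> L2b tm (fun s => Dw w (K_ i j s)) B.
Proof.
  intros HQ HO HB Ha w. remember (length w) as n eqn:En. revert w En.
  induction n as [n IH] using (well_founded_induction lt_wf); intros w En i j Hw Hi Hj.
  apply (L2b_pointwise tm (klist w) _ _ (4 + 10 / dl)).
  - assumption.
  - apply kC_pos.
  - intros; apply K_pointwise; assumption.
  - intros g [<-|[<-|Hg]]; [apply Ha; auto; lia | apply Ha; auto; lia|].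
    apply kterms_in in Hg; destruct Hg as (i' & k & j' & p & Hi' & Hk & Hj' & Hp & ->).
    apply psplits_in in Hp; destruct Hp as (Hp & L1 & L2). assert (E := splits_ord w p Hp).
    destruct (HQ w p Hw Hp) as [Q1 Q2]. assert (HM := M_ge). specialize (HO w Hw).
    destruct (Nat.le_gt_cases (ord (fst p) + 3) (2 * M)) as [C|C].
    (* One factor always fits the sup norm: if the first has order at least 2M - 2, the total 2M + 2
       leaves at most 4 for the second, and 4 + 3 <= 2M. *)
    + apply (L2b_le tm _ (fun s => 1 * B s)); [|apply lesssim_le; intros; lra].
      apply L2b_mul_sup; [apply one_nn | assumption | |].
      * apply (Supb_le tm _ se); [apply K_sup; auto | apply se_one].
      * apply (IH (length (snd p))); auto; lia.
    + apply (L2b_le tm _ (fun s => B s * 1)); [|apply lesssim_le; intros; lra].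
      apply L2b_mul_sup_r; [assumption | apply one_nn | |].
      * apply (IH (length (fst p))); auto; lia.
      * apply (Supb_le tm _ se); [apply K_sup; auto; lia | apply se_one].
Qed.

Lemma K_Reg n B : (n <= 2 * M + 2)%nat -> nn B -> (forall i, (i < 2)%nat -> Reg tm n B (K_ i 2)) ->
  forall i j, (i < 3)%nat -> (j < 3)%nat -> Reg tm n B (K_ i j).
Proof.
  intros Hn HB Ha i j Hi Hj w Hw.
  apply (K_L2_of_a (fun w => (ord w <= n)%nat) B); auto.
  - intros v p Hv Hp; assert (E := splits_ord v p Hp); lia.
  - intros; lia.
  - intros v k Hv Hk; apply Ha; assumption.
Qed.

Lemma Reg_K i j : (i < 3)%nat -> (j < 3)%nat -> Reg tm (2 * M) se (K_ i j).
Proof. intros; apply K_Reg; auto; [lia | apply se_nn | apply Reg_a]. Qed.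

End KA.

(** * Nonlinear terms *)

Section NL.
Context {P : Par}.

(* The energy estimate is closed at these two orders only. *)
Definition level (N : nat) : Prop := N = 2%nat \/ N = (2 * M)%nat.

(** The size of a remainder that, paired with a field of size [sd N], is absorbed by the dissipation
    as soon as [ep] is small. *)
Definition ed (N : nat) (s : St) : R := ep s * sd N s.

Lemma ed_nn N : nn (ed N).
Proof. intros s; apply Rmult_le_pos; [apply ep_nn | apply sd_nn]. Qed.

Lemma ed_sd N : ed N <~ sd N.
Proof.
  apply lesssim_le; intros s; unfold ed; assert (H := ep_le1 s); assert (H' := sd_nn N s); nra.
Qed.

Lemma Reg_eqT n B (f g : St -> F) : (forall s, eqT (sT (ss s)) (f s) (g s)) -> Reg tm n B g -> Reg tm n B f.
Proof.
  intros H Hg w Hw. apply (L2b_ext tm _ (fun s => Dw w (g s))); [|apply Hg, Hw].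
  intros s x y z; apply (eqT_Dw _ w _ _ (sT_pos (ss s)) (H s)), tm_ok.
Qed.
Lemma Reg_unscal n B c (f : St -> F) : c <> 0 -> Reg tm n B (fun s => Fc c * f s)%fld -> Reg tm n B f.
Proof.
  intros Hc H w Hw. apply (L2b_ext tm _ (fun s => Fc (/ c) * Dw w (Fc c * f s))%fld).
  - intros s x y z; rewrite Dw_scal; Fv; field; assumption.
  - apply L2b_scal, H, Hw.
Qed.
Lemma Reg_ext n B (f g : St -> F) : (forall s, f s = g s) -> Reg tm n B g -> Reg tm n B f.
Proof. intros H Hg; apply (Reg_eqT n B f g); [|assumption]. intros s; rewrite H; intros t x y z _; reflexivity. Qed.

(** At order 2 the first factor is always smooth enough for the sup norm; at order 2M, whichever
    factor carries fewer derivatives is. The room for this comes from 2M >= 8. *)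
Lemma Reg_mul_se_sd N n f g : level N -> (n <= N)%nat -> Reg tm (2 * M) se f -> Reg tm n (sd N) g ->
  (N <= n + 1)%nat -> Reg tm n (ed N) (fun s => f s * g s)%fld.
Proof.
  intros HN Hn Hf Hg Hn'. apply (Reg_le tm n (fun s => se s * sd N s)).
  { apply lesssim_le; intros s; apply Rmult_le_compat_r; [apply sd_nn | apply se_le_ep]. }
  apply (Reg_mul tm n (2 * M) n); auto; [apply se_nn | apply sd_nn|].
  intros b c H. assert (HM := M_ge). destruct HN as [-> | ->]; lia.
Qed.
Lemma Reg_mul_se_ed N f g : level N -> Reg tm (2 * M) se f -> Reg tm N (ed N) g ->
  Reg tm N (ed N) (fun s => f s * g s)%fld.
Proof.
  intros HN Hf Hg. apply (Reg_le tm N (fun s => 1 * ed N s)); [apply lesssim_le; intros; lra|].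
  apply (Reg_mul tm N (2 * M) N); auto; [apply one_nn | apply ed_nn | eapply Reg_le; [apply se_one | exact Hf]|].
  intros b c H. assert (HM := M_ge). destruct HN as [-> | ->]; lia.
Qed.

Lemma Reg_adv N f : level N -> Reg tm (N + 1) (sd N) f -> Reg tm N (ed N) (fun s => advF (su (ss s)) (f s)).
Proof.
  intros HN Hf. unfold advF, F3.
  assert (H : forall k, (k < 3)%nat -> Reg tm N (ed N) (fun s => su (ss s) k * D (S k) (f s))%fld).
  { intros k Hk. apply (Reg_mul_se_sd N N (u_ k) (fun s => D (S k) (f s))); auto; [apply Reg_u, Hk| |lia].
    apply Reg_D. eapply Reg_mono; [|exact Hf]. simpl; lia. }
  apply Reg_add; [apply Reg_add|]; apply H; lia.
Qed.

Lemma Reg_th_low_sd N i : (i < 3)%nat -> Reg tm N (sd N) (th_ i).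
Proof. intros Hi; eapply Reg_mono; [|apply Reg_th_sd, Hi]; lia. Qed.

Lemma Reg_Kth N i : level N -> (i < 3)%nat -> Reg tm N (ed N) (fun s => mvF (sK (ss s)) (sth (ss s)) i).
Proof.
  intros HN Hi. unfold mvF, F3.
  assert (H : forall j, (j < 3)%nat -> Reg tm N (ed N) (fun s => sK (ss s) i j * sth (ss s) j)%fld).
  { intros j Hj. apply (Reg_mul_se_sd N N (K_ i j) (th_ j)); auto; [apply Reg_K; auto | apply Reg_th_low_sd, Hj | lia]. }
  apply Reg_add; [apply Reg_add|]; apply H; lia.
Qed.

Lemma Reg_cross N (a b : St -> nat -> F) i :
  (forall j k, (j < 3)%nat -> (k < 3)%nat -> Reg tm N (ed N) (fun s => a s j * b s k)%fld) ->
  Reg tm N (ed N) (fun s => crossF (a s) (b s) i).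
Proof.
  intros H. unfold crossF. destruct i as [|[|i]]; apply Reg_sub; apply H; lia.
Qed.

Lemma Reg_NLc N i : level N -> (i < 3)%nat -> Reg tm N (ed N) (fun s => NLc (sth (ss s)) (sK (ss s)) i).
Proof.
  intros HN Hi. unfold NLc.
  apply Reg_add; [apply Reg_add; [apply Reg_add|]|].
  - apply (Reg_cross N (fun s => sth (ss s)) (fun s j => Fc ttil * sK (ss s) j 2%nat)%fld). intros j k Hj Hk.
    apply (Reg_ext N _ _ (fun s => Fc ttil * (K_ k 2 s * th_ j s))%fld); [intros s; unfold K_, th_; ring|].
    apply Reg_scal, Reg_mul_se_sd; auto; [apply Reg_K; auto | apply Reg_th_low_sd, Hj | lia].
  - apply (Reg_cross N (fun s => omF) (fun s => mvF (sK (ss s)) (sth (ss s)))). intros j k Hj Hk.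
    unfold omF; destruct (j =? 2)%nat; apply (Reg_scal tm); apply Reg_Kth; auto.
  - apply (Reg_cross N (fun s => sth (ss s)) (fun s j => Fc (jd j) * sth (ss s) j)%fld). intros j k Hj Hk.
    apply (Reg_ext N _ _ (fun s => Fc (jd k) * (th_ j s * th_ k s))%fld); [intros s; unfold th_; ring|].
    apply Reg_scal, Reg_mul_se_sd; auto; [apply Reg_th; auto | apply Reg_th_low_sd, Hk | lia].
  - apply (Reg_cross N (fun s => sth (ss s)) (fun s => mvF (sK (ss s)) (sth (ss s)))). intros j k Hj Hk.
    apply (Reg_mul_se_ed N (th_ j)); auto; [apply Reg_th, Hj | apply Reg_Kth; auto].
Qed.

Lemma Reg_NLth N i : level N -> (i < 3)%nat -> Reg tm N (ed N) (fun s => NLth (su (ss s)) (sth (ss s)) (sK (ss s)) i).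
Proof.
  intros HN Hi. unfold NLth.
  apply Reg_add; [apply Reg_add|].
  - apply Reg_scal, (Reg_adv N (th_ i)); auto. apply Reg_th_sd, Hi.
  - unfold F3.
    assert (H : forall j, (j < 3)%nat -> Reg tm N (ed N) (fun s => sK (ss s) i j * advF (su (ss s)) (sth (ss s) j))%fld).
    { intros j Hj. apply (Reg_mul_se_ed N (K_ i j)); auto; [apply Reg_K; auto | apply (Reg_adv N (th_ j)); auto; apply Reg_th_sd, Hj]. }
    apply Reg_add; [apply Reg_add|]; apply H; lia.
  - apply Reg_NLc; auto.
Qed.

Lemma ttil_pos : 0 < ttil.
Proof. unfold ttil; apply Rdiv_lt_0_compat; [apply tau_pos | assert (H := kappa_pos); lra]. Qed.

Lemma Reg_lap N n i : (n + 2 <= N + 1)%nat -> (i < 3)%nat -> Reg tm n (sd N) (fun s => lapF (sth (ss s) i)).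
Proof.
  intros Hn Hi. unfold lapF, F3.
  assert (H : forall j, Reg tm n (sd N) (fun s => D (S j) (D (S j) (sth (ss s) i)))).
  { intros j; apply (Reg_D tm n (sd N) (S j) (fun s => D (S j) (sth (ss s) i))). apply (Reg_D tm _ (sd N) (S j) (th_ i)).
    eapply Reg_mono; [|apply Reg_th_sd, Hi]. simpl; lia. }
  apply Reg_add; [apply Reg_add|]; apply H.
Qed.
Lemma Reg_graddiv N n i : (n + 2 <= N + 1)%nat -> Reg tm n (sd N) (fun s => D (S i) (divF (sth (ss s)))).
Proof.
  intros Hn. apply (Reg_D tm n (sd N) (S i) (fun s => divF (sth (ss s)))). unfold divF, F3.
  assert (H : forall j, (j < 3)%nat -> Reg tm (wt (S i) + n) (sd N) (fun s => D (S j) (sth (ss s) j))).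
  { intros j Hj; apply (Reg_D tm _ (sd N) (S j) (th_ j)).
    eapply Reg_mono; [|apply Reg_th_sd, Hj]. simpl; lia. }
  apply Reg_add; [apply Reg_add|]; apply H; lia.
Qed.
Lemma Reg_curlu N n i : (n + 1 <= N + 1)%nat -> Reg tm n (sd N) (fun s => curlF (su (ss s)) i).
Proof.
  intros Hn.
  assert (H : forall j k, (j < 3)%nat -> Reg tm n (sd N) (fun s => D (S k) (su (ss s) j))).
  { intros j k Hj; apply (Reg_D tm _ (sd N) (S k) (u_ j)). eapply Reg_mono; [|apply Reg_u_sd, Hj]. simpl; lia. }
  unfold curlF; destruct i as [|[|i]]; apply Reg_sub; apply H; lia.
Qed.

(* The rotation components of the microrotation equation express [a] through dissipated quantities. *)
Lemma Reg_thLin N i : level N -> (i < 3)%nat ->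
  Reg tm (N - 1) (sd N) (fun s => LinF (sth (ss s)) (sK (ss s)) i).
Proof.
  intros HN Hi. assert (HM := M_ge).
  apply (Reg_eqT _ _ _ (fun s => Fc kappa * curlF (su (ss s)) i - Fc (2 * kappa) * sth (ss s) i
     + Fc (atil - gtil) * D (S i) (divF (sth (ss s))) + Fc gtil * lapF (sth (ss s) i)
     - NLth (su (ss s)) (sth (ss s)) (sK (ss s)) i
     - (Fc (jd i) * D 0 (sth (ss s) i) + F3 (fun j => sK (ss s) i j * D 0 (sth (ss s) j))))%fld).
  { intros s t x y z Ht. assert (H := s_th (ss s) i Hi t x y z Ht). revert H; Fv. intros H. lra. }
  assert (Hp : Reg tm (N - 1) (sd N) (fun s => NLth (su (ss s)) (sth (ss s)) (sK (ss s)) i)).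
  { eapply Reg_le; [apply (ed_sd N)|]. eapply Reg_mono; [|apply Reg_NLth; auto]. lia. }
  assert (Ht : forall j, (j < 3)%nat -> Reg tm (N - 1) (sd N) (fun s => D 0 (sth (ss s) j))).
  { intros j Hj; apply (Reg_D tm _ (sd N) 0 (th_ j)). eapply Reg_mono; [|apply Reg_th_sd, Hj].
    destruct HN as [-> | ->]; simpl; lia. }
  assert (HKt : forall j, (j < 3)%nat -> Reg tm (N - 1) (sd N) (fun s => sK (ss s) i j * D 0 (sth (ss s) j))%fld).
  { intros j Hj. eapply Reg_le; [apply (ed_sd N)|].
    apply (Reg_mul_se_sd N (N - 1) (K_ i j)); auto; [lia | apply Reg_K; auto | lia]. }
  apply Reg_sub; [apply Reg_sub|].
  - apply Reg_add; [apply Reg_add; [apply Reg_sub|]|]; apply Reg_scal.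
    + apply Reg_curlu; lia.
    + eapply Reg_mono; [|apply (Reg_th_sd N i Hi)]; lia.
    + apply Reg_graddiv; destruct HN as [-> | ->]; lia.
    + apply Reg_lap; auto; destruct HN as [-> | ->]; lia.
  - exact Hp.
  - apply Reg_add; [apply Reg_scal, Ht, Hi|]. unfold F3.
    apply Reg_add; [apply Reg_add|]; apply HKt; lia.
Qed.

(** As the equilibrium rotates, [ttil] is nonzero and the first two components of [LinF] determine
    [a]. The order drops to [N - 1] because they equal expressions with two space derivatives or one
    time derivative of theta, which is known to order N + 1. *)
Lemma Reg_a_sd N i : level N -> (i < 2)%nat -> Reg tm (N - 1) (sd N) (K_ i 2).
Proof.
  intros HN Hi. assert (Ht := ttil_pos).
  assert (Hc : ttil * ttil <> 0) by nra.
  apply (Reg_unscal _ _ _ _ Hc).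
  destruct i as [|[|i]]; [| |lia].
  - apply (Reg_ext _ _ _ (fun s => LinF (sth (ss s)) (sK (ss s)) 1 + Fc (ttil * dl) * th_ 0 s)%fld).
    { intros s; unfold LinF, K_, th_; ring. }
    apply Reg_add; [apply Reg_thLin; auto | apply Reg_scal]. eapply Reg_mono; [|apply (Reg_th_low_sd N 0)]; lia.
  - apply (Reg_ext _ _ _ (fun s => Fc (ttil * dl) * th_ 1 s - LinF (sth (ss s)) (sK (ss s)) 0)%fld).
    { intros s; unfold LinF, K_, th_; ring. }
    apply Reg_sub; [apply Reg_scal | apply Reg_thLin; auto]. eapply Reg_mono; [|apply (Reg_th_low_sd N 1)]; lia.
Qed.

Lemma Reg_K_sd N i j : level N -> (i < 3)%nat -> (j < 3)%nat -> Reg tm (N - 1) (sd N) (K_ i j).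
Proof.
  intros HN Hi Hj. assert (HM := M_ge). apply K_Reg; auto; [destruct HN as [-> | ->]; lia | apply sd_nn|].
  intros k Hk; apply Reg_a_sd; assumption.
Qed.

(** The full term with all derivatives on [D 0] of theta would need order N + 2 and belongs to the
    energy; its commutator puts a derivative on [K] and needs order N + 1 only. *)
Lemma commutator_K_dtheta N w i j : level N -> (ord w <= N)%nat -> (i < 3)%nat -> (j < 3)%nat ->
  L2b tm (fun s => Dw w (K_ i j s * D 0 (th_ j s)) - K_ i j s * Dw w (D 0 (th_ j s)))%fld (ed N).
Proof.
  intros HN Hw Hi Hj. assert (HM := M_ge).
  apply (L2b_le tm _ (fun s => se s * sd N s)).
  2:{ apply lesssim_le; intros s; apply Rmult_le_compat_r; [apply sd_nn | apply se_le_ep]. }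
  apply (comm_L2b tm (2 * M) (N - 1) se (sd N) (K_ i j) (fun s => D 0 (th_ j s))); [apply se_nn | apply sd_nn | apply Reg_K; auto| |].
  - apply Reg_D. eapply Reg_mono; [|apply Reg_th_sd, Hj]. destruct HN as [-> | ->]; simpl; lia.
  - intros b c H1 H2. destruct HN as [-> | ->]; lia.
Qed.

End NL.

(** * The energy identity *)

Lemma Dw_lap w f : Dw w (lapF f) = lapF (Dw w f).
Proof. unfold lapF, F3; rewrite !Dw_add, !Dw_D; reflexivity. Qed.
Lemma Dw_div w v : Dw w (divF v) = divF (fun i => Dw w (v i)).
Proof. unfold divF, F3; rewrite !Dw_add, !Dw_D; reflexivity. Qed.
Lemma Dw_curl w v i : Dw w (curlF v i) = curlF (fun i => Dw w (v i)) i.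
Proof. unfold curlF; destruct i as [|[|i]]; rewrite Dw_sub, !Dw_D; reflexivity. Qed.

Definition grad2 (v : nat -> F) (t : R) : R :=
  sum3 (fun i => sum3 (fun j => L2 (D (S j) (v i)) t)).

Lemma grad2_nonneg v t : 0 <= grad2 v t.
Proof. unfold grad2, sum3; repeat apply Rplus_le_le_0_compat; apply L2_nonneg. Qed.

(** Two integrations by parts exchange the directions in the mixed terms, which then cancel. The
    identity makes the theta dissipation coercive whatever the sign of [atil - gtil]. *)
Lemma curl_div_grad v t : sum3 (fun i => L2 (curlF v i) t) + L2 (divF v) t = grad2 v t.
Proof.
  assert (X : forall i j f g, ip (D (S i) f) (D (S j) g) t = ip (D (S j) f) (D (S i) g) t).
  { intros. rewrite ip_D, D_comm, <- ip_D. reflexivity. }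
  unfold grad2, sum3, divF, F3; cbn [curlF]. rewrite <- !ip_self.
  repeat rewrite ?ip_add_l, ?ip_add_r, ?ip_sub_l, ?ip_sub_r.
  set (v0 := v 0%nat); set (v1 := v 1%nat); set (v2 := v 2%nat).
  rewrite (ip_sym (D 2 v1) (D 1 v0)), (ip_sym (D 3 v2) (D 1 v0)), (ip_sym (D 3 v2) (D 2 v1)).
  rewrite (ip_sym (D 3 v1) (D 2 v2)), (ip_sym (D 1 v2) (D 3 v0)), (ip_sym (D 2 v0) (D 1 v1)).
  rewrite (X 1%nat 2%nat v2 v1), (X 2%nat 0%nat v0 v2), (X 0%nat 1%nat v1 v0).
  rewrite (ip_sym (D 3 v2) (D 2 v1)), (ip_sym (D 2 v1) (D 1 v0)). ring.
Qed.

(** The curl is self-adjoint, so the exchange terms between [u] and theta are equal and add up. *)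
Lemma curl_sym u v t : sum3 (fun i => ip (u i) (curlF v i) t) = sum3 (fun i => ip (v i) (curlF u i) t).
Proof.
  unfold sum3; cbn [curlF]. rewrite !ip_sub_r.
  assert (X : forall i f g, ip f (D (S i) g) t = - ip g (D (S i) f) t).
  { intros. rewrite (ip_sym f), ip_D; reflexivity. }
  rewrite (X 1%nat (u 0%nat)), (X 2%nat (u 0%nat)), (X 2%nat (u 1%nat)), (X 0%nat (u 1%nat)), (X 0%nat (u 2%nat)), (X 1%nat (u 2%nat)). ring.
Qed.

Lemma ip_lap f t : ip f (lapF f) t = - sum3 (fun j => L2 (D (S j) f) t).
Proof.
  unfold lapF, F3, sum3. rewrite !ip_add_r. 
  assert (X : forall i, ip f (D (S i) (D (S i) f)) t = - L2 (D (S i) f) t).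
  { intros; rewrite ip_sym, ip_D, ip_self; reflexivity. }
  rewrite !X; ring.
Qed.

Lemma ip_young f g t r : 0 < r -> 2 * ip f g t <= r * L2 f t + / r * L2 g t.
Proof.
  intros Hr. assert (H := L2_nonneg (Fc r * f - g)%fld t). rewrite <- ip_self in H.
  repeat rewrite ?ip_sub_l, ?ip_sub_r, ?ip_scal_l, ?ip_scal_r in H. rewrite !ip_self, (ip_sym g f) in H.
  apply Rmult_le_reg_l with r; [assumption|].
  replace (r * (r * L2 f t + / r * L2 g t)) with (r * r * L2 f t + L2 g t) by (field; lra). lra.
Qed.

Section Energy.
Context {P : Par}.

Definition ca : R := ttil * ttil / dl.

Lemma ca_pos : 0 < ca.
Proof. unfold ca. assert (H := ttil_pos). assert (H' := dl_pos). apply Rdiv_lt_0_compat; nra. Qed.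

(* The weight [ca] makes the coupling of theta and [a] antisymmetric, and including [K] in the inertia avoids losing a derivative on the time derivative of theta. *)
Definition EwF (S : Sol) (w : list nat) : F :=
  let U := fun i => Dw w (su S i) in let Th := fun i => Dw w (sth S i) in let A := fun i => Dw w (sK S i 2%nat) in
  (Fc (1 / 2) * F3 (fun i => U i * U i) + Fc (1 / 2) * F3 (fun i => Fc (jd i) * (Th i * Th i))
   + Fc (1 / 2) * F3 (fun i => F3 (fun j => sK S i j * (Th i * Th j)))
   + Fc (ca / 2) * (A 0%nat * A 0%nat + A 1%nat * A 1%nat))%fld.

Definition Ew (S : Sol) (w : list nat) (t : R) : R := TI (EwF S w) t.

Definition rem_u (S : Sol) w i : F := Dw w (advF (su S) (su S i)).
Definition rem_th (S : Sol) w i : F := (Dw w (NLth (su S) (sth S) (sK S) i)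
  + F3 (fun j => Dw w (sK S i j * D 0 (sth S j)) - sK S i j * Dw w (D 0 (sth S j))))%fld.
Definition rem_a (S : Sol) w i : F := Dw w (NLK (su S) (sth S) (sK S) i 2).

(** The derivative of the energy density, regrouped into the combinations that the equations
    express. By the symmetry of [K] the two halves of the derivative of its quadratic form merge. *)
Definition dEwF (S : Sol) (w : list nat) : F :=
  let U := fun i => Dw w (su S i) in let Th := fun i => Dw w (sth S i) in let A := fun i => Dw w (sK S i 2%nat) in
  (F3 (fun i => U i * D 0 (U i))
   + F3 (fun i => Th i * (Fc (jd i) * D 0 (Th i) + F3 (fun j => sK S i j * D 0 (Th j))))
   + Fc (1 / 2) * F3 (fun i => F3 (fun j => (D 0 (sK S i j) * Th i) * Th j))
   + Fc ca * (A 0%nat * D 0 (A 0%nat) + A 1%nat * D 0 (A 1%nat)))%fld.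

Lemma D_EwF S w : eqT (sT S) (D 0 (EwF S w)) (dEwF S w).
Proof.
  intros t x y z Ht. unfold EwF, dEwF, F3.
  assert (H1 := s_sym S 1%nat 0%nat ltac:(lia) ltac:(lia) t x y z Ht).
  assert (H2 := s_sym S 2%nat 0%nat ltac:(lia) ltac:(lia) t x y z Ht).
  assert (H3 := s_sym S 2%nat 1%nat ltac:(lia) ltac:(lia) t x y z Ht).
  repeat rewrite ?D_add, ?D_scal, ?D_mul, ?D_c. Fv. rewrite H1, H2, H3. field.
Qed.

Lemma Ew_derive S w t : 0 <= t <= sT S -> is_derive (Ew S w) t (TI (dEwF S w) t).
Proof.
  intros Ht. unfold Ew. replace (TI (dEwF S w) t) with (TI (D 0 (EwF S w)) t) by (apply TI_ext; intros; apply D_EwF, Ht).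
  apply TI_derive.
Qed.

Lemma eq_U S w i : (i < 3)%nat -> eqT (sT S) (D 0 (Dw w (su S i)))
  (Fc (mu + kappa / 2) * lapF (Dw w (su S i)) + Fc kappa * curlF (fun i => Dw w (sth S i)) i
   - D (Datatypes.S i) (Dw w (sp S)) - rem_u S w i)%fld.
Proof.
  intros Hi. assert (H := eqT_Dw _ w _ _ (sT_pos S) (s_u S i Hi)).
  rewrite Dw_D in H. rewrite !Dw_sub, Dw_add, !Dw_scal, Dw_lap, Dw_curl, Dw_D in H. exact H.
Qed.

Lemma Dw_LinF w th K i : Dw w (LinF th K i) = LinF (fun i => Dw w (th i)) (fun i j => Dw w (K i j)) i.
Proof.
  unfold LinF; destruct i as [|[|i]]; [| |apply Dw_0]; rewrite Dw_sub, !Dw_scal; reflexivity.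
Qed.

Lemma eq_Th S w i : (i < 3)%nat -> eqT (sT S)
  (Fc (jd i) * D 0 (Dw w (sth S i)) + F3 (fun j => sK S i j * D 0 (Dw w (sth S j))))%fld
  (Fc kappa * curlF (fun i => Dw w (su S i)) i - Fc (2 * kappa) * Dw w (sth S i)
   + Fc (atil - gtil) * D (Datatypes.S i) (divF (fun i => Dw w (sth S i))) + Fc gtil * lapF (Dw w (sth S i))
   - LinF (fun i => Dw w (sth S i)) (fun i j => Dw w (sK S i j)) i - rem_th S w i)%fld.
Proof.
  intros Hi t x y z Ht. assert (H := eqT_Dw _ w _ _ (sT_pos S) (s_th S i Hi) t x y z Ht).
  unfold F3 in H. rewrite !Dw_sub, !Dw_add, Dw_sub, !Dw_scal, Dw_lap, Dw_curl, !Dw_D, Dw_div, Dw_LinF in H.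
  unfold rem_th, F3. rewrite !Dw_D. revert H; Fv. lra.
Qed.

Lemma eq_A0 S w : eqT (sT S) (D 0 (Dw w (sK S 0%nat 2%nat)))
  (Fc dl * Dw w (sth S 1%nat) - Fc ttil * Dw w (sK S 1%nat 2%nat) + rem_a S w 0)%fld.
Proof.
  intros t x y z Ht. assert (H := eqT_Dw _ w _ _ (sT_pos S) (s_K S 0%nat 2%nat ltac:(lia) ltac:(lia)) t x y z Ht).
  rewrite Dw_D in H. rewrite H.
  replace (commF (tenF omF) (sK S) 0 2 + commF (tenF (sth S)) JeqF 0 2 + NLK (su S) (sth S) (sK S) 0 2)%fld
    with (Fc dl * sth S 1%nat - Fc ttil * sK S 1%nat 2%nat + NLK (su S) (sth S) (sK S) 0 2)%fld.
  - rewrite Dw_add, Dw_sub, !Dw_scal. reflexivity.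
  - apply F_ext; intros; unfold commF, tenF, omF, JeqF, F3; Fv; simpl; Fv. unfold Jeq, dl; simpl. ring.
Qed.
Lemma eq_A1 S w : eqT (sT S) (D 0 (Dw w (sK S 1%nat 2%nat)))
  (Fc ttil * Dw w (sK S 0%nat 2%nat) - Fc dl * Dw w (sth S 0%nat) + rem_a S w 1)%fld.
Proof.
  intros t x y z Ht. assert (H := eqT_Dw _ w _ _ (sT_pos S) (s_K S 1%nat 2%nat ltac:(lia) ltac:(lia)) t x y z Ht).
  rewrite Dw_D in H. rewrite H.
  replace (commF (tenF omF) (sK S) 1 2 + commF (tenF (sth S)) JeqF 1 2 + NLK (su S) (sth S) (sK S) 1 2)%fld
    with (Fc ttil * sK S 0%nat 2%nat - Fc dl * sth S 0%nat + NLK (su S) (sth S) (sK S) 1 2)%fld.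
  - rewrite Dw_add, Dw_sub, !Dw_scal. reflexivity.
  - apply F_ext; intros; unfold commF, tenF, omF, JeqF, F3; Fv; simpl; Fv. unfold Jeq, dl; simpl. ring.
Qed.

Definition Rem (S : Sol) w t : R :=
  1 / 2 * sum3 (fun i => sum3 (fun j => ip (D 0 (sK S i j) * Dw w (sth S i))%fld (Dw w (sth S j)) t))
  - sum3 (fun i => ip (Dw w (su S i)) (rem_u S w i) t) - sum3 (fun i => ip (Dw w (sth S i)) (rem_th S w i) t).
(** Kept apart from [Rem], because its test field [a] is not dissipated at the full order of [w];
    the orders 2 and 2M treat it by different means. *)
Definition Aterm (S : Sol) w t : R :=
  ip (Dw w (sK S 0%nat 2%nat)) (rem_a S w 0) t + ip (Dw w (sK S 1%nat 2%nat)) (rem_a S w 1) t.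

(** The pressure drops out by incompressibility, the rotation within [a] by antisymmetry, and the
    coupling of theta with [a] because [ca * dl] equals the square of [ttil]. *)
Lemma energy_identity S w t : 0 <= t <= sT S ->
  let U := fun i => Dw w (su S i) in let Th := fun i => Dw w (sth S i) in
  TI (dEwF S w) t = - (mu + kappa / 2) * grad2 U t + 2 * kappa * sum3 (fun i => ip (Th i) (curlF U i) t)
    - 2 * kappa * sum3 (fun i => L2 (Th i) t) - (atil - gtil) * L2 (divF Th) t - gtil * grad2 Th t
    + Rem S w t + ca * Aterm S w t.
Proof.
  intros Ht U Th.
  set (A := fun i => Dw w (sK S i 2%nat)).
  assert (E1 : TI (dEwF S w) t = sum3 (fun i => ip (U i) (D 0 (U i)) t)
    + sum3 (fun i => ip (Th i) (Fc (jd i) * D 0 (Th i) + F3 (fun j => sK S i j * D 0 (Th j)))%fld t)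
    + 1 / 2 * sum3 (fun i => sum3 (fun j => ip (D 0 (sK S i j) * Th i)%fld (Th j) t))
    + ca * (ip (A 0%nat) (D 0 (A 0%nat)) t + ip (A 1%nat) (D 0 (A 1%nat)) t)).
  { unfold dEwF, ip, sum3, F3; cbv zeta. repeat rewrite ?TI_add, ?TI_scal. unfold U, Th, A. ring. }
  assert (EU : forall i, (i < 3)%nat -> ip (U i) (D 0 (U i)) t
     = (mu + kappa / 2) * ip (U i) (lapF (U i)) t + kappa * ip (U i) (curlF Th i) t
       - ip (U i) (D (Datatypes.S i) (Dw w (sp S))) t - ip (U i) (rem_u S w i) t).
  { intros i Hi. rewrite (ip_ext (U i) (D 0 (U i)) (U i) _ t (fun _ _ _ => eq_refl) (fun x y z => eq_U S w i Hi t x y z Ht)).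
    rewrite !ip_sub_r, ip_add_r, !ip_scal_r. reflexivity. }
  assert (ET : forall i, (i < 3)%nat -> ip (Th i) (Fc (jd i) * D 0 (Th i) + F3 (fun j => sK S i j * D 0 (Th j)))%fld t
     = kappa * ip (Th i) (curlF U i) t - 2 * kappa * L2 (Th i) t + (atil - gtil) * ip (Th i) (D (Datatypes.S i) (divF Th)) t
       + gtil * ip (Th i) (lapF (Th i)) t - ip (Th i) (LinF Th (fun i j => Dw w (sK S i j)) i) t - ip (Th i) (rem_th S w i) t).
  { intros i Hi. rewrite (ip_ext (Th i) (Fc (jd i) * D 0 (Th i) + F3 (fun j => sK S i j * D 0 (Th j)))%fld (Th i) _ t (fun _ _ _ => eq_refl) (fun x y z => eq_Th S w i Hi t x y z Ht)).
    rewrite !ip_sub_r, !ip_add_r, !ip_sub_r, !ip_scal_r, ip_self. reflexivity. }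
  assert (EA0 : ip (A 0%nat) (D 0 (A 0%nat)) t = dl * ip (A 0%nat) (Th 1%nat) t - ttil * ip (A 0%nat) (A 1%nat) t + ip (A 0%nat) (rem_a S w 0) t).
  { rewrite (ip_ext (A 0%nat) (D 0 (A 0%nat)) (A 0%nat) _ t (fun _ _ _ => eq_refl) (fun x y z => eq_A0 S w t x y z Ht)).
    rewrite ip_add_r, ip_sub_r, !ip_scal_r. reflexivity. }
  assert (EA1 : ip (A 1%nat) (D 0 (A 1%nat)) t = ttil * ip (A 1%nat) (A 0%nat) t - dl * ip (A 1%nat) (Th 0%nat) t + ip (A 1%nat) (rem_a S w 1) t).
  { rewrite (ip_ext (A 1%nat) (D 0 (A 1%nat)) (A 1%nat) _ t (fun _ _ _ => eq_refl) (fun x y z => eq_A1 S w t x y z Ht)).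
    rewrite ip_add_r, ip_sub_r, !ip_scal_r. reflexivity. }
  assert (EP : sum3 (fun i => ip (U i) (D (Datatypes.S i) (Dw w (sp S))) t) = 0).
  { assert (X : forall i, ip (U i) (D (Datatypes.S i) (Dw w (sp S))) t = - ip (D (Datatypes.S i) (U i)) (Dw w (sp S)) t)
      by (intros; rewrite ip_D; ring).
    unfold sum3; rewrite !X.
    assert (Z : ip (divF U) (Dw w (sp S)) t = 0).
    { assert (Hd := eqT_Dw _ w _ _ (sT_pos S) (s_div S)). rewrite Dw_div, Dw_0 in Hd.
      rewrite (ip_ext (divF U) (Dw w (sp S)) (Fc 0 * Fc 0)%fld (Dw w (sp S)) t); [rewrite ip_scal_l; ring| |reflexivity].
      intros x y z. apply eq_trans with (1 := Hd t x y z Ht). Fv; ring. }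
    unfold divF, F3 in Z; rewrite !ip_add_l in Z. lra. }
  assert (ED : sum3 (fun i => ip (Th i) (D (Datatypes.S i) (divF Th)) t) = - L2 (divF Th) t).
  { assert (X : forall i, ip (Th i) (D (Datatypes.S i) (divF Th)) t = - ip (D (Datatypes.S i) (Th i)) (divF Th) t)
      by (intros; rewrite ip_D; ring).
    unfold sum3; rewrite !X, <- ip_self. unfold divF at 4, F3. rewrite !ip_add_l. ring. }
  assert (EC := curl_sym U Th t).
  assert (EL : sum3 (fun i => ip (Th i) (LinF Th (fun i j => Dw w (sK S i j)) i) t)
     = ttil * ttil * (ip (Th 1%nat) (A 0%nat) t - ip (Th 0%nat) (A 1%nat) t)).
  { unfold sum3; cbn [LinF]. rewrite !ip_sub_r, !ip_scal_r. fold (A 0%nat) (A 1%nat).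
    rewrite (ip_sym (Th 1%nat) (Th 0%nat)).
    replace (Fc 0) with (Fc 0 * Fc 0)%fld by ring. rewrite ip_scal_r. unfold A; ring. }
  assert (Hca : ca * dl = ttil * ttil) by (unfold ca; field; assert (H := dl_pos); lra).
  rewrite E1, EA0, EA1. unfold sum3 at 1 2. rewrite !EU, !ET by lia. rewrite !ip_lap.
  assert (ER : Rem S w t = 1 / 2 * sum3 (fun i => sum3 (fun j => ip (D 0 (sK S i j) * Th i)%fld (Th j) t))
    - sum3 (fun i => ip (U i) (rem_u S w i) t) - sum3 (fun i => ip (Th i) (rem_th S w i) t)) by reflexivity.
  assert (EA : Aterm S w t = ip (A 0%nat) (rem_a S w 0) t + ip (A 1%nat) (rem_a S w 1) t) by reflexivity.
  rewrite ER, EA. unfold sum3 in *. clear E1 EU ET EA0 EA1 ER EA.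
  clearbody U Th A.
  rewrite (ip_sym (A 1%nat) (A 0%nat)), (ip_sym (A 0%nat) (Th 1%nat)), (ip_sym (A 1%nat) (Th 0%nat)).
  unfold grad2, sum3.
  replace (ca * (dl * ip (Th 1%nat) (A 0%nat) t - ttil * ip (A 0%nat) (A 1%nat) t + ip (A 0%nat) (rem_a S w 0) t +
     (ttil * ip (A 0%nat) (A 1%nat) t - dl * ip (Th 0%nat) (A 1%nat) t + ip (A 1%nat) (rem_a S w 1) t)))
  with (ttil * ttil * (ip (Th 1%nat) (A 0%nat) t - ip (Th 0%nat) (A 1%nat) t) + ca * (ip (A 0%nat) (rem_a S w 0) t + ip (A 1%nat) (rem_a S w 1) t))
  by (rewrite <- Hca; ring).
  rewrite <- EL. apply (f_equal (Rmult kappa)) in EC. apply (f_equal (Rmult (atil - gtil))) in ED. lra.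
Qed.

(** Young's inequality with weight [2 kappa / (kappa + mu)] on the curl coupling leaves [mu / 2] of
    the velocity gradient and [2 kappa mu / (kappa + mu)] of theta. In the theta dissipation the
    divergence has coefficient [atil] and the curl [gtil]. *)
Definition c1 : R := Rmin (mu / 2) (Rmin (2 * kappa * mu / (kappa + mu)) (Rmin atil gtil)).

Lemma atil_pos : 0 < atil. Proof. unfold atil; assert (H := alpha_pos); assert (H' := beta_pos); lra. Qed.
Lemma gtil_pos : 0 < gtil. Proof. unfold gtil; assert (H := gamma_pos); assert (H' := beta_pos); lra. Qed.
Lemma c1_pos : 0 < c1.
Proof.
  assert (H := mu_pos). assert (H' := kappa_pos).
  unfold c1; repeat apply Rmin_pos; [lra | apply Rdiv_lt_0_compat; nra | apply atil_pos | apply gtil_pos].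
Qed.

Definition Gw (S : Sol) w t : R :=
  grad2 (fun i => Dw w (su S i)) t + sum3 (fun i => L2 (Dw w (sth S i)) t) + grad2 (fun i => Dw w (sth S i)) t.

Lemma energy_ineq S w t : 0 <= t <= sT S -> TI (dEwF S w) t <= - c1 * Gw S w t + Rem S w t + ca * Aterm S w t.
Proof.
  intros Ht. assert (EI := energy_identity S w t Ht). cbv zeta in EI. rewrite EI; clear EI. unfold Gw.
  set (U := fun i => Dw w (su S i)). set (Th := fun i => Dw w (sth S i)).
  assert (Hm := mu_pos). assert (Hk := kappa_pos). assert (Ha := atil_pos). assert (Hg := gtil_pos).
  assert (C1 := curl_div_grad U t). assert (C2 := curl_div_grad Th t).
  assert (Y : forall i, 2 * kappa * ip (Th i) (curlF U i) t <= 2 * kappa * kappa / (kappa + mu) * L2 (Th i) t + (kappa + mu) / 2 * L2 (curlF U i) t).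
  { intros i. assert (Hr : 0 < 2 * kappa / (kappa + mu)) by (apply Rdiv_lt_0_compat; lra).
    assert (Z := ip_young (Th i) (curlF U i) t _ Hr).
    replace (2 * kappa * kappa / (kappa + mu) * L2 (Th i) t + (kappa + mu) / 2 * L2 (curlF U i) t)
      with (kappa * (2 * kappa / (kappa + mu) * L2 (Th i) t + / (2 * kappa / (kappa + mu)) * L2 (curlF U i) t)) by (field; lra).
    nra. }
  assert (Y0 := Y 0%nat). assert (Y1 := Y 1%nat). assert (Y2 := Y 2%nat). clear Y.
  assert (B1 : c1 <= mu / 2) by apply Rmin_l.
  assert (B2 : c1 <= 2 * kappa * mu / (kappa + mu)) by (eapply Rle_trans; [apply Rmin_r | apply Rmin_l]).
  assert (B3 : c1 <= atil) by (eapply Rle_trans; [apply Rmin_r | eapply Rle_trans; [apply Rmin_r | apply Rmin_l]]).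
  assert (B4 : c1 <= gtil) by (eapply Rle_trans; [apply Rmin_r | eapply Rle_trans; [apply Rmin_r | apply Rmin_r]]).
  assert (E : 2 * kappa - 2 * kappa * kappa / (kappa + mu) = 2 * kappa * mu / (kappa + mu)) by (field; lra).
  assert (N1 := L2_nonneg (divF U) t). assert (N2 := L2_nonneg (divF Th) t).
  assert (N3 : 0 <= sum3 (fun i => L2 (curlF Th i) t)) by (unfold sum3; repeat apply Rplus_le_le_0_compat; apply L2_nonneg).
  assert (N4 : 0 <= sum3 (fun i => L2 (Th i) t)) by (unfold sum3; repeat apply Rplus_le_le_0_compat; apply L2_nonneg).
  assert (N5 := grad2_nonneg U t).
  assert (X1 : 2 * kappa * sum3 (fun i => ip (Th i) (curlF U i) t)
     <= 2 * kappa * kappa / (kappa + mu) * sum3 (fun i => L2 (Th i) t) + (kappa + mu) / 2 * grad2 U t).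
  { rewrite <- C1. unfold sum3. assert (0 <= (kappa + mu) / 2 * L2 (divF U) t) by (apply Rmult_le_pos; lra). lra. }
  assert (X2 : - (atil - gtil) * L2 (divF Th) t - gtil * grad2 Th t <= - c1 * grad2 Th t) by (rewrite <- C2; nra).
  assert (X3 : - (mu + kappa / 2) * grad2 U t + (kappa + mu) / 2 * grad2 U t <= - c1 * grad2 U t) by nra.
  assert (X4 : 2 * kappa * kappa / (kappa + mu) * sum3 (fun i => L2 (Th i) t) - 2 * kappa * sum3 (fun i => L2 (Th i) t)
     <= - c1 * sum3 (fun i => L2 (Th i) t)) by nra.
  change (fun i => ip (Dw w (sth S i)) (curlF U i) t) with (fun i => ip (Th i) (curlF U i) t).
  change (fun i => L2 (Dw w (sth S i)) t) with (fun i => L2 (Th i) t).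
  lra.
Qed.

(** Every term is cubic: two factors are dissipated derivatives of [u], theta or [K], and the third
    is small by the energy. The time derivative of [K] in the quadratic form enters through the sup
    norm. *)
Lemma Rem_bound N w : level N -> (ord w <= N)%nat -> (fun s => Rabs (Rem (ss s) w (tm s))) <~ (fun s => ep s * DN N s).
Proof.
  intros HN Hw. assert (HM := M_ge).
  assert (Hnn : nn (fun s => ep s * DN N s)) by (intros s; apply Rmult_le_pos; [apply ep_nn | apply DN_nonneg]).
  assert (Hed : (fun s => sd N s * ed N s) <~ (fun s => ep s * DN N s)).
  { apply lesssim_le; intros s; unfold ed; rewrite <- sd_sqr. apply Req_le; ring. }
  assert (Hu : forall i, (i < 3)%nat -> L2b tm (fun s => Dw w (su (ss s) i)) (sd N)) by (intros i Hi; apply (Reg_u_sd N i Hi); lia).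
  assert (Hth : forall i, (i < 3)%nat -> L2b tm (fun s => Dw w (sth (ss s) i)) (sd N)) by (intros i Hi; apply (Reg_th_sd N i Hi); lia).
  assert (T1 : forall i, (i < 3)%nat -> (fun s => Rabs (ip (Dw w (su (ss s) i)) (rem_u (ss s) w i) (tm s))) <~ (fun s => ep s * DN N s)).
  { intros i Hi. eapply lesssim_trans; [|exact Hed].
    apply (ip_lesssim tm (fun s => Dw w (su (ss s) i)) (fun s => rem_u (ss s) w i)); [apply sd_nn | apply ed_nn | auto|].
    apply (Reg_adv N (u_ i) HN (Reg_u_sd N i Hi) w Hw). }
  assert (T2 : forall i, (i < 3)%nat -> (fun s => Rabs (ip (Dw w (sth (ss s) i)) (rem_th (ss s) w i) (tm s))) <~ (fun s => ep s * DN N s)).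
  { intros i Hi. eapply lesssim_trans; [|exact Hed].
    apply (ip_lesssim tm (fun s => Dw w (sth (ss s) i)) (fun s => rem_th (ss s) w i)); [apply sd_nn | apply ed_nn | auto|].
    unfold rem_th. apply L2b_add; [apply (Reg_NLth N i HN Hi w Hw)|]. unfold F3.
    apply L2b_add; [apply L2b_add|]; apply (commutator_K_dtheta N w i); auto; lia. }
  assert (T3 : forall i j, (i < 3)%nat -> (j < 3)%nat ->
     (fun s => Rabs (ip (D 0 (sK (ss s) i j) * Dw w (sth (ss s) i))%fld (Dw w (sth (ss s) j)) (tm s))) <~ (fun s => ep s * DN N s)).
  { intros i j Hi Hj. eapply lesssim_trans; [|exact Hed].
    eapply lesssim_trans.
    - apply (ip_lesssim tm (fun s => D 0 (sK (ss s) i j) * Dw w (sth (ss s) i))%fld (fun s => Dw w (sth (ss s) j)) (ed N) (sd N));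
        [apply ed_nn | apply sd_nn | | exact (Hth j Hj)].
      assert (X : Supb tm (fun s => D 0 (sK (ss s) i j)) ep).
      { apply (Supb_le tm _ se); [|apply se_ep]. exact (K_sup [0%nat] i j ltac:(simpl; lia) Hi Hj). }
      exact (L2b_mul_sup tm _ _ _ _ ep_nn (sd_nn N) X (Hth i Hi)).
    - apply lesssim_le; intros; lra. }
  apply lesssim_trans with (fun s => 1 / 2 * sum3 (fun i => sum3 (fun j => Rabs (ip (D 0 (sK (ss s) i j) * Dw w (sth (ss s) i))%fld (Dw w (sth (ss s) j)) (tm s))))
    + sum3 (fun i => Rabs (ip (Dw w (su (ss s) i)) (rem_u (ss s) w i) (tm s))) + sum3 (fun i => Rabs (ip (Dw w (sth (ss s) i)) (rem_th (ss s) w i) (tm s)))).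
  - apply lesssim_le; intros s. unfold Rem, sum3. apply Rabs_le.
    repeat match goal with |- context [Rabs ?x] => lazymatch goal with H : _ <= x <= _ |- _ => fail | _ =>
      let H := fresh in assert (H : - Rabs x <= x <= Rabs x) by (apply Rabs_le_between; lra); revert H; generalize (Rabs x); intros ? H end end.
    split; lra.
  - unfold sum3. repeat apply lesssim_add; try (apply lesssim_scal; [lra|]; repeat apply lesssim_add); first [apply T1; lia | apply T2; lia | apply T3; lia].
Qed.

End Energy.

(** * Summation over words and coercivity *)

Fixpoint words_len (n : nat) : list (list nat) :=
  match n with
  | O => [[]]
  | S n => flat_map (fun w => [0%nat :: w; 1%nat :: w; 2%nat :: w; 3%nat :: w]) (words_len n)
  end.
(** A multi-index occurs once for each of its orderings, which changes the summed norms by constant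
    factors only. *)
Definition W (N : nat) : list (list nat) :=
  filter (fun w => (ord w <=? N)%nat) (flat_map words_len (seq 0 (N + 1))).

Lemma words_len_in w : (forall k, In k w -> (k <= 3)%nat) -> In w (words_len (length w)).
Proof.
  induction w as [|k w IH]; intros H; simpl; [left; reflexivity|].
  apply in_flat_map; exists w; split; [apply IH; intros; apply H; right; assumption|].
  assert (Hk := H k (or_introl eq_refl)). destruct k as [|[|[|[|k]]]]; simpl; auto; lia.
Qed.
Lemma length_le_ord w : (length w <= ord w)%nat.
Proof. induction w as [|k w IH]; simpl; [lia|]. destruct k; simpl; lia. Qed.
Lemma W_in w N : (forall k, In k w -> (k <= 3)%nat) -> (ord w <= N)%nat -> In w (W N).
Proof.
  intros H1 H2. apply filter_In; split; [|apply Nat.leb_le, H2].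
  apply in_flat_map; exists (length w); split; [|apply words_len_in, H1].
  apply in_seq. assert (L := length_le_ord w). lia.
Qed.
Lemma W_ord w N : In w (W N) -> (ord w <= N)%nat.
Proof. intros H; apply filter_In in H; apply Nat.leb_le, H. Qed.
Lemma cw_letters a0 a1 a2 a3 k : In k (cw a0 a1 a2 a3) -> (k <= 3)%nat.
Proof.
  unfold cw; intros H. repeat (apply in_app_or in H; destruct H as [H|H]; [apply repeat_spec in H; lia|]).
  apply repeat_spec in H; lia.
Qed.
Lemma cw_W a0 a1 a2 a3 N : (2 * a0 + a1 + a2 + a3 <= N)%nat -> In (cw a0 a1 a2 a3) (W N).
Proof. intros H; apply W_in; [apply cw_letters | rewrite ord_cw; assumption]. Qed.

Lemma lsum_term {I} (l : list I) (f : I -> R) i : (forall i, 0 <= f i) -> In i l -> f i <= lsum (map f l).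
Proof.
  intros H; induction l as [|j l IH]; intros [].
  - subst; simpl. assert (X := lsum_nonneg l f H). lra.
  - simpl. specialize (IH H0). specialize (H j). lra.
Qed.
Lemma lsum_le {I} (l : list I) (f g : I -> R) : (forall i, In i l -> f i <= g i) -> lsum (map f l) <= lsum (map g l).
Proof.
  induction l as [|j l IH]; intros H; simpl; [lra|].
  apply Rplus_le_compat; [apply H; left; reflexivity | apply IH; intros; apply H; right; assumption].
Qed.
Lemma lsum_derive {I} (l : list I) (f : I -> R -> R) (d : I -> R) t : (forall i, In i l -> is_derive (f i) t (d i)) ->
  is_derive (fun t => lsum (map (fun i => f i t) l)) t (lsum (map d l)).
Proof.
  induction l as [|j l IH]; intros H; simpl; [apply (is_derive_const (V := R_NormedModule))|].
  apply (is_derive_plus (V := R_NormedModule)); [apply H; left; reflexivity | apply IH; intros; apply H; right; assumption].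
Qed.

(** Needed to apply the Poincare inequality to derivatives of [u] in time alone, on which no
    gradient is available. *)
Lemma TI_zero_dt (f : F) T n : 0 < T -> (forall t, 0 <= t <= T -> TI f t = 0) ->
  forall t, 0 <= t <= T -> TI (Dw (repeat 0%nat n) f) t = 0.
Proof.
  intros HT H. induction n as [|n IH]; intros t Ht; simpl; [apply H, Ht|].
  rewrite <- (is_derive_unique _ _ _ (TI_derive (Dw (repeat 0%nat n) f) t)).
  apply (Derive_zero_on _ T); auto. eexists; apply TI_derive.
Qed.

Section Coercive.
Context {P : Par}.

Definition Xw (S : Sol) w t : R :=
  sum3 (fun i => L2 (Dw w (su S i)) t) + sum3 (fun i => L2 (Dw w (sth S i)) t)
  + (L2 (Dw w (sK S 0%nat 2%nat)) t + L2 (Dw w (sK S 1%nat 2%nat)) t).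

Lemma Xw_nonneg S w t : 0 <= Xw S w t.
Proof. unfold Xw, sum3; repeat apply Rplus_le_le_0_compat; apply L2_nonneg. Qed.

Lemma Gw_nonneg S w t : 0 <= Gw S w t.
Proof. unfold Gw; repeat apply Rplus_le_le_0_compat; try apply grad2_nonneg; apply L2_nonneg. Qed.

(** Half the smallest inertia [lam], less the contribution [3 k0 / 2] of [K], is above [lam / 4]
    since [k0 <= lam / 20]. *)
Definition cE : R := Rmin (1 / 2) (Rmin (lam / 4) (ca / 2)).
Definition CE : R := 1 / 2 + nu + ca / 2.

Lemma cE_pos : 0 < cE.
Proof. unfold cE. assert (H := lam_pos). assert (H' := ca_pos). repeat apply Rmin_pos; lra. Qed.

Lemma quad_bound k (a00 a01 a02 a10 a11 a12 a20 a21 a22 x y z : R) :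
  Rabs a00 <= k -> Rabs a01 <= k -> Rabs a02 <= k -> Rabs a10 <= k -> Rabs a11 <= k -> Rabs a12 <= k ->
  Rabs a20 <= k -> Rabs a21 <= k -> Rabs a22 <= k ->
  Rabs (a00 * (x * x) + a01 * (x * y) + a02 * (x * z) + (a10 * (y * x) + a11 * (y * y) + a12 * (y * z))
    + (a20 * (z * x) + a21 * (z * y) + a22 * (z * z))) <= 3 * k * (x * x + y * y + z * z).
Proof.
  intros.
  assert (X : forall a p q, Rabs a <= k -> Rabs (a * (p * q)) <= k * ((p * p + q * q) / 2)).
  { intros a p q Ha. rewrite Rabs_mult. apply Rmult_le_compat; try apply Rabs_pos; [assumption|].
    assert (0 <= (p - q) * (p - q)) by apply Rle_0_sqr. assert (0 <= (p + q) * (p + q)) by apply Rle_0_sqr.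
    apply Rabs_le; lra. }
  assert (Y00 := X a00 x x ltac:(assumption)). assert (Y01 := X a01 x y ltac:(assumption)). assert (Y02 := X a02 x z ltac:(assumption)).
  assert (Y10 := X a10 y x ltac:(assumption)). assert (Y11 := X a11 y y ltac:(assumption)). assert (Y12 := X a12 y z ltac:(assumption)).
  assert (Y20 := X a20 z x ltac:(assumption)). assert (Y21 := X a21 z y ltac:(assumption)). assert (Y22 := X a22 z z ltac:(assumption)).
  apply Rabs_le_between in Y00. apply Rabs_le_between in Y01. apply Rabs_le_between in Y02.
  apply Rabs_le_between in Y10. apply Rabs_le_between in Y11. apply Rabs_le_between in Y12.
  apply Rabs_le_between in Y20. apply Rabs_le_between in Y21. apply Rabs_le_between in Y22.
  apply Rabs_le; split; lra.
Qed.

Lemma EwF_bounds S w t x y z : 0 <= t <= sT S ->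
  let U := fun i => Dw w (su S i) t x y z in let Th := fun i => Dw w (sth S i) t x y z in
  let A := fun i => Dw w (sK S i 2%nat) t x y z in
  let q := fun v => sum3 (fun i : nat => v i * v i) in
  cE * (q U + q Th + (A 0%nat * A 0%nat + A 1%nat * A 1%nat)) <= EwF S w t x y z
    <= CE * (q U + q Th + (A 0%nat * A 0%nat + A 1%nat * A 1%nat)).
Proof.
  intros Ht U Th A q. unfold EwF, F3; Fv. cbn [jd Nat.eqb].
  fold (U 0%nat) (U 1%nat) (U 2%nat) (Th 0%nat) (Th 1%nat) (Th 2%nat) (A 0%nat) (A 1%nat).
  change (Dw w (su S 0) t x y z) with (U 0%nat). change (Dw w (su S 1) t x y z) with (U 1%nat). change (Dw w (su S 2) t x y z) with (U 2%nat).
  change (Dw w (sth S 0) t x y z) with (Th 0%nat). change (Dw w (sth S 1) t x y z) with (Th 1%nat). change (Dw w (sth S 2) t x y z) with (Th 2%nat).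
  change (Dw w (sK S 0 2) t x y z) with (A 0%nat). change (Dw w (sK S 1 2) t x y z) with (A 1%nat).
  assert (B : forall i j, (i < 3)%nat -> (j < 3)%nat -> Rabs (sK S i j t x y z) <= k0) by (intros; apply s_small; assumption).
  assert (Q := quad_bound k0 _ _ _ _ _ _ _ _ _ (Th 0%nat) (Th 1%nat) (Th 2%nat)
    (B 0 0 ltac:(lia) ltac:(lia))%nat (B 0 1 ltac:(lia) ltac:(lia))%nat (B 0 2 ltac:(lia) ltac:(lia))%nat
    (B 1 0 ltac:(lia) ltac:(lia))%nat (B 1 1 ltac:(lia) ltac:(lia))%nat (B 1 2 ltac:(lia) ltac:(lia))%nat
    (B 2 0 ltac:(lia) ltac:(lia))%nat (B 2 1 ltac:(lia) ltac:(lia))%nat (B 2 2 ltac:(lia) ltac:(lia))%nat).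
  assert (Hk := k0_lam). assert (Hl := lam_pos). assert (Hn := lam_nu). assert (Hc := ca_pos).
  assert (Hk0 : 0 <= k0) by (eapply Rle_trans; [apply Rabs_pos | apply (B 0 0 ltac:(lia) ltac:(lia))%nat]).
  assert (c_1 : cE <= 1 / 2) by apply Rmin_l.
  assert (c_2 : cE <= lam / 4) by (eapply Rle_trans; [apply Rmin_r | apply Rmin_l]).
  assert (c_3 : cE <= ca / 2) by (eapply Rle_trans; [apply Rmin_r | apply Rmin_r]).
  apply Rabs_le_between in Q. clear B.
  unfold q, sum3, CE. clearbody U Th A.
  set (qq := sK S 0 0 t x y z * (Th 0%nat * Th 0%nat) + sK S 0 1 t x y z * (Th 0%nat * Th 1%nat) + sK S 0 2 t x y z * (Th 0%nat * Th 2%nat) + (sK S 1 0 t x y z * (Th 1%nat * Th 0%nat) + sK S 1 1 t x y z * (Th 1%nat * Th 1%nat) + sK S 1 2 t x y z * (Th 1%nat * Th 2%nat)) + (sK S 2 0 t x y z * (Th 2%nat * Th 0%nat) + sK S 2 1 t x y z * (Th 2%nat * Th 1%nat) + sK S 2 2 t x y z * (Th 2%nat * Th 2%nat))) in *.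
  assert (S0 : forall r, 0 <= r * r) by (intros; apply Rle_0_sqr).
  assert (u0 := S0 (U 0%nat)). assert (u1 := S0 (U 1%nat)). assert (u2 := S0 (U 2%nat)).
  assert (t0 := S0 (Th 0%nat)). assert (t1 := S0 (Th 1%nat)). assert (t2 := S0 (Th 2%nat)).
  assert (a0 := S0 (A 0%nat)). assert (a1 := S0 (A 1%nat)).
  set (U0 := U 0%nat * U 0%nat) in *; set (U1 := U 1%nat * U 1%nat) in *; set (U2 := U 2%nat * U 2%nat) in *.
  set (T0 := Th 0%nat * Th 0%nat) in *; set (T1 := Th 1%nat * Th 1%nat) in *; set (T2 := Th 2%nat * Th 2%nat) in *.
  set (A0 := A 0%nat * A 0%nat) in *; set (A1 := A 1%nat * A 1%nat) in *.
  clearbody qq U0 U1 U2 T0 T1 T2 A0 A1. clear U Th A q.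
  split; nra.
Qed.

Lemma Xw_TI S w t : Xw S w t = TI (F3 (fun i => Dw w (su S i) * Dw w (su S i)) + F3 (fun i => Dw w (sth S i) * Dw w (sth S i))
   + (Dw w (sK S 0%nat 2%nat) * Dw w (sK S 0%nat 2%nat) + Dw w (sK S 1%nat 2%nat) * Dw w (sK S 1%nat 2%nat)))%fld t.
Proof. unfold Xw, sum3, F3, L2. rewrite !TI_add. reflexivity. Qed.

Lemma Ew_bounds S w t : 0 <= t <= sT S -> cE * Xw S w t <= Ew S w t <= CE * Xw S w t.
Proof.
  intros Ht. rewrite Xw_TI, <- !TI_scal. unfold Ew.
  split; apply TI_le; intros x y z; destruct (EwF_bounds S w t x y z Ht) as [H1 H2]; unfold F3; Fv; [exact H1 | exact H2].
Qed.

Definition yN (N : nat) (S : Sol) (t : R) : R := lsum (map (fun w => Ew S w t) (W N)).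
Definition dyN (N : nat) (S : Sol) (t : R) : R := lsum (map (fun w => TI (dEwF S w) t) (W N)).
Definition XN (N : nat) (S : Sol) (t : R) : R := lsum (map (fun w => Xw S w t) (W N)).
Definition GN (N : nat) (S : Sol) (t : R) : R := lsum (map (fun w => Gw S w t) (W N)).
Definition AN (N : nat) (S : Sol) (t : R) : R := lsum (map (fun w => Aterm S w t) (W N)).

Lemma yN_derive N S t : 0 <= t <= sT S -> is_derive (yN N S) t (dyN N S t).
Proof. intros Ht; apply (lsum_derive (W N) (fun w t => Ew S w t)); intros w _; apply Ew_derive, Ht. Qed.

Lemma yN_bounds N S t : 0 <= t <= sT S -> cE * XN N S t <= yN N S t <= CE * XN N S t.
Proof.
  intros Ht. unfold yN, XN.
  assert (E : forall c, c * lsum (map (fun w => Xw S w t) (W N)) = lsum (map (fun w => c * Xw S w t) (W N))).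
  { intros c; induction (W N) as [|w l IH]; simpl; [ring | rewrite <- IH; ring]. }
  rewrite !E. split; apply lsum_le; intros w _; apply Ew_bounds, Ht.
Qed.

Lemma L2_le_XN N S w t i : (ord w <= N)%nat -> (i < 3)%nat ->
  L2 (Dw w (su S i)) t <= XN N S t /\ L2 (Dw w (sth S i)) t <= XN N S t /\ ((i < 2)%nat -> L2 (Dw w (sK S i 2%nat)) t <= XN N S t).
Proof.
  intros Hw Hi. destruct (canonical_word w) as (a0 & a1 & a2 & a3 & E & H & _).
  assert (X : Xw S (cw a0 a1 a2 a3) t <= XN N S t)
    by (apply (lsum_term (W N) (fun w => Xw S w t)); [intros; apply Xw_nonneg | apply cw_W; lia]).
  rewrite !H. set (v := cw a0 a1 a2 a3) in *. unfold Xw, sum3 in X.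
  assert (n0 := L2_nonneg (Dw v (su S 0%nat)) t). assert (n1 := L2_nonneg (Dw v (su S 1%nat)) t). assert (n2 := L2_nonneg (Dw v (su S 2%nat)) t).
  assert (m0 := L2_nonneg (Dw v (sth S 0%nat)) t). assert (m1 := L2_nonneg (Dw v (sth S 1%nat)) t). assert (m2 := L2_nonneg (Dw v (sth S 2%nat)) t).
  assert (p0 := L2_nonneg (Dw v (sK S 0%nat 2%nat)) t). assert (p1 := L2_nonneg (Dw v (sK S 1%nat 2%nat)) t).
  destruct i as [|[|[|i]]]; [| | |lia]; repeat split; intros; try lia; lra.
Qed.

Lemma XN_nonneg N S t : 0 <= XN N S t.
Proof. apply lsum_nonneg; intros; apply Xw_nonneg. Qed.
Lemma GN_nonneg N S t : 0 <= GN N S t.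
Proof. apply lsum_nonneg; intros; apply Gw_nonneg. Qed.

Lemma Pk_of_words k (f : F) t B : (0 <= B) -> (forall w, (ord w <= k)%nat -> L2 (Dw w f) t <= B) ->
  Pk_sq k f t <= INR (S k) * (INR (S k) * (INR (S k) * (INR (S k) * B))).
Proof.
  intros HB H.
  assert (X : forall n (g : nat -> R) b, (forall i, g i <= b) -> sum_f_R0 g n <= INR (S n) * b).
  { intros n g b Hg; induction n as [|n IH]; [simpl; specialize (Hg 0%nat); lra|].
    rewrite tech5, S_INR. specialize (Hg (S n)). lra. }
  unfold Pk_sq. repeat (apply X; intros).
  destruct (_ <=? _)%nat eqn:E; [|assumption]. apply Nat.leb_le in E.
  rewrite dmulti_Dw, L2_E. apply H. rewrite ord_cw; assumption.
Qed.

Lemma E_le_X (S : Sol) t : 0 <= t <= sT S ->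
  Ebar M (fun i => su S i) (fun i => sth S i) (fun i j => sK S i j) t
   <= 8 * (INR (Datatypes.S (2 * M)) * (INR (Datatypes.S (2 * M)) * (INR (Datatypes.S (2 * M)) * (INR (Datatypes.S (2 * M)) * XN (2 * M) S t)))).
Proof.
  intros Ht. unfold Ebar, sumN, comps3, aK. cbn [app fold_right].
  assert (X : forall f : F, (forall w, (ord w <= 2 * M)%nat -> L2 (Dw w f) t <= XN (2 * M) S t) ->
    Pk_sq (2 * M) f t <= INR (Datatypes.S (2 * M)) * (INR (Datatypes.S (2 * M)) * (INR (Datatypes.S (2 * M)) * (INR (Datatypes.S (2 * M)) * XN (2 * M) S t))))
    by (intros; apply Pk_of_words; [apply XN_nonneg | assumption]).
  assert (Y := fun w i H => L2_le_XN (2 * M) S w t i H).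
  assert (u0 := X (su S 0%nat) (fun w H => proj1 (Y w 0%nat H ltac:(lia)))).
  assert (u1 := X (su S 1%nat) (fun w H => proj1 (Y w 1%nat H ltac:(lia)))).
  assert (u2 := X (su S 2%nat) (fun w H => proj1 (Y w 2%nat H ltac:(lia)))).
  assert (t0 := X (sth S 0%nat) (fun w H => proj1 (proj2 (Y w 0%nat H ltac:(lia))))).
  assert (t1 := X (sth S 1%nat) (fun w H => proj1 (proj2 (Y w 1%nat H ltac:(lia))))).
  assert (t2 := X (sth S 2%nat) (fun w H => proj1 (proj2 (Y w 2%nat H ltac:(lia))))).
  assert (k0 := X (sK S 0%nat 2%nat) (fun w H => proj2 (proj2 (Y w 0%nat H ltac:(lia))) ltac:(lia))).
  assert (k1 := X (sK S 1%nat 2%nat) (fun w H => proj2 (proj2 (Y w 1%nat H ltac:(lia))) ltac:(lia))).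
  lra.
Qed.

Lemma X_le_E N : (N <= 2 * M)%nat -> (fun s => XN N (ss s) (tm s)) <~ E_.
Proof.
  intros HN. apply (lesssim_lsum (W N) (fun w s => Xw (ss s) w (tm s))); [intros s; apply E_nonneg|].
  intros w Hw. apply W_ord in Hw. assert (Hw' : (ord w <= 2 * M)%nat) by lia. unfold Xw, sum3.
  assert (Y : forall f, Reg tm (2 * M) se f -> (fun s => L2 (Dw w (f s)) (tm s)) <~ E_).
  { intros f Hf. eapply lesssim_trans; [apply (L2_of_L2b tm (fun s => Dw w (f s)) se); [apply se_nn | apply Hf, Hw']|].
    apply lesssim_le; intros s; rewrite se_sqr; lra. }
  repeat apply lesssim_add; first [apply (Y (u_ 0)), Reg_u; lia | apply (Y (u_ 1)), Reg_u; lia | apply (Y (u_ 2)), Reg_u; lia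
    | apply (Y (th_ 0)), Reg_th; lia | apply (Y (th_ 1)), Reg_th; lia | apply (Y (th_ 2)), Reg_th; lia
    | apply (Y (K_ 0 2)), Reg_a; lia | apply (Y (K_ 1 2)), Reg_a; lia].
Qed.

Lemma grad2_in (v : nat -> F) t i k : (i < 3)%nat -> (k < 3)%nat -> L2 (D (S k) (v i)) t <= grad2 v t.
Proof.
  intros Hi Hk. unfold grad2, sum3.
  assert (N := fun i k => L2_nonneg (D (S k) (v i)) t).
  assert (a := N 0%nat 0%nat). assert (b := N 0%nat 1%nat). assert (c := N 0%nat 2%nat).
  assert (d := N 1%nat 0%nat). assert (e := N 1%nat 1%nat). assert (f := N 1%nat 2%nat).
  assert (g := N 2%nat 0%nat). assert (h := N 2%nat 1%nat). assert (l := N 2%nat 2%nat).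
  destruct i as [|[|[|i]]]; destruct k as [|[|[|k]]]; try lia; lra.
Qed.

(** A word with a space letter is a component of the gradient of a shorter word. For a word of time
    letters alone, theta is damped directly and [u] is recovered by the Poincare inequality. *)
Lemma D_le_G N : level N -> DN N <~ (fun s => GN N (ss s) (tm s)).
Proof.
  intros HN.
  assert (Hnn : nn (fun s => GN N (ss s) (tm s))) by (intros s; apply GN_nonneg).
  assert (G1 : forall w s, In w (W N) -> Gw (ss s) w (tm s) <= GN N (ss s) (tm s))
    by (intros w s Hw; apply (lsum_term (W N) (fun w => Gw (ss s) w (tm s))); [intros; apply Gw_nonneg | assumption]).
  assert (Gsp : forall w s, Gw (ss s) w (tm s) = grad2 (fun i => Dw w (su (ss s) i)) (tm s) + sum3 (fun i => L2 (Dw w (sth (ss s) i)) (tm s)) + grad2 (fun i => Dw w (sth (ss s) i)) (tm s)) by reflexivity.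
  assert (N1 : forall w s, 0 <= grad2 (fun i => Dw w (su (ss s) i)) (tm s)) by (intros; apply grad2_nonneg).
  assert (N2 : forall w s, 0 <= grad2 (fun i => Dw w (sth (ss s) i)) (tm s)) by (intros; apply grad2_nonneg).
  assert (N3 : forall w s, 0 <= sum3 (fun i => L2 (Dw w (sth (ss s) i)) (tm s)))
    by (intros; unfold sum3; repeat apply Rplus_le_le_0_compat; apply L2_nonneg).
  assert (Key : forall w i, (ord w <= N + 1)%nat -> (i < 3)%nat ->
     (forall s, L2 (Dw w (su (ss s) i)) (tm s) <= 9 * GN N (ss s) (tm s)) /\
     (forall s, L2 (Dw w (sth (ss s) i)) (tm s) <= 9 * GN N (ss s) (tm s))).
  { intros w i Hw Hi. destruct (canonical_word w) as (a0 & a1 & a2 & a3 & E & H & _).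
    assert (Sp : (exists v k, (k < 3)%nat /\ In v (W N) /\ forall f, Dw w f = D (S k) (Dw v f))
              \/ (w = w /\ (2 * a0 <= N)%nat /\ forall f, Dw w f = Dw (repeat 0%nat a0) f)).
    { assert (Q : forall k v, (k < 3)%nat -> Permutation (S k :: v) (cw a0 a1 a2 a3) ->
         exists v k, (k < 3)%nat /\ In v (W N) /\ forall f, Dw w f = D (S k) (Dw v f)).
      { intros k v Hk Hv. exists v, k; split; [assumption|split].
        - apply W_in.
          + intros l Hl; apply (cw_letters a0 a1 a2 a3). eapply Permutation_in; [exact Hv | right; assumption].
          + apply ord_perm in Hv. rewrite ord_cw in Hv. simpl in Hv. lia.
        - intros f; rewrite H. symmetry; apply (Dw_perm (S k :: v)); assumption. }
      destruct a1 as [|a1]; [destruct a2 as [|a2]; [destruct a3 as [|a3]|]|].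
      - right; split; [reflexivity|split].
        (* Both levels are even, so a pure time word of order at most N + 1 has order at most N. *)
        + assert (HM := M_ge). destruct HN as [-> | ->]; lia.
        + intros f; rewrite H; unfold cw; simpl; rewrite !app_nil_r; reflexivity.
      - left; apply (Q 2%nat (cw a0 0 0 a3)); [lia|]. unfold cw; simpl. apply Permutation_middle.
      - left; apply (Q 1%nat (cw a0 0 a2 a3)); [lia|]. unfold cw; simpl. apply Permutation_middle.
      - left; apply (Q 0%nat (cw a0 a1 a2 a3)); [lia|]. unfold cw; simpl. apply Permutation_middle. }
    destruct Sp as [(v & k & Hk & Hv & Hf)|(_ & Ha & Hf)].
    - split; intros s; rewrite Hf; specialize (G1 v s Hv); rewrite Gsp in G1; specialize (N1 v s); specialize (N2 v s); specialize (N3 v s).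
      + assert (X := grad2_in (fun i => Dw v (su (ss s) i)) (tm s) i k Hi Hk). cbv beta in X. lra.
      + assert (X := grad2_in (fun i => Dw v (sth (ss s) i)) (tm s) i k Hi Hk). cbv beta in X. lra.
    - assert (Hv : In (repeat 0%nat a0) (W N)).
      { replace (repeat 0%nat a0) with (cw a0 0 0 0) by (unfold cw; simpl; rewrite !app_nil_r; reflexivity). apply cw_W; lia. }
      remember (repeat 0%nat a0) as v eqn:Ev.
      split; intros s; rewrite Hf; specialize (G1 v s Hv); rewrite Gsp in G1; specialize (N1 v s); specialize (N2 v s); specialize (N3 v s).
      + assert (Z : TI (Dw v (su (ss s) i)) (tm s) = 0).
        { rewrite Ev; apply (TI_zero_dt _ (sT (ss s))); [apply sT_pos | intros; apply s_mean; assumption | apply tm_ok]. }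
        assert (X := poincare _ _ Z).
        assert (X0 := grad2_in (fun i => Dw v (su (ss s) i)) (tm s) i 0 Hi ltac:(lia)).
        assert (X1 := grad2_in (fun i => Dw v (su (ss s) i)) (tm s) i 1 Hi ltac:(lia)).
        assert (X2 := grad2_in (fun i => Dw v (su (ss s) i)) (tm s) i 2 Hi ltac:(lia)). cbv beta in *. lra.
      + assert (X : L2 (Dw v (sth (ss s) i)) (tm s) <= sum3 (fun i => L2 (Dw v (sth (ss s) i)) (tm s))).
        { unfold sum3. assert (n0 := L2_nonneg (Dw v (sth (ss s) 0%nat)) (tm s)). assert (n1 := L2_nonneg (Dw v (sth (ss s) 1%nat)) (tm s)).
          assert (n2 := L2_nonneg (Dw v (sth (ss s) 2%nat)) (tm s)). destruct i as [|[|[|i]]]; try lia; lra. }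
        lra. }
  assert (KeyL : forall f : St -> F, (forall w, (ord w <= N + 1)%nat -> forall s, L2 (Dw w (f s)) (tm s) <= 9 * GN N (ss s) (tm s)) ->
     (fun s => Pk_sq (N + 1) (f s) (tm s)) <~ (fun s => GN N (ss s) (tm s))).
  { intros f Hf. apply Pk_lesssim; [assumption|]. intros w Hw. exists 9; split; [lra | apply Hf, Hw]. }
  unfold DN, sumN, comps3. cbn [app fold_right].
  repeat apply lesssim_add; try (apply lesssim_zero; assumption).
  - apply (KeyL (fun s => su (ss s) 0%nat)); intros w Hw; apply (Key w 0%nat); [assumption | lia].
  - apply (KeyL (fun s => su (ss s) 1%nat)); intros w Hw; apply (Key w 1%nat); [assumption | lia].
  - apply (KeyL (fun s => su (ss s) 2%nat)); intros w Hw; apply (Key w 2%nat); [assumption | lia].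
  - apply (KeyL (fun s => sth (ss s) 0%nat)); intros w Hw; apply (Key w 0%nat); [assumption | lia].
  - apply (KeyL (fun s => sth (ss s) 1%nat)); intros w Hw; apply (Key w 1%nat); [assumption | lia].
  - apply (KeyL (fun s => sth (ss s) 2%nat)); intros w Hw; apply (Key w 2%nat); [assumption | lia].
Qed.

Lemma dyN_bound N : level N -> exists c C, 0 < c /\ 0 <= C /\ forall s,
  dyN N (ss s) (tm s) <= - c * DN N s + C * (ep s * DN N s) + ca * AN N (ss s) (tm s).
Proof.
  intros HN.
  destruct (D_le_G N HN) as (d & Hd & HD).
  assert (HR : (fun s => lsum (map (fun w => Rabs (Rem (ss s) w (tm s))) (W N))) <~ (fun s => ep s * DN N s)).
  { apply (lesssim_lsum (W N) (fun w s => Rabs (Rem (ss s) w (tm s)))).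
    - intros s; apply Rmult_le_pos; [apply ep_nn | apply DN_nonneg].
    - intros w Hw; apply Rem_bound; [assumption | apply W_ord, Hw]. }
  destruct HR as (C & HC & HR).
  exists (c1 / (d + 1)), C; split; [apply Rdiv_lt_0_compat; [apply c1_pos | lra]|split; [assumption|]].
  intros s.
  apply Rle_trans with (- c1 * GN N (ss s) (tm s) + lsum (map (fun w => Rabs (Rem (ss s) w (tm s))) (W N)) + ca * AN N (ss s) (tm s)).
  - unfold dyN, GN, AN. clear HR HD. induction (W N) as [|w l IH]; simpl; [lra|].
    assert (H := energy_ineq (ss s) w (tm s) (tm_ok s)). assert (H' := Rle_abs (Rem (ss s) w (tm s))). lra.
  - specialize (HR s). specialize (HD s).
    assert (X : c1 / (d + 1) * DN N s <= c1 * GN N (ss s) (tm s)).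
    { assert (Hc := c1_pos). assert (G := GN_nonneg N (ss s) (tm s)).
      apply Rmult_le_reg_r with (d + 1); [lra|].
      replace (c1 / (d + 1) * DN N s * (d + 1)) with (c1 * DN N s) by (field; lra).
      rewrite Rmult_assoc. apply Rmult_le_compat_l; [lra|]. nra. }
    lra.
Qed.

End Coercive.

(** * Algebraic decay of the low-order energy *)

Lemma deriv_le_lin (f df : R -> R) T B : (forall t, 0 <= t <= T -> is_derive f t (df t)) ->
  (forall t, 0 <= t <= T -> df t <= B) -> forall t, 0 <= t <= T -> f t <= f 0 + B * t.
Proof.
  intros H1 H2 t Ht. destruct (Req_dec t 0) as [->|N]; [lra|].
  destruct (MVT_gen f 0 t df) as (c & Hc & E).
  - intros x Hx; rewrite Rmin_left, Rmax_right in Hx by lra. apply H1; lra.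
  - intros x Hx; rewrite Rmin_left, Rmax_right in Hx by lra.
    apply derivable_continuous_pt. exists (df x). apply is_derive_Reals, H1; lra.
  - rewrite Rmin_left, Rmax_right in Hc by lra. specialize (H2 c ltac:(lra)).
    assert (df c * (t - 0) <= B * t) by (rewrite Rminus_0_r; apply Rmult_le_compat_r; lra). lra.
Qed.

(* The interpolation hypothesis, optimised in [rho], gives y' <= - c y^(1 + 1/m). *)
Lemma decay_ode (c C2 : R) (m : nat) : 0 < c -> 0 < C2 -> exists C, 0 < C /\
  forall (y dy Dl : R -> R) (T Eb : R), 0 <= Eb ->
  (forall t, 0 <= t <= T -> 0 <= y t) ->
  (forall t, 0 <= t <= T -> is_derive y t (dy t)) ->
  (forall t, 0 <= t <= T -> dy t <= - c * Dl t) ->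
  (forall t, 0 <= t <= T -> 0 <= Dl t) ->
  (forall t rho, 0 <= t <= T -> 0 < rho -> y t <= C2 * ((1 + rho) * Dl t + (/ rho) ^ m * Eb)) ->
  forall t, 0 <= t <= T -> y t * (1 + t) ^ m <= C * (y 0 + Eb).
Proof.
  intros Hc HC2. set (n := INR (S m)).
  assert (Hn : 0 < n) by (unfold n; rewrite S_INR; assert (H := pos_INR m); lra).
  (* With [rho = sg (t + B)] the dissipation produced by differentiating the weight equals exactly
     the one available. *)
  set (sg := c / (2 * C2 * n)).
  assert (Hsg : 0 < sg) by (apply Rdiv_lt_0_compat; [lra | apply Rmult_lt_0_compat; [lra | assumption]]).
  (* The shift makes [sg (t + B) >= 1] from time 0 on, so that [1 + rho <= 2 rho]. *)
  set (B := 1 + / sg).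
  assert (Hi : 0 < / sg) by (apply Rinv_0_lt_compat, Hsg).
  assert (HB : 1 <= B) by (unfold B; lra).
  assert (HsB : 1 <= sg * B) by (unfold B; rewrite Rmult_plus_distr_l, Rinv_r by lra; lra).
  set (C3 := c / (2 * sg) * (/ sg) ^ m).
  assert (HC3 : 0 < C3) by (apply Rmult_lt_0_compat; [apply Rdiv_lt_0_compat; lra | apply pow_lt; assumption]).
  assert (HBm : 0 < B ^ (S m)) by (apply pow_lt; lra).
  exists (B ^ (S m) + C3); split; [lra|].
  intros y dy Dl T Eb HE Hy0 Hy Hdy HDl Hint t Ht.
  set (f := fun t => (t + B) ^ (S m) * y t).
  set (df := fun t => n * (t + B) ^ m * y t + (t + B) ^ (S m) * dy t).
  assert (Hf : forall t, 0 <= t <= T -> is_derive f t (df t)).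
  { intros s Hs. unfold f, df.
    apply (is_derive_mult (fun t => (t + B) ^ (S m)) y s); [|apply Hy, Hs|intros; apply Rmult_comm].
    replace (n * (s + B) ^ m) with (INR (S m) * 1 * (s + B) ^ pred (S m)) by (unfold n; simpl pred; ring).
    apply (is_derive_pow (fun t => t + B) (S m) s 1). auto_derive; [trivial | reflexivity]. }
  assert (Hdf : forall t, 0 <= t <= T -> df t <= C3 * Eb).
  { intros s Hs. unfold df.
    set (tau := s + B). assert (Htau : 0 < tau) by (unfold tau; lra).
    assert (Hrho : 0 < sg * tau) by (apply Rmult_lt_0_compat; assumption).
    assert (H1 : 1 <= sg * tau) by (unfold tau; nra).
    assert (I := Hint s (sg * tau) Hs Hrho). specialize (Hdy s Hs). specialize (HDl s Hs).
    assert (J : y s <= C2 * (2 * (sg * tau) * Dl s + (/ (sg * tau)) ^ m * Eb)).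
    { eapply Rle_trans; [exact I|]. apply Rmult_le_compat_l; [lra|]. nra. }
    assert (Hpm : 0 < tau ^ m) by (apply pow_lt; assumption).
    assert (K : n * tau ^ m * y s <= n * tau ^ m * (C2 * (2 * (sg * tau) * Dl s + (/ (sg * tau)) ^ m * Eb))).
    { apply Rmult_le_compat_l; [apply Rmult_le_pos; lra | exact J]. }
    assert (E1 : n * tau ^ m * (C2 * (2 * (sg * tau) * Dl s)) = c * tau ^ (S m) * Dl s).
    { unfold sg. simpl. field. split; lra. }
    assert (E2 : n * tau ^ m * (C2 * ((/ (sg * tau)) ^ m * Eb)) = C3 * Eb).
    { rewrite Rinv_mult, Rpow_mult_distr.
      replace (n * tau ^ m * (C2 * ((/ sg) ^ m * (/ tau) ^ m * Eb))) with (n * C2 * (/ sg) ^ m * Eb * (tau ^ m * (/ tau) ^ m)) by ring.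
      rewrite <- Rpow_mult_distr, Rinv_r, pow1 by lra. assert (Es : c / (2 * sg) = C2 * n) by (unfold sg; field; repeat split; lra).
      unfold C3; rewrite Es; ring. }
    assert (L : tau ^ S m * dy s <= tau ^ S m * (- c * Dl s)) by (apply Rmult_le_compat_l; [left; apply pow_lt; assumption | assumption]).
    fold tau. nra. }
  assert (R := deriv_le_lin f df T (C3 * Eb) Hf Hdf t Ht). unfold f in R. rewrite Rplus_0_l in R.
  set (tau := t + B) in *. assert (Htau : 1 <= tau) by (unfold tau; lra).
  assert (Hpm : 0 < tau ^ m) by (apply pow_lt; lra).
  assert (Y0 := Hy0 0 ltac:(lra)). assert (Yt := Hy0 t Ht).
  apply Rle_trans with (y t * tau ^ m).
  { apply Rmult_le_compat_l; [assumption|]. apply pow_incr; unfold tau; lra. }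
  apply Rmult_le_reg_l with tau; [lra|].
  replace (tau * (y t * tau ^ m)) with (tau ^ S m * y t) by (simpl; ring).
  eapply Rle_trans; [exact R|].
  assert (Q1 : B ^ S m * y 0 <= tau * (B ^ S m * y 0)).
  { assert (0 <= B ^ S m * y 0) by (apply Rmult_le_pos; lra). nra. }
  assert (Q2 : C3 * Eb * t <= tau * (C3 * Eb)).
  { assert (0 <= C3 * Eb) by (apply Rmult_le_pos; lra). assert (t <= tau) by (unfold tau; lra). nra. }
  assert (Q3 : 0 <= tau * (C3 * y 0)) by (apply Rmult_le_pos; [lra | apply Rmult_le_pos; lra]).
  assert (Q4 : 0 <= tau * (B ^ S m * Eb)) by (apply Rmult_le_pos; [lra | apply Rmult_le_pos; lra]).
  lra.
Qed.

(** * Log-convexity and interpolation of homogeneous Sobolev norms *)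

(** The squared homogeneous Sobolev norm, that is the pairing of [f] with the k-th power of minus
    the Laplacian applied to [f]. Summing over ordered words makes the recursion exact. *)
Fixpoint hk (k : nat) (f : F) (t : R) : R :=
  match k with O => L2 f t | S k => hk k (D 1 f) t + hk k (D 2 f) t + hk k (D 3 f) t end.

Lemma hk_nonneg k f t : 0 <= hk k f t.
Proof. revert f; induction k as [|k IH]; intros f; simpl; [apply L2_nonneg | repeat apply Rplus_le_le_0_compat; apply IH]. Qed.

Lemma cs_pair a1 b1 c1 a2 b2 c2 : 0 <= b1 -> 0 <= c1 -> 0 <= b2 -> 0 <= c2 ->
  a1 * a1 <= b1 * c1 -> a2 * a2 <= b2 * c2 -> 2 * (a1 * a2) <= b1 * c2 + b2 * c1.
Proof.
  intros H1 H2 H3 H4 H5 H6.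
  assert (P1 : 0 <= b1 * c2) by (apply Rmult_le_pos; assumption). assert (P2 : 0 <= b2 * c1) by (apply Rmult_le_pos; assumption).
  destruct (Rle_dec (a1 * a2) 0) as [L|L]; [lra|].
  apply Rsqr_incr_0_var; [|lra]. unfold Rsqr.
  assert (Q : (a1 * a1) * (a2 * a2) <= (b1 * c1) * (b2 * c2)) by (apply Rmult_le_compat; auto; apply Rle_0_sqr).
  assert (S0 : 0 <= (b1 * c2 - b2 * c1) * (b1 * c2 - b2 * c1)) by apply Rle_0_sqr. nra.
Qed.

(** The base case is Cauchy-Schwarz for [f] and its Laplacian, after integrations by parts. The step
    adds the inequalities for the three first derivatives, with [cs_pair] for the mixed products. *)
Lemma hk_convex k f t : hk (S k) f t * hk (S k) f t <= hk k f t * hk (S (S k)) f t.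
Proof.
  revert f; induction k as [|k IH]; intros f.
  - assert (E : hk 1 f t = - ip f (lapF f) t) by (rewrite ip_lap; simpl; unfold sum3; ring).
    assert (E2 : hk 2 f t = L2 (lapF f) t).
    { assert (X : forall i j, ip (D (S i) (D (S i) f)) (D (S j) (D (S j) f)) t = L2 (D (S j) (D (S i) f)) t).
      { intros. rewrite ip_D, (D_comm (S i) (S j)), ip_sym, ip_D, Ropp_involutive.
        rewrite (D_comm (S i) (S j)), ip_self; reflexivity. }
      rewrite <- (ip_self (lapF f)). unfold lapF, F3. repeat rewrite ?ip_add_l, ?ip_add_r. rewrite !X. simpl. ring. }
    rewrite E2. rewrite E at 1 2. simpl (hk 0 f t).
    assert (C := cauchy_schwarz f (lapF f) t). rewrite <- !n2_sqr.
    assert (N1 := n2_nonneg f t). assert (N2 := n2_nonneg (lapF f) t).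
    assert (A : - ip f (lapF f) t * - ip f (lapF f) t = Rabs (ip f (lapF f) t) * Rabs (ip f (lapF f) t)).
    { rewrite <- Rabs_mult, Rabs_right; [ring | apply Rle_ge, Rle_0_sqr]. }
    rewrite A. replace (n2 f t * n2 f t * (n2 (lapF f) t * n2 (lapF f) t)) with ((n2 f t * n2 (lapF f) t) * (n2 f t * n2 (lapF f) t)) by ring.
    apply Rmult_le_compat; auto; apply Rabs_pos.
  - assert (H1 := IH (D 1 f)). assert (H2 := IH (D 2 f)). assert (H3 := IH (D 3 f)).
    change (hk (S (S k)) f t) with (hk (S k) (D 1 f) t + hk (S k) (D 2 f) t + hk (S k) (D 3 f) t).
    change (hk (S (S (S k))) f t) with (hk (S (S k)) (D 1 f) t + hk (S (S k)) (D 2 f) t + hk (S (S k)) (D 3 f) t).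
    change (hk (S k) f t) with (hk k (D 1 f) t + hk k (D 2 f) t + hk k (D 3 f) t).
    assert (P12 := cs_pair _ _ _ _ _ _ (hk_nonneg k (D 1 f) t) (hk_nonneg (S (S k)) (D 1 f) t) (hk_nonneg k (D 2 f) t) (hk_nonneg (S (S k)) (D 2 f) t) H1 H2).
    assert (P13 := cs_pair _ _ _ _ _ _ (hk_nonneg k (D 1 f) t) (hk_nonneg (S (S k)) (D 1 f) t) (hk_nonneg k (D 3 f) t) (hk_nonneg (S (S k)) (D 3 f) t) H1 H3).
    assert (P23 := cs_pair _ _ _ _ _ _ (hk_nonneg k (D 2 f) t) (hk_nonneg (S (S k)) (D 2 f) t) (hk_nonneg k (D 3 f) t) (hk_nonneg (S (S k)) (D 3 f) t) H2 H3).
    lra.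
Qed.

(** If the second norm exceeds [rho] times the first, log-convexity propagates this ratio: each
    further norm gains at least a factor [rho], and m steps lead from order 2 to order m + 2. *)
Lemma hk_interp m f t rho : 0 < rho -> hk 2 f t <= rho * hk 1 f t + (/ rho) ^ m * hk (m + 2) f t.
Proof.
  intros Hr.
  destruct (Rle_dec (hk 2 f t) (rho * hk 1 f t)) as [L|L].
  { assert (0 <= (/ rho) ^ m * hk (m + 2) f t); [|lra].
    apply Rmult_le_pos; [apply pow_le; left; apply Rinv_0_lt_compat, Hr | apply hk_nonneg]. }
  assert (G : forall k, rho * hk (S k) f t <= hk (S (S k)) f t).
  { induction k as [|k IH]; [lra|].
    assert (C := hk_convex (S k) f t). assert (N1 := hk_nonneg (S k) f t). assert (N2 := hk_nonneg (S (S k)) f t).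
    assert (N3 := hk_nonneg (S (S (S k))) f t).
    destruct (Req_dec (hk (S (S k)) f t) 0) as [Z|Z]; [rewrite Z; lra|].
    assert (P2 : 0 < hk (S (S k)) f t) by lra.
    assert (P1 : 0 < hk (S k) f t) by nra.
    apply Rmult_le_reg_l with (hk (S k) f t); [assumption|]. nra. }
  assert (H : forall k, rho ^ k * hk 2 f t <= hk (k + 2) f t).
  { induction k as [|k IH]; simpl (_ ^ _); [simpl (0 + 2)%nat; lra|].
    replace (S k + 2)%nat with (S (S (S k))) by lia. specialize (G (S k)).
    replace (k + 2)%nat with (S (S k)) in IH by lia. assert (0 <= rho) by lra. nra. }
  specialize (H m). rewrite pow_inv.
  assert (Hp : 0 < rho ^ m) by (apply pow_lt, Hr). assert (N1 := hk_nonneg 1 f t).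
  assert (X : hk 2 f t <= / rho ^ m * hk (m + 2) f t).
  { apply Rmult_le_reg_l with (rho ^ m); [assumption|]. rewrite <- Rmult_assoc, Rinv_r by lra. lra. }
  assert (0 <= rho * hk 1 f t) by (apply Rmult_le_pos; lra). lra.
Qed.

Lemma L2_le_hk w f t : ~ In 0%nat w -> L2 (Dw w f) t <= hk (length w) f t.
Proof.
  revert f; induction w as [|k w IH]; intros f Hw; simpl; [lra|].
  rewrite <- Dw_D. assert (H := IH (D k f) (fun I => Hw (or_intror I))).
  eapply Rle_trans; [exact H|].
  assert (n1 := hk_nonneg (length w) (D 1 f) t). assert (n2 := hk_nonneg (length w) (D 2 f) t). assert (n3 := hk_nonneg (length w) (D 3 f) t).
  destruct k as [|[|[|k]]]; [exfalso; apply Hw; left; reflexivity | lra | lra |].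
  rewrite (D_ge3 k f). lra.
Qed.

Lemma hk_Reg {St} (tm : St -> R) k n f B : nn B -> (k <= n)%nat -> Reg tm n B f ->
  (fun s => hk k (f s) (tm s)) <~ (fun s => B s * B s).
Proof.
  intros HB. revert n f; induction k as [|k IH]; intros n f Hk Hf; simpl.
  - apply L2_of_L2b; [assumption|]. apply (Hf []); simpl; lia.
  - destruct n as [|n]; [lia|].
    assert (X : forall i, Reg tm n B (fun s => D (S i) (f s))) by (intros i; apply Reg_D; exact Hf).
    repeat apply lesssim_add.
    + apply (IH n (fun s => D 1 (f s))); [lia | apply X].
    + apply (IH n (fun s => D 2 (f s))); [lia | apply X].
    + apply (IH n (fun s => D 3 (f s))); [lia | apply X].
Qed.

Lemma ip_Dw_abs w f h t : ~ In 0%nat w -> Rabs (ip f (Dw w h) t) = Rabs (ip (Dw (rev w) f) h t).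
Proof.
  revert f; induction w as [|k w IH]; intros f Hw; simpl; [reflexivity|].
  destruct k as [|k]; [exfalso; apply Hw; left; reflexivity|].
  rewrite Dw_app. simpl. rewrite <- IH by (intros I; apply Hw; right; assumption).
  rewrite (ip_sym f), ip_D, Rabs_Ropp, ip_sym. reflexivity.
Qed.

Lemma ip_mul_lesssim {St} (tm : St -> R) (Z f g : St -> F) (A B C : St -> R) : nn A -> nn B -> nn C ->
  Supb tm Z A -> L2b tm f B -> L2b tm g C ->
  (fun s => Rabs (ip (Z s) (f s * g s)%fld (tm s))) <~ (fun s => A s * (B s * C s)).
Proof.
  intros HA HB HC H1 H2 H3.
  apply (lesssim_ext _ (fun s => Rabs (ip (Z s * f s)%fld (g s) (tm s)))).
  { intros s; f_equal. unfold ip; f_equal; ring. }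
  eapply lesssim_trans.
  - apply (ip_lesssim tm (fun s => Z s * f s)%fld g (fun s => A s * B s) C); [|assumption|apply L2b_mul_sup; assumption|assumption].
    intros s; apply Rmult_le_pos; auto.
  - apply lesssim_le; intros; lra.
Qed.

Section Low.
Context {P : Par}.

Definition NLKs (i j : nat) (s : St) : F := NLK (su (ss s)) (sth (ss s)) (sK (ss s)) i j.

(** An induction principle for the nonlinearity of the inertia equation: an estimate stable under
    sums and signs has to be checked only on the products of theta with [K] and on the transport
    term. *)
Lemma NLK_ind (Q : (St -> F) -> Prop) :
  Q (fun _ => Fc 0) -> (forall f g, Q f -> Q g -> Q (fun s => f s + g s)%fld) -> (forall f, Q f -> Q (fun s => - f s)%fld) ->
  (forall l k j, (l < 3)%nat -> (k < 3)%nat -> (j < 3)%nat -> Q (fun s => th_ l s * K_ k j s)%fld) ->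
  forall i j, (i < 3)%nat -> (j < 3)%nat -> Q (fun s => advF (su (ss s)) (K_ i j s)) -> Q (NLKs i j).
Proof.
  intros Q0 Qa Qo Qt i j Hi Hj Qadv.
  assert (Qx : forall f g : St -> F, (forall s, f s = g s) -> Q g -> Q f).
  { intros f g E; replace f with g; [auto | apply functional_extensionality; intros; symmetry; apply E]. }
  assert (T1 : forall a b k l, (a < 3)%nat -> (b < 3)%nat -> (k < 3)%nat -> (l < 3)%nat ->
     Q (fun s => tenF (sth (ss s)) a b * sK (ss s) k l)%fld).
  { intros a b k l Ha Hb Hk Hl.
    assert (Z : Q (fun s => Fc 0 * sK (ss s) k l)%fld) by (apply (Qx _ (fun _ => Fc 0)); [intros; ring | exact Q0]).
    assert (Pp : forall n, (n < 3)%nat -> Q (fun s => sth (ss s) n * sK (ss s) k l)%fld) by (intros; apply (Qt n k l); assumption).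
    assert (Pm : forall n, (n < 3)%nat -> Q (fun s => - sth (ss s) n * sK (ss s) k l)%fld).
    { intros n Hn; apply (Qx _ (fun s => - (sth (ss s) n * sK (ss s) k l))%fld); [intros; ring | apply Qo, Pp, Hn]. }
    destruct a as [|[|[|a]]]; destruct b as [|[|[|b]]]; try lia; simpl; first [exact Z | apply Pp; lia | apply Pm; lia]. }
  assert (T2 : forall a b k l, (a < 3)%nat -> (b < 3)%nat -> (k < 3)%nat -> (l < 3)%nat ->
     Q (fun s => sK (ss s) k l * tenF (sth (ss s)) a b)%fld).
  { intros a b k l Ha Hb Hk Hl. apply (Qx _ (fun s => tenF (sth (ss s)) a b * sK (ss s) k l)%fld); [intros; ring | apply T1; assumption]. }
  unfold NLKs, NLK, commF, F3, Fsub.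
  apply Qa; [apply Qa; [|apply Qo]|apply Qo, Qadv]; (apply Qa; [apply Qa|]); first [apply T1; lia | apply T2; lia].
Qed.

Lemma level2 : level 2. Proof. left; reflexivity. Qed.
Lemma Reg_u_sd2 i : (i < 3)%nat -> Reg tm 3 (sd 2) (u_ i). Proof. apply (Reg_u_sd 2). Qed.
Lemma Reg_th_sd2 i : (i < 3)%nat -> Reg tm 3 (sd 2) (th_ i). Proof. apply (Reg_th_sd 2). Qed.
Lemma Reg_K_sd2 i j : (i < 3)%nat -> (j < 3)%nat -> Reg tm 1 (sd 2) (K_ i j). Proof. apply (Reg_K_sd 2), level2. Qed.

Lemma Supb_one (f : St -> F) : Supb tm f se -> Supb tm f (fun _ => 1).
Proof. intros H; eapply Supb_le; [exact H | apply se_one]. Qed.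

Lemma u_sup i w : (i < 3)%nat -> (ord w + 3 <= 2 * M)%nat -> Supb tm (fun s => Dw w (u_ i s)) se.
Proof. intros Hi Hw; apply (Reg_Supb tm (2 * M)); [apply se_nn | apply Reg_u, Hi | exact Hw]. Qed.
Lemma th_sup i w : (i < 3)%nat -> (ord w + 3 <= 2 * M)%nat -> Supb tm (fun s => Dw w (th_ i s)) se.
Proof. intros Hi Hw; apply (Reg_Supb tm (2 * M)); [apply se_nn | apply Reg_th, Hi | exact Hw]. Qed.

Lemma L2b_one_mul (f : St -> F) B : L2b tm f (fun s => 1 * B s) -> L2b tm f B.
Proof. intros H; apply (L2b_le tm _ _ _ H). apply lesssim_le; intros; lra. Qed.

Lemma L2b_NLK i j : (i < 3)%nat -> (j < 3)%nat -> L2b tm (NLKs i j) (sd 2).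
Proof.
  intros Hi Hj. assert (HM := M_ge).
  apply (NLK_ind (fun f => L2b tm f (sd 2))); auto.
  - apply L2b_zero, sd_nn.
  - intros; apply L2b_add; assumption.
  - intros; apply L2b_opp; assumption.
  - intros l k m Hl Hk Hm. apply L2b_one_mul, L2b_mul_sup; [apply one_nn | apply sd_nn | |].
    + apply Supb_one, (th_sup l []); [assumption | simpl; lia].
    + apply (Reg_K_sd2 k m Hk Hm []); simpl; lia.
  - unfold advF, F3.
    assert (H : forall k, (k < 3)%nat -> L2b tm (fun s => su (ss s) k * D (S k) (K_ i j s))%fld (sd 2)).
    { intros k Hk. apply L2b_one_mul, L2b_mul_sup; [apply one_nn | apply sd_nn | |].
      + apply Supb_one, (u_sup k []); [assumption | simpl; lia].
      + apply (Reg_K_sd2 i j Hi Hj [S k]); simpl; lia. }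
    apply L2b_add; [apply L2b_add|]; apply H; lia.
Qed.

(** The equation of [a] replaces the time derivative by at most one space derivative, which is
    dissipated; the parabolic count, where time weighs two, would not see this. *)
Lemma L2b_dt_a i : (i < 2)%nat -> L2b tm (fun s => D 0 (K_ i 2 s)) (sd 2).
Proof.
  intros Hi.
  assert (Kt : forall i, (i < 3)%nat -> L2b tm (fun s => sth (ss s) i) (sd 2)) by (intros k Hk; apply (Reg_th_sd2 k Hk []); simpl; lia).
  assert (Ka : forall i, (i < 2)%nat -> L2b tm (fun s => sK (ss s) i 2%nat) (sd 2)) by (intros k Hk; apply (Reg_K_sd2 k 2%nat ltac:(lia) ltac:(lia) []); simpl; lia).
  destruct i as [|[|i]]; [| |lia].
  - eapply L2b_ext; [intros s x y z; apply (eq_A0 (ss s) [] (tm s) x y z (tm_ok s))|]. simpl.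
    apply L2b_add; [apply L2b_sub; apply L2b_scal; [apply Kt; lia | apply Ka; lia]|]. apply L2b_NLK; lia.
  - eapply L2b_ext; [intros s x y z; apply (eq_A1 (ss s) [] (tm s) x y z (tm_ok s))|]. simpl.
    apply L2b_add; [apply L2b_sub; apply L2b_scal; [apply Ka; lia | apply Kt; lia]|]. apply L2b_NLK; lia.
Qed.

Lemma ep_sd_sd N : (fun s => ep s * (sd N s * sd N s)) <~ (fun s => ep s * DN N s).
Proof. apply lesssim_le; intros s; rewrite sd_sqr; lra. Qed.

Lemma word_le2 w : (ord w <= 2)%nat -> In 0%nat w -> w = [0%nat].
Proof.
  intros H I. destruct w as [|a [|b [|c w]]]; simpl in *.
  - destruct I.
  - destruct I as [->|[]]; reflexivity.
  - exfalso. destruct I as [E|[E|[]]]; subst; simpl in H; [destruct b | destruct a]; simpl in H; lia.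
  - destruct a, b, c; simpl in H; lia.
Qed.

(** Two L2 factors of size [sd 2] and one sup factor of size [ep] have to be found. For the time
    derivative the product rule provides them, the sup factor being the time derivative of [a] or of
    [g]. *)
Lemma low_Aterm_prod w i (f g : St -> F) : (ord w <= 2)%nat -> (i < 2)%nat ->
  Reg tm 3 (sd 2) f -> L2b tm g (sd 2) -> Supb tm (fun s => D 0 (g s)) ep ->
  (fun s => Rabs (ip (Dw w (K_ i 2 s)) (Dw w (f s * g s)%fld) (tm s))) <~ (fun s => ep s * DN 2 s).
Proof.
  intros Hw Hi Hf Hg Hdg. assert (HM := M_ge).
  destruct (in_dec Nat.eq_dec 0%nat w) as [I|I].
  - assert (Ew := word_le2 w Hw I). subst w. simpl.
    eapply lesssim_trans with (fun s => Rabs (ip (D 0 (K_ i 2 s)) (D 0 (f s) * g s)%fld (tm s)) + Rabs (ip (D 0 (g s)) (f s * D 0 (K_ i 2 s))%fld (tm s))).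
    + apply lesssim_le; intros s. rewrite D_mul, ip_add_r.
      replace (ip (D 0 (K_ i 2 s)) (f s * D 0 (g s))%fld (tm s)) with (ip (D 0 (g s)) (f s * D 0 (K_ i 2 s))%fld (tm s)) by (unfold ip; f_equal; ring).
      apply Rabs_triang.
    + apply lesssim_add; (eapply lesssim_trans; [|apply (ep_sd_sd 2)]).
      * apply (ip_mul_lesssim tm (fun s => D 0 (K_ i 2 s)) (fun s => D 0 (f s)) g); try apply ep_nn; try apply sd_nn; auto.
        -- eapply Supb_le; [exact (K_sup [0%nat] i 2 ltac:(simpl; lia) ltac:(lia) ltac:(lia)) | apply se_ep].
        -- apply (Hf [0%nat]); simpl; lia.
      * apply (ip_mul_lesssim tm (fun s => D 0 (g s)) f (fun s => D 0 (K_ i 2 s))); try apply ep_nn; try apply sd_nn; auto.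
        -- apply (Hf []); simpl; lia.
        -- apply L2b_dt_a, Hi.
  (* All derivatives of a spatial word go onto the tested copy of [a]. Its order is then at most 4,
     and 4 + 3 <= 2M allows the sup norm. *)
  - eapply lesssim_ext; [intros s; apply (ip_Dw_abs w _ _ _ I)|].
    eapply lesssim_trans; [|apply (ep_sd_sd 2)].
    apply (ip_mul_lesssim tm (fun s => Dw (rev w) (Dw w (K_ i 2 s))) f g); try apply ep_nn; try apply sd_nn; auto.
    + eapply Supb_le; [|apply se_ep].
      assert (X := K_sup (rev w ++ w) i 2).
      rewrite ord_app, (ord_perm (rev w) w) in X by (symmetry; apply Permutation_rev).
      specialize (X ltac:(lia) ltac:(lia) ltac:(lia)).
      destruct X as (C & HC & X); exists C; split; [assumption|]. intros s x y z; rewrite <- Dw_app; apply X.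
    + apply (Hf []); simpl; lia.
Qed.

Lemma low_Aterm w : (ord w <= 2)%nat -> (fun s => Rabs (Aterm (ss s) w (tm s))) <~ (fun s => ep s * DN 2 s).
Proof.
  intros Hw. assert (HM := M_ge).
  assert (Hnn : nn (fun s => ep s * DN 2 s)) by (intros s; apply Rmult_le_pos; [apply ep_nn | apply DN_nonneg]).
  assert (X : forall i, (i < 2)%nat -> (fun s => Rabs (ip (Dw w (K_ i 2 s)) (Dw w (NLKs i 2 s)) (tm s))) <~ (fun s => ep s * DN 2 s)).
  { intros i Hi. apply (NLK_ind (fun h => (fun s => Rabs (ip (Dw w (K_ i 2 s)) (Dw w (h s)) (tm s))) <~ (fun s => ep s * DN 2 s))); try lia.
    - apply (lesssim_ext _ (fun _ => 0)); [|apply lesssim_zero, Hnn]. intros s. rewrite Dw_0.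
      replace (Fc 0) with (Fc 0 * Fc 0)%fld by ring. rewrite ip_scal_r, Rmult_0_l, Rabs_R0; reflexivity.
    - intros f g Hf Hg. eapply lesssim_trans; [|apply lesssim_add; [exact Hf | exact Hg]].
      apply lesssim_le; intros s. rewrite Dw_add, ip_add_r. apply Rabs_triang.
    - intros f Hf. eapply lesssim_ext; [|exact Hf]. intros s; rewrite Dw_opp, ip_opp_r, Rabs_Ropp; reflexivity.
    - intros l k j Hl Hk Hj. apply low_Aterm_prod; auto.
      + apply Reg_th_sd2, Hl.
      + apply (Reg_K_sd2 k j Hk Hj []); simpl; lia.
      + eapply Supb_le; [exact (K_sup [0%nat] k j ltac:(simpl; lia) Hk Hj) | apply se_ep].
    - assert (H : forall k, (k < 3)%nat -> (fun s => Rabs (ip (Dw w (K_ i 2 s)) (Dw w (su (ss s) k * D (S k) (K_ i 2 s))%fld) (tm s))) <~ (fun s => ep s * DN 2 s)).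
      { intros k Hk. apply (low_Aterm_prod w i (u_ k) (fun s => D (S k) (K_ i 2 s))); auto.
        + apply Reg_u_sd2, Hk.
        + apply (Reg_K_sd2 i 2 ltac:(lia) ltac:(lia) [S k]); simpl; lia.
        + eapply Supb_le; [exact (K_sup [0%nat; S k] i 2 ltac:(simpl; lia) ltac:(lia) ltac:(lia)) | apply se_ep]. }
      eapply lesssim_trans; [|apply lesssim_add; [apply lesssim_add; [apply (H 0%nat); lia | apply (H 1%nat); lia] | apply (H 2%nat); lia]].
      apply lesssim_le; intros s. unfold advF, F3. rewrite !Dw_add, !ip_add_r.
      eapply Rle_trans; [apply Rabs_triang|]. apply Rplus_le_compat_r. apply Rabs_triang. }
  eapply lesssim_trans; [|apply lesssim_add; [apply (X 0%nat); lia | apply (X 1%nat); lia]].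
  apply lesssim_le; intros s; apply Rabs_triang.
Qed.

Lemma lsum_abs_le {I} (l : list I) (f : I -> R) : lsum (map f l) <= lsum (map (fun i => Rabs (f i)) l).
Proof. apply lsum_le; intros; apply Rle_abs. Qed.

Lemma low_dissipation : exists c C, 0 < c /\ 0 <= C /\ forall s, dyN 2 (ss s) (tm s) <= - c * DN 2 s + C * (ep s * DN 2 s).
Proof.
  destruct (dyN_bound 2 level2) as (c & C & Hc & HC & H).
  assert (HA : (fun s => lsum (map (fun w => Rabs (Aterm (ss s) w (tm s))) (W 2))) <~ (fun s => ep s * DN 2 s)).
  { apply (lesssim_lsum (W 2) (fun w s => Rabs (Aterm (ss s) w (tm s)))).
    - intros s; apply Rmult_le_pos; [apply ep_nn | apply DN_nonneg].
    - intros w Hw; apply low_Aterm, W_ord, Hw. }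
  destruct HA as (C' & HC' & HA). assert (Hca := ca_pos).
  exists c, (C + ca * C'); split; [assumption|split; [nra|]]. intros s. specialize (H s). specialize (HA s).
  assert (X := lsum_abs_le (W 2) (fun w => Aterm (ss s) w (tm s))). fold (AN 2 (ss s) (tm s)) in X.
  assert (ca * AN 2 (ss s) (tm s) <= ca * (C' * (ep s * DN 2 s))) by (apply Rmult_le_compat_l; lra). lra.
Qed.

(** At order 2 only the second space derivatives of [a] escape the dissipation. They are
    interpolated between the first ones and order 2M, a gap of 2M - 2 above order 2. *)
Lemma low_interp : exists C, 0 <= C /\ forall s rho, 0 < rho ->
  XN 2 (ss s) (tm s) <= C * ((1 + rho) * DN 2 s + (/ rho) ^ (2 * M - 2) * E_ s).
Proof.
  assert (HM := M_ge).
  set (B := fun s => DN 2 s + hk 2 (K_ 0 2 s) (tm s) + hk 2 (K_ 1 2 s) (tm s)).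
  assert (HB : nn B) by (intros s; unfold B; assert (h := DN_nonneg 2 s); assert (h0 := hk_nonneg 2 (K_ 0 2 s) (tm s)); assert (h1 := hk_nonneg 2 (K_ 1 2 s) (tm s)); lra).
  assert (DB : DN 2 <~ B) by (apply lesssim_le; intros s; unfold B; assert (h0 := hk_nonneg 2 (K_ 0 2 s) (tm s)); assert (h1 := hk_nonneg 2 (K_ 1 2 s) (tm s)); lra).
  assert (L : forall f, L2b tm f (sd 2) -> (fun s => L2 (f s) (tm s)) <~ B).
  { intros f Hf. eapply lesssim_trans; [apply (L2_of_L2b tm f (sd 2)); [apply sd_nn | exact Hf]|].
    eapply lesssim_trans; [|exact DB]. apply lesssim_le; intros s; rewrite sd_sqr; lra. }
  assert (H1 : (fun s => XN 2 (ss s) (tm s)) <~ B).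
  { apply (lesssim_lsum (W 2) (fun w s => Xw (ss s) w (tm s))); [exact HB|].
    intros w Hw. apply W_ord in Hw. unfold Xw, sum3.
    assert (Ha : forall i, (i < 2)%nat -> (fun s => L2 (Dw w (K_ i 2 s)) (tm s)) <~ B).
    { intros i Hi. destruct (in_dec Nat.eq_dec 0%nat w) as [I|I].
      - rewrite (word_le2 w Hw I). apply (L (fun s => D 0 (K_ i 2 s))), L2b_dt_a, Hi.
      - destruct (Nat.eq_dec (ord w) 2) as [E2|E2].
        + assert (El : length w = 2%nat).
          { clear - I E2. destruct w as [|[|a] [|[|b] [|[|c] w]]]; simpl in *; try lia; tauto. }
          apply lesssim_le; intros s. eapply Rle_trans; [apply L2_le_hk, I|]. rewrite El. unfold B.
          assert (h0 := hk_nonneg 2 (K_ 0 2 s) (tm s)); assert (h1 := hk_nonneg 2 (K_ 1 2 s) (tm s)); assert (d := DN_nonneg 2 s).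
          destruct i as [|[|i]]; [| |lia]; lra.
        + apply (L (fun s => Dw w (K_ i 2 s))). apply (Reg_K_sd2 i 2); lia. }
    repeat apply lesssim_add; first [apply (Ha 0%nat); lia | apply (Ha 1%nat); lia | apply L].
    - apply (Reg_u_sd2 0); lia.
    - apply (Reg_u_sd2 1); lia.
    - apply (Reg_u_sd2 2); lia.
    - apply (Reg_th_sd2 0); lia.
    - apply (Reg_th_sd2 1); lia.
    - apply (Reg_th_sd2 2); lia. }
  assert (H2 : (fun s => hk 1 (K_ 0 2 s) (tm s) + hk 1 (K_ 1 2 s) (tm s)) <~ DN 2).
  { apply lesssim_trans with (fun s => sd 2 s * sd 2 s); [|apply lesssim_le; intros s; rewrite sd_sqr; lra].
    apply lesssim_add; apply (hk_Reg tm 1 1); try apply sd_nn; auto; apply Reg_K_sd2; lia. }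
  assert (H3 : (fun s => hk (2 * M - 2 + 2) (K_ 0 2 s) (tm s) + hk (2 * M - 2 + 2) (K_ 1 2 s) (tm s)) <~ E_).
  { apply lesssim_trans with (fun s => se s * se s); [|apply lesssim_le; intros s; rewrite se_sqr; lra].
    apply lesssim_add; apply (hk_Reg tm (2 * M - 2 + 2) (2 * M)); try apply se_nn; try lia; apply Reg_a; lia. }
  destruct H1 as (b1 & Hb1 & H1). destruct H2 as (b2 & Hb2 & H2). destruct H3 as (b3 & Hb3 & H3).
  exists (b1 * (1 + b2 + b3)); split; [apply Rmult_le_pos; lra|]. intros s rho Hr.
  specialize (H1 s). specialize (H2 s). specialize (H3 s). eapply Rle_trans; [exact H1|].
  rewrite Rmult_assoc. apply Rmult_le_compat_l; [assumption|]. unfold B.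
  assert (I0 := hk_interp (2 * M - 2) (K_ 0 2 s) (tm s) rho Hr). assert (I1 := hk_interp (2 * M - 2) (K_ 1 2 s) (tm s) rho Hr).
  set (q := (/ rho) ^ (2 * M - 2)) in *. assert (Hq : 0 <= q) by (apply pow_le; left; apply Rinv_0_lt_compat, Hr).
  assert (d := DN_nonneg 2 s). assert (e := E_nonneg s).
  set (k10 := hk 1 (K_ 0 2 s) (tm s)) in *. set (k11 := hk 1 (K_ 1 2 s) (tm s)) in *.
  set (km0 := hk (2 * M - 2 + 2) (K_ 0 2 s) (tm s)) in *. set (km1 := hk (2 * M - 2 + 2) (K_ 1 2 s) (tm s)) in *.
  assert (A1 : rho * (k10 + k11) <= rho * (b2 * DN 2 s)) by (apply Rmult_le_compat_l; lra).
  assert (A2 : q * (km0 + km1) <= q * (b3 * E_ s)) by (apply Rmult_le_compat_l; lra).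
  assert (P1 : 0 <= rho * DN 2 s) by (apply Rmult_le_pos; lra). assert (P2 : 0 <= q * E_ s) by (apply Rmult_le_pos; lra).
  assert (P3 : 0 <= b2 * DN 2 s) by (apply Rmult_le_pos; lra). assert (P4 : 0 <= b3 * DN 2 s) by (apply Rmult_le_pos; lra).
  assert (P5 : 0 <= b3 * (rho * DN 2 s)) by (apply Rmult_le_pos; lra). assert (P6 : 0 <= b2 * (q * E_ s)) by (apply Rmult_le_pos; lra).
  nra.
Qed.

Definition Esol (S : Sol) (t : R) : R := Ebar M (fun i => su S i) (fun i => sth S i) (fun i j => sK S i j) t.

(** The bound [Eb] of the top energy is left free: with the square of [eps] it yields the decay of
    [lownorm], and with a multiple of the initial energy the decay in the final estimate. *)
Lemma low_decay : exists e0 C, 0 < e0 /\ 0 < C /\ forall (S : Sol) Eb, eps S <= e0 ->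
  (forall t, 0 <= t <= sT S -> Esol S t <= Eb) ->
  forall t, 0 <= t <= sT S -> XN 2 S t * (1 + t) ^ (2 * M - 2) <= C * (XN 2 S 0 + Eb).
Proof.
  destruct low_dissipation as (c & C & Hc & HC & Hd). destruct low_interp as (Ci & HCi & Hi).
  assert (HCE : 0 < CE) by (unfold CE; assert (a := ca_pos); assert (b := lam_pos); assert (d := lam_nu); lra).
  assert (HcE := cE_pos).
  destruct (decay_ode (c / 2) (CE * Ci + 1) (2 * M - 2)) as (Co & HCo & Hode); [lra | nra|].
  exists (c / (2 * (C + 1))), (Co * (CE + 1) / cE). split; [apply Rdiv_lt_0_compat; lra|].
  split; [apply Rdiv_lt_0_compat; [nra | assumption]|].
  intros S Eb He HE t Ht.
  assert (HEb : 0 <= Eb).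
  { eapply Rle_trans; [|apply (HE 0); assert (H := sT_pos S); lra].
    apply (E_nonneg (mkSt S 0 ltac:(assert (H := sT_pos S); lra))). }
  assert (HDs : exists Dl : R -> R, forall t (H : 0 <= t <= sT S), Dl t = DN 2 (mkSt S t H)).
  { exists (fun t => sumN (Pk_sq (2 + 1)) (comps3 (fun i => su S i) ++ comps3 (fun i => sth S i)) t). reflexivity. }
  destruct HDs as (Dl & HDl).
  assert (O := Hode (yN 2 S) (dyN 2 S) Dl (sT S) Eb HEb).
  assert (Y : forall t, 0 <= t <= sT S -> cE * XN 2 S t <= yN 2 S t <= CE * XN 2 S t) by (intros; apply yN_bounds; assumption).
  assert (R1 : yN 2 S t * (1 + t) ^ (2 * M - 2) <= Co * (yN 2 S 0 + Eb)).
  { apply O; auto.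
    - intros r Hr. apply Rle_trans with (cE * XN 2 S r); [apply Rmult_le_pos; [lra | apply XN_nonneg] | apply Y, Hr].
    - intros; apply yN_derive; assumption.
    - intros r Hr. rewrite (HDl r Hr). assert (X := Hd (mkSt S r Hr)). simpl in X.
      assert (N := DN_nonneg 2 (mkSt S r Hr)). set (dd := DN 2 (mkSt S r Hr)) in *. unfold ep in X; simpl in X.
      assert (Z : C * (eps S * dd) <= c / 2 * dd).
      { assert (Z : C * eps S <= c / 2).
        { apply Rle_trans with ((C + 1) * (c / (2 * (C + 1)))); [|apply Req_le; field; lra].
          apply Rmult_le_compat; [lra | apply s_eps | lra | exact He]. }
        nra. }
      lra.
    - intros r Hr; rewrite (HDl r Hr); apply DN_nonneg.
    - intros r rho Hr Hrho. rewrite (HDl r Hr). assert (X := Hi (mkSt S r Hr) rho Hrho). simpl ss in X. simpl tm in X.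
      destruct (Y r Hr) as [_ Yu]. eapply Rle_trans; [exact Yu|].
      assert (N := DN_nonneg 2 (mkSt S r Hr)). set (dd := DN 2 (mkSt S r Hr)) in *.
      assert (Hq : 0 <= (/ rho) ^ (2 * M - 2)) by (apply pow_le; left; apply Rinv_0_lt_compat, Hrho).
      set (q := (/ rho) ^ (2 * M - 2)) in *.
      assert (Ee : E_ (mkSt S r Hr) <= Eb) by (apply (HE r Hr)).
      apply Rle_trans with (CE * (Ci * ((1 + rho) * dd + q * Eb))).
      + apply Rmult_le_compat_l; [lra|]. eapply Rle_trans; [exact X|]. apply Rmult_le_compat_l; [assumption|].
        apply Rplus_le_compat_l. apply Rmult_le_compat_l; assumption.
      + assert (0 <= (1 + rho) * dd + q * Eb) by (apply Rplus_le_le_0_compat; apply Rmult_le_pos; lra). nra. }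
  assert (Hp : 0 < (1 + t) ^ (2 * M - 2)) by (apply pow_lt; lra).
  destruct (Y t Ht) as [Yl _]. destruct (Y 0 ltac:(assert (H := sT_pos S); lra)) as [_ Y0].
  assert (X0 := XN_nonneg 2 S 0).
  replace (Co * (CE + 1) / cE * (XN 2 S 0 + Eb)) with (/ cE * (Co * ((CE + 1) * (XN 2 S 0 + Eb)))) by (field; lra).
  apply Rmult_le_reg_l with cE; [assumption|]. rewrite <- (Rmult_assoc cE (/ cE)), Rinv_r, Rmult_1_l by lra.
  apply Rle_trans with (yN 2 S t * (1 + t) ^ (2 * M - 2)); [rewrite <- Rmult_assoc; apply Rmult_le_compat_r; lra|].
  eapply Rle_trans; [exact R1|]. apply Rmult_le_compat_l; [lra|]. nra.
Qed.

End Low.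

(** * The high-order energy *)

(** Log-convexity at the orders 3, 4 and 5 combined: 4 is the midpoint of 2 and 6. *)
Lemma hk4_interp f t : hk 4 f t * hk 4 f t <= hk 2 f t * hk 6 f t.
Proof.
  assert (H3 := hk_convex 2 f t). assert (H4 := hk_convex 3 f t). assert (H5 := hk_convex 4 f t).
  assert (n2 := hk_nonneg 2 f t). assert (n3 := hk_nonneg 3 f t). assert (n4 := hk_nonneg 4 f t).
  assert (n5 := hk_nonneg 5 f t). assert (n6 := hk_nonneg 6 f t).
  revert H3 H4 H5 n2 n3 n4 n5 n6.
  generalize (hk 2 f t) (hk 3 f t) (hk 4 f t) (hk 5 f t) (hk 6 f t). intros a b c d e Hb Hc Hd Ha0 Hb0 Hc0 Hd0 He0.
  destruct (Req_dec c 0) as [->|N]; [assert (0 <= a * e) by (apply Rmult_le_pos; assumption); lra|].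
  assert (Pc : 0 < c * c) by (apply Rmult_lt_0_compat; lra).
  apply Rmult_le_reg_l with (c * c); [assumption|].
  assert (X1 : (c * c) * (c * c) <= (b * d) * (b * d)) by (apply Rmult_le_compat; lra).
  assert (X2 : (b * b) * (d * d) <= (a * c) * (c * e)) by (apply Rmult_le_compat; auto; apply Rle_0_sqr).
  lra.
Qed.

Lemma L2_continuous f t : continuous (fun t => L2 f t) t.
Proof.
  apply (ex_derive_continuous (fun t => L2 f t)). eexists. unfold L2. apply TI_derive.
Qed.
Lemma sum_f_continuous (g : nat -> R -> R) n t : (forall i, continuous (g i) t) -> continuous (fun t => sum_f_R0 (fun i => g i t) n) t.
Proof.
  intros H; induction n as [|n IH]; simpl; [apply H|].
  apply (continuous_plus (fun t => sum_f_R0 (fun i => g i t) n) (g (S n))); [exact IH | apply H].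
Qed.
Lemma if_continuous (b : bool) (g : R -> R) t : continuous g t -> continuous (fun t => if b then g t else 0) t.
Proof. intros H; destruct b; [exact H | apply continuous_const]. Qed.
Lemma Pk_continuous k (f : F) t : continuous (fun t => Pk_sq k f t) t.
Proof.
  unfold Pk_sq. apply sum_f_continuous; intros a0. apply sum_f_continuous; intros a1.
  apply sum_f_continuous; intros a2. apply sum_f_continuous; intros a3. apply if_continuous.
  apply (continuous_ext (fun r => L2 (Dw (cw a0 a1 a2 a3) f) r)); [|apply L2_continuous].
  intros r; rewrite <- L2_E, dmulti_Dw; reflexivity.
Qed.
Lemma Hs_continuous k j (f : F) t : continuous (fun t => Hs_sq k (dpow 0 j f) t) t.
Proof.
  unfold Hs_sq. apply sum_f_continuous; intros a1. apply sum_f_continuous; intros a2. apply sum_f_continuous; intros a3.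
  apply if_continuous. apply (continuous_ext (fun r => L2 (Dw (cw 0 a1 a2 a3 ++ repeat 0%nat j) f) r)); [|apply L2_continuous].
  intros r; rewrite <- L2_E, dmulti_dpow; reflexivity.
Qed.

Lemma integrated_dissipation (f df Dd : R -> R) T c : (forall t, 0 <= t <= T -> is_derive f t (df t)) ->
  (forall t, continuous Dd t) -> (forall t, 0 <= t <= T -> df t <= - c * Dd t) ->
  forall t, 0 <= t <= T -> f t + c * RInt Dd 0 t <= f 0.
Proof.
  intros H1 H2 H3 t Ht.
  assert (H := deriv_le_lin (fun t => f t + c * RInt Dd 0 t) (fun t => df t + c * Dd t) T 0).
  assert (E : RInt Dd 0 0 = 0) by apply (RInt_point (V := R_CompleteNormedModule)). cbv beta in H. rewrite E in H.
  specialize (H ltac:(intros s Hs; apply (is_derive_plus (V := R_NormedModule) f (fun t => c * RInt Dd 0 t));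
    [apply H1, Hs | apply (is_derive_scal (fun t => RInt Dd 0 t)); apply (is_derive_RInt Dd (fun t => RInt Dd 0 t) 0);
      [exists (mkposreal 1 Rlt_0_1); intros; apply (RInt_correct (V := R_CompleteNormedModule)), ex_RInt_cont, H2 | apply H2]])).
  specialize (H ltac:(intros s Hs; specialize (H3 s Hs); lra) t Ht). lra.
Qed.

(** For a divergence-free velocity the integrand is half the divergence of the velocity times the
    square of [A]. *)
Lemma transport_zero (u : nat -> F) T (A : F) t : eqT T (divF u) (Fc 0) -> 0 <= t <= T -> ip A (advF u A) t = 0.
Proof.
  intros Hdiv Ht. unfold advF, F3.
  assert (X : forall k, ip A (u k * D (S k) A)%fld t = - 1 / 2 * ip (D (S k) (u k)) (A * A)%fld t).
  { intros k. assert (Y := ip_D k (u k) (A * A)%fld t). rewrite D_mul, ip_add_r in Y.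
    replace (ip (u k) (D (S k) A * A)%fld t) with (ip A (u k * D (S k) A)%fld t) in Y by (unfold ip; f_equal; ring).
    replace (ip (u k) (A * D (S k) A)%fld t) with (ip A (u k * D (S k) A)%fld t) in Y by (unfold ip; f_equal; ring).
    lra. }
  rewrite !ip_add_r, !X.
  assert (Z : ip (divF u) (A * A)%fld t = 0).
  { rewrite (ip_ext (divF u) (A * A)%fld (Fc 0 * Fc 0)%fld (A * A)%fld t); [rewrite ip_scal_l; ring| |reflexivity].
    intros x y z; rewrite (Hdiv t x y z Ht); Fv; ring. }
  unfold divF, F3 in Z. rewrite !ip_add_l in Z. lra.
Qed.

Section High.
Context {P : Par}.

Lemma levelM : level (2 * M). Proof. right; reflexivity. Qed.

(* An H^4 norm: it decays faster than 1/t, hence integrably, and controls in the sup norm the coefficients of the transport terms that are not dissipated. *)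
Definition lownorm_sq (s : St) : R :=
  sum3 (fun i => sum_f_R0 (fun k => hk k (u_ i s) (tm s) + hk k (th_ i s) (tm s)) 4).
Definition lownorm (s : St) : R := sqrt (lownorm_sq s).

Lemma lownorm_sq_term i k s : (i < 3)%nat -> (k <= 4)%nat -> hk k (u_ i s) (tm s) <= lownorm_sq s /\ hk k (th_ i s) (tm s) <= lownorm_sq s.
Proof.
  intros Hi Hk. unfold lownorm_sq.
  assert (X : forall i, 0 <= sum_f_R0 (fun k => hk k (u_ i s) (tm s) + hk k (th_ i s) (tm s)) 4).
  { intros j; apply cond_pos_sum; intros; apply Rplus_le_le_0_compat; apply hk_nonneg. }
  assert (Y : hk k (u_ i s) (tm s) + hk k (th_ i s) (tm s) <= sum_f_R0 (fun k => hk k (u_ i s) (tm s) + hk k (th_ i s) (tm s)) 4).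
  { apply (sum_f_term (fun k => hk k (u_ i s) (tm s) + hk k (th_ i s) (tm s))); [intros; apply Rplus_le_le_0_compat; apply hk_nonneg | assumption]. }
  assert (Z : sum_f_R0 (fun k => hk k (u_ i s) (tm s) + hk k (th_ i s) (tm s)) 4 <= sum3 (fun i => sum_f_R0 (fun k => hk k (u_ i s) (tm s) + hk k (th_ i s) (tm s)) 4)).
  { assert (X0 := X 0%nat). assert (X1 := X 1%nat). assert (X2 := X 2%nat). unfold sum3.
    destruct i as [|[|[|i]]]; try lia;
    set (q0 := sum_f_R0 (fun k => hk k (u_ 0 s) (tm s) + hk k (th_ 0 s) (tm s)) 4) in *;
    set (q1 := sum_f_R0 (fun k => hk k (u_ 1 s) (tm s) + hk k (th_ 1 s) (tm s)) 4) in *;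
    set (q2 := sum_f_R0 (fun k => hk k (u_ 2 s) (tm s) + hk k (th_ 2 s) (tm s)) 4) in *; lra. }
  assert (n1 := hk_nonneg k (u_ i s) (tm s)). assert (n2 := hk_nonneg k (th_ i s) (tm s)). split; lra.
Qed.
Lemma lownorm_sq_nonneg s : 0 <= lownorm_sq s.
Proof. eapply Rle_trans; [apply (hk_nonneg 0 (u_ 0 s) (tm s)) | apply (lownorm_sq_term 0 0 s); lia]. Qed.
Lemma lownorm_nn : nn lownorm. Proof. intros s; apply sqrt_pos. Qed.

(** Three derivatives for the Sobolev inequality and one for the gradient of the velocity explain
    the order 4. *)
Lemma Supb_lownorm (f : St -> F) w : (forall k s, (k <= 4)%nat -> hk k (f s) (tm s) <= lownorm_sq s) -> ~ In 0%nat w -> (length w <= 1)%nat ->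
  Supb tm (fun s => Dw w (f s)) lownorm.
Proof.
  intros H Hw Hl. apply Supb_sobolev; [apply lownorm_nn|]. intros v Hv.
  apply (L2b_ext tm _ (fun s => Dw (v ++ w) (f s))); [intros; rewrite Dw_app; reflexivity|].
  apply L2b_sqrt; [intros s; apply lownorm_sq_nonneg|]. apply lesssim_le; intros s.
  assert (Lv : (length v <= 3)%nat /\ ~ In 0%nat v).
  { clear - Hv. repeat (destruct Hv as [<-|Hv]; [simpl; split; [lia | intuition discriminate]|]); destruct Hv. }
  destruct Lv as [Lv Nv].
  eapply Rle_trans; [apply L2_le_hk|].
  - intros I; apply in_app_or in I; tauto.
  - apply H. rewrite length_app; lia.
Qed.
Lemma Supb_th_lownorm i : (i < 3)%nat -> Supb tm (th_ i) lownorm.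
Proof. intros Hi; apply (Supb_lownorm (th_ i) []); [intros k s Hk; apply (lownorm_sq_term i k s Hi Hk) | intros [] | simpl; lia]. Qed.
Lemma Supb_du_lownorm i k : (i < 3)%nat -> Supb tm (fun s => D (S k) (u_ i s)) lownorm.
Proof.
  intros Hi; apply (Supb_lownorm (u_ i) [S k]); [intros n s Hn; apply (lownorm_sq_term i n s Hi Hn) | intros [|[]]; discriminate | simpl; lia].
Qed.

(** Orders up to 2 are in the low energy already. Orders 3 and 4 are interpolated between order 2
    and the orders 4 and 6, both at most 2M. *)
Lemma lownorm_sq_interp : (fun s => lownorm_sq s * lownorm_sq s) <~ (fun s => XN 2 (ss s) (tm s) * E_ s).
Proof.
  assert (HM := M_ge).
  set (B := fun s => XN 2 (ss s) (tm s) * E_ s).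
  assert (HX : nn (fun s => XN 2 (ss s) (tm s))) by (intros s; apply XN_nonneg).
  assert (HB : nn B) by (intros s; apply Rmult_le_pos; [apply XN_nonneg | apply E_nonneg]).
  set (rx := fun s => sqrt (XN 2 (ss s) (tm s))).
  assert (Hrx : nn rx) by (intros s; apply sqrt_pos).
  assert (Erx : forall s, rx s * rx s = XN 2 (ss s) (tm s)) by (intros s; apply sqrt_sqrt, XN_nonneg).
  assert (T : forall f, Reg tm 2 rx f -> Reg tm (2 * M) se f -> forall k, (k <= 4)%nat -> (fun s => hk k (f s) (tm s)) <~ (fun s => sqrt (B s))).
  { intros f H2 HE k Hk.
    assert (A2 : forall k, (k <= 2)%nat -> (fun s => hk k (f s) (tm s)) <~ (fun s => XN 2 (ss s) (tm s))).
    { intros j Hj. eapply lesssim_trans; [apply (hk_Reg tm j 2 f rx); auto|]. apply lesssim_le; intros s; rewrite Erx; lra. }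
    assert (AE : forall k, (k <= 2 * M)%nat -> (fun s => hk k (f s) (tm s)) <~ E_).
    { intros j Hj. eapply lesssim_trans; [apply (hk_Reg tm j (2 * M) f se); auto; apply se_nn|]. apply lesssim_le; intros s; rewrite se_sqr; lra. }
    assert (Sq : (fun s => hk k (f s) (tm s) * hk k (f s) (tm s)) <~ B).
    { assert (Pr : forall a b, (a <= 2)%nat -> (b <= 2 * M)%nat -> (fun s => hk a (f s) (tm s) * hk b (f s) (tm s)) <~ B).
      { intros a b Ha Hb. apply lesssim_mul; [intros s; apply hk_nonneg | intros s; apply hk_nonneg | apply A2, Ha | apply AE, Hb]. }
      destruct (Nat.le_gt_cases k 2) as [L|L]; [apply Pr; lia|].
      assert (Hk' : k = 3%nat \/ k = 4%nat) by lia. destruct Hk' as [-> | ->].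
      - eapply lesssim_trans; [|apply (Pr 2%nat 4%nat); lia]. apply lesssim_le; intros s; apply (hk_convex 2).
      - eapply lesssim_trans; [|apply (Pr 2%nat 6%nat); lia]. apply lesssim_le; intros s; apply hk4_interp. }
    destruct Sq as (C & HC & Sq). exists (sqrt C); split; [apply sqrt_pos|]. intros s.
    rewrite <- sqrt_mult by (try assumption; apply HB). rewrite <- (sqrt_square (hk k (f s) (tm s))) by apply hk_nonneg.
    apply sqrt_le_1_alt, Sq. }
  assert (R2 : forall i, (i < 3)%nat -> Reg tm 2 rx (u_ i) /\ Reg tm 2 rx (th_ i)).
  { intros i Hi; split; intros w Hw; apply L2b_sqrt; auto; apply lesssim_le; intros s; apply (L2_le_XN 2 (ss s) w (tm s) i Hw Hi). }
  assert (G : lownorm_sq <~ (fun s => sqrt (B s))).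
  { unfold lownorm_sq, sum3.
    assert (Gi : forall i, (i < 3)%nat -> (fun s => sum_f_R0 (fun k => hk k (u_ i s) (tm s) + hk k (th_ i s) (tm s)) 4) <~ (fun s => sqrt (B s))).
    { intros i Hi. apply (lesssim_sum_f (fun k s => hk k (u_ i s) (tm s) + hk k (th_ i s) (tm s))). intros k Hk. apply lesssim_add.
      - apply (T (u_ i)); [apply R2, Hi | apply Reg_u, Hi | exact Hk].
      - apply (T (th_ i)); [apply R2, Hi | apply Reg_th, Hi | exact Hk]. }
    apply lesssim_add; [apply lesssim_add|]; apply Gi; lia. }
  eapply lesssim_trans; [apply lesssim_mul; [intros s; apply lownorm_sq_nonneg | intros s; apply lownorm_sq_nonneg | exact G | exact G]|].
  apply lesssim_le; intros s. rewrite sqrt_sqrt by apply HB. unfold B; lra.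
Qed.

(** The first part is integrable in time against the energy, the second is absorbed by the
    dissipation. *)
Definition high_err (s : St) : R := lownorm s * E_ s + ep s * DN (2 * M) s.
Lemma high_err_nn : nn high_err.
Proof.
  intros s; apply Rplus_le_le_0_compat; apply Rmult_le_pos; [apply lownorm_nn | apply E_nonneg | apply ep_nn | apply DN_nonneg].
Qed.
Lemma high_err_lownorm : (fun s => lownorm s * (se s * se s)) <~ high_err.
Proof.
  apply lesssim_le; intros s; rewrite se_sqr; unfold high_err.
  assert (0 <= ep s * DN (2 * M) s) by (apply Rmult_le_pos; [apply ep_nn | apply DN_nonneg]). lra.
Qed.
Lemma high_err_se : (fun s => se s * (sd (2 * M) s * sd (2 * M) s)) <~ high_err.
Proof.
  apply lesssim_le; intros s; rewrite sd_sqr; unfold high_err.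
  assert (0 <= lownorm s * E_ s) by (apply Rmult_le_pos; [apply lownorm_nn | apply E_nonneg]).
  assert (se s * DN (2 * M) s <= ep s * DN (2 * M) s) by (apply Rmult_le_compat_r; [apply DN_nonneg | apply se_le_ep]). lra.
Qed.

Lemma word_ord1 w : ord w = 1%nat -> exists k, w = [S k].
Proof.
  intros H. destruct w as [|[|k] [|[|b] w]]; simpl in H; try lia. exists k; reflexivity.
Qed.

Lemma csplits_sum (A : F) w f g t : ip A (Dw w (f * g)%fld) t =
  ip A (f * Dw w g)%fld t + lsum (map (fun p => ip A (lterm f g p) t) (csplits w)).
Proof.
  rewrite leibniz_comm, ip_add_r. f_equal.
  induction (csplits w) as [|p l IH]; simpl.
  - replace (Fc 0) with (Fc 0 * Fc 0)%fld by ring. rewrite ip_scal_r; ring.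
  - rewrite ip_add_r, IH; reflexivity.
Qed.

Lemma lsum_Rabs {I} (l : list I) (f : I -> R) : Rabs (lsum (map f l)) <= lsum (map (fun i => Rabs (f i)) l).
Proof.
  induction l as [|i l IH]; simpl; [rewrite Rabs_R0; lra|]. eapply Rle_trans; [apply Rabs_triang|]. apply Rplus_le_compat_l, IH.
Qed.

(* Only the terms where at most one derivative falls on the velocity or the microrotation need pointwise decay. *)
Lemma transport_est w i j (BA BD : St -> R) : nn BA -> nn BD -> (i < 3)%nat -> (j < 3)%nat ->
  (forall k l, (k < 3)%nat -> (l < 3)%nat -> L2b tm (fun s => Dw w (K_ k l s)) BA) ->
  (forall p k, In p (csplits w) -> ord (fst p) = 1%nat -> (k < 3)%nat -> L2b tm (fun s => Dw (S k :: snd p) (K_ i j s)) BA) ->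
  (forall l k m, (l < 3)%nat -> (k < 3)%nat -> (m < 3)%nat ->
     L2b tm (fun s => Dw w (th_ l s * K_ k m s) - th_ l s * Dw w (K_ k m s))%fld BD) ->
  (forall p k, In p (csplits w) -> (2 <= ord (fst p))%nat -> (k < 3)%nat -> L2b tm (fun s => lterm (u_ k s) (D (S k) (K_ i j s)) p) BD) ->
  (fun s => Rabs (ip (Dw w (K_ i j s)) (Dw w (NLKs i j s)) (tm s))) <~ (fun s => lownorm s * (BA s * BA s) + BA s * BD s).
Proof.
  intros HBA HBD Hi Hj H1 H2 H3 H4.
  set (B := fun s => lownorm s * (BA s * BA s) + BA s * BD s).
  assert (P1 : forall s, 0 <= lownorm s * (BA s * BA s)) by (intros s; apply Rmult_le_pos; [apply lownorm_nn | apply Rmult_le_pos; apply HBA]).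
  assert (P2 : forall s, 0 <= BA s * BD s) by (intros s; apply Rmult_le_pos; [apply HBA | apply HBD]).
  assert (HB : nn B) by (intros s; specialize (P1 s); specialize (P2 s); unfold B; lra).
  assert (B1 : (fun s => lownorm s * (BA s * BA s)) <~ B) by (apply lesssim_le; intros s; specialize (P2 s); unfold B; lra).
  assert (B2 : (fun s => BA s * BD s) <~ B) by (apply lesssim_le; intros s; specialize (P1 s); unfold B; lra).
  assert (HA := H1 i j Hi Hj).
  apply (NLK_ind (fun h => (fun s => Rabs (ip (Dw w (K_ i j s)) (Dw w (h s)) (tm s))) <~ B)); auto.
  - apply (lesssim_ext _ (fun _ => 0)); [|apply lesssim_zero, HB]. intros s. rewrite Dw_0.
    replace (Fc 0) with (Fc 0 * Fc 0)%fld by ring. rewrite ip_scal_r, Rmult_0_l, Rabs_R0; reflexivity.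
  - intros f g Hf Hg. eapply lesssim_trans; [|apply lesssim_add; [exact Hf | exact Hg]].
    apply lesssim_le; intros s. rewrite Dw_add, ip_add_r. apply Rabs_triang.
  - intros f Hf. eapply lesssim_ext; [|exact Hf]. intros s; rewrite Dw_opp, ip_opp_r, Rabs_Ropp; reflexivity.
  - intros l k m Hl Hk Hm.
    apply lesssim_trans with (fun s => Rabs (ip (th_ l s) (Dw w (K_ i j s) * Dw w (K_ k m s))%fld (tm s))
      + Rabs (ip (Dw w (K_ i j s)) (Dw w (th_ l s * K_ k m s) - th_ l s * Dw w (K_ k m s))%fld (tm s))).
    { apply lesssim_le; intros s.
      replace (ip (th_ l s) (Dw w (K_ i j s) * Dw w (K_ k m s))%fld (tm s)) with (ip (Dw w (K_ i j s)) (th_ l s * Dw w (K_ k m s))%fld (tm s)) by (unfold ip; f_equal; ring).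
      eapply Rle_trans; [|apply Rabs_triang]. rewrite <- ip_add_r. apply Req_le; do 2 f_equal. ring. }
    apply lesssim_add.
    + eapply lesssim_trans; [|exact B1].
      apply (ip_mul_lesssim tm (th_ l) (fun s => Dw w (K_ i j s)) (fun s => Dw w (K_ k m s))); try apply lownorm_nn; auto.
      apply Supb_th_lownorm, Hl.
    + eapply lesssim_trans; [|exact B2].
      apply (ip_lesssim tm (fun s => Dw w (K_ i j s)) (fun s => Dw w (th_ l s * K_ k m s) - th_ l s * Dw w (K_ k m s))%fld); auto.
  - apply lesssim_trans with (fun s => sum3 (fun k => lsum (map (fun p => Rabs (ip (Dw w (K_ i j s)) (lterm (u_ k s) (D (S k) (K_ i j s)) p) (tm s))) (csplits w)))).
    { apply lesssim_le; intros s. unfold advF, F3. rewrite !Dw_add, !ip_add_r, !csplits_sum.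
      (* The Leibniz term with all derivatives on the transported field vanishes by
         incompressibility. *)
      assert (Z := transport_zero (su (ss s)) (sT (ss s)) (Dw w (K_ i j s)) (tm s) (s_div (ss s)) (tm_ok s)). unfold advF, F3 in Z. rewrite !ip_add_r in Z. rewrite !Dw_D.
      unfold sum3.
      assert (A0 := lsum_Rabs (csplits w) (fun p => ip (Dw w (K_ i j s)) (lterm (u_ 0 s) (D 1 (K_ i j s)) p) (tm s))).
      assert (A1 := lsum_Rabs (csplits w) (fun p => ip (Dw w (K_ i j s)) (lterm (u_ 1 s) (D 2 (K_ i j s)) p) (tm s))).
      assert (A2 := lsum_Rabs (csplits w) (fun p => ip (Dw w (K_ i j s)) (lterm (u_ 2 s) (D 3 (K_ i j s)) p) (tm s))).
      unfold u_ in *.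
      set (q0 := lsum (map (fun p => ip (Dw w (K_ i j s)) (lterm (su (ss s) 0) (D 1 (K_ i j s)) p) (tm s)) (csplits w))) in *.
      set (q1 := lsum (map (fun p => ip (Dw w (K_ i j s)) (lterm (su (ss s) 1) (D 2 (K_ i j s)) p) (tm s)) (csplits w))) in *.
      set (q2 := lsum (map (fun p => ip (Dw w (K_ i j s)) (lterm (su (ss s) 2) (D 3 (K_ i j s)) p) (tm s)) (csplits w))) in *.
      match goal with |- Rabs ?x <= _ => replace x with (q0 + q1 + q2) by lra end.
      eapply Rle_trans; [apply Rabs_triang|]. assert (A3 := Rabs_triang q0 q1). lra. }
    assert (Hk : forall k, (k < 3)%nat -> (fun s => lsum (map (fun p => Rabs (ip (Dw w (K_ i j s)) (lterm (u_ k s) (D (S k) (K_ i j s)) p) (tm s))) (csplits w))) <~ B).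
    { intros k Hk. apply (lesssim_lsum (csplits w) (fun p s => Rabs (ip (Dw w (K_ i j s)) (lterm (u_ k s) (D (S k) (K_ i j s)) p) (tm s)))); [apply HB|].
      intros p Hp. destruct (csplits_in _ _ Hp) as [Hp1 Hp2].
      (* Parabolic order one means a single space derivative of the velocity, bounded in sup by
         [lownorm]; with more derivatives on the velocity, hypothesis [H4] applies. *)
      destruct (Nat.eq_dec (ord (fst p)) 1) as [E1|E1].
      - destruct (word_ord1 _ E1) as (m & Em).
        eapply lesssim_trans; [|exact B1].
        apply (lesssim_ext _ (fun s => Rabs (ip (D (S m) (u_ k s)) (Dw w (K_ i j s) * Dw (snd p) (D (S k) (K_ i j s)))%fld (tm s)))).
        { intros s; unfold lterm; rewrite Em; simpl. f_equal. unfold ip; f_equal; ring. }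
        apply (ip_mul_lesssim tm (fun s => D (S m) (u_ k s)) (fun s => Dw w (K_ i j s)) (fun s => Dw (snd p) (D (S k) (K_ i j s)))); try apply lownorm_nn; auto.
        + apply Supb_du_lownorm, Hk.
        + apply (L2b_ext tm _ (fun s => Dw (S k :: snd p) (K_ i j s))); [intros; rewrite Dw_D; reflexivity|]. apply H2; assumption.
      - eapply lesssim_trans; [|exact B2].
        apply (ip_lesssim tm (fun s => Dw w (K_ i j s)) (fun s => lterm (u_ k s) (D (S k) (K_ i j s)) p)); auto.
        apply H4; auto; lia. }
    unfold sum3. apply lesssim_add; [apply lesssim_add|]; apply Hk; lia.
Qed.

(** With at least two derivatives on the velocity, at most 2M - 1 remain on [K], an order at which
    [K] is dissipated. Both factors then have size [sd], and the undissipated test field contributes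
    only the small factor [se]. *)
Lemma high_Aterm w : (ord w <= 2 * M)%nat -> (fun s => Rabs (Aterm (ss s) w (tm s))) <~ high_err.
Proof.
  intros Hw. assert (HM := M_ge).
  assert (X : forall i, (i < 2)%nat -> (fun s => Rabs (ip (Dw w (K_ i 2 s)) (Dw w (NLKs i 2 s)) (tm s))) <~ high_err).
  { intros i Hi.
    eapply lesssim_trans; [apply (transport_est w i 2 se (fun s => sd (2 * M) s * sd (2 * M) s))|apply lesssim_add; [exact high_err_lownorm | exact high_err_se]]; try lia.
    - apply se_nn.
    - intros s; apply Rmult_le_pos; apply sd_nn.
    - intros k l Hk Hl; apply (Reg_K k l Hk Hl); assumption.
    - intros p k Hp E1 Hk. apply csplits_in in Hp; destruct Hp as [Hp _]. assert (Ho := splits_ord w p Hp).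
      apply (Reg_a i Hi); simpl; lia.
    - intros l k m Hl Hk Hm.
      apply (comm_L2b tm (2 * M + 1) (2 * M - 1)); try apply sd_nn; [apply Reg_th_sd, Hl | apply Reg_K_sd; auto; apply levelM|].
      intros b c E1 E2; lia.
    - intros p k Hp E1 Hk. apply csplits_in in Hp; destruct Hp as [Hp _]. assert (Ho := splits_ord w p Hp).
      apply (Reg_prod_L2b tm (2 * M + 1) (2 * M - 2) (sd (2 * M)) (sd (2 * M)) (u_ k) (fun s => D (S k) (K_ i 2 s))); try apply sd_nn.
      + apply Reg_u_sd, Hk.
      + apply Reg_D. eapply Reg_mono; [|apply (Reg_K_sd (2 * M) i 2 levelM); lia]. simpl; lia.
      + lia. }
  eapply lesssim_trans; [|apply lesssim_add; [apply (X 0%nat); lia | apply (X 1%nat); lia]].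
  apply lesssim_le; intros s; apply Rabs_triang.
Qed.

Lemma high_dissipation : exists c C, 0 < c /\ 0 <= C /\ forall s,
  dyN (2 * M) (ss s) (tm s) <= - c * DN (2 * M) s + C * (ep s * DN (2 * M) s) + C * (lownorm s * E_ s).
Proof.
  destruct (dyN_bound (2 * M) levelM) as (c & C & Hc & HC & H).
  assert (HA : (fun s => lsum (map (fun w => Rabs (Aterm (ss s) w (tm s))) (W (2 * M)))) <~ high_err).
  { apply (lesssim_lsum (W (2 * M)) (fun w s => Rabs (Aterm (ss s) w (tm s)))); [apply high_err_nn|].
    intros w Hw; apply high_Aterm, W_ord, Hw. }
  destruct HA as (C' & HC' & HA). assert (Hca := ca_pos).
  exists c, (C + ca * C'); split; [assumption|split; [nra|]]. intros s. specialize (H s). specialize (HA s).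
  assert (X := lsum_abs_le (W (2 * M)) (fun w => Aterm (ss s) w (tm s))). fold (AN (2 * M) (ss s) (tm s)) in X.
  assert (ca * AN (2 * M) (ss s) (tm s) <= ca * (C' * high_err s)) by (apply Rmult_le_compat_l; lra).
  unfold high_err in H0. assert (0 <= C * (lownorm s * E_ s)) by (apply Rmult_le_pos; [lra | apply Rmult_le_pos; [apply lownorm_nn | apply E_nonneg]]). lra.
Qed.

Definition w32 (t : R) : R := / ((1 + t) * sqrt (1 + t)).
Definition DNs (N : nat) (S : Sol) (t : R) : R :=
  sumN (Pk_sq (N + 1)) (comps3 (fun i => su S i) ++ comps3 (fun i => sth S i)) t.

Lemma DNs_continuous N S t : continuous (DNs N S) t.
Proof.
  unfold DNs, sumN, comps3. cbn [app fold_right].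
  do 6 (apply (continuous_plus (V := R_NormedModule)); [apply Pk_continuous|]). apply continuous_const.
Qed.

(** The fourth power of [lownorm] is bounded by the low energy times the top energy, so a quarter of
    the decay exponent of the former is inherited. *)
Lemma lownorm_decay : exists e0 C, 0 < e0 /\ 0 < C /\ forall s, ep s <= e0 -> lownorm s <= C * ep s * w32 (tm s).
Proof.
  destruct low_decay as (e0 & C1 & He0 & HC1 & Hl). destruct lownorm_sq_interp as (C2 & HC2 & Hg). assert (HM := M_ge).
  destruct (X_le_E 2 ltac:(lia)) as (C3 & HC3 & HX).
  set (Q := C2 * (C1 * (C3 + 1))).
  assert (HQ : 0 <= Q) by (unfold Q; repeat apply Rmult_le_pos; lra).
  exists e0, (sqrt (sqrt Q) + 1); split; [assumption|split; [assert (H := sqrt_pos (sqrt Q)); lra|]].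
  intros s Hs. destruct s as [S t Ht]. unfold ep in *; simpl in Hs |- *.
  assert (HT := sT_pos S).
  assert (L := Hl S (eps S * eps S) Hs (fun t Ht => s_E S t Ht) t Ht).
  set (s := mkSt S t Ht).
  assert (X0 : XN 2 S 0 <= C3 * (eps S * eps S)).
  { assert (H0 : 0 <= 0 <= sT S) by lra.
    assert (X := HX (mkSt S 0 H0)). simpl in X. eapply Rle_trans; [exact X|]. apply Rmult_le_compat_l; [assumption|].
      apply (s_E S 0 H0). }
  assert (Hp : 0 < 1 + t) by lra.
  (* M >= 4 enters here: 2M - 2 >= 6, and a quarter of 6 is the exponent 3/2. *)
  assert (Hpow : (1 + t) ^ 6 <= (1 + t) ^ (2 * M - 2)) by (apply Rle_pow; [lra | lia]).
  assert (XN0 := XN_nonneg 2 S t).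
  assert (A1 : XN 2 S t * (1 + t) ^ 6 <= C1 * ((C3 + 1) * (eps S * eps S))).
  { apply Rle_trans with (XN 2 S t * (1 + t) ^ (2 * M - 2)); [apply Rmult_le_compat_l; assumption|].
    eapply Rle_trans; [exact L|]. apply Rmult_le_compat_l; lra. }
  assert (G := Hg s). simpl in G.
  assert (Ee : E_ s <= eps S * eps S) by apply (s_E S t Ht).
  assert (e0' := E_nonneg s).
  assert (Hep : 0 <= eps S) by apply s_eps.
  assert (G2 : lownorm_sq s * lownorm_sq s * (1 + t) ^ 6 <= Q * (eps S * eps S) * (eps S * eps S)).
  { apply Rle_trans with (C2 * (XN 2 S t * E_ s) * (1 + t) ^ 6); [apply Rmult_le_compat_r; [apply pow_le; lra | exact G]|].
    replace (C2 * (XN 2 S t * E_ s) * (1 + t) ^ 6) with (C2 * ((XN 2 S t * (1 + t) ^ 6) * E_ s)) by ring.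
    unfold Q. replace (C2 * (C1 * (C3 + 1)) * (eps S * eps S) * (eps S * eps S)) with (C2 * ((C1 * ((C3 + 1) * (eps S * eps S))) * (eps S * eps S))) by ring.
    apply Rmult_le_compat_l; [assumption|]. apply Rmult_le_compat; auto. apply Rmult_le_pos; [assumption | apply pow_le; lra]. }
  assert (Hg0 := lownorm_sq_nonneg s).
  assert (S1 : lownorm_sq s * (1 + t) ^ 3 <= sqrt Q * (eps S * eps S)).
  { apply Rsqr_incr_0_var; [|apply Rmult_le_pos; [apply sqrt_pos | apply Rmult_le_pos; assumption]].
    unfold Rsqr. replace (lownorm_sq s * (1 + t) ^ 3 * (lownorm_sq s * (1 + t) ^ 3)) with (lownorm_sq s * lownorm_sq s * (1 + t) ^ 6) by ring.
    replace (sqrt Q * (eps S * eps S) * (sqrt Q * (eps S * eps S))) with ((sqrt Q * sqrt Q) * (eps S * eps S) * (eps S * eps S)) by ring.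
    rewrite sqrt_sqrt by assumption. exact G2. }
  assert (Hsq : 0 < sqrt (1 + t)) by (apply sqrt_lt_R0; lra).
  assert (S2 : lownorm s * ((1 + t) * sqrt (1 + t)) <= sqrt (sqrt Q) * eps S).
  { apply Rsqr_incr_0_var; [|apply Rmult_le_pos; [apply sqrt_pos | assumption]].
    unfold Rsqr. replace (lownorm s * ((1 + t) * sqrt (1 + t)) * (lownorm s * ((1 + t) * sqrt (1 + t)))) with ((lownorm s * lownorm s) * ((1 + t) * (1 + t) * (sqrt (1 + t) * sqrt (1 + t)))) by ring.
    rewrite sqrt_sqrt by lra. unfold lownorm. rewrite sqrt_sqrt by assumption.
    replace (sqrt (sqrt Q) * eps S * (sqrt (sqrt Q) * eps S)) with ((sqrt (sqrt Q) * sqrt (sqrt Q)) * (eps S * eps S)) by ring.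
    rewrite sqrt_sqrt by apply sqrt_pos. simpl in S1. lra. }
  unfold w32. assert (Hd : 0 < (1 + t) * sqrt (1 + t)) by (apply Rmult_lt_0_compat; assumption).
  fold s. apply Rmult_le_reg_r with ((1 + t) * sqrt (1 + t)); [assumption|].
  rewrite Rmult_assoc, Rinv_l, Rmult_1_r by lra. lra.
Qed.

(* The weight 1 + (1 + t)^(-1/2) absorbs error terms with coefficient (1 + t)^(-3/2). *)
Lemma weight_derive t : 0 <= t -> is_derive (fun t => 1 + / sqrt (1 + t)) t (- (1 / 2) * w32 t).
Proof.
  intros Ht. assert (Hs : 0 < sqrt (1 + t)) by (apply sqrt_lt_R0; lra).
  auto_derive; [split; [lra | split; [lra | trivial]]|].
  unfold w32. set (q := sqrt (1 + t)) in *. assert (E : 1 + t = q * q) by (unfold q; rewrite sqrt_sqrt; lra).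
  rewrite E. field. lra.
Qed.
Lemma w32_pos t : 0 <= t -> 0 < w32 t.
Proof. intros Ht; apply Rinv_0_lt_compat, Rmult_lt_0_compat; [lra | apply sqrt_lt_R0; lra]. Qed.
Lemma inv_sqrt_bounds t : 0 <= t -> 0 < / sqrt (1 + t) <= 1.
Proof.
  intros Ht. assert (1 <= sqrt (1 + t)) by (rewrite <- sqrt_1 at 1; apply sqrt_le_1_alt; lra).
  split; [apply Rinv_0_lt_compat; lra|]. apply Rmult_le_reg_l with (sqrt (1 + t)); [lra|]. rewrite Rinv_r; lra.
Qed.

(** The weighted energy is dissipative outright, as the decreasing weight pays for the transport
    terms of [a]; since the weight lies between 1 and 2, its removal costs only a constant. *)
Lemma high_energy : exists e0 C, 0 < e0 /\ 0 < C /\ forall S : Sol, eps S <= e0 -> forall t, 0 <= t <= sT S ->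
  Esol S t + RInt (DNs (2 * M) S) 0 t <= C * Esol S 0.
Proof.
  destruct high_dissipation as (c & C & Hc & HC & Hd). destruct lownorm_decay as (e1 & Cg & He1 & HCg & Hg).
  destruct (X_le_E (2 * M) ltac:(lia)) as (C3 & HC3 & HX).
  assert (HCE : 0 < CE) by (unfold CE; assert (a := ca_pos); assert (b := lam_pos); assert (d := lam_nu); lra).
  assert (HcE := cE_pos).
  set (KE := 8 * (INR (S (2 * M)) * (INR (S (2 * M)) * (INR (S (2 * M)) * INR (S (2 * M)))))).
  assert (HKE : 0 < KE).
  { unfold KE. assert (0 < INR (S (2 * M))) by (apply lt_0_INR; lia). repeat apply Rmult_lt_0_compat; lra. }
  assert (HE : forall S t, 0 <= t <= sT S -> Esol S t <= KE / cE * yN (2 * M) S t).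
  { intros S t Ht. assert (X := E_le_X S t Ht). destruct (yN_bounds (2 * M) S t Ht) as [Y _].
    eapply Rle_trans; [exact X|]. apply Rle_trans with (KE * XN (2 * M) S t); [unfold KE; apply Req_le; ring|].
    replace (KE / cE * yN (2 * M) S t) with (KE * (yN (2 * M) S t / cE)) by (field; lra).
    apply Rmult_le_compat_l; [lra|]. apply Rmult_le_reg_l with cE; [assumption|].
    replace (cE * (yN (2 * M) S t / cE)) with (yN (2 * M) S t) by (field; lra). exact Y. }
  set (K1 := C * Cg * (KE / cE)).
  assert (Hke : 0 < KE / cE) by (apply Rdiv_lt_0_compat; assumption).
  assert (HK1 : 0 <= K1) by (unfold K1; apply Rmult_le_pos; [apply Rmult_le_pos; lra | lra]).
  (* The thresholds serve, in this order, the decay of [lownorm], the absorption of errors in half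
     the dissipation, and a coefficient at most 1/4 in front of [w32]. *)
  set (e0 := Rmin e1 (Rmin (c / (2 * (C + 1))) (/ (4 * (K1 + 1))))).
  assert (He0 : 0 < e0) by (unfold e0; repeat apply Rmin_pos; [assumption | apply Rdiv_lt_0_compat; lra | apply Rinv_0_lt_compat; lra]).
  set (Cf := (KE / cE + 2 / c) * (2 * (CE * C3))).
  assert (H2c : 0 < 2 / c) by (apply Rdiv_lt_0_compat; lra).
  exists e0, (Cf + 1); split; [assumption|split; [unfold Cf; assert (0 <= (KE / cE + 2 / c) * (2 * (CE * C3))) by (repeat apply Rmult_le_pos; lra); lra|]].
  intros S Hs t Ht.
  assert (B1 : eps S <= e1) by (eapply Rle_trans; [exact Hs | apply Rmin_l]).
  assert (B2 : eps S <= c / (2 * (C + 1))) by (eapply Rle_trans; [exact Hs | eapply Rle_trans; [apply Rmin_r | apply Rmin_l]]).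
  assert (B3 : eps S <= / (4 * (K1 + 1))) by (eapply Rle_trans; [exact Hs | eapply Rle_trans; [apply Rmin_r | apply Rmin_r]]).
  assert (Hep : 0 <= eps S) by apply s_eps.
  set (y := yN (2 * M) S). set (dy := dyN (2 * M) S).
  assert (Hy0 : forall r, 0 <= r <= sT S -> 0 <= y r).
  { intros r Hr; destruct (yN_bounds (2 * M) S r Hr) as [Y _]. eapply Rle_trans; [|exact Y]. apply Rmult_le_pos; [lra | apply XN_nonneg]. }
  assert (Hdy : forall r, 0 <= r <= sT S -> dy r <= - (c / 2) * DNs (2 * M) S r + 1 / 4 * w32 r * y r).
  { intros r Hr. assert (X := Hd (mkSt S r Hr)). assert (G := Hg (mkSt S r Hr) B1). unfold ep in X, G. simpl ss in X, G. simpl tm in X, G.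
    fold (dy r) in X. change (DN (2 * M) (mkSt S r Hr)) with (DNs (2 * M) S r) in X. change (E_ (mkSt S r Hr)) with (Esol S r) in X.
    assert (N := DN_nonneg (2 * M) (mkSt S r Hr)). change (DN (2 * M) (mkSt S r Hr)) with (DNs (2 * M) S r) in N.
    assert (N' := E_nonneg (mkSt S r Hr)). change (E_ (mkSt S r Hr)) with (Esol S r) in N'.
    set (dd := DNs (2 * M) S r) in *.
    assert (Z : C * (eps S * dd) <= c / 2 * dd).
    { assert (Z : C * eps S <= c / 2).
      { apply Rle_trans with ((C + 1) * (c / (2 * (C + 1)))); [|apply Req_le; field; lra].
        apply Rmult_le_compat; lra. }
      nra. }
    assert (W0 := w32_pos r ltac:(lra)).
    assert (Z2 : C * (lownorm (mkSt S r Hr) * Esol S r) <= 1 / 4 * w32 r * y r).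
    { apply Rle_trans with (C * ((Cg * eps S * w32 r) * (KE / cE * y r))).
      - apply Rmult_le_compat_l; [assumption|]. apply Rmult_le_compat; [apply lownorm_nn | exact N' | exact G | apply HE, Hr].
      - replace (C * (Cg * eps S * w32 r * (KE / cE * y r))) with ((K1 * eps S) * (w32 r * y r)) by (unfold K1; ring).
        assert (Z' : K1 * eps S <= 1 / 4).
        { apply Rle_trans with ((K1 + 1) * (/ (4 * (K1 + 1)))); [apply Rmult_le_compat; lra | apply Req_le; field; lra]. }
        assert (0 <= w32 r * y r) by (apply Rmult_le_pos; [lra | apply Hy0, Hr]). nra. }
    lra. }
  set (f := fun r => (1 + / sqrt (1 + r)) * y r).
  set (df := fun r => - (1 / 2) * w32 r * y r + (1 + / sqrt (1 + r)) * dy r).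
  assert (Hf : forall r, 0 <= r <= sT S -> is_derive f r (df r)).
  { intros r Hr. apply (is_derive_mult (fun r => 1 + / sqrt (1 + r)) y r); [apply weight_derive; lra | apply yN_derive, Hr | intros; apply Rmult_comm]. }
  (* The weight is at most 2, so the error is at most [w32 r * y r / 2], which the derivative of the
     weight cancels. *)
  assert (Hdf : forall r, 0 <= r <= sT S -> df r <= - (c / 2) * DNs (2 * M) S r).
  { intros r Hr. unfold df. destruct (inv_sqrt_bounds r ltac:(lra)) as [m1 m2]. specialize (Hdy r Hr). specialize (Hy0 r Hr).
    assert (W0 := w32_pos r ltac:(lra)). set (m := / sqrt (1 + r)) in *.
    assert (N := DN_nonneg (2 * M) (mkSt S r Hr)). change (DN (2 * M) (mkSt S r Hr)) with (DNs (2 * M) S r) in N.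
    set (dd := DNs (2 * M) S r) in *.
    assert (0 <= w32 r * y r) by (apply Rmult_le_pos; lra).
    assert (Z : (1 + m) * dy r <= (1 + m) * (- (c / 2) * dd + 1 / 4 * w32 r * y r)) by (apply Rmult_le_compat_l; lra).
    assert (0 <= c * dd) by (apply Rmult_le_pos; lra). nra. }
  assert (R := integrated_dissipation f df (DNs (2 * M) S) (sT S) (c / 2) Hf (DNs_continuous (2 * M) S) Hdf t Ht).
  assert (H0 : 0 <= 0 <= sT S) by (assert (H := sT_pos S); lra).
  assert (F0 : f 0 <= 2 * (CE * C3) * Esol S 0).
  { unfold f. destruct (inv_sqrt_bounds 0 ltac:(lra)) as [m1 m2]. destruct (yN_bounds (2 * M) S 0 H0) as [_ Y]. fold (y 0) in Y.
    assert (X := HX (mkSt S 0 H0)). simpl ss in X; simpl tm in X. change (E_ (mkSt S 0 H0)) with (Esol S 0) in X.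
    specialize (Hy0 0 H0). apply Rle_trans with (2 * y 0); [apply Rmult_le_compat_r; lra|].
    rewrite !Rmult_assoc. apply Rmult_le_compat_l; [lra|]. eapply Rle_trans; [exact Y|]. apply Rmult_le_compat_l; lra. }
  assert (Fy : y t <= f t).
  { unfold f. destruct (inv_sqrt_bounds t ltac:(lra)) as [m1 m2]. specialize (Hy0 t Ht). nra. }
  assert (RI : 0 <= RInt (DNs (2 * M) S) 0 t).
  { apply RInt_ge_0; [lra | apply ex_RInt_cont, DNs_continuous|]. intros r Hr.
    assert (Hr' : 0 <= r <= sT S) by lra. exact (DN_nonneg (2 * M) (mkSt S r Hr')). }
  assert (Y0 := Hy0 t Ht). assert (E0 := E_nonneg (mkSt S 0 H0)). change (E_ (mkSt S 0 H0)) with (Esol S 0) in E0.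
  set (I := RInt (DNs (2 * M) S) 0 t) in *.
  assert (Q1 : Esol S t <= KE / cE * f 0).
  { eapply Rle_trans; [apply HE, Ht|]. apply Rmult_le_compat_l; [lra|]. fold (y t).
    assert (0 <= c / 2 * I) by (apply Rmult_le_pos; lra). lra. }
  assert (Q2 : I <= 2 / c * f 0).
  { apply Rmult_le_reg_l with (c / 2); [lra|]. replace (c / 2 * (2 / c * f 0)) with (f 0) by (field; lra). lra. }
  apply Rle_trans with ((KE / cE + 2 / c) * f 0); [lra|].
  apply Rle_trans with ((KE / cE + 2 / c) * (2 * (CE * C3) * Esol S 0)); [apply Rmult_le_compat_l; lra|].
  unfold Cf. lra.
Qed.

End High.

(** * Time derivatives of the inertia tensor *)

Fixpoint nt (w : list nat) : nat := match w with [] => O | O :: w => S (nt w) | S _ :: w => nt w end.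
Fixpoint nx (w : list nat) : nat := match w with [] => O | O :: w => nx w | S _ :: w => S (nx w) end.

Lemma ord_nt_nx w : ord w = (2 * nt w + nx w)%nat.
Proof. induction w as [|[|k] w IH]; simpl; lia. Qed.
Lemma nt_perm w w' : Permutation w w' -> nt w = nt w'.
Proof. intros H; induction H; simpl; try congruence; try (destruct x); try (destruct y); simpl; congruence. Qed.
Lemma nx_perm w w' : Permutation w w' -> nx w = nx w'.
Proof. intros H; induction H; simpl; try congruence; try (destruct x); try (destruct y); simpl; congruence. Qed.
Lemma nt_app w w' : nt (w ++ w') = (nt w + nt w')%nat.
Proof. induction w as [|[|k] w IH]; simpl; lia. Qed.
Lemma nx_app w w' : nx (w ++ w') = (nx w + nx w')%nat.
Proof. induction w as [|[|k] w IH]; simpl; lia. Qed.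
Lemma nt_repeat0 j : nt (repeat 0%nat j) = j. Proof. induction j; simpl; lia. Qed.
Lemma nx_repeat0 j : nx (repeat 0%nat j) = 0%nat. Proof. induction j; simpl; lia. Qed.
Lemma nt_spatial w : ~ In 0%nat w -> nt w = 0%nat.
Proof. induction w as [|[|k] w IH]; simpl; intros H; [reflexivity | exfalso; apply H; left; reflexivity | apply IH; tauto]. Qed.
Lemma extract_time w : (0 < nt w)%nat -> exists v, Permutation w (0%nat :: v).
Proof.
  induction w as [|[|k] w IH]; simpl; intros H; [lia | exists w; reflexivity|].
  destruct (IH H) as (v & Hv). exists (S k :: v). rewrite Hv. apply perm_swap.
Qed.

Section Gain.
Context {P : Par}.

(* Exactly [n] time and at most [r] space derivatives of [K] are bounded by [B]. *)
Definition ST (n r : nat) (B : St -> R) : Prop :=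
  forall v, nt v = n -> (nx v <= r)%nat -> forall i j, (i < 3)%nat -> (j < 3)%nat -> L2b tm (fun s => Dw v (K_ i j s)) B.

Lemma ST_mono n r r' B : (r' <= r)%nat -> ST n r B -> ST n r' B.
Proof. intros Hr H v Hn Hx; apply H; [assumption | lia]. Qed.

(* The transport equation trades a time derivative of [K] for a single space derivative, not two as in the parabolic count. *)
Lemma ST_time_derivative n r N B : nn B -> (2 * n + r <= N)%nat -> (N <= 2 * M + 1)%nat ->
  (forall i, (i < 3)%nat -> Reg tm N B (u_ i)) -> (forall i, (i < 3)%nat -> Reg tm N B (th_ i)) ->
  (forall m, (m <= n)%nat -> ST m (r + 1) B) -> ST (S n) r B.
Proof.
  intros HB Hnr HN Hu Hth HS w Hnt Hnx i j Hi Hj. assert (HM := M_ge).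
  destruct (extract_time w) as (v & Hv); [lia|].
  assert (Hnt' := nt_perm _ _ Hv). assert (Hnx' := nx_perm _ _ Hv). simpl in Hnt', Hnx'.
  assert (Hov : ord v = (2 * n + nx v)%nat) by (rewrite ord_nt_nx; lia).
  assert (HK : forall k l, (k < 3)%nat -> (l < 3)%nat -> L2b tm (fun s => Dw v (sK (ss s) k l)) B)
    by (intros k l Hk Hl; apply (HS n); auto; lia).
  assert (HT : forall l, (l < 3)%nat -> L2b tm (fun s => Dw v (sth (ss s) l)) B) by (intros l Hl; apply (Hth l Hl); lia).
  assert (Hsp : forall p, In p (splits v) -> (nt (fst p) + nt (snd p) = n /\ nx (fst p) + nx (snd p) = nx v)%nat).
  { intros p Hp. assert (Pp := splits_perm v p Hp). split; [rewrite <- nt_app, (nt_perm _ _ Pp); lia | rewrite <- nx_app, (nx_perm _ _ Pp); reflexivity]. }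
  assert (prod : forall f g : St -> F, Reg tm N B f -> (forall u, (ord u + 3 <= 2 * M)%nat -> Supb tm (fun s => Dw u (f s)) se) ->
     (forall u, (ord u + 4 <= 2 * M)%nat -> Supb tm (fun s => Dw u (g s)) se) ->
     (forall u, (nt u <= n)%nat -> (nx u <= r)%nat -> L2b tm (fun s => Dw u (g s)) B) ->
     L2b tm (fun s => Dw v (f s * g s)%fld) B).
  { intros f g Hf Hfs Hgs Hg.
    apply (L2b_ext tm _ (fun s => Fsum (map (fun p => lterm (f s) (g s) p) (splits v)))); [intros; rewrite leibniz; reflexivity|].
    apply (L2b_Fsum tm (splits v) (fun p s => lterm (f s) (g s) p)); [assumption|]. intros p Hp.
    assert (Ho := splits_ord v p Hp). destruct (Hsp p Hp) as [Hp1 Hp2].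
    (* The total order is at most 2M + 1. If the first factor is too high for the sup norm, the
       second has order at most 3, which leaves room for the extra derivative of the transport
       term. *)
    destruct (Nat.le_gt_cases (ord (fst p) + 3) (2 * M)) as [L|L].
    - apply L2b_one_mul, L2b_mul_sup; [apply one_nn | assumption | apply Supb_one, Hfs, L | apply Hg; lia].
    - apply (L2b_le tm _ (fun s => B s * 1)); [|apply lesssim_le; intros; lra].
      apply L2b_mul_sup_r; [assumption | apply one_nn | apply Hf; lia | apply Supb_one, Hgs; lia]. }
  assert (HNL : L2b tm (fun s => Dw v (NLKs i j s)) B).
  { apply (NLK_ind (fun h => L2b tm (fun s => Dw v (h s)) B)); auto.
    - apply (L2b_ext tm _ (fun _ => Fc 0)); [intros; rewrite Dw_0; reflexivity | apply L2b_zero, HB].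
    - intros f g Hf Hg. apply (L2b_ext tm _ (fun s => Dw v (f s) + Dw v (g s))%fld); [intros; rewrite Dw_add; reflexivity | apply L2b_add; assumption].
    - intros f Hf. apply (L2b_ext tm _ (fun s => - Dw v (f s))%fld); [intros; rewrite Dw_opp; reflexivity | apply L2b_opp; assumption].
    - intros l k m Hl Hk Hm. apply (prod (th_ l) (K_ k m)); auto.
      + intros u Hu'; apply th_sup; auto.
      + intros u Hu'; apply K_sup; auto; lia.
      + intros u H1 H2; apply (HS (nt u)); auto; lia.
    - unfold advF, F3.
      assert (H : forall k, (k < 3)%nat -> L2b tm (fun s => Dw v (su (ss s) k * D (S k) (K_ i j s))%fld) B).
      { intros k Hk. apply (prod (u_ k) (fun s => D (S k) (K_ i j s))); auto.
        + intros u Hu'; apply u_sup; auto.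
        + intros u Hu'. destruct (K_sup (u ++ [S k]) i j) as (C & HC & X); auto; [rewrite ord_app; simpl; lia|].
          exists C; split; [assumption|]. intros s x y z. specialize (X s x y z). rewrite Dw_app in X. exact X.
        + intros u H1 H2. apply (L2b_ext tm _ (fun s => Dw (S k :: u) (K_ i j s))); [intros; rewrite Dw_D; reflexivity|].
          apply (HS (nt u)); auto; simpl; lia. }
      apply (L2b_ext tm _ (fun s => Dw v (su (ss s) 0%nat * D 1 (K_ i j s)) + Dw v (su (ss s) 1%nat * D 2 (K_ i j s)) + Dw v (su (ss s) 2%nat * D 3 (K_ i j s)))%fld);
        [intros; rewrite !Dw_add; reflexivity|].
      apply L2b_add; [apply L2b_add|]; apply H; lia. }
  apply (L2b_ext tm _ (fun s => Dw v (commF (tenF omF) (sK (ss s)) i j) + Dw v (commF (tenF (sth (ss s))) JeqF i j) + Dw v (NLKs i j s))%fld).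
  { intros s x y z. rewrite (Dw_perm _ _ _ Hv). simpl. rewrite <- Dw_D.
    assert (E := eqT_Dw _ v _ _ (sT_pos (ss s)) (s_K (ss s) i j Hi Hj) (tm s) x y z (tm_ok s)). unfold K_. rewrite E.
    rewrite !Dw_add. reflexivity. }
  assert (Hten : forall c (f : St -> F), L2b tm (fun s => Dw v (f s)) B -> L2b tm (fun s => Dw v (Fc c * f s)%fld) B).
  { intros c f Hf. apply (L2b_ext tm _ (fun s => Fc c * Dw v (f s))%fld); [intros; rewrite Dw_scal; reflexivity | apply L2b_scal, Hf]. }
  assert (LC : forall c k l, (k < 3)%nat -> (l < 3)%nat -> L2b tm (fun s => Dw v (Fc c * sK (ss s) k l)%fld) B) by (intros c k l Hk Hl; apply Hten; apply HK; auto).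
  assert (LT : forall c l, (l < 3)%nat -> L2b tm (fun s => Dw v (Fc c * sth (ss s) l)%fld) B) by (intros c l Hl; apply Hten; apply HT; auto).
  assert (Sm : forall f g : St -> F, L2b tm (fun s => Dw v (f s)) B -> L2b tm (fun s => Dw v (g s)) B -> L2b tm (fun s => Dw v (f s - g s)%fld) B).
  { intros f g Hf Hg. apply (L2b_ext tm _ (fun s => Dw v (f s) - Dw v (g s))%fld); [intros; rewrite Dw_sub; reflexivity | apply L2b_sub; assumption]. }
  assert (Sa : forall f g : St -> F, L2b tm (fun s => Dw v (f s)) B -> L2b tm (fun s => Dw v (g s)) B -> L2b tm (fun s => Dw v (f s + g s)%fld) B).
  { intros f g Hf Hg. apply (L2b_ext tm _ (fun s => Dw v (f s) + Dw v (g s))%fld); [intros; rewrite Dw_add; reflexivity | apply L2b_add; assumption]. }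
  assert (Sx : forall f g : St -> F, (forall s, f s = g s) -> L2b tm (fun s => Dw v (g s)) B -> L2b tm (fun s => Dw v (f s)) B).
  { intros f g E Hg. apply (L2b_ext tm _ (fun s => Dw v (g s))); [intros; rewrite E; reflexivity | exact Hg]. }
  apply L2b_add; [apply L2b_add|exact HNL].
  - assert (To : forall a b, exists c, tenF omF a b = Fc c).
    { intros a b. destruct a as [|[|[|a]]]; destruct b as [|[|[|b]]]; simpl; unfold omF; simpl; try (eexists; reflexivity);
        try (exists (- ttil); apply F_ext; intros; Fv; ring); exists 0; apply F_ext; intros; Fv; ring. }
    unfold commF, F3.
    assert (L1 : forall a b k l, (k < 3)%nat -> (l < 3)%nat -> L2b tm (fun s => Dw v (tenF omF a b * sK (ss s) k l)%fld) B).
    { intros a b k l Hk Hl. destruct (To a b) as (c & ->). apply LC; assumption. }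
    assert (L2' : forall a b k l, (k < 3)%nat -> (l < 3)%nat -> L2b tm (fun s => Dw v (sK (ss s) k l * tenF omF a b)%fld) B).
    { intros a b k l Hk Hl. apply (Sx _ (fun s => tenF omF a b * sK (ss s) k l)%fld); [intros; ring | apply L1; assumption]. }
    apply Sm; (apply Sa; [apply Sa|]); first [apply L1; lia | apply L2'; lia].
  - unfold commF, F3, JeqF.
    assert (L1 : forall a b c, L2b tm (fun s => Dw v (tenF (sth (ss s)) a b * Fc c)%fld) B).
    { intros a b c.
      assert (Z0 : L2b tm (fun s => Dw v (Fc 0 * Fc c)%fld) B).
      { apply (L2b_ext tm _ (fun _ => Fc 0)); [intros; replace (Fc 0 * Fc c)%fld with (Fc 0) by ring; rewrite Dw_0; reflexivity | apply L2b_zero, HB]. }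
      assert (Zp : forall l, (l < 3)%nat -> L2b tm (fun s => Dw v (sth (ss s) l * Fc c)%fld) B).
      { intros l Hl. apply (Sx _ (fun s => Fc c * sth (ss s) l)%fld); [intros; ring | apply LT, Hl]. }
      assert (Zm : forall l, (l < 3)%nat -> L2b tm (fun s => Dw v (- sth (ss s) l * Fc c)%fld) B).
      { intros l Hl. apply (Sx _ (fun s => Fc (- c) * sth (ss s) l)%fld); [|apply LT, Hl].
        intros s. apply F_ext; intros; Fv; ring. }
      destruct a as [|[|[|a]]]; destruct b as [|[|[|b]]]; simpl; first [exact Z0 | apply Zp; lia | apply Zm; lia]. }
    assert (L2' : forall a b c, L2b tm (fun s => Dw v (Fc c * tenF (sth (ss s)) a b)%fld) B).
    { intros a b c. apply (Sx _ (fun s => tenF (sth (ss s)) a b * Fc c)%fld); [intros; ring | apply L1]. }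
    apply Sm; (apply Sa; [apply Sa|]); first [apply L1 | apply L2'].
Qed.

Lemma ST_of_Reg n B : (forall i j, (i < 3)%nat -> (j < 3)%nat -> Reg tm n B (K_ i j)) -> ST 0 n B.
Proof. intros H v H1 H2 i j Hi Hj; apply (H i j Hi Hj). rewrite ord_nt_nx; lia. Qed.

(** Each time derivative costs one space derivative of [K], whence the bound on [r + j]. The other
    condition is that [u] and theta, differentiated j - 1 times in time and r times in space, stay
    within parabolic order 2M. *)
Lemma ST_E j r : (r + 2 * j <= 2 * M + 2)%nat -> (r + j <= 2 * M)%nat -> ST j r se.
Proof.
  revert r; induction j as [j IH] using (well_founded_induction lt_wf); intros r H1 H2.
  destruct j as [|n].
  - apply (ST_mono 0 (2 * M)); [lia|]. apply ST_of_Reg, Reg_K.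
  - apply (ST_time_derivative n r (2 * M)); [apply se_nn | lia | lia | apply Reg_u | apply Reg_th|].
    intros m Hm; apply IH; lia.
Qed.
(** The same trade with the dissipation, where [K] starts at order 2M - 1 and [u] and theta at 2M +
    1. *)
Lemma ST_D j r : (r + 2 * j <= 2 * M + 3)%nat -> (r + j <= 2 * M - 1)%nat -> ST j r (sd (2 * M)).
Proof.
  revert r; induction j as [j IH] using (well_founded_induction lt_wf); intros r H1 H2.
  destruct j as [|n].
  - apply (ST_mono 0 (2 * M - 1)); [lia|]. apply ST_of_Reg. intros; apply Reg_K_sd; auto; apply levelM.
  - apply (ST_time_derivative n r (2 * M + 1)); [apply sd_nn | lia | lia | apply Reg_u_sd | apply Reg_th_sd|].
    intros m Hm; apply IH; lia.
Qed.

Lemma Hs_of_ST k n i j B : nn B -> ST n k B -> (i < 3)%nat -> (j < 3)%nat ->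
  (fun s => Hs_sq k (dpow 0 n (sK (ss s) i j)) (tm s)) <~ (fun s => B s * B s).
Proof.
  intros HB H Hi Hj. apply (Hs_lesssim tm k n (K_ i j)); [intros s; apply Rle_0_sqr|].
  intros w Hw H0. apply (L2_of_L2b tm (fun s => Dw (w ++ repeat 0%nat n) (K_ i j s))); [assumption|].
  assert (T0 := nt_spatial w H0). assert (O := ord_nt_nx w).
  apply H; auto; rewrite ?nt_app, ?nx_app, ?nt_repeat0, ?nx_repeat0; lia.
Qed.

Definition Ks (s : St) : MField := fun i j => sK (ss s) i j.
Definition us (s : St) : VField := fun i => su (ss s) i.
Definition ths (s : St) : VField := fun i => sth (ss s) i.

Lemma sumN_K k n B : nn B -> ST n k B ->
  (fun s => sumN (Hs_sq k) (dtl n (compsK (Ks s))) (tm s)) <~ (fun s => B s * B s).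
Proof.
  intros HB H. unfold sumN, dtl, compsK, Ks; cbn [map fold_right].
  repeat (apply lesssim_add; [apply Hs_of_ST; auto; lia|]). apply lesssim_zero; intros s; apply Rle_0_sqr.
Qed.
Lemma sumN_a k n B : nn B -> ST n k B ->
  (fun s => sumN (Hs_sq k) (dtl n (aK (Ks s))) (tm s)) <~ (fun s => B s * B s).
Proof.
  intros HB H. unfold sumN, dtl, aK, Ks; cbn [map fold_right].
  repeat (apply lesssim_add; [apply Hs_of_ST; auto; lia|]). apply lesssim_zero; intros s; apply Rle_0_sqr.
Qed.

Lemma lesssim_sum_from (g : nat -> St -> R) m n (C : St -> R) : nn C -> (forall i, (m <= i <= n)%nat -> g i <~ C) ->
  (fun s => sum_from m n (fun i => g i s)) <~ C.
Proof.
  intros HC H. unfold sum_from. apply (lesssim_sum_f (fun i s => if (m <=? i)%nat then g i s else 0)).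
  intros i Hi. apply lesssim_if; [assumption|]. intros E; apply Nat.leb_le in E; apply H; lia.
Qed.

Lemma sumN_dtl0 (N : Field -> R -> R) l t : sumN N (dtl 0 l) t = sumN N l t.
Proof. unfold dtl. induction l as [|f l IH]; simpl; [reflexivity|]. rewrite IH; reflexivity. Qed.

Lemma EK_le_E : (fun s => EK M (Ks s) (tm s)) <~ E_.
Proof.
  assert (HM := M_ge).
  apply lesssim_trans with (fun s => se s * se s); [|apply lesssim_le; intros s; rewrite se_sqr; lra].
  assert (Hnn : nn (fun s => se s * se s)) by (intros s; apply Rle_0_sqr).
  unfold EK. apply lesssim_add; [apply lesssim_add; [apply lesssim_add|]|].
  - eapply lesssim_ext; [intros s; symmetry; apply (sumN_dtl0 _ (compsK (Ks s)))|]. apply sumN_K; [apply se_nn | apply ST_E; lia].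
  - apply sumN_K; [apply se_nn | apply ST_E; lia].
  - apply sumN_K; [apply se_nn | apply ST_E; lia].
  - apply (lesssim_sum_from (fun j s => sumN (Hs_sq (2 * M - 2 * j + 2)) (dtl j (compsK (Ks s))) (tm s))); [assumption|].
    intros j Hj. apply sumN_K; [apply se_nn | apply ST_E; lia].
Qed.

Lemma DM_le_D : (fun s => DM M (us s) (ths s) (Ks s) (tm s)) <~ DN (2 * M).
Proof.
  assert (HM := M_ge).
  assert (Hnn : nn (fun s => sd (2 * M) s * sd (2 * M) s)) by (intros s; apply Rle_0_sqr).
  assert (X : (fun s => sd (2 * M) s * sd (2 * M) s) <~ DN (2 * M)) by (apply lesssim_le; intros s; rewrite sd_sqr; lra).
  unfold DM. apply lesssim_add; [apply lesssim_add|].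
  - apply lesssim_le; intros s; apply Rle_refl.
  - eapply lesssim_trans; [|exact X].
    apply (lesssim_sum_from (fun j s => sumN (Hs_sq (2 * M - j - 1)) (dtl j (aK (Ks s))) (tm s))); [assumption|].
    intros j Hj. apply sumN_a; [apply sd_nn | apply ST_D; lia].
  - eapply lesssim_trans; [|exact X].
    apply (lesssim_sum_from (fun j s => sumN (Hs_sq (2 * M - 2 * j + 3)) (dtl j (aK (Ks s))) (tm s))); [assumption|].
    intros j Hj. apply sumN_a; [apply sd_nn | apply ST_D; lia].
Qed.

(** The extra norms of time derivatives of [a] exceed parabolic order 2; two uses of the inertia
    equation bring them back to it. *)
Lemma Elow_le_X : (fun s => Elow (us s) (ths s) (Ks s) (tm s)) <~ (fun s => XN 2 (ss s) (tm s)).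
Proof.
  assert (HM := M_ge).
  set (rx := fun s => sqrt (XN 2 (ss s) (tm s))).
  assert (Hrx : nn rx) by (intros s; apply sqrt_pos).
  assert (Erx : (fun s => rx s * rx s) <~ (fun s => XN 2 (ss s) (tm s))) by (apply lesssim_le; intros s; unfold rx; rewrite sqrt_sqrt by apply XN_nonneg; lra).
  assert (HX : nn (fun s => XN 2 (ss s) (tm s))) by (intros s; apply XN_nonneg).
  assert (Ru2 : forall i, (i < 3)%nat -> Reg tm 2 rx (u_ i)) by (intros i Hi w Hw; apply L2b_sqrt; auto; apply lesssim_le; intros s; apply (L2_le_XN 2 (ss s) w (tm s) i Hw Hi)).
  assert (Rt2 : forall i, (i < 3)%nat -> Reg tm 2 rx (th_ i)) by (intros i Hi w Hw; apply L2b_sqrt; auto; apply lesssim_le; intros s; apply (L2_le_XN 2 (ss s) w (tm s) i Hw Hi)).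
  assert (Ra2 : forall i, (i < 2)%nat -> Reg tm 2 rx (K_ i 2)) by (intros i Hi w Hw; apply L2b_sqrt; auto; apply lesssim_le; intros s; apply (L2_le_XN 2 (ss s) w (tm s) i Hw ltac:(lia)); assumption).
  assert (S0 : ST 0 2 rx) by (apply ST_of_Reg; intros; apply K_Reg; auto; lia).
  assert (S1 : ST 1 1 rx).
  { apply (ST_time_derivative 0 1 2); auto; try lia. intros m Hm. replace m with 0%nat by lia. exact S0. }
  assert (S2 : ST 2 0 rx).
  { apply (ST_time_derivative 1 0 2); auto; try lia. intros m Hm. destruct m as [|[|m]]; [apply (ST_mono 0 2); auto | exact S1 | lia]. }
  assert (Pk2 : forall f, Reg tm 2 rx f -> (fun s => Pk_sq 2 (f s) (tm s)) <~ (fun s => XN 2 (ss s) (tm s))).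
  { intros f Hf. apply Pk_lesssim; [assumption|]. intros w Hw. eapply lesssim_trans; [|exact Erx].
    apply (L2_of_L2b tm (fun s => Dw w (f s))); [assumption | apply Hf, Hw]. }
  unfold Elow. apply lesssim_add; [apply lesssim_add|].
  - unfold sumN, comps3, aK, us, ths, Ks; cbn [app fold_right].
    apply lesssim_add; [apply (Pk2 (u_ 0)), Ru2; lia|]. apply lesssim_add; [apply (Pk2 (u_ 1)), Ru2; lia|].
    apply lesssim_add; [apply (Pk2 (u_ 2)), Ru2; lia|]. apply lesssim_add; [apply (Pk2 (th_ 0)), Rt2; lia|].
    apply lesssim_add; [apply (Pk2 (th_ 1)), Rt2; lia|]. apply lesssim_add; [apply (Pk2 (th_ 2)), Rt2; lia|].
    apply lesssim_add; [apply (Pk2 (K_ 0 2)), Ra2; lia|]. apply lesssim_add; [apply (Pk2 (K_ 1 2)), Ra2; lia|].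
    apply lesssim_zero; assumption.
  - eapply lesssim_trans; [apply (sumN_a 1 1 rx Hrx S1) | exact Erx].
  - unfold sumN, dtl, aK, Ks; cbn [map fold_right].
    assert (X : forall i, (i < 2)%nat -> (fun s => L2sq (dpow 0 2 (sK (ss s) i 2%nat)) (tm s)) <~ (fun s => XN 2 (ss s) (tm s))).
    { intros i Hi. apply (lesssim_ext _ (fun s => L2 (Dw [0%nat; 0%nat] (K_ i 2 s)) (tm s))).
      { intros s. rewrite <- L2_E, Dw_val. reflexivity. }
      eapply lesssim_trans; [|exact Erx]. apply (L2_of_L2b tm (fun s => Dw [0%nat; 0%nat] (K_ i 2 s))); [assumption|].
      apply S2; simpl; lia. }
    apply lesssim_add; [apply X; lia|]. apply lesssim_add; [apply X; lia|]. apply lesssim_zero; assumption.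
Qed.

(** * Growth of the highest norm of the inertia tensor *)

Definition WS (n : nat) : list (list nat) := filter (fun w => negb (existsb (Nat.eqb 0) w)) (W n).

Lemma WS_spatial w n : In w (WS n) -> ~ In 0%nat w /\ (ord w <= n)%nat.
Proof.
  intros H; apply filter_In in H; destruct H as [H1 H2]; split; [|apply W_ord, H1].
  intros I. assert (E : existsb (Nat.eqb 0) w = true) by (apply existsb_exists; exists 0%nat; split; [assumption | reflexivity]).
  rewrite E in H2; discriminate.
Qed.
Lemma cw_WS a1 a2 a3 n : (a1 + a2 + a3 <= n)%nat -> In (cw 0 a1 a2 a3) (WS n).
Proof.
  intros H; apply filter_In; split; [apply cw_W; lia|].
  destruct (existsb (Nat.eqb 0) (cw 0 a1 a2 a3)) eqn:E; [|reflexivity].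
  apply existsb_exists in E; destruct E as (k & Hk & E). apply Nat.eqb_eq in E; subst k.
  unfold cw in Hk; simpl in Hk.
  repeat (apply in_app_or in Hk; destruct Hk as [Hk|Hk]; [apply repeat_spec in Hk; discriminate|]).
  apply repeat_spec in Hk; discriminate.
Qed.

Definition Phw (S : Sol) w t : R := sum3 (fun i => sum3 (fun j => L2 (Dw w (sK S i j)) t)).
(** The sum over all nine entries is invariant under conjugation by rotations, so the equilibrium
    rotation drops out of its time derivative. *)
Definition Phi (S : Sol) (t : R) : R := lsum (map (fun w => Phw S w t) (WS (2 * M + 1))).
Definition dPhw (S : Sol) w t : R := 2 * sum3 (fun i => sum3 (fun j => ip (Dw w (sK S i j)) (D 0 (Dw w (sK S i j))) t)).
Definition dPhi (S : Sol) (t : R) : R := lsum (map (fun w => dPhw S w t) (WS (2 * M + 1))).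
Definition Phs (s : St) : R := Phi (ss s) (tm s).
Definition ph (s : St) : R := sqrt (Phs s).

Lemma Phw_nonneg S w t : 0 <= Phw S w t.
Proof. unfold Phw, sum3; repeat apply Rplus_le_le_0_compat; apply L2_nonneg. Qed.
Lemma Phi_nonneg S t : 0 <= Phi S t. Proof. apply lsum_nonneg; intros; apply Phw_nonneg. Qed.
Lemma Phs_nonneg s : 0 <= Phs s. Proof. apply Phi_nonneg. Qed.
Lemma ph_nn : nn ph. Proof. intros s; apply sqrt_pos. Qed.
Lemma ph_sqr s : ph s * ph s = Phs s. Proof. apply sqrt_sqrt, Phs_nonneg. Qed.

Lemma sum33_derive (f d : nat -> nat -> R -> R) t : (forall i j, is_derive (f i j) t (d i j t)) ->
  is_derive (fun t => sum3 (fun i => sum3 (fun j => f i j t))) t (sum3 (fun i => sum3 (fun j => d i j t))).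
Proof.
  intros H. unfold sum3. repeat apply (is_derive_plus (V := R_NormedModule)); apply H.
Qed.

Lemma Phi_derive S t : is_derive (Phi S) t (dPhi S t).
Proof.
  apply (lsum_derive (WS (2 * M + 1)) (fun w t => Phw S w t)). intros w _. unfold Phw, dPhw.
  replace (2 * sum3 (fun i => sum3 (fun j => ip (Dw w (sK S i j)) (D 0 (Dw w (sK S i j))) t)))
    with (sum3 (fun i => sum3 (fun j => 2 * ip (Dw w (sK S i j)) (D 0 (Dw w (sK S i j))) t))) by (unfold sum3; ring).
  apply (sum33_derive (fun i j t => L2 (Dw w (sK S i j)) t) (fun i j t => 2 * ip (Dw w (sK S i j)) (D 0 (Dw w (sK S i j))) t)).
  intros i j. replace (2 * ip (Dw w (sK S i j)) (D 0 (Dw w (sK S i j))) t) with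
    (ip (D 0 (Dw w (sK S i j))) (Dw w (sK S i j)) t + ip (Dw w (sK S i j)) (D 0 (Dw w (sK S i j))) t) by (rewrite (ip_sym (D 0 _)); ring).
  apply (is_derive_ext (ip (Dw w (sK S i j)) (Dw w (sK S i j)))); [intros; apply ip_self | apply ip_derive].
Qed.

Lemma K_Phi w i j : ~ In 0%nat w -> (ord w <= 2 * M + 1)%nat -> (i < 3)%nat -> (j < 3)%nat -> L2b tm (fun s => Dw w (K_ i j s)) ph.
Proof.
  intros Hw Ho Hi Hj. apply L2b_sqrt; [intros s; apply Phs_nonneg|]. apply lesssim_le; intros s.
  destruct (canonical_word w) as (a0 & a1 & a2 & a3 & E & H & Z). specialize (Z Hw); subst a0. rewrite H.
  apply Rle_trans with (Phw (ss s) (cw 0 a1 a2 a3) (tm s)).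
  - unfold Phw, K_. set (v := cw 0 a1 a2 a3).
    assert (N : forall i j, 0 <= L2 (Dw v (sK (ss s) i j)) (tm s)) by (intros; apply L2_nonneg).
    assert (A : forall i j, (j < 3)%nat -> L2 (Dw v (sK (ss s) i j)) (tm s) <= sum3 (fun j => L2 (Dw v (sK (ss s) i j)) (tm s))).
    { intros a b Hb. unfold sum3. assert (n0 := N a 0%nat). assert (n1 := N a 1%nat). assert (n2 := N a 2%nat). destruct b as [|[|[|b]]]; try lia; lra. }
    eapply Rle_trans; [apply (A i j Hj)|].
    assert (N' : forall i, 0 <= sum3 (fun j => L2 (Dw v (sK (ss s) i j)) (tm s))) by (intros; unfold sum3; repeat apply Rplus_le_le_0_compat; apply N).
    unfold sum3 at 2. assert (n0 := N' 0%nat). assert (n1 := N' 1%nat). assert (n2 := N' 2%nat). destruct i as [|[|[|i]]]; try lia; lra.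
  - apply (lsum_term (WS (2 * M + 1)) (fun w => Phw (ss s) w (tm s))); [intros; apply Phw_nonneg | apply cw_WS; lia].
Qed.

Definition growth_err (s : St) : R := lownorm s * Phs s + ph s * sd (2 * M) s.

(** Conjugation by the rotations that an antisymmetric matrix generates preserves the Frobenius
    norm; this is the infinitesimal form. *)
Lemma rotation_zero (X : nat -> nat -> F) t : sum3 (fun i => sum3 (fun j => ip (X i j) (commF (tenF omF) X i j) t)) = 0.
Proof.
  assert (E : TI (F3 (fun i => F3 (fun j => X i j * commF (tenF omF) X i j)))%fld t = 0).
  { rewrite <- (TI_c 0 t). apply TI_ext; intros x y z. unfold F3, commF, F3. cbn [tenF omF Nat.eqb]. Fv. ring. }
  unfold F3 in E. rewrite !TI_add in E. unfold sum3, ip. exact E.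
Qed.

(** The rotation part cancels in the sum. The linear source contains theta to order 2M + 1, which is
    just dissipated, and the nonlinearity is covered by [transport_est], here one order above the
    energy. *)
Lemma dPhw_bound w : In w (WS (2 * M + 1)) -> (fun s => dPhw (ss s) w (tm s)) <~ growth_err.
Proof.
  intros Hw. apply WS_spatial in Hw; destruct Hw as [H0 Ho]. assert (HM := M_ge).
  assert (P1 : forall s, 0 <= lownorm s * Phs s) by (intros s; apply Rmult_le_pos; [apply lownorm_nn | apply Phs_nonneg]).
  assert (P2 : forall s, 0 <= ph s * sd (2 * M) s) by (intros s; apply Rmult_le_pos; [apply ph_nn | apply sd_nn]).
  assert (HB : nn growth_err) by (intros s; unfold growth_err; specialize (P1 s); specialize (P2 s); lra).
  assert (HKw : forall i j, (i < 3)%nat -> (j < 3)%nat -> L2b tm (fun s => Dw w (K_ i j s)) ph) by (intros; apply K_Phi; auto).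
  assert (T1 : forall i j, (i < 3)%nat -> (j < 3)%nat ->
     (fun s => Rabs (ip (Dw w (K_ i j s)) (Dw w (NLKs i j s)) (tm s))) <~ growth_err).
  { intros i j Hi Hj.
    eapply lesssim_trans; [apply (transport_est w i j ph (sd (2 * M)))|apply lesssim_le; intros s; unfold growth_err; rewrite ph_sqr; lra]; auto.
    - apply ph_nn.
    - apply sd_nn.
    - intros p k Hp E1 Hk. apply csplits_in in Hp; destruct Hp as [Hp _]. assert (Hs := splits_ord w p Hp).
      apply K_Phi; auto; [|simpl; lia]. intros [I|I]; [discriminate|]. apply H0.
      eapply Permutation_in; [apply (splits_perm w p Hp) | apply in_or_app; right; exact I].
    - intros l k m Hl Hk Hm.
      apply (L2b_le tm _ (fun s => sd (2 * M) s * 1)); [|apply lesssim_le; intros; lra].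
      apply (comm_L2b tm (2 * M + 1) (2 * M)); [apply sd_nn | apply one_nn | apply Reg_th_sd, Hl | eapply Reg_le; [apply se_one | apply Reg_K; auto]|].
      intros b c E1 E2; lia.
    - intros p k Hp E1 Hk. apply csplits_in in Hp; destruct Hp as [Hp _]. assert (Hs := splits_ord w p Hp).
      apply (L2b_le tm _ (fun s => sd (2 * M) s * 1)); [|apply lesssim_le; intros; lra].
      apply (Reg_prod_L2b tm (2 * M + 1) (2 * M - 1) (sd (2 * M)) (fun _ => 1) (u_ k) (fun s => D (S k) (K_ i j s))); [apply sd_nn | apply one_nn | apply Reg_u_sd, Hk| |lia].
      apply Reg_D. eapply Reg_le; [apply se_one|]. eapply Reg_mono; [|apply (Reg_K i j Hi Hj)]. simpl; lia. }
  assert (T2 : forall i j, (i < 3)%nat -> (j < 3)%nat ->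
     (fun s => Rabs (ip (Dw w (K_ i j s)) (Dw w (commF (tenF (sth (ss s))) JeqF i j)) (tm s))) <~ growth_err).
  { intros i j Hi Hj.
    eapply lesssim_trans; [|apply lesssim_le; intros s; unfold growth_err; specialize (P1 s); instantiate (1 := fun s => ph s * sd (2 * M) s); simpl; lra].
    apply (ip_lesssim tm (fun s => Dw w (K_ i j s)) (fun s => Dw w (commF (tenF (sth (ss s))) JeqF i j))); [apply ph_nn | apply sd_nn | auto|].
    apply (L2b_ext tm _ (fun s => Dw w (Fc (Jeq lam nu j j - Jeq lam nu i i) * tenF (sth (ss s)) i j)%fld)).
    { intros s x y z. f_equal. f_equal. apply F_ext; intros. unfold commF, F3, JeqF.
      destruct i as [|[|[|i]]]; destruct j as [|[|[|j]]]; try lia; cbn [tenF]; Fv; unfold Jeq; simpl; ring. }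
    apply (L2b_ext tm _ (fun s => Fc (Jeq lam nu j j - Jeq lam nu i i) * Dw w (tenF (sth (ss s)) i j))%fld); [intros; rewrite Dw_scal; reflexivity|].
    apply L2b_scal.
    assert (Tp : forall l, (l < 3)%nat -> L2b tm (fun s => Dw w (sth (ss s) l)) (sd (2 * M))) by (intros l Hl; apply (Reg_th_sd (2 * M) l Hl); assumption).
    assert (Tm : forall l, (l < 3)%nat -> L2b tm (fun s => Dw w (- sth (ss s) l)%fld) (sd (2 * M))).
    { intros l Hl. apply (L2b_ext tm _ (fun s => - Dw w (sth (ss s) l))%fld); [intros; rewrite Dw_opp; reflexivity | apply L2b_opp, Tp, Hl]. }
    assert (T0 : L2b tm (fun _ => Dw w (Fc 0)) (sd (2 * M))) by (apply (L2b_ext tm _ (fun _ => Fc 0)); [intros; rewrite Dw_0; reflexivity | apply L2b_zero, sd_nn]).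
    destruct i as [|[|[|i]]]; destruct j as [|[|[|j]]]; try lia; cbn [tenF]; first [exact T0 | apply Tp; lia | apply Tm; lia]. }
  apply lesssim_trans with (fun s => 2 * sum3 (fun i => sum3 (fun j => Rabs (ip (Dw w (K_ i j s)) (Dw w (NLKs i j s)) (tm s))
     + Rabs (ip (Dw w (K_ i j s)) (Dw w (commF (tenF (sth (ss s))) JeqF i j)) (tm s))))).
  - apply lesssim_le; intros s. unfold dPhw.
    assert (E : forall i j, (i < 3)%nat -> (j < 3)%nat -> ip (Dw w (sK (ss s) i j)) (D 0 (Dw w (sK (ss s) i j))) (tm s) =
       ip (Dw w (sK (ss s) i j)) (commF (tenF omF) (fun k l => Dw w (sK (ss s) k l)) i j) (tm s)
       + ip (Dw w (sK (ss s) i j)) (Dw w (commF (tenF (sth (ss s))) JeqF i j)) (tm s) + ip (Dw w (sK (ss s) i j)) (Dw w (NLKs i j s)) (tm s)).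
    { intros i j Hi Hj. rewrite <- !ip_add_r. apply ip_ext; [reflexivity|]. intros x y z. rewrite <- Dw_D.
      rewrite (eqT_Dw _ w _ _ (sT_pos (ss s)) (s_K (ss s) i j Hi Hj) (tm s) x y z (tm_ok s)).
      rewrite !Dw_add. Fv. f_equal. f_equal.
      assert (To : forall a b, exists c, tenF omF a b = Fc c).
      { intros a b. destruct a as [|[|[|a]]]; destruct b as [|[|[|b]]]; simpl; unfold omF; simpl; try (eexists; reflexivity);
          try (exists (- ttil); apply F_ext; intros; Fv; ring); exists 0; apply F_ext; intros; Fv; ring. }
      unfold commF, F3. rewrite Dw_sub, !Dw_add.
      assert (Q1 : forall a b f, Dw w (tenF omF a b * f)%fld = (tenF omF a b * Dw w f)%fld).
      { intros a b f. destruct (To a b) as (c & ->). apply Dw_scal. }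
      assert (Q2 : forall a b f, Dw w (f * tenF omF a b)%fld = (Dw w f * tenF omF a b)%fld).
      { intros a b f. replace (f * tenF omF a b)%fld with (tenF omF a b * f)%fld by ring. rewrite Q1; ring. }
      rewrite !Q1, !Q2. reflexivity. }
    assert (Z := rotation_zero (fun k l => Dw w (sK (ss s) k l)) (tm s)).
    apply Rmult_le_compat_l; [lra|]. unfold sum3 in *. rewrite !E by lia. unfold K_.
    repeat match goal with |- context [Rabs ?x] =>
      let H := fresh in assert (H : x <= Rabs x) by apply Rle_abs; revert H; generalize (Rabs x); intros ? H end.
    lra.
  - apply lesssim_scal; [lra|]. unfold sum3. repeat apply lesssim_add; first [apply T1; lia | apply T2; lia].
Qed.

Lemma dPhi_bound : (fun s => dPhi (ss s) (tm s)) <~ growth_err.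
Proof.
  apply (lesssim_lsum (WS (2 * M + 1)) (fun w s => dPhw (ss s) w (tm s))).
  - intros s; unfold growth_err; apply Rplus_le_le_0_compat; apply Rmult_le_pos; [apply lownorm_nn | apply Phs_nonneg | apply ph_nn | apply sd_nn].
  - intros w Hw; apply dPhw_bound, Hw.
Qed.

(** Young's inequality on the source has to be paid over an interval of length [t0]; the resulting
    factor 1 + t0 in front of the dissipation is the growth of the estimate. *)
Lemma Phi_growth : exists e0 C, 0 < e0 /\ 0 < C /\ forall S : Sol, eps S <= e0 -> forall t, 0 <= t <= sT S ->
  Phi S t <= C * (Phi S 0 + (1 + t) * RInt (DNs (2 * M) S) 0 t).
Proof.
  destruct dPhi_bound as (C & HC & Hd). destruct lownorm_decay as (e1 & Cg & He1 & HCg & Hg).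
  set (e0 := Rmin e1 (/ (6 * (C * Cg + 1)))).
  assert (HCC : 0 <= C * Cg) by (apply Rmult_le_pos; lra).
  assert (He0 : 0 < e0) by (unfold e0; apply Rmin_pos; [assumption | apply Rinv_0_lt_compat; lra]).
  exists e0, (3 + 3 * C * C); split; [assumption|split; [nra|]].
  intros S Hs t0 Ht0.
  assert (B1 : eps S <= e1) by (eapply Rle_trans; [exact Hs | apply Rmin_l]).
  assert (B2 : eps S <= / (6 * (C * Cg + 1))) by (eapply Rle_trans; [exact Hs | apply Rmin_r]).
  assert (Hep : 0 <= eps S) by apply s_eps.
  (* The additional weight [1 - h r] stays nonnegative up to the final time, and its slope absorbs
     the quadratic part of the source. *)
  set (h := / (1 + t0)). assert (Hh : 0 < h) by (apply Rinv_0_lt_compat; lra).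
  assert (Hht : h * t0 <= 1) by (unfold h; apply Rmult_le_reg_l with (1 + t0); [lra|]; rewrite <- Rmult_assoc, Rinv_r by lra; lra).
  set (Wt := fun r => (1 + / sqrt (1 + r)) + (1 - h * r)).
  set (f := fun r => Wt r * Phi S r).
  set (df := fun r => (- (1 / 2) * w32 r - h) * Phi S r + Wt r * dPhi S r).
  assert (Hf : forall r, 0 <= r <= t0 -> is_derive f r (df r)).
  { intros r Hr. apply (is_derive_mult Wt (Phi S) r); [|apply Phi_derive|intros; apply Rmult_comm].
    apply (is_derive_plus (V := R_NormedModule) (fun r => 1 + / sqrt (1 + r)) (fun r => 1 - h * r)); [apply weight_derive; lra|].
    auto_derive; [trivial | ring]. }
  set (Q := 9 / 4 * C * C * (1 + t0)).
  assert (Hdf : forall r, 0 <= r <= t0 -> df r <= - (- Q) * DNs (2 * M) S r).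
  { intros r Hr. assert (Hr' : 0 <= r <= sT S) by lra.
    assert (X := Hd (mkSt S r Hr')). assert (G := Hg (mkSt S r Hr') B1). unfold ep in G. cbn [ss tm] in X, G.
    unfold df. destruct (inv_sqrt_bounds r ltac:(lra)) as [m1 m2]. assert (W0 := w32_pos r ltac:(lra)).
    assert (N := sd_nn (2 * M) (mkSt S r Hr')). assert (N' := sd_sqr (2 * M) (mkSt S r Hr')).
    change (DN (2 * M) (mkSt S r Hr')) with (DNs (2 * M) S r) in N'. rewrite <- N'.
    assert (Np := ph_nn (mkSt S r Hr')). assert (Np' := ph_sqr (mkSt S r Hr')). unfold Phs in Np'. cbn [ss tm] in Np'.
    unfold growth_err, Phs in X. cbn [ss tm] in X. rewrite <- Np' in *.
    assert (Ng := lownorm_nn (mkSt S r Hr')).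
    set (a := ph (mkSt S r Hr')) in *. set (d := sd (2 * M) (mkSt S r Hr')) in *. set (g := lownorm (mkSt S r Hr')) in *.
    assert (HW : 1 <= Wt r <= 3).
    { unfold Wt. assert (0 <= h * r) by (apply Rmult_le_pos; lra). assert (h * r <= h * t0) by (apply Rmult_le_compat_l; lra). lra. }
    assert (Ha : 0 <= a * a) by apply Rle_0_sqr.
    assert (Z1 : 3 * (C * g) <= 1 / 2 * w32 r).
    { apply Rle_trans with (3 * (C * Cg * eps S) * w32 r).
      - replace (3 * (C * Cg * eps S) * w32 r) with (3 * (C * (Cg * eps S * w32 r))) by ring.
        apply Rmult_le_compat_l; [lra|]. apply Rmult_le_compat_l; assumption.
      - apply Rmult_le_compat_r; [lra|].
        assert (Z : C * Cg * eps S <= / 6).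
        { apply Rle_trans with ((C * Cg + 1) * / (6 * (C * Cg + 1))); [apply Rmult_le_compat; lra | apply Req_le; field; lra]. }
        lra. }
    (* Young: 3 C a d <= h a^2 + (9/4) C^2 d^2 / h *)
    assert (Z2 : 3 * (C * (a * d)) <= h * (a * a) + Q * (d * d)).
    { assert (Eh : h * (1 + t0) = 1) by (unfold h; apply Rinv_l; lra).
      assert (Sq : 0 <= (h * a - 3 / 2 * C * d) * (h * a - 3 / 2 * C * d)) by apply Rle_0_sqr.
      apply Rmult_le_reg_l with h; [assumption|].
      replace (h * (h * (a * a) + Q * (d * d))) with (h * h * (a * a) + 9 / 4 * C * C * (h * (1 + t0)) * (d * d)) by (unfold Q; ring).
      rewrite Eh. lra. }
    set (Pd := dPhi S r) in *. clearbody Pd.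
    assert (Z3 : Wt r * Pd <= 3 * (C * (g * (a * a) + a * d))).
    { assert (0 <= C * (g * (a * a) + a * d)).
      { apply Rmult_le_pos; [assumption|]. apply Rplus_le_le_0_compat; apply Rmult_le_pos; assumption. }
      apply Rle_trans with (Wt r * (C * (g * (a * a) + a * d))); [apply Rmult_le_compat_l; lra|].
      apply Rmult_le_compat_r; lra. }
    assert (Z4 : 3 * (C * g) * (a * a) <= 1 / 2 * w32 r * (a * a)) by (apply Rmult_le_compat_r; assumption).
    lra. }
  assert (R := integrated_dissipation f df (DNs (2 * M) S) t0 (- Q) Hf (DNs_continuous (2 * M) S) Hdf t0 ltac:(lra)).
  assert (P0 := Phi_nonneg S 0). assert (Pt := Phi_nonneg S t0).
  assert (F0 : f 0 <= 3 * Phi S 0).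
  { unfold f, Wt. destruct (inv_sqrt_bounds 0 ltac:(lra)) as [m1 m2]. rewrite Rmult_0_r. apply Rmult_le_compat_r; lra. }
  assert (Ft : Phi S t0 <= f t0).
  { unfold f, Wt. destruct (inv_sqrt_bounds t0 ltac:(lra)) as [m1 m2]. set (m := / sqrt (1 + t0)) in *. nra. }
  assert (RI : 0 <= RInt (DNs (2 * M) S) 0 t0).
  { apply RInt_ge_0; [lra | apply ex_RInt_cont, DNs_continuous|]. intros r Hr.
    assert (Hr' : 0 <= r <= sT S) by lra. exact (DN_nonneg (2 * M) (mkSt S r Hr')). }
  set (I := RInt (DNs (2 * M) S) 0 t0) in *. unfold Q in R.
  assert (HI : 0 <= (1 + t0) * I) by (apply Rmult_le_pos; lra).
  assert (0 <= C * C * ((1 + t0) * I)) by (apply Rmult_le_pos; [apply Rle_0_sqr | assumption]).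
  assert (0 <= C * C * Phi S 0) by (apply Rmult_le_pos; [apply Rle_0_sqr | assumption]).
  lra.
Qed.

Lemma FM_le_Phi : (fun s => FM M (Ks s) (tm s)) <~ (fun s => Phs s + E_ s).
Proof.
  assert (HM := M_ge).
  set (B := fun s => sqrt (Phs s + E_ s)).
  assert (Hpe : forall s, 0 <= Phs s + E_ s) by (intros s; apply Rplus_le_le_0_compat; [apply Phs_nonneg | apply E_nonneg]).
  assert (HB : nn B) by (intros s; apply sqrt_pos).
  assert (EB : (fun s => B s * B s) <~ (fun s => Phs s + E_ s)) by (apply lesssim_le; intros s; unfold B; rewrite sqrt_sqrt by apply Hpe; lra).
  assert (L1 : ph <~ B) by (apply lesssim_le; intros s; apply sqrt_le_1_alt; assert (H := E_nonneg s); lra).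
  assert (L2' : se <~ B) by (apply lesssim_le; intros s; apply sqrt_le_1_alt; assert (H := Phi_nonneg (ss s) (tm s)); unfold Phs; lra).
  assert (Hu : forall i, (i < 3)%nat -> Reg tm (2 * M) B (u_ i)) by (intros; eapply Reg_le; [exact L2' | apply Reg_u; assumption]).
  assert (Hth : forall i, (i < 3)%nat -> Reg tm (2 * M) B (th_ i)) by (intros; eapply Reg_le; [exact L2' | apply Reg_th; assumption]).
  assert (S0 : ST 0 (2 * M + 1) B).
  { intros v H1 H2 i j Hi Hj. eapply L2b_le; [|exact L1]. apply K_Phi; auto; [|rewrite ord_nt_nx; lia].
    clear - H1. intros I. induction v as [|[|k] v IH]; simpl in *; [destruct I | discriminate | destruct I as [I|I]; [discriminate | auto]]. }
  assert (S1 : ST 1 (2 * M) B).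
  { apply (ST_time_derivative 0 (2 * M) (2 * M)); auto; try lia. intros m Hm; replace m with 0%nat by lia; exact S0. }
  assert (S2 : ST 2 (2 * M - 2) B).
  { apply (ST_time_derivative 1 (2 * M - 2) (2 * M)); auto; try lia. intros m Hm. destruct m as [|[|m]]; [apply (ST_mono 0 (2 * M + 1)); [lia | exact S0] | apply (ST_mono 1 (2 * M)); [lia | exact S1] | lia]. }
  eapply lesssim_trans; [|exact EB].
  unfold FM. apply lesssim_add; [apply lesssim_add|].
  - eapply lesssim_ext; [intros s; symmetry; apply (sumN_dtl0 _ (compsK (Ks s)))|]. apply sumN_K; assumption.
  - apply sumN_K; assumption.
  - apply sumN_K; assumption.
Qed.

Lemma Phi_le_FM (S : Sol) t : Phi S t <= INR (length (WS (2 * M + 1))) * FM M (fun i j => sK S i j) t.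
Proof.
  assert (N := fun k j (f : F) => Hs_nonneg k (Dw (repeat 0%nat j) f) t).
  assert (H1 : forall w, In w (WS (2 * M + 1)) -> Phw S w t <= FM M (fun i j => sK S i j) t).
  { intros w Hw. apply WS_spatial in Hw; destruct Hw as [H0 Ho].
    assert (X : forall i j, L2 (Dw w (sK S i j)) t <= Hs_sq (2 * M + 1) (sK S i j) t) by (intros; apply L2_le_Hs; assumption).
    assert (Y : forall k n (l : list F), 0 <= sumN (Hs_sq k) (dtl n (map (fun f : F => fv f) l)) t).
    { intros k n l. unfold sumN, dtl. induction l as [|f l IH]; simpl; [lra|]. apply Rplus_le_le_0_compat; [|exact IH].
      assert (Z := N k n f). rewrite Dw_val, <- dpow_fold in Z. exact Z. }
    set (lK := [sK S 0 0; sK S 0 1; sK S 0 2; sK S 1 0; sK S 1 1; sK S 1 2; sK S 2 0; sK S 2 1; sK S 2 2]%nat).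
    assert (Y1 := Y (2 * M)%nat 1%nat lK). assert (Y2 := Y (2 * M - 2)%nat 2%nat lK).
    unfold FM.
    change (compsK (fun i j => sK S i j)) with (map (fun f : F => fv f) lK).
    assert (A : Phw S w t <= sumN (Hs_sq (2 * M + 1)) (map (fun f : F => fv f) lK) t).
    { unfold Phw, sum3, sumN, lK; cbn [map fold_right].
      assert (x00 := X 0%nat 0%nat). assert (x01 := X 0%nat 1%nat). assert (x02 := X 0%nat 2%nat).
      assert (x10 := X 1%nat 0%nat). assert (x11 := X 1%nat 1%nat). assert (x12 := X 1%nat 2%nat).
      assert (x20 := X 2%nat 0%nat). assert (x21 := X 2%nat 1%nat). assert (x22 := X 2%nat 2%nat). lra. }
    lra. }
  unfold Phi. revert H1. induction (WS (2 * M + 1)) as [|w l IH]; intros H1; [simpl; lra|].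
  simpl map. simpl length. rewrite S_INR. cbn [lsum fold_right].
  specialize (IH (fun w Hw => H1 w (or_intror Hw))). unfold lsum in IH. specialize (H1 w (or_introl eq_refl)). lra.
Qed.

End Gain.

(** * The spectral constraint *)

(* For symmetric A the matrix X = (A - l)(A - n) is symmetric, and the trace of X^2 is a polynomial in the
   coefficients of the characteristic polynomial of A that vanishes when the spectrum is {l, l, n}. *)
Lemma spectrum_quadratic (A : nat -> nat -> R) (l n : R) :
  (forall i j, (i < 3)%nat -> (j < 3)%nat -> A i j = A j i) ->
  (forall s, det3 (fun i j => (if (i =? j)%nat then s else 0) - A i j) = (s - l) ^ 2 * (s - n)) ->
  forall i j, (i < 3)%nat -> (j < 3)%nat ->
  sum3 (fun k => (A i k - (if (i =? k)%nat then l else 0)) * (A k j - (if (k =? j)%nat then n else 0))) = 0.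
Proof.
  intros Hs Hd.
  assert (S1 := Hs 1%nat 0%nat ltac:(lia) ltac:(lia)). assert (S2 := Hs 2%nat 0%nat ltac:(lia) ltac:(lia)).
  assert (S3 := Hs 2%nat 1%nat ltac:(lia) ltac:(lia)).
  (* The values at 0, 1 and -1 determine the three coefficients of a monic cubic. *)
  assert (D0 := Hd 0). assert (D1 := Hd 1). assert (D2 := Hd (-1)).
  unfold det3 in D0, D1, D2; simpl in D0, D1, D2. rewrite S1, S2, S3 in *.
  set (a := A 0%nat 0%nat) in *. set (b := A 0%nat 1%nat) in *. set (c := A 0%nat 2%nat) in *.
  set (d := A 1%nat 1%nat) in *. set (e := A 1%nat 2%nat) in *. set (f := A 2%nat 2%nat) in *.
  set (e1 := a + d + f). set (e2 := a * d + a * f + d * f - b * b - c * c - e * e).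
  set (e3 := a * (d * f - e * e) - b * (b * f - e * c) + c * (b * e - d * c)).
  assert (E3 : e3 = l * l * n) by (unfold e3; lra).
  assert (E1 : e1 = 2 * l + n) by (unfold e1; lra).
  assert (E2 : e2 = l * l + 2 * l * n) by (unfold e2; lra).
  set (x00 := (a - l) * (a - n) + b * b + c * c).
  set (x01 := (a - l) * b + b * (d - n) + c * e).
  set (x02 := (a - l) * c + b * e + c * (f - n)).
  set (x10 := b * (a - n) + (d - l) * b + e * c).
  set (x11 := b * b + (d - l) * (d - n) + e * e).
  set (x12 := b * c + (d - l) * e + e * (f - n)).
  set (x20 := c * (a - n) + e * b + (f - l) * c).
  set (x21 := c * b + e * (d - n) + (f - l) * e).
  set (x22 := c * c + e * e + (f - l) * (f - n)).
  assert (Z : x00 * x00 + x01 * x01 + x02 * x02 + x10 * x10 + x11 * x11 + x12 * x12 + x20 * x20 + x21 * x21 + x22 * x22 = 0).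
  (* The trace of (A - l)^2 (A - n)^2, with the power sums of the eigenvalues expressed by Newton's
     identities. *)
  { transitivity ((e1 ^ 4 - 4 * e1 ^ 2 * e2 + 2 * e2 ^ 2 + 4 * e1 * e3) - 2 * (l + n) * (e1 ^ 3 - 3 * e1 * e2 + 3 * e3)
      + ((l + n) ^ 2 + 2 * l * n) * (e1 ^ 2 - 2 * e2) - 2 * l * n * (l + n) * e1 + 3 * l ^ 2 * n ^ 2).
    - unfold x00, x01, x02, x10, x11, x12, x20, x21, x22, e1, e2, e3. ring.
    - rewrite E1, E2, E3. ring. }
  assert (N : forall r, 0 <= r * r) by (intros; apply Rle_0_sqr).
  assert (Zr : forall r, r * r = 0 -> r = 0) by (intros r Hr; destruct (Rmult_integral _ _ Hr); assumption).
  assert (n00 := N x00). assert (n01 := N x01). assert (n02 := N x02). assert (n10 := N x10). assert (n11 := N x11).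
  assert (n12 := N x12). assert (n20 := N x20). assert (n21 := N x21). assert (n22 := N x22).
  assert (z00 : x00 = 0) by (apply Zr; lra). assert (z01 : x01 = 0) by (apply Zr; lra). assert (z02 : x02 = 0) by (apply Zr; lra).
  assert (z10 : x10 = 0) by (apply Zr; lra). assert (z11 : x11 = 0) by (apply Zr; lra). assert (z12 : x12 = 0) by (apply Zr; lra).
  assert (z20 : x20 = 0) by (apply Zr; lra). assert (z21 : x21 = 0) by (apply Zr; lra). assert (z22 : x22 = 0) by (apply Zr; lra).
  unfold x00, x01, x02, x10, x11, x12, x20, x21, x22 in z00, z01, z02, z10, z11, z12, z20, z21, z22.
  clear Z n00 n01 n02 n10 n11 n12 n20 n21 n22 x00 x01 x02 x10 x11 x12 x20 x21 x22.
  intros i j Hi Hj. unfold sum3.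
  destruct i as [|[|[|i]]]; destruct j as [|[|[|j]]]; try lia; simpl; rewrite ?S1, ?S2, ?S3; fold a b c d e f; lra.
Qed.

(** * From the system to the record of solutions: persistence of the constraint *)

Section Build.
Context {P : Par}.
Context (u : nat -> F) (p : F) (th : nat -> F) (K : nat -> nat -> F) (T : R).
Context (HT : 0 < T).
Context (Hsys : forall t x y z, 0 <= t <= T ->
  system_P mu kappa alpha beta gamma tau lam nu (fun i => u i) p (fun i => th i) (fun i j => K i j) t x y z).

Lemma fv_D2 k l (f : F) : fv (D k (D l f)) = pd k (pd l f).
Proof. rewrite !fv_D; reflexivity. Qed.
Lemma div_divF (v : nat -> F) : div (fun i => v i) = fv (divF v).
Proof. apply field_ext; intros; unfold div, divF, F3, sum3, dx; Fv; rewrite !fv_D; reflexivity. Qed.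

Ltac sysv := unfold lap, curl, sum3, lapF, curlF, advF, F3 in *; unfold dt, dx in *; cbv beta iota zeta in *; cbn [Nat.eqb] in *; Fv; rewrite ?fv_D2, ?fv_D.

Lemma sys_u i : (i < 3)%nat -> eqT T (D 0 (u i))
    (Fc (mu + kappa / 2) * lapF (u i) + Fc kappa * curlF th i - D (S i) p - advF u (u i))%fld.
Proof.
  intros Hi t x y z Ht. destruct (Hsys t x y z Ht) as (A & _). specialize (A i Hi). clear Hsys.
  destruct i as [|[|[|i]]]; [| | |lia]; sysv; lra.
Qed.
Lemma sys_div : eqT T (divF u) (Fc 0).
Proof.
  intros t x y z Ht. destruct (Hsys t x y z Ht) as (_ & A & _). rewrite div_divF in A. rewrite A, Fc_v; reflexivity.
Qed.
(** The constant part of the gyroscopic term vanishes because the equilibrium velocity is an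
    eigenvector of [Jeq]; the rest is split into [LinF] and the contribution [NLc] to [NLth]. *)
Lemma sys_th i : (i < 3)%nat -> eqT T (Fc (jd i) * D 0 (th i) + F3 (fun j => K i j * D 0 (th j)))%fld
    (Fc kappa * curlF u i - Fc (2 * kappa) * th i + Fc (atil - gtil) * D (S i) (divF th)
     + Fc gtil * lapF (th i) - LinF th K i - NLth u th K i)%fld.
Proof.
  intros Hi t x y z Ht. destruct (Hsys t x y z Ht) as (_ & _ & A & _). specialize (A i Hi). clear Hsys.
  rewrite div_divF in A.
  assert (E : fv (D (S i) (divF th)) = pd (S i) (fv (divF th))) by apply fv_D.
  Fv. rewrite E. change (dx i (fv (divF th)) t x y z) with (pd (S i) (fv (divF th)) t x y z) in A. fold atil gtil in A.
  generalize dependent (pd (S i) (divF th) t x y z). intros gd A.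
  unfold NLth, NLc, LinF, mvF, omF.
  destruct i as [|[|[|i]]]; [| | |lia];
    unfold mv, cross, Jeq, omega_eq, jd in *; cbn [Nat.eqb crossF] in *; sysv;
    fold ttil in A; unfold atil, gtil, dl in *; lra.
Qed.
Lemma sys_K i j : (i < 3)%nat -> (j < 3)%nat -> eqT T (D 0 (K i j))
    (commF (tenF omF) K i j + commF (tenF th) JeqF i j + NLK u th K i j)%fld.
Proof.
  intros Hi Hj t x y z Ht. destruct (Hsys t x y z Ht) as (_ & _ & _ & A & _). specialize (A i j Hi Hj). clear Hsys.
  unfold NLK, commF, JeqF, omF. unfold comm, mm, ten, Jeq, omega_eq in A.
  destruct i as [|[|[|i]]]; [| | |lia]; (destruct j as [|[|[|j]]]; [| | |lia]); unfold F3, sum3 in *; cbv beta in *; cbn [Nat.eqb tenF] in *; unfold Jeq; cbn [Nat.eqb]; sysv;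
    fold ttil in A; lra.
Qed.
Lemma sys_sym i j : (i < 3)%nat -> (j < 3)%nat -> eqT T (K i j) (K j i).
Proof. intros Hi Hj t x y z Ht. destruct (Hsys t x y z Ht) as (_ & _ & _ & _ & A). apply A; assumption. Qed.

Definition AF (i j : nat) : F := (JeqF i j + K i j)%fld.
Definition QF (i j : nat) : F := F3 (fun k => (AF i k - Fc (if (i =? k)%nat then lam else 0)) * (AF k j - Fc (if (k =? j)%nat then nu else 0)))%fld.
Definition WF (i : nat) : F := (omF i + th i)%fld.

Lemma sys_A i j : (i < 3)%nat -> (j < 3)%nat -> eqT T (D 0 (AF i j) + advF u (AF i j))%fld (commF (tenF WF) AF i j).
Proof.
  intros Hi Hj t x y z Ht. assert (E := sys_K i j Hi Hj t x y z Ht).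
  unfold AF at 1 2. unfold advF, F3. rewrite !D_add. unfold JeqF at 1 2 3 4. rewrite !D_c. Fv. rewrite E. clear E.
  unfold NLK, advF, commF, F3, WF, AF, JeqF, omF; Fv.
  destruct i as [|[|[|i]]]; [| | |lia]; (destruct j as [|[|[|j]]]; [| | |lia]); cbn [Nat.eqb tenF]; unfold Jeq; cbn [Nat.eqb]; Fv; ring.
Qed.

(* [QF] is transported by the same commutator equation as the inertia tensor, which preserves its norm. *)
Lemma sys_Q i j : (i < 3)%nat -> (j < 3)%nat -> eqT T (D 0 (QF i j) + advF u (QF i j))%fld (commF (tenF WF) QF i j).
Proof.
  intros Hi Hj t x y z Ht.
  assert (E := fun i j Hi Hj => sys_A i j Hi Hj t x y z Ht). clear Hsys.
  (* The material derivative is a derivation that ignores constants, and multiples of the identity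
     commute with everything, so both factors of [QF] obey the commutator equation. *)
  assert (L : forall f g, (D 0 (f * g) + advF u (f * g))%fld = ((D 0 f + advF u f) * g + f * (D 0 g + advF u g))%fld).
  { intros f g. unfold advF, F3. rewrite !D_mul. ring. }
  assert (La : forall f g, (D 0 (f + g) + advF u (f + g))%fld = ((D 0 f + advF u f) + (D 0 g + advF u g))%fld).
  { intros f g. unfold advF, F3. rewrite !D_add. ring. }
  assert (Lc : forall f c, (D 0 (f - Fc c) + advF u (f - Fc c))%fld = (D 0 f + advF u f)%fld).
  { intros f c. unfold advF, F3. rewrite !D_sub, !D_c. ring. }
  assert (Q1 : (D 0 (QF i j) + advF u (QF i j))%fld t x y z = F3 (fun k => commF (tenF WF) AF i k * (AF k j - Fc (if (k =? j)%nat then nu else 0))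
     + (AF i k - Fc (if (i =? k)%nat then lam else 0)) * commF (tenF WF) AF k j)%fld t x y z).
  { unfold QF. unfold F3 at 1 2. rewrite !La, !L, !Lc. unfold F3 at 1. repeat rewrite ?Fadd_v, ?Fmul_v.
    rewrite <- !Fadd_v, !E by lia. Fv. reflexivity. }
  rewrite Q1. clear E L La Lc Q1. unfold QF, commF, F3. Fv.
  destruct i as [|[|[|i]]]; [| | |lia]; (destruct j as [|[|[|j]]]; [| | |lia]); cbn [Nat.eqb tenF]; Fv; ring.
Qed.

(** In the derivative of the squared norm of [QF] the transport vanishes by incompressibility and
    the commutator by antisymmetry, so the norm cannot grow from its initial value zero. *)
Lemma QF_zero : (forall x y z s, det3 (fun i j => (if (i =? j)%nat then s else 0) - (Jeq lam nu i j + K i j 0 x y z)) = (s - lam) ^ 2 * (s - nu)) ->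
  forall i j, (i < 3)%nat -> (j < 3)%nat -> eqT T (QF i j) (Fc 0).
Proof.
  intros Hspec.
  set (q := fun t => sum3 (fun i => sum3 (fun j => L2 (QF i j) t))).
  set (dq := fun t => sum3 (fun i => sum3 (fun j => 2 * ip (QF i j) (D 0 (QF i j)) t))).
  assert (Hq : forall t, 0 <= t <= T -> is_derive q t (dq t)).
  { intros t Ht. apply (sum33_derive (fun i j t => L2 (QF i j) t) (fun i j t => 2 * ip (QF i j) (D 0 (QF i j)) t)). intros i j.
    replace (2 * ip (QF i j) (D 0 (QF i j)) t) with (ip (D 0 (QF i j)) (QF i j) t + ip (QF i j) (D 0 (QF i j)) t) by (rewrite (ip_sym (D 0 _)); ring).
    apply (is_derive_ext (ip (QF i j) (QF i j))); [intros; apply ip_self | apply ip_derive]. }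
  assert (Hdq : forall t, 0 <= t <= T -> dq t <= 0).
  { intros t Ht. unfold dq.
    assert (E : forall i j, (i < 3)%nat -> (j < 3)%nat -> ip (QF i j) (D 0 (QF i j)) t = ip (QF i j) (commF (tenF WF) QF i j) t).
    { intros i j Hi Hj. assert (Z := transport_zero u T (QF i j) t sys_div Ht).
      assert (X : ip (QF i j) (D 0 (QF i j) + advF u (QF i j))%fld t = ip (QF i j) (commF (tenF WF) QF i j) t).
      { apply ip_ext; [reflexivity|]. intros x y z. apply sys_Q; assumption. }
      rewrite ip_add_r in X. lra. }
    assert (Z : TI (F3 (fun i => F3 (fun j => QF i j * commF (tenF WF) QF i j)))%fld t = 0).
    { rewrite <- (TI_c 0 t). apply TI_ext; intros x y z. unfold F3, commF, F3. cbn [tenF]. generalize QF WF; intros X Y. Fv. ring. }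
    unfold F3 in Z. rewrite !TI_add in Z. unfold sum3. rewrite !E by lia. unfold ip. lra. }
  assert (Q0 : forall i j, (i < 3)%nat -> (j < 3)%nat -> L2 (QF i j) 0 = 0).
  { intros i j Hi Hj. unfold L2. transitivity (TI (Fc 0) 0); [|apply TI_c]. apply TI_ext; intros x y z. Fv.
    assert (Z : QF i j 0 x y z = 0).
    { unfold QF, F3, AF, JeqF. Fv.
      apply (spectrum_quadratic (fun i j => Jeq lam nu i j + K i j 0 x y z) lam nu); auto.
      - intros a b Ha Hb. rewrite (sys_sym a b Ha Hb 0 x y z ltac:(lra)). f_equal. unfold Jeq. rewrite Nat.eqb_sym.
        destruct (b =? a)%nat eqn:E; [apply Nat.eqb_eq in E; subst; reflexivity | reflexivity]. }
    rewrite Z; ring. }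
  assert (Hq0 : q 0 = 0) by (unfold q, sum3; rewrite !Q0 by lia; ring).
  intros i j Hi Hj t x y z Ht. rewrite Fc_v. apply L2_zero_pt.
  assert (R := deriv_le_lin q dq T 0 Hq Hdq t Ht). rewrite Hq0 in R.
  assert (N : forall i j, 0 <= L2 (QF i j) t) by (intros; apply L2_nonneg).
  unfold q, sum3 in R.
  assert (n00 := N 0%nat 0%nat). assert (n01 := N 0%nat 1%nat). assert (n02 := N 0%nat 2%nat).
  assert (n10 := N 1%nat 0%nat). assert (n11 := N 1%nat 1%nat). assert (n12 := N 1%nat 2%nat).
  assert (n20 := N 2%nat 0%nat). assert (n21 := N 2%nat 1%nat). assert (n22 := N 2%nat 2%nat).
  destruct i as [|[|[|i]]]; [| | |lia]; (destruct j as [|[|[|j]]]; [| | |lia]); lra.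
Qed.

End Build.

Section Quad.
Context {P : Par}.

(** On the upper block [J - lam] reads [K] and [J - nu] reads [K - dl]; at the last diagonal entry
    they read [K + dl] and [K], whence the opposite sign. *)
Lemma quad_entries (K : nat -> nat -> F) T : (forall i j, (i < 3)%nat -> (j < 3)%nat -> eqT T (QF K i j) (Fc 0)) ->
  (forall i j, (i < 2)%nat -> (j < 2)%nat -> eqT T (Fc dl * K i j)%fld (F3 (fun k => K i k * K k j)%fld)) /\
  eqT T (Fc dl * K 2%nat 2%nat)%fld (- F3 (fun k => K 2%nat k * K k 2%nat)%fld)%fld.
Proof.
  intros H. split.
  - intros i j Hi Hj t x y z Ht. assert (E := H i j ltac:(lia) ltac:(lia) t x y z Ht).
    unfold QF, F3, AF, JeqF in E. unfold F3, dl. revert E. Fv. unfold Jeq.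
    destruct i as [|[|i]]; [| |lia]; (destruct j as [|[|j]]; [| |lia]); cbn [Nat.eqb]; intros; lra.
  - intros t x y z Ht. assert (E := H 2%nat 2%nat ltac:(lia) ltac:(lia) t x y z Ht).
    unfold QF, F3, AF, JeqF in E. unfold F3, dl. revert E. Fv. unfold Jeq. cbn [Nat.eqb]; intros; lra.
Qed.

Lemma sumN_Hs_nonneg k n (l : list F) t : 0 <= sumN (Hs_sq k) (dtl n (map (fun f : F => fv f) l)) t.
Proof.
  unfold sumN, dtl. induction l as [|f l IH]; simpl; [lra|]. apply Rplus_le_le_0_compat; [|exact IH].
  assert (Z := Hs_nonneg k (Dw (repeat 0%nat n) f) t). rewrite Dw_val, <- dpow_fold in Z. exact Z.
Qed.
Lemma compsK_map (K : nat -> nat -> F) :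
  compsK (fun i j => K i j) = map (fun f : F => fv f) [K 0 0; K 0 1; K 0 2; K 1 0; K 1 1; K 1 2; K 2 0; K 2 1; K 2 2]%nat.
Proof. reflexivity. Qed.

Lemma FM_nonneg (K : nat -> nat -> F) t : 0 <= FM M (fun i j => K i j) t.
Proof.
  unfold FM. rewrite compsK_map, <- (sumN_dtl0 (Hs_sq (2 * M + 1))).
  apply Rplus_le_le_0_compat; [apply Rplus_le_le_0_compat|]; apply sumN_Hs_nonneg.
Qed.
Lemma EK_nonneg (K : nat -> nat -> F) t : 0 <= EK M (fun i j => K i j) t.
Proof.
  unfold EK. rewrite compsK_map, <- (sumN_dtl0 (Hs_sq (2 * M - 3)) (map _ _)).
  apply Rplus_le_le_0_compat; [apply Rplus_le_le_0_compat; [apply Rplus_le_le_0_compat|]|]; [apply sumN_Hs_nonneg.. |].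
  unfold sum_from. apply cond_pos_sum; intros n. destruct (3 <=? n)%nat; [apply sumN_Hs_nonneg | lra].
Qed.

(** The Sobolev constant 8 meets eight words, each of squared norm at most [d * d]; the words have
    order at most 3, within the 2M - 3 space derivatives contained in [EK]. *)
Lemma K_small_of_EK (u th : nat -> F) (K : nat -> nat -> F) t d : 0 <= d -> EM M (fun i => u i) (fun i => th i) (fun i j => K i j) t <= d * d ->
  forall x y z i j, (i < 3)%nat -> (j < 3)%nat -> Rabs (K i j t x y z) <= 8 * d.
Proof.
  intros Hd H x y z i j Hi Hj. assert (HM := M_ge).
  assert (HE : Hs_sq (2 * M - 3) (K i j) t <= d * d).
  { eapply Rle_trans; [|exact H]. unfold EM.
    assert (E0 : 0 <= Ebar M (fun i => u i) (fun i => th i) (fun i j => K i j) t).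
    { unfold Ebar, sumN, comps3, aK; cbn [app fold_right]. repeat apply Rplus_le_le_0_compat; try apply Pk_nonneg; lra. }
    assert (A : Hs_sq (2 * M - 3) (K i j) t <= sumN (Hs_sq (2 * M - 3)) (compsK (fun i j => K i j)) t).
    { unfold sumN, compsK; cbn [fold_right].
      assert (X := fun i j => Hs_nonneg (2 * M - 3) (K i j) t).
      assert (x00 := X 0%nat 0%nat). assert (x01 := X 0%nat 1%nat). assert (x02 := X 0%nat 2%nat).
      assert (x10 := X 1%nat 0%nat). assert (x11 := X 1%nat 1%nat). assert (x12 := X 1%nat 2%nat).
      assert (x20 := X 2%nat 0%nat). assert (x21 := X 2%nat 1%nat). assert (x22 := X 2%nat 2%nat).
      destruct i as [|[|[|i]]]; [| | |lia]; (destruct j as [|[|[|j]]]; [| | |lia]); lra. }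
    unfold EK. rewrite compsK_map in *.
    assert (Y1 := sumN_Hs_nonneg (2 * M - 3) 1 [K 0 0; K 0 1; K 0 2; K 1 0; K 1 1; K 1 2; K 2 0; K 2 1; K 2 2]%nat t).
    assert (Y2 := sumN_Hs_nonneg (2 * M - 3) 2 [K 0 0; K 0 1; K 0 2; K 1 0; K 1 1; K 1 2; K 2 0; K 2 1; K 2 2]%nat t).
    assert (Y3 : 0 <= sum_from 3 M (fun n => sumN (Hs_sq (2 * M - 2 * n + 2)) (dtl n (compsK (fun i j => K i j))) t)).
    { rewrite compsK_map. unfold sum_from. apply cond_pos_sum; intros n. destruct (3 <=? n)%nat; [apply sumN_Hs_nonneg | lra]. }
    rewrite compsK_map in Y3. lra. }
  assert (S := sobolev (K i j) t x y z).
  assert (L : forall w, (ord w <= 3)%nat -> ~ In 0%nat w -> L2 (Dw w (K i j)) t <= d * d).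
  { intros w Hw H0. eapply Rle_trans; [apply (L2_le_Hs w (2 * M - 3)); [lia | assumption] | exact HE]. }
  assert (B : lsum (map (fun w => L2 (Dw w (K i j)) t) sobolev_words) <= 8 * (d * d)).
  { cbn [sobolev_words map lsum fold_right].
    assert (l0 := L [] ltac:(simpl; lia) ltac:(simpl; intuition discriminate)).
    assert (l1 := L [3%nat] ltac:(simpl; lia) ltac:(simpl; intuition discriminate)).
    assert (l2 := L [2%nat] ltac:(simpl; lia) ltac:(simpl; intuition discriminate)).
    assert (l3 := L [3; 2]%nat ltac:(simpl; lia) ltac:(simpl; intuition discriminate)).
    assert (l4 := L [1%nat] ltac:(simpl; lia) ltac:(simpl; intuition discriminate)).
    assert (l5 := L [3; 1]%nat ltac:(simpl; lia) ltac:(simpl; intuition discriminate)).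
    assert (l6 := L [2; 1]%nat ltac:(simpl; lia) ltac:(simpl; intuition discriminate)).
    assert (l7 := L [3; 2; 1]%nat ltac:(simpl; lia) ltac:(simpl; intuition discriminate)). lra. }
  apply Rsqr_incr_0_var; [|lra]. rewrite <- Rsqr_abs. unfold Rsqr. simpl (_ ^ 2) in S. lra.
Qed.

End Quad.

(** * The a priori estimates *)

Section Apriori.
Context {P : Par}.

Lemma Dbar_continuous (u th : nat -> F) t : continuous (Dbar M (fun i => u i) (fun i => th i)) t.
Proof.
  unfold Dbar, sumN, comps3. cbn [app fold_right].
  do 6 (apply (continuous_plus (V := R_NormedModule)); [apply Pk_continuous|]). apply continuous_const.
Qed.
Lemma DM_continuous (u th : nat -> F) (K : nat -> nat -> F) t :
  continuous (DM M (fun i => u i) (fun i => th i) (fun i j => K i j)) t.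
Proof.
  assert (A : forall n m g, (forall j, continuous (g j) t) -> continuous (fun t => sum_from n m (fun j => g j t)) t).
  { intros n m g Hg. unfold sum_from. apply (sum_f_continuous (fun j t => if (n <=? j)%nat then g j t else 0)). intros j. apply if_continuous, Hg. }
  assert (B : forall k j, continuous (fun t => sumN (Hs_sq k) (dtl j (aK (fun i j => K i j))) t) t).
  { intros k j. unfold sumN, dtl, aK. cbn [map fold_right].
    do 2 (apply (continuous_plus (V := R_NormedModule)); [apply Hs_continuous|]). apply continuous_const. }
  unfold DM. apply (continuous_plus (V := R_NormedModule)); [apply (continuous_plus (V := R_NormedModule))|].
  - apply Dbar_continuous.
  - apply (A 0%nat 3%nat (fun j t => sumN (Hs_sq (2 * M - j - 1)) (dtl j (aK (fun i j => K i j))) t)). intros; apply B.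
  - apply (A 4%nat M (fun j t => sumN (Hs_sq (2 * M - 2 * j + 3)) (dtl j (aK (fun i j => K i j))) t)). intros; apply B.
Qed.

Lemma apriori : exists e0 C, 0 < e0 /\ 0 < C /\ forall S : Sol, eps S <= e0 ->
  let u := fun i => fv (su S i) in let th := fun i => fv (sth S i) in let K := fun i j => fv (sK S i j) in
  forall t, 0 <= t <= sT S ->
  Elow u th K t * (1 + t) ^ (2 * M - 2) + Ebar M u th K t + FM M K t / (1 + t) + RInt (DM M u th K) 0 (sT S)
    <= C * (Ebar M u th K 0 + FM M K 0) /\
  EK M K t <= C * Ebar M u th K 0.
Proof.
  destruct low_decay as (e1 & C1 & He1 & HC1 & H1). destruct high_energy as (e2 & C2 & He2 & HC2 & H2).
  destruct Phi_growth as (e3 & C3 & He3 & HC3 & H3).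
  destruct (X_le_E 2) as (C4 & HC4 & H4); [assert (HM := M_ge); lia|].
  destruct Elow_le_X as (C5 & HC5 & H5). destruct FM_le_Phi as (C6 & HC6 & H6).
  destruct DM_le_D as (C7 & HC7 & H7). destruct EK_le_E as (C8 & HC8 & H8).
  set (C9 := INR (length (WS (2 * M + 1)))). assert (HC9 : 0 <= C9) by apply pos_INR.
  set (c1 := C5 * (C1 * (C4 + C2))). set (c2 := C6 * (C3 * (C9 + C2) + C2)). set (c3 := C7 * C2). set (c4 := C8 * C2).
  assert (Hc1 : 0 <= c1) by (unfold c1; repeat (apply Rmult_le_pos; try lra)).
  assert (Hc2 : 0 <= c2) by (unfold c2; apply Rmult_le_pos; [lra|]; apply Rplus_le_le_0_compat; [apply Rmult_le_pos|]; lra).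
  assert (Hc3 : 0 <= c3) by (apply Rmult_le_pos; lra).
  assert (Hc4 : 0 <= c4) by (apply Rmult_le_pos; lra).
  exists (Rmin e1 (Rmin e2 e3)), (c1 + C2 + c2 + c3 + c4).
  split; [repeat apply Rmin_pos; assumption | split; [lra|]].
  intros S HS u th K t Ht.
  assert (Q1 : eps S <= e1) by (eapply Rle_trans; [exact HS | apply Rmin_l]).
  assert (Q2 : eps S <= e2) by (eapply Rle_trans; [exact HS |]; eapply Rle_trans; [apply Rmin_r | apply Rmin_l]).
  assert (Q3 : eps S <= e3) by (eapply Rle_trans; [exact HS |]; eapply Rle_trans; [apply Rmin_r | apply Rmin_r]).
  assert (H0 : 0 <= 0 <= sT S) by lra. assert (HT : 0 <= sT S <= sT S) by lra.
  change (Ebar M u th K) with (Esol S).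
  set (e := Esol S 0). set (f := FM M K 0). set (I := RInt (DNs (2 * M) S) 0).
  assert (Pe : forall r, 0 <= r <= sT S -> 0 <= Esol S r) by (intros r Hr; exact (E_nonneg (mkSt S r Hr))).
  assert (Pe0 : 0 <= e) by (apply Pe, H0). assert (Pf : 0 <= f) by apply FM_nonneg.
  assert (PI : forall r, 0 <= r <= sT S -> 0 <= I r).
  { intros r Hr. apply RInt_ge_0; [lra | apply ex_RInt_cont, DNs_continuous|]. intros q Hq.
    assert (Hq' : 0 <= q <= sT S) by lra. exact (DN_nonneg (2 * M) (mkSt S q Hq')). }
  assert (B2 : forall r, 0 <= r <= sT S -> Esol S r <= C2 * e /\ I r <= C2 * e).
  { intros r Hr. assert (X := H2 S Q2 r Hr). fold (I r) e in X. specialize (Pe r Hr). specialize (PI r Hr). lra. }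
  assert (B1 : Elow u th K t * (1 + t) ^ (2 * M - 2) <= c1 * e).
  (* The decay is now used with the propagated bound [C2 * e] of the top energy, which makes it
     proportional to the initial energy. *)
  { assert (X := H1 S (C2 * e) Q1 (fun r Hr => proj1 (B2 r Hr)) t Ht). assert (Y := H4 (mkSt S 0 H0)). assert (Z := H5 (mkSt S t Ht)).
    cbn [ss tm] in *. change (E_ (mkSt S 0 H0)) with e in Y. change (Elow u th K t <= C5 * XN 2 S t) in Z.
    assert (Hp : 0 <= (1 + t) ^ (2 * M - 2)) by (apply pow_le; lra).
    apply Rle_trans with (C5 * (XN 2 S t * (1 + t) ^ (2 * M - 2))); [rewrite <- Rmult_assoc; apply Rmult_le_compat_r; assumption|].
    unfold c1. rewrite Rmult_assoc. apply Rmult_le_compat_l; [assumption|].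
    eapply Rle_trans; [exact X|]. rewrite Rmult_assoc. apply Rmult_le_compat_l; lra. }
  assert (B3 : FM M K t / (1 + t) <= c2 * (e + f)).
  { assert (X := H3 S Q3 t Ht). fold (I t) in X. assert (Y := H6 (mkSt S t Ht)). unfold Phs in Y. cbn [ss tm] in Y.
    change (FM M K t <= C6 * (Phi S t + Esol S t)) in Y. assert (Z := Phi_le_FM S 0). change (Phi S 0 <= C9 * f) in Z.
    destruct (B2 t Ht) as [Y1 Y2]. specialize (PI t Ht).
    apply Rle_div_l; [lra|]. eapply Rle_trans; [exact Y|]. unfold c2.
    replace (C6 * (C3 * (C9 + C2) + C2) * (e + f) * (1 + t)) with (C6 * ((C3 * (C9 + C2) + C2) * (e + f) * (1 + t))) by ring.
    apply Rmult_le_compat_l; [assumption|].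
    assert (W1 : Phi S t <= C3 * (C9 + C2) * (e + f) * (1 + t)).
    { eapply Rle_trans; [exact X|]. rewrite !Rmult_assoc. apply Rmult_le_compat_l; [lra|].
      assert (w1 : (1 + t) * I t <= (1 + t) * (C2 * e)) by (apply Rmult_le_compat_l; lra).
      assert (w2 : 0 <= C9 * f) by (apply Rmult_le_pos; lra). assert (w3 : 0 <= t * (C9 * f)) by (apply Rmult_le_pos; lra).
      assert (w4 : 0 <= (1 + t) * (C9 * e)) by (repeat apply Rmult_le_pos; lra).
      assert (w5 : 0 <= (1 + t) * (C2 * f)) by (repeat apply Rmult_le_pos; lra). lra. }
    assert (W2 : Esol S t <= C2 * (e + f) * (1 + t)).
    { eapply Rle_trans; [exact Y1|]. assert (w1 : 0 <= C2 * f) by (apply Rmult_le_pos; lra).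
      assert (w2 : 0 <= C2 * (e + f) * t) by (repeat apply Rmult_le_pos; lra). lra. }
    lra. }
  assert (B4 : RInt (DM M u th K) 0 (sT S) <= c3 * e).
  { apply Rle_trans with (RInt (fun r => C7 * DNs (2 * M) S r) 0 (sT S)).
    - apply RInt_le; [lra | apply ex_RInt_cont, DM_continuous | |].
      + apply (ex_RInt_scal (V := R_NormedModule)), ex_RInt_cont, DNs_continuous.
      + intros r Hr. assert (Hr' : 0 <= r <= sT S) by lra. exact (H7 (mkSt S r Hr')).
    - rewrite (RInt_scal (V := R_CompleteNormedModule)) by apply ex_RInt_cont, DNs_continuous.
      unfold c3. rewrite Rmult_assoc. apply Rmult_le_compat_l; [assumption | apply B2, HT]. }
  assert (B5 : EK M K t <= c4 * e).
  { assert (X := H8 (mkSt S t Ht)). cbn [tm] in X. change (EK M K t <= C8 * Esol S t) in X.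
    eapply Rle_trans; [exact X|]. unfold c4. rewrite Rmult_assoc. apply Rmult_le_compat_l; [assumption | apply B2, Ht]. }
  destruct (B2 t Ht) as [B6 _].
  assert (w1 : 0 <= c1 * f) by (apply Rmult_le_pos; lra). assert (w2 : 0 <= C2 * f) by (apply Rmult_le_pos; lra).
  assert (w3 : 0 <= c3 * f) by (apply Rmult_le_pos; lra). assert (w4 : 0 <= c4 * (e + f)) by (apply Rmult_le_pos; lra).
  assert (w5 : 0 <= c1 * e) by (apply Rmult_le_pos; lra). assert (w6 : 0 <= C2 * e) by (apply Rmult_le_pos; lra).
  assert (w7 : 0 <= c2 * e) by (apply Rmult_le_pos; lra). assert (w8 : 0 <= c3 * e) by (apply Rmult_le_pos; lra).
  split; lra.
Qed.

End Apriori.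

(** * Bundling the data of the statement and choosing the constants *)

(** Smoothness is given for the components below 3 only, so the others are filled with zero. The
    case analysis keeps components at numeral indices convertible to the given fields, and [change]
    then recovers the functionals of the statement. *)
Definition bundle3 (v : VField) (H : forall i, (i < 3)%nat -> smooth (v i) /\ periodic (v i)) (i : nat) : F :=
  match i with
  | O => mkF (v 0%nat) (proj1 (H 0%nat ltac:(lia))) (proj2 (H 0%nat ltac:(lia)))
  | 1%nat => mkF (v 1%nat) (proj1 (H 1%nat ltac:(lia))) (proj2 (H 1%nat ltac:(lia)))
  | 2%nat => mkF (v 2%nat) (proj1 (H 2%nat ltac:(lia))) (proj2 (H 2%nat ltac:(lia)))
  | _ => Fc 0
  end.
Definition bundle33 (K : MField) (H : forall i j, (i < 3)%nat -> (j < 3)%nat -> smooth (K i j) /\ periodic (K i j)) (i j : nat) : F :=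
  match i with
  | O => bundle3 (K 0%nat) (fun j => H 0%nat j ltac:(lia)) j
  | 1%nat => bundle3 (K 1%nat) (fun j => H 1%nat j ltac:(lia)) j
  | 2%nat => bundle3 (K 2%nat) (fun j => H 2%nat j ltac:(lia)) j
  | _ => Fc 0
  end.

Theorem theorem4p33 (mu kappa alpha beta gamma tau lam nu : R) (M : nat) :
  0 < mu -> 0 < kappa -> 0 < alpha -> 0 < beta -> 0 < gamma -> 0 < tau ->
  0 < lam -> lam < nu -> (4 <= M)%nat ->
  exists eta_ap delta_ap C_ap : R,
    0 < eta_ap <= 1 /\ 0 < delta_ap <= 1 /\ 0 < C_ap /\
    forall (T : R) (u : VField) (p : Field) (th : VField) (K : MField),
      0 < T ->
      (forall i, (i < 3)%nat -> smooth (u i) /\ periodic (u i)) ->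
      smooth p -> periodic p ->
      (forall i, (i < 3)%nat -> smooth (th i) /\ periodic (th i)) ->
      (forall i j, (i < 3)%nat -> (j < 3)%nat -> smooth (K i j) /\ periodic (K i j)) ->
      (forall t x y z, 0 <= t <= T ->
         system_P mu kappa alpha beta gamma tau lam nu u p th K t x y z) ->
      (forall t, 0 <= t <= T -> forall i, (i < 3)%nat -> torus_int (u i) t = 0) ->
      (forall x y z s,
         det3 (fun i j => (if (i =? j)%nat then s else 0)
                          - (Jeq lam nu i j + K i j 0 x y z))
         = (s - lam) ^ 2 * (s - nu)) ->
      EM M u th K 0 + FM M K 0 <= eta_ap ->
      (forall t, 0 <= t <= T ->
         EM M u th K t + RInt (Dbar M u th) 0 T <= delta_ap) ->
      (forall t, 0 <= t <= T ->
         Elow u th K t * (1 + t) ^ (2 * M - 2) + Ebar M u th K t + FM M K t / (1 + t)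
         + RInt (DM M u th K) 0 T
         <= C_ap * (Ebar M u th K 0 + FM M K 0)) /\
      (forall t, 0 <= t <= T ->
         EK M K t <= C_ap * (EM M u th K 0 + FM M K 0)).
Proof.
  intros Hmu Hka Hal Hbe Hga Hta Hla Hnu HM.
  set (P := mkPar mu kappa alpha beta gamma tau lam nu M Hmu Hka Hal Hbe Hga Hta Hla Hnu HM).
  destruct (@apriori P) as (e0 & C & He0 & HC & Hap).
  assert (Hk0 : 0 < @k0 P).
  { unfold k0. apply Rdiv_lt_0_compat; [|lra]. apply Rmin_pos; [unfold dl; simpl; lra | exact Hla]. }
  (* An energy of at most [e * e] gives entries of [K] of size at most [8 * e]; division of [k0] by
     8 therefore secures the pointwise smallness required by [Sol]. *)
  set (e := Rmin 1 (Rmin e0 (@k0 P / 8))).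
  assert (He : 0 < e) by (repeat apply Rmin_pos; lra).
  assert (He1 : e <= 1) by apply Rmin_l.
  assert (He2 : e <= e0) by (eapply Rle_trans; [apply Rmin_r | apply Rmin_l]).
  assert (He3 : 8 * e <= @k0 P) by (assert (e <= @k0 P / 8) by (eapply Rle_trans; [apply Rmin_r | apply Rmin_r]); lra).
  exists 1, (e * e), C. split; [lra|]. split; [split; [apply Rmult_lt_0_compat; lra | nra]|]. split; [assumption|].
  intros T u p th K HT Hu Hp1 Hp2 Hth HK Hsys Hmean Hspec _ Hsmall.
  set (uF := bundle3 u Hu). set (pF := mkF p Hp1 Hp2). set (thF := bundle3 th Hth). set (KF := bundle33 K HK).
  assert (HsysF : forall t x y z, 0 <= t <= T ->
    system_P mu kappa alpha beta gamma tau lam nu (fun i => uF i) pF (fun i => thF i) (fun i j => KF i j) t x y z).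
  { intros t x y z Ht. destruct (Hsys t x y z Ht) as (S1 & S2 & S3 & S4 & S5).
    split; [|split; [exact S2|split; [|split]]].
    - intros [|[|[|i]]] Hi; [exact (S1 0%nat Hi) | exact (S1 1%nat Hi) | exact (S1 2%nat Hi) | lia].
    - intros [|[|[|i]]] Hi; [exact (S3 0%nat Hi) | exact (S3 1%nat Hi) | exact (S3 2%nat Hi) | lia].
    - intros [|[|[|i]]] [|[|[|j]]] Hi Hj; try lia;
        [exact (S4 0%nat 0%nat Hi Hj) | exact (S4 0%nat 1%nat Hi Hj) | exact (S4 0%nat 2%nat Hi Hj)
        |exact (S4 1%nat 0%nat Hi Hj) | exact (S4 1%nat 1%nat Hi Hj) | exact (S4 1%nat 2%nat Hi Hj)
        |exact (S4 2%nat 0%nat Hi Hj) | exact (S4 2%nat 1%nat Hi Hj) | exact (S4 2%nat 2%nat Hi Hj)].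
    - intros [|[|[|i]]] [|[|[|j]]] Hi Hj; try lia;
        [exact (S5 0%nat 0%nat Hi Hj) | exact (S5 0%nat 1%nat Hi Hj) | exact (S5 0%nat 2%nat Hi Hj)
        |exact (S5 1%nat 0%nat Hi Hj) | exact (S5 1%nat 1%nat Hi Hj) | exact (S5 1%nat 2%nat Hi Hj)
        |exact (S5 2%nat 0%nat Hi Hj) | exact (S5 2%nat 1%nat Hi Hj) | exact (S5 2%nat 2%nat Hi Hj)]. }
  assert (Hquad := @quad_entries P KF T (@QF_zero P uF pF thF KF T HT HsysF Hspec)).
  assert (HD : 0 <= RInt (Dbar M u th) 0 T).
  { apply RInt_ge_0; [lra | |].
    - apply ex_RInt_cont. intros t. change (continuous (Dbar M (fun i => uF i) (fun i => thF i)) t). apply (@Dbar_continuous P).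
    - intros t _. change (0 <= Dbar M (fun i => uF i) (fun i => thF i) t). unfold Dbar, sumN, comps3. cbn [app fold_right].
      repeat apply Rplus_le_le_0_compat; try apply Pk_nonneg; lra. }
  assert (HEM : forall t, 0 <= t <= T -> EM M (fun i => uF i) (fun i => thF i) (fun i j => KF i j) t <= e * e).
  { intros t Ht. specialize (Hsmall t Ht). change (EM M u th K t <= e * e). lra. }
  assert (HE : forall t, 0 <= t <= T -> Ebar M (fun i => uF i) (fun i => thF i) (fun i j => KF i j) t <= e * e).
  { intros t Ht. specialize (HEM t Ht). unfold EM in HEM. assert (N := @EK_nonneg P KF t). change (0 <= EK M (fun i j => KF i j) t) in N. lra. }
  assert (HmeanF : forall t i, 0 <= t <= T -> (i < 3)%nat -> TI (uF i) t = 0).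
  { intros t [|[|[|i]]] Ht Hi; try lia; rewrite TI_E;
      [exact (Hmean t Ht 0%nat Hi) | exact (Hmean t Ht 1%nat Hi) | exact (Hmean t Ht 2%nat Hi)]. }
  set (S := @mkSol P uF pF thF KF T e HT
    (@sys_u P uF pF thF KF T HsysF) (@sys_div P uF pF thF KF T HsysF) (@sys_th P uF pF thF KF T HsysF)
    (@sys_K P uF pF thF KF T HsysF) (@sys_sym P uF pF thF KF T HsysF) (proj1 Hquad) (proj2 Hquad)
    HmeanF
    (fun t x y z i j Ht Hi Hj => Rle_trans _ _ _ (@K_small_of_EK P uF thF KF t e (Rlt_le _ _ He) (HEM t Ht) x y z i j Hi Hj) He3)
    (conj (Rlt_le _ _ He) He1) HE).
  assert (Hfin := Hap S He2).
  split; intros t Ht; destruct (Hfin t Ht) as [A B].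
  - exact A.
  - assert (N1 := @EK_nonneg P KF 0). assert (N2 := @FM_nonneg P KF 0).
    eapply Rle_trans; [exact B|]. apply Rmult_le_compat_l; [lra|].
    change (Ebar M u th K 0 <= Ebar M u th K 0 + EK M K 0 + FM M K 0).
    change (0 <= EK M K 0) in N1. change (0 <= FM M K 0) in N2. lra.
Qed.
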